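(* Let $\theta>1$ and let $V$ be twice continuously differentiable on $[0,+\infty)$ with $\lim_{x\to+\infty}V(x)/\log x=+\infty$. Suppose a probability measure $\mu$ is supported on one interval $[0,b]$, has a continuous density $\psi$ on $(0,b)$, and satisfies, for some $\ell\in\mathbb R$, $$\int\log|x-y|d\mu(y)+\int\log|x^\theta-y^\theta|d\mu(y)-V(x)=\ell\quad\text{for }x\in\operatorname{supp}\mu,$$ $$\int\log|x-y|d\mu(y)+\int\log|x^\theta-y^\theta|d\mu(y)-V(x)\le\ell\quad\text{for }x\in[0,+\infty).$$ Then $b=c\frac{(1+\theta)^{1+1/\theta}}{\theta}$, where $c>0$ solves $$\frac{1}{2\pi i}\oint_\gamma\frac{V'(J_c(s))J_c(s)}{s}\,ds=1+\theta,$$ and for $x\in(0,b)$, $$\psi(x)=\frac{1}{2\pi^2x}\int_0^b\big(V''(y)y+V'(y)\big)\log\left|\frac{I_+(y)-I_-(x)}{I_+(y)-I_+(x)}\right|dy.$$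
   Context: For $c>0$, $J_c(s)=c(s+1)\left(\frac{s+1}{s}\right)^{1/\theta}$, with the branch analytic in $\mathbb C\setminus[-1,0]$ and such that $J_c(s)\sim cs$ as $s\to\infty$. Its real critical points are $-1$ and $s_b=1/\theta$, with $J_c(-1)=0$ and $J_c(1/\theta)=c(1+\theta)^{1+1/\theta}/\theta$. There are two complex conjugate arcs $\gamma_1$ (upper half-plane) and $\gamma_2$ (lower half-plane) joining $-1$ and $1/\theta$ on which $J_c$ is real; each is mapped bijectively onto $[0,J_c(1/\theta)]$ by $J_c$. $\gamma=\gamma_1\cup\gamma_2$ is oriented counterclockwise. For $x$ in that interval, $I_+(x)\in\gamma_1$ and $I_-(x)\in\gamma_2$ denote the preimages of $x$ under $J_c$. *)

(* Defs.v *)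
From HB Require Import structures.
Set Warnings "-notation-overridden,-notation-incompatible-prefix,-ambiguous-paths,-overwriting-delimiting-key,-deprecated".
From mathcomp Require Import all_boot all_order all_algebra.
From mathcomp Require Import all_classical all_reals all_analysis.
From mathcomp Require Import complex.
Set Implicit Arguments.
Unset Strict Implicit.
Unset Printing Implicit Defensive.
Import Order.TTheory GRing.Theory Num.Theory.
Import numFieldNormedType.Exports.
Local Open Scope classical_set_scope.
Local Open Scope ring_scope.
Local Open Scope complex_scope.

Section Defs.
Variable R : realType.

Definition cconj (z : R[i]) : R[i] := Complex (complex.Re z) (- complex.Im z).
Definition cabs (z : R[i]) : R := Normc.normc z.

(* principal argument, in (-pi, pi], of a nonzero complex number *)
Definition Arg (w : R[i]) : R :=
  if 0 <= complex.Im w then acos (complex.Re w / cabs w) else - acos (complex.Re w / cabs w).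

Definition cpow (w : R[i]) (a : R) : R[i] :=
  if w == 0 then 0
  else (expR (a * ln (cabs w)))%:C * Complex (cos (a * Arg w)) (sin (a * Arg w)).

(* J_c(s) = c (s+1) ((s+1)/s)^(1/theta), principal branch: analytic on
   C \ [-1,0] and ~ c s at infinity. *)
Definition Jc (theta c : R) (s : R[i]) : R[i] :=
  c%:C * (s + 1) * cpow ((s + 1) / s) theta^-1.

Definition Jmax (theta c : R) : R := complex.Re (Jc theta c (theta^-1)%:C).

(* gamma_1: the arc in the upper half-plane joining -1 and 1/theta on which
   J_c is real (endpoints included) *)
Definition gamma1 (theta c : R) : set R[i] :=
  [set s | (0 < complex.Im s /\ complex.Im (Jc theta c s) = 0) \/ s = -1 \/ s = (theta^-1)%:C].

(* a C^1 injective parametrization t in [0,1] |-> gx t + i gy t of gamma_1,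
   running from 1/theta to -1 (i.e. gamma_1 with the counterclockwise
   orientation of gamma = gamma_1 \cup gamma_2) *)
Definition gamma1_param (theta c : R) (gx gy : R -> R) : Prop :=
  [/\ (forall t, derivable gx t 1) /\ (forall t, derivable gy t 1),
      continuous (derive1 gx) /\ continuous (derive1 gy),
      Complex (gx 0) (gy 0) = (theta^-1)%:C /\ Complex (gx 1) (gy 1) = -1,
      (forall t u, t \in `[0, 1] -> u \in `[0, 1] ->
         Complex (gx t) (gy t) = Complex (gx u) (gy u) -> t = u) &
      (forall t, t \in `[0, 1] -> gamma1 theta c (Complex (gx t) (gy t)))].

Definition cint01 (h : R -> R[i]) : R[i] :=
  Complex (\int[lebesgue_measure]_(t in `[0, 1]) complex.Re (h t))
          (\int[lebesgue_measure]_(t in `[0, 1]) complex.Im (h t)).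

(* (1/(2 pi i)) \oint_gamma f(s) ds, gamma = gamma_1 \cup gamma_2 counterclockwise,
   gamma_1 parametrized by g (from 1/theta to -1), gamma_2 = conj(gamma_1)
   traversed from -1 to 1/theta. *)
Definition contour_gamma (gx gy : R -> R) (f : R[i] -> R[i]) : R[i] :=
  let g t := Complex (gx t) (gy t) in
  let dg t := Complex (derive1 gx t) (derive1 gy t) in
  ((2 * pi)%:C * 'i)^-1 *
    (cint01 (fun t => f (g t) * dg t)
     - cint01 (fun t => f (cconj (g t)) * cconj (dg t))).

Definition Iplus_spec (theta c : R) (Ip : R -> R[i]) : Prop :=
  forall y, y \in `[0, Jmax theta c] ->
    gamma1 theta c (Ip y) /\ Jc theta c (Ip y) = y%:C.

Definition msupp (mu : {measure set R -> \bar R}) : set R :=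
  [set x | forall e : R, 0 < e -> (0 < mu [set y | (x - e < y < x + e)%R])%E].

Definition effpot (mu : {measure set R -> \bar R}) (theta : R) (V : R -> R)
  (x : R) : \bar R :=
  (\int[mu]_y (ln `|x - y|)%:E + \int[mu]_y (ln `|x `^ theta - y `^ theta|)%:E
   - (V x)%:E)%E.

End Defs.

(* Main.v *)
(* Parametrize gamma_1 by its argument, s(t) with 0 <= t <= pi, and put
   y(t) = J_c(s(t)), a decreasing bijection onto [0, b] once c is chosen so that
   J_c(1/theta) = b. With T(s) = s J_c(s)^theta, the logarithmic kernel
   log |y(t) - y| + log |y(t)^theta - y^theta| is the sum of the real parts of
   log ((J_c(s) - y) / s), holomorphic outside gamma, and log (T(s) - s y^theta),
   holomorphic inside gamma. For p outside gamma in the upper half-plane and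
   w = p (p + 1) / (p - 1/theta), test the Euler-Lagrange equation against the
   derivative of the real part of w / (s - p) - conj w / (s - conj p) along
   gamma_1. Dilating gamma outwards and inwards evaluates the kernel against it
   by residues at p, so that Fubini leaves the Poisson integral of
   Im (J_c(p) / (J_c(p) - y)) against mu. Letting p tend to s(t0) yields
     2 pi^2 x psi(x) = int_0^b (V'(y) y)' log |(s - conj s(t0)) / (s - s(t0))| dy
                       + 2 q (t0) ((1 + 1/theta) pi - I / theta),
   with x = y(t0), I = int_0^pi V'(y(t)) y(t) dt and
   q (t0) = Im s(t0) / |s(t0) - 1/theta|^2, which blows up as t0 -> 0. If
   I > (1 + theta) pi the density would be negative near b; if I < (1 + theta) pi
   it would be unbounded near b and the effective potential would exceed l just
   to the right of b. Hence I = (1 + theta) pi: this is the equation for c, and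
   what is left of the identity is the formula for psi. *)
Require Import Defs.
From HB Require Import structures.
Set Warnings "-notation-overridden,-notation-incompatible-prefix,-ambiguous-paths,-overwriting-delimiting-key,-deprecated".
From mathcomp Require Import all_boot all_order all_algebra.
From mathcomp Require Import all_classical all_reals all_analysis.
From mathcomp Require Import complex measurable_realfun ring lra.
Import Order.TTheory GRing.Theory Num.Theory.
Import numFieldNormedType.Exports.
Local Open Scope classical_set_scope.
Local Open Scope ring_scope.
Local Open Scope complex_scope.

(** The two logarithms must be continued to opposite sides of gamma: [J] is holomorphic outside but
    has its cut inside, while [s J^theta] is a power of [1 + s] and so is holomorphic inside.
    Outside, [log (J - y)] winds around infinity; dividing by [s] makes it single-valued, and this
    same [s] is the factor that the inner logarithm needs, so no stray [log |s|] is left and the two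
    arguments cancel on gamma. The conjugate pole makes the test function purely imaginary on the
    real axis. All boundary terms at [-1] and [1/theta] then vanish, and everything can be done on
    the upper arc alone. The density is only known to be continuous on the open interval and may
    blow up at its ends. It is therefore recovered pointwise, at interior points, by an approximate
    identity, and the equation for [c] cannot be read off from a value of [psi] at [b]. It comes
    from comparing a remainder that is bounded up to the ends of the arc with a coefficient [q] that
    is not. Cauchy's theorem is needed only for dilates of gamma: the derivative of such an integral
    in the dilation factor is an exact derivative in the angle. *)

Local Notation Re := complex.Re.
Local Notation Im := complex.Im.

Arguments cabs {R} z : simpl never.
Arguments Arg {R} w : simpl never.
Arguments cpow {R} w a : simpl never.

(** * Complex numbers in rectangular and polar form *)

Section ComplexBasics.
Context {R : realType}.
Implicit Types (z w : R[i]) (x y : R).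

Lemma complex_eq z w : Re z = Re w -> Im z = Im w -> z = w.
Proof. by case: z w => [a b] [c d] /= -> ->. Qed.

Lemma ReD z w : Re (z + w) = Re z + Re w. Proof. by case: z w => [a b] []. Qed.
Lemma ImD z w : Im (z + w) = Im z + Im w. Proof. by case: z w => [a b] []. Qed.
Lemma ReN z : Re (- z) = - Re z. Proof. by case: z. Qed.
Lemma ImN z : Im (- z) = - Im z. Proof. by case: z. Qed.
Lemma ReB z w : Re (z - w) = Re z - Re w. Proof. by rewrite ReD ReN. Qed.
Lemma ImB z w : Im (z - w) = Im z - Im w. Proof. by rewrite ImD ImN. Qed.
Lemma ReM z w : Re (z * w) = Re z * Re w - Im z * Im w.
Proof. by case: z w => [a b] []. Qed.
Lemma ImM z w : Im (z * w) = Re z * Im w + Im z * Re w.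
Proof. by case: z w => [a b] []. Qed.
Lemma ReV z : Re z^-1 = Re z / (Re z ^+ 2 + Im z ^+ 2).
Proof. by case: z. Qed.
Lemma ImV z : Im z^-1 = - (Im z / (Re z ^+ 2 + Im z ^+ 2)).
Proof. by case: z. Qed.
Lemma ReC x : Re x%:C = x. Proof. by []. Qed.
Lemma ImC x : Im x%:C = 0. Proof. by []. Qed.
Lemma Im1 : Im (1 : R[i]) = 0. Proof. by []. Qed.
Lemma Re0 : Re (0 : R[i]) = 0. Proof. by []. Qed.
Lemma Im0 : Im (0 : R[i]) = 0. Proof. by []. Qed.

Lemma CM x y : (x * y)%:C = x%:C * y%:C :> R[i]. Proof. exact: rmorphM. Qed.
Lemma CD x y : (x + y)%:C = x%:C + y%:C :> R[i]. Proof. exact: rmorphD. Qed.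
Lemma CN x : (- x)%:C = - x%:C :> R[i]. Proof. exact: rmorphN. Qed.
Lemma CV x : (x^-1)%:C = x%:C^-1 :> R[i]. Proof. exact: fmorphV. Qed.
Lemma C_eq0 x : (x%:C == 0 :> R[i]) = (x == 0).
Proof. by rewrite eq_complex/= eqxx andbT. Qed.
Lemma ReCM x z : Re (x%:C * z) = x * Re z.
Proof. by rewrite ReM ImC mul0r subr0. Qed.
Lemma ImCM x z : Im (x%:C * z) = x * Im z.
Proof. by rewrite ImM ImC mul0r addr0. Qed.

Lemma ReJ z : Re (cconj z) = Re z. Proof. by []. Qed.
Lemma ImJ z : Im (cconj z) = - Im z. Proof. by []. Qed.
Lemma cconjM z w : cconj (z * w) = cconj z * cconj w.
Proof. by apply: complex_eq; rewrite !(ReJ, ImJ, ReM, ImM); ring. Qed.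
Lemma cconjV z : cconj z^-1 = (cconj z)^-1.
Proof. by apply: complex_eq; rewrite !(ReJ, ImJ, ReV, ImV) ?sqrrN ?mulNr. Qed.
Lemma cconjD z w : cconj (z + w) = cconj z + cconj w.
Proof. by apply: complex_eq; rewrite !(ReJ, ImJ, ReD, ImD)// opprD. Qed.
Lemma cconjN z : cconj (- z) = - cconj z.
Proof. by apply: complex_eq; rewrite !(ReJ, ImJ, ReN, ImN). Qed.
Lemma cconjC x : cconj x%:C = x%:C.
Proof. by apply: complex_eq; rewrite !(ReJ, ImJ)/= ?oppr0. Qed.
Lemma cconjK z : cconj (cconj z) = z.
Proof. by apply: complex_eq; rewrite !(ReJ, ImJ) ?opprK. Qed.
Lemma cconj_eq0 z : (cconj z == 0) = (z == 0).
Proof. by rewrite !eq_complex ReJ ImJ oppr_eq0. Qed.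

Lemma cabsE z : cabs z = Num.sqrt (Re z ^+ 2 + Im z ^+ 2). Proof. by case: z. Qed.
Lemma cabs_ge0 z : 0 <= cabs z. Proof. by rewrite cabsE sqrtr_ge0. Qed.
Lemma cabs_sqr z : cabs z ^+ 2 = Re z ^+ 2 + Im z ^+ 2.
Proof. by rewrite cabsE sqr_sqrtr// addr_ge0 ?sqr_ge0. Qed.
Lemma cabsM z w : cabs (z * w) = cabs z * cabs w. Proof. exact: Normc.normcM. Qed.
Lemma cabsV z : cabs z^-1 = (cabs z)^-1. Proof. exact: Normc.normcV. Qed.
Lemma cabs_eq0 z : (cabs z == 0) = (z == 0).
Proof.
apply/idP/eqP => [/eqP/Normc.eq0_normc //|->]; by rewrite /cabs Normc.normc0.
Qed.
Lemma cabs_gt0 z : (0 < cabs z) = (z != 0).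
Proof. by rewrite lt0r cabs_eq0 cabs_ge0 andbT. Qed.
Lemma cabsJ z : cabs (cconj z) = cabs z.
Proof. by rewrite !cabsE ReJ ImJ sqrrN. Qed.
Lemma cabsN z : cabs (- z) = cabs z.
Proof. by rewrite !cabsE ReN ImN !sqrrN. Qed.
Lemma cabs0 : cabs (0 : R[i]) = 0. Proof. exact: Normc.normc0. Qed.
Lemma cabsC x : cabs x%:C = `|x|.
Proof. by rewrite cabsE ReC ImC expr0n addr0 sqrtr_sqr. Qed.

Lemma normRe_le z : `|Re z| <= cabs z.
Proof. by rewrite cabsE -sqrtr_sqr ler_sqrt ?lerDl ?addr_ge0 ?sqr_ge0. Qed.
Lemma normIm_le z : `|Im z| <= cabs z.
Proof. by rewrite cabsE -sqrtr_sqr ler_sqrt ?lerDr ?addr_ge0 ?sqr_ge0. Qed.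
Lemma cabs_le z : cabs z <= `|Re z| + `|Im z|.
Proof.
rewrite -(@ler_pXn2r _ 2) ?nnegrE ?cabs_ge0 ?addr_ge0//.
rewrite cabs_sqr sqrrD !real_normK ?num_real//.
have : 0 <= `|Re z| * `|Im z| by rewrite mulr_ge0.
lra.
Qed.

Lemma cabsD_le z w : cabs (z + w) <= cabs z + cabs w.
Proof.
have := ComplexField.lec_normD z w.
by rewrite -[ComplexField.lec _ _]/((cabs (z + w))%:C <= (cabs z)%:C + (cabs w)%:C)
  -rmorphD lecR.
Qed.

Lemma slit_Re_neq z : 0 < Re z \/ Im z != 0 -> z != 0.
Proof. by rewrite eq_complex; case=> [/gt_eqF -> //|/negPf -> ]; rewrite andbF. Qed.

Definition expi x : R[i] := Complex (cos x) (sin x).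

Lemma Im_expi x : Im (expi x) = sin x. Proof. by []. Qed.
Lemma cabs_expi x : cabs (expi x) = 1.
Proof. by rewrite cabsE/= cos2Dsin2 sqrtr1. Qed.
Lemma expiD x y : expi (x + y) = expi x * expi y.
Proof. by apply: complex_eq; rewrite ?ReM ?ImM/= ?cosD ?sinD//; ring. Qed.
Lemma expi0 : expi 0 = 1.
Proof. by rewrite /expi cos0 sin0. Qed.
Lemma expi_neq0 x : expi x != 0.
Proof. by rewrite -cabs_eq0 cabs_expi oner_eq0. Qed.
Lemma expiN x : expi (- x) = (expi x)^-1.
Proof.
by apply/(mulfI (expi_neq0 x)); rewrite -expiD subrr expi0 divff// expi_neq0.
Qed.
Lemma cconj_expi x : cconj (expi x) = expi (- x).
Proof. by apply: complex_eq; rewrite /= ?cosN ?sinN. Qed.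

Definition cexp z : R[i] := (expR (Re z))%:C * expi (Im z).
Definition clog z : R[i] := Complex (ln (cabs z)) (Arg z).

Lemma cabs_cexp z : cabs (cexp z) = expR (Re z).
Proof. by rewrite cabsM cabsC cabs_expi mulr1 ger0_norm ?expR_ge0. Qed.
Lemma cexpD z w : cexp (z + w) = cexp z * cexp w.
Proof. by rewrite /cexp ReD ImD expRD expiD rmorphM; ring. Qed.
Lemma cexp0 : cexp 0 = 1.
Proof. by rewrite /cexp Re0 Im0 expR0 expi0 mulr1. Qed.

Lemma Re_div_cabs z : z != 0 -> -1 <= Re z / cabs z <= 1.
Proof.
rewrite -cabs_gt0 => z0; rewrite -ler_norml normrM normfV (ger0_norm (cabs_ge0 _)).
by rewrite ler_pdivrMr// mul1r normRe_le.
Qed.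

Lemma polar z : z != 0 -> z = (cabs z)%:C * expi (Arg z).
Proof.
move=> z0; have cz := Re_div_cabs _ z0.
have az : 0 < cabs z by rewrite cabs_gt0.
have cE : cos (Arg z) = Re z / cabs z.
  by rewrite /Arg; case: ifP => _; rewrite ?cosN acosK// in_itv/=.
have sE0 : sin (acos (Re z / cabs z)) = `|Im z| / cabs z.
  rewrite sin_acos// -[RHS]ger0_norm ?divr_ge0 ?cabs_ge0// -sqrtr_sqr.
  congr Num.sqrt; rewrite !expr_div_n real_normK ?num_real//.
  have := cabs_sqr z => /(congr1 (fun u => u - Re z ^+ 2)); rewrite addrAC subrr add0r => <-.
  by field; rewrite gt_eqF.
have sE : sin (Arg z) = Im z / cabs z.
  rewrite /Arg; case: ifPn => [i0|]; first by rewrite sE0 ger0_norm.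
  by rewrite -ltNge => i0; rewrite sinN sE0 ltr0_norm// mulNr opprK.
by apply: complex_eq; rewrite ?ReCM ?ImCM/= ?cE ?sE mulrC divfK// gt_eqF.
Qed.

Lemma Arg_bound z : z != 0 -> - pi < Arg z <= pi.
Proof.
move=> z0; have cz := Re_div_cabs _ z0.
have a0 := acos_ge0 cz; have ap := acos_lepi cz.
have p0 : 0 < pi :> R := pi_gt0 R.
rewrite /Arg; case: ifPn => [i0|]; first by apply/andP; split => //; lra.
rewrite -ltNge => i0; apply/andP; split; last by lra.
rewrite ltrN2 acos_ltpi//; case/andP: cz => c1 c2; rewrite c2 andbT.
rewrite lt_neqAle c1 andbT eq_sym; apply/negP => /eqP e.
have az : 0 < cabs z by rewrite cabs_gt0.
have : cabs z ^+ 2 = Re z ^+ 2.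
  have -> : Re z = - cabs z by rewrite -[LHS](divfK (lt0r_neq0 az)) e mulN1r.
  by rewrite sqrrN.
by rewrite cabs_sqr => /eqP; rewrite -subr_eq0 addrAC subrr add0r expf_eq0/= lt_eqF.
Qed.

Lemma expi_inj x y : - pi < x <= pi -> - pi < y <= pi -> expi x = expi y -> x = y.
Proof.
move=> /andP[x1 x2] /andP[y1 y2] e.
have : expi (x - y) = 1 by rewrite expiD expiN e divff// expi_neq0.
wlog xy : x y x1 x2 y1 y2 e / y <= x.
  move=> h; case: (leP y x) => [yx|/ltW xy] E; first exact: h.
  apply/esym/h => //; by rewrite expiD expiN e divff// expi_neq0.
move=> [c s].
have hxy : 0 <= (x - y) / 2 <= pi by apply/andP; split; lra.
(* Half the difference lies in [[0, pi]], where cosine is injective, so it is 0 or [pi]; the value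
   [pi] is excluded by the half-open interval. *)
have : cos ((x - y)/2) ^+ 2 = 1.
  have := cos_mulr2n ((x - y)/2); rewrite (_ : _ *+ 2 = x - y); last by rewrite mulr2n; lra.
  by rewrite c mulr2n; lra.
move/eqP; rewrite sqrf_eq1 => /orP[]/eqP h.
  have : (x - y) / 2 = 0.
    by apply: cos_inj; rewrite ?in_itv//= ?lexx ?pi_ge0// cos0.
  lra.
have : (x - y) / 2 = pi.
  by apply: cos_inj; rewrite ?in_itv//= ?lexx ?pi_ge0// cospi.
lra.
Qed.

Lemma Arg_polar x y : 0 < x -> - pi < y <= pi -> Arg (x%:C * expi y) = y.
Proof.
move=> x0 yb; have z0 : x%:C * expi y != 0.
  by rewrite mulf_neq0 ?expi_neq0// eq_complex/= gt_eqF.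
apply: expi_inj => //; first exact: Arg_bound.
have := polar _ z0; rewrite cabsM cabsC cabs_expi mulr1 gtr0_norm//.
by move/mulfI => <-//; rewrite eq_complex/= gt_eqF.
Qed.

Lemma cexp_clog z : z != 0 -> cexp (clog z) = z.
Proof. by move=> z0; rewrite /cexp/= lnK ?posrE ?cabs_gt0// -polar. Qed.

Lemma cpowE z x : z != 0 -> cpow z x = cexp (x%:C * clog z).
Proof. by move=> z0; rewrite /cpow (negPf z0) /cexp ReCM ImCM. Qed.

Lemma cpow_polar x y u : 0 < x -> - pi < y <= pi ->
  cpow (x%:C * expi y) u = (expR (u * ln x))%:C * expi (u * y).
Proof.
move=> x0 yb; have z0 : x%:C * expi y != 0.
  by rewrite mulf_neq0 ?expi_neq0// eq_complex/= gt_eqF.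
by rewrite /cpow (negPf z0) Arg_polar// cabsM cabsC cabs_expi mulr1 gtr0_norm.
Qed.

(** The definition of [Arg] changes sign across the real axis. This form has no case split and
    yields continuity across the positive reals. *)
Lemma Arg_Re_gt0 z : 0 < Re z -> Arg z = atan (Im z / Re z).
Proof.
move=> z0; have zn : z != 0 by apply: slit_Re_neq; left.
set p := atan _; have [p1 p2] : - (pi / 2) < p /\ p < pi / 2 := conj (atan_gtNpi2 _) (atan_ltpi2 _).
have cp : 0 < cos p by apply: cos_gt0_pihalf; rewrite p1 p2.
have tp : sin p / cos p = Im z / Re z by rewrite -[LHS]/(tan p) atanK.
have -> : z = (Re z / cos p)%:C * expi p.
  apply: complex_eq; rewrite ?ReCM ?ImCM/= ?divfK ?gt_eqF//.
  by rewrite mulrAC -mulrA tp mulrC divfK// gt_eqF.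
have p0 : 0 < pi :> R := pi_gt0 R.
by rewrite Arg_polar// ?divr_gt0//; apply/andP; split; lra.
Qed.

Lemma ArgJ z : Im z != 0 -> Arg (cconj z) = - Arg z.
Proof.
move=> z0; rewrite /Arg ImJ ReJ cabsJ oppr_ge0.
case: ltgtP z0 => //= _ _; by rewrite opprK.
Qed.

Lemma Arg_scale x z : 0 < x -> z != 0 -> Arg (x%:C * z) = Arg z.
Proof.
move=> x0 z0; rewrite [in LHS](polar _ z0) mulrA -rmorphM Arg_polar ?Arg_bound//.
by rewrite mulr_gt0 ?cabs_gt0.
Qed.

Lemma Im_sin_Arg z : z != 0 -> sin (Arg z) = Im z / cabs z.
Proof.
move=> z0; rewrite {2}(polar _ z0) ImCM/= mulrAC divff ?mul1r// gt_eqF ?cabs_gt0//.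
Qed.

Lemma Arg_upper z : 0 < Im z -> 0 < Arg z < pi.
Proof.
move=> z0; have zn : z != 0 by apply: slit_Re_neq; right; rewrite gt_eqF.
have := Arg_bound _ zn => /andP[a1 a2].
have s0 : 0 < sin (Arg z) by rewrite Im_sin_Arg// divr_gt0 ?cabs_gt0.
have A0 : 0 <= Arg z by rewrite /Arg (ltW z0) acos_ge0// Re_div_cabs.
rewrite !lt_neqAle A0 a2 !andbT; apply/andP; split; apply/eqP => e.
  by move: s0; rewrite -e sin0 ltxx.
by move: s0; rewrite e sinpi ltxx.
Qed.

End ComplexBasics.

(** * Complex differentiability *)

Section ComplexCalculus.
Context {R : realType}.
Implicit Types (z w : R[i]).

(** Componentwise convergence along an arbitrary filter reduces to real limits and covers sequences,
    paths and two-parameter families at once. *)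
Definition ccvg {T : Type} (F : set_system T) (g : T -> R[i]) (l : R[i]) :=
  (fun x => Re (g x)) @ F --> Re l /\ (fun x => Im (g x)) @ F --> Im l.

Section Filter.
Context {T : Type} {F : set_system T} {FF : Filter F}.
Implicit Types g h : T -> R[i].

Lemma ccvg_cst z : ccvg F (fun=> z) z.
Proof. by split; apply: cvg_cst. Qed.

Lemma ccvgC (g : T -> R) (x : R) : g @ F --> x -> ccvg F (fun t => (g t)%:C) x%:C.
Proof. by move=> h; split => //=; apply: cvg_cst. Qed.

Lemma ccvgD g h z w : ccvg F g z -> ccvg F h w -> ccvg F (fun x => g x + h x) (z + w).
Proof.
move=> [g1 g2] [h1 h2]; split.
  by rewrite ReD; under eq_fun do rewrite ReD; apply: cvgD.
by rewrite ImD; under eq_fun do rewrite ImD; apply: cvgD.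
Qed.

Lemma ccvgN g z : ccvg F g z -> ccvg F (fun x => - g x) (- z).
Proof.
move=> [g1 g2]; split.
  by rewrite ReN; under eq_fun do rewrite ReN; apply: cvgN.
by rewrite ImN; under eq_fun do rewrite ImN; apply: cvgN.
Qed.

Lemma ccvgB g h z w : ccvg F g z -> ccvg F h w -> ccvg F (fun x => g x - h x) (z - w).
Proof. by move=> g1 h1; apply: ccvgD => //; apply: ccvgN. Qed.

Lemma ccvgM g h z w : ccvg F g z -> ccvg F h w -> ccvg F (fun x => g x * h x) (z * w).
Proof.
move=> [g1 g2] [h1 h2]; split.
  by rewrite ReM; under eq_fun do rewrite ReM; apply: cvgB; apply: cvgM.
by rewrite ImM; under eq_fun do rewrite ImM; apply: cvgD; apply: cvgM.
Qed.

Lemma ccvg_sqr g z : ccvg F g z ->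
  (fun x => Re (g x) ^+ 2 + Im (g x) ^+ 2) @ F --> Re z ^+ 2 + Im z ^+ 2.
Proof.
move=> [g1 g2]; under eq_fun do rewrite !expr2.
by rewrite !expr2; apply: cvgD; apply: cvgM.
Qed.

Lemma ccvgV g z : z != 0 -> ccvg F g z -> ccvg F (fun x => (g x)^-1) z^-1.
Proof.
move=> z0 gz; have [g1 g2] := gz; have := ccvg_sqr _ _ gz.
have nz : Re z ^+ 2 + Im z ^+ 2 != 0 by rewrite -cabs_sqr expf_eq0/= cabs_eq0.
move=> gs; have gi := cvgV nz gs; split.
  by rewrite ReV; under eq_fun do rewrite ReV; apply: cvgM; [exact: g1|exact: gi].
by rewrite ImV; under eq_fun do rewrite ImV; apply: cvgN; apply: cvgM; [exact: g2|exact: gi].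
Qed.

Lemma ccvg_cabs g z : ccvg F g z -> (fun x => cabs (g x)) @ F --> cabs z.
Proof.
move=> /ccvg_sqr h; rewrite cabsE; under eq_fun do rewrite cabsE.
by apply: (cvg_comp _ _ h); apply: sqrt_continuous.
Qed.

Lemma ccvg_conj g z : ccvg F g z -> ccvg F (fun x => cconj (g x)) (cconj z).
Proof. by move=> [g1 g2]; split => //=; apply: cvgN. Qed.

Lemma ccvg_cabs0 g : (fun x => cabs (g x)) @ F --> 0 -> ccvg F g 0.
Proof.
move=> h; split; apply/cvgrPdist_lt => e e0; move/cvgrPdist_lt: h => /(_ _ e0);
  apply: filterS => t; rewrite !sub0r !normrN (ger0_norm (cabs_ge0 _));
  apply: le_lt_trans; [exact: normRe_le|exact: normIm_le].
Qed.

Lemma ccvg_neq0 g z : z != 0 -> ccvg F g z -> F [set x | g x != 0].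
Proof.
move=> z0 /ccvg_cabs h; have a0 : 0 < cabs z by rewrite cabs_gt0.
by apply: filterS (cvgr_gt _ h _ a0) => t /=; rewrite cabs_gt0.
Qed.

Lemma ccvg_near g h z : F [set x | g x = h x] -> ccvg F g z -> ccvg F h z.
Proof.
move=> gh [g1 g2]; split.
  apply: cvg_trans g1; apply: near_eq_cvg; apply: filterS gh => t /= <- //.
apply: cvg_trans g2; apply: near_eq_cvg; apply: filterS gh => t /= <- //.
Qed.

(** The plane cut along the closed negative real axis, domain of the principal logarithm. *)
Definition slit z := 0 < Re z \/ Im z != 0.

Lemma cvg_Arg g z : slit z -> ccvg F g z -> (fun x => Arg (g x)) @ F --> Arg z.
Proof.
move=> sz gz; have [g1 g2] := gz.
have z0 : z != 0 by exact: slit_Re_neq.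
case: sz => [rz|].
  have h : (fun x => atan (Im (g x) / Re (g x))) @ F --> atan (Im z / Re z).
    have hq : (fun x => Im (g x) / Re (g x)) @ F --> Im z / Re z.
      by apply: cvgM => //; apply: cvgV => //; rewrite gt_eqF.
    by apply: (cvg_comp _ _ hq); exact: continuous_atan.
  rewrite Arg_Re_gt0//; apply: cvg_trans h; apply: near_eq_cvg.
  by apply: filterS (cvgr_gt _ g1 _ rz) => t /= ?; rewrite Arg_Re_gt0.
(* Off the real axis [|Re z| < |z|], so [acos] is evaluated in the open interval where it is
   continuous. *)
have hac : Im z != 0 ->
    (fun x => acos (Re (g x) / cabs (g x))) @ F --> acos (Re z / cabs z).
  move=> iz; have hq : (fun x => Re (g x) / cabs (g x)) @ F --> Re z / cabs z.
    by apply: cvgM => //; apply: cvgV (ccvg_cabs _ _ gz); rewrite cabs_eq0.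
  apply: (cvg_comp _ _ hq).
  apply: continuous_acos; rewrite -ltr_norml normrM normfV (ger0_norm (cabs_ge0 _)).
  rewrite ltr_pdivrMr ?cabs_gt0// mul1r cabsE -sqrtr_sqr ltr_sqrt.
    by rewrite ltrDl exprn_even_gt0.
  by rewrite -cabs_sqr exprn_gt0// cabs_gt0.
case: ltgtP => // iz _.
  rewrite {2}/Arg leNgt iz/=; apply: cvg_trans (cvgN (hac _)); last by rewrite lt_eqF.
  apply: near_eq_cvg; apply: filterS (cvgr_lt _ g2 _ iz) => t /= ?.
  by rewrite /Arg leNgt (_ : Im _ < 0).
rewrite {2}/Arg (ltW iz); apply: cvg_trans (hac _); last by rewrite gt_eqF.
apply: near_eq_cvg; apply: filterS (cvgr_gt _ g2 _ iz) => t /= h.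
by rewrite /Arg (ltW h).
Qed.

Lemma ccvg_clog g z : slit z -> ccvg F g z -> ccvg F (fun x => clog (g x)) (clog z).
Proof.
move=> sz gz; split => /=; last exact: cvg_Arg.
apply: (cvg_comp _ _ (ccvg_cabs _ _ gz)); apply: continuous_ln.
by rewrite cabs_gt0 slit_Re_neq.
Qed.

End Filter.

Lemma ccvg_Re {T : topologicalType} (g : T -> R[i]) (x : T) :
  ccvg (nbhs x) g (g x) -> {for x, continuous (fun u => Re (g u))}.
Proof. by case. Qed.

(** Continuity at [z] tested against every filter converging to [z]: composition is immediate, and
    one statement applies to sequences, to paths and to the pair (dilation, angle). *)
Definition ucont (f : R[i] -> R[i]) z := forall (T : Type) (F : set_system T),
  Filter F -> forall g : T -> R[i], ccvg F g z -> ccvg F (fun x => f (g x)) (f z).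

(* Caratheodory's form of complex differentiability. *)
Definition chol (G : R[i] -> R[i]) z (D : R[i]) := exists f : R[i] -> R[i],
  [/\ forall w, G w = G z + f w * (w - z), f z = D & ucont f z].

Lemma ucont_cst c z : ucont (fun=> c) z.
Proof. by move=> T F FF g _; exact: ccvg_cst. Qed.
Lemma ucont_id z : ucont id z.
Proof. by []. Qed.
Lemma ucontD f g z : ucont f z -> ucont g z -> ucont (fun w => f w + g w) z.
Proof. by move=> hf hg T F FF h hz; apply: ccvgD; [exact: hf|exact: hg]. Qed.
Lemma ucontN f z : ucont f z -> ucont (fun w => - f w) z.
Proof. by move=> hf T F FF h hz; apply: ccvgN; exact: hf. Qed.
Lemma ucontB f g z : ucont f z -> ucont g z -> ucont (fun w => f w - g w) z.
Proof. by move=> hf hg; apply: ucontD => //; apply: ucontN. Qed.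
Lemma ucontM f g z : ucont f z -> ucont g z -> ucont (fun w => f w * g w) z.
Proof. by move=> hf hg T F FF h hz; apply: ccvgM; [exact: hf|exact: hg]. Qed.
Lemma ucontV f z : f z != 0 -> ucont f z -> ucont (fun w => (f w)^-1) z.
Proof. by move=> fz hf T F FF h hz; apply: (@ccvgV _ _ _ (fun x => f (h x))) => //; exact: hf. Qed.
Lemma ucont_div f g z : g z != 0 -> ucont f z -> ucont g z -> ucont (fun w => f w / g w) z.
Proof. by move=> gz hf hg; apply: ucontM => //; apply: ucontV. Qed.
Lemma ucont_comp f g z : ucont f z -> ucont g (f z) -> ucont (fun w => g (f w)) z.
Proof. by move=> hf hg T F FF h hz; apply: (hg _ _ _ (fun x => f (h x))); exact: hf. Qed.
Lemma chol_ucont G z D : chol G z D -> ucont G z.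
Proof.
move=> [f [fE fz cf]] T F FF g gz.
have -> : (fun x => G (g x)) = fun x => G z + f (g x) * (g x - z).
  by apply/funext => x; exact: fE.
have {2}-> : G z = G z + f z * (z - z) by rewrite subrr mulr0 addr0.
apply: ccvgD; first exact: ccvg_cst.
by apply: ccvgM; [exact: cf|apply: ccvgB => //; exact: ccvg_cst].
Qed.

Lemma chol_cst c z : chol (fun=> c) z 0.
Proof. by exists (fun=> 0); split => // [w|]; [rewrite mul0r addr0|exact: ucont_cst]. Qed.
Lemma chol_id z : chol id z 1.
Proof. by exists (fun=> 1); split => // [w|]; [rewrite mul1r addrC subrK|exact: ucont_cst]. Qed.
Lemma cholD G H z D E : chol G z D -> chol H z E -> chol (fun w => G w + H w) z (D + E).
Proof.
move=> [f [fE fz cf]] [g [gE gz cg]]; exists (fun w => f w + g w); split.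
- by move=> w; rewrite fE gE; ring.
- by rewrite fz gz.
- exact: ucontD.
Qed.
Lemma cholM G H z D E : chol G z D -> chol H z E ->
  chol (fun w => G w * H w) z (D * H z + G z * E).
Proof.
move=> hG hH; have cH := chol_ucont _ _ _ hH; move: hG hH.
move=> [f [fE fz cf]] [g [gE gz cg]].
exists (fun w => f w * H w + G z * g w); split.
- by move=> w; rewrite fE (gE w); ring.
- by rewrite fz gz.
- by apply: ucontD; apply: ucontM => //; exact: ucont_cst.
Qed.
Lemma cholZ c G z D : chol G z D -> chol (fun w => c * G w) z (c * D).
Proof.
move=> h; have := cholM _ _ _ _ _ (chol_cst c z) h; by rewrite mul0r add0r.
Qed.
Lemma cholN G z D : chol G z D -> chol (fun w => - G w) z (- D).
Proof.
move=> /(cholZ (-1)); rewrite mulN1r; congr chol; apply/funext => w; exact: mulN1r.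
Qed.
Lemma cholB G H z D E : chol G z D -> chol H z E -> chol (fun w => G w - H w) z (D - E).
Proof. by move=> hG hH; apply: cholD => //; apply: cholN. Qed.
Lemma chol_comp G H z D E : chol G z D -> chol H (G z) E ->
  chol (fun w => H (G w)) z (E * D).
Proof.
move=> hG; have cG := chol_ucont _ _ _ hG; move: hG.
move=> [f [fE fz cf]] [g [gE gz cg]].
exists (fun w => g (G w) * f w); split.
- by move=> w; rewrite (gE (G w)) {2}(fE w); ring.
- by rewrite fz gz.
- by apply: ucontM => //; exact: ucont_comp.
Qed.
Lemma chol_inv z : z != 0 -> chol (fun w => w^-1) z (- z^-2).
Proof.
move=> z0; exists (fun w => if w == 0 then - (z^-1 * - z^-1) else - (z^-1 * w^-1)); split.
- move=> w; case: eqVneq => [->|w0]; first by rewrite invr0; field.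
  by field; rewrite w0 z0.
- by rewrite (negPf z0) expr2 invfM.
- move=> T F FF g gz; rewrite (negPf z0).
  apply: (@ccvg_near _ _ _ (fun x => - (z^-1 * (g x)^-1))).
    by apply: filterS (ccvg_neq0 _ _ z0 gz) => t /= /negPf ->.
  by apply: ccvgN; apply: ccvgM; [exact: ccvg_cst|exact: ccvgV].
Qed.
Lemma cholV G z D : G z != 0 -> chol G z D -> chol (fun w => (G w)^-1) z (- D / G z ^+ 2).
Proof.
move=> Gz h; have := chol_comp _ _ _ _ _ h (chol_inv _ Gz).
by rewrite mulNr mulrC -mulNr.
Qed.
Lemma chol_div G H z D E : H z != 0 -> chol G z D -> chol H z E ->
  chol (fun w => G w / H w) z ((D * H z - G z * E) / H z ^+ 2).
Proof.
move=> Hz hG hH; have := cholM _ _ _ _ _ hG (cholV _ _ _ Hz hH).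
by congr chol; field.
Qed.
Lemma chol_eqD G z D E : D = E -> chol G z D -> chol G z E.
Proof. by move=> ->. Qed.

(** With difference quotients completed by their limit, the chain and product rules become ring
    identities. *)
Lemma real_slope (f : R -> R) (t d : R) : is_derive t (1 : R) f d ->
  exists g : R -> R, [/\ forall u, f u = f t + g u * (u - t), g t = d & {for t, continuous g}].
Proof.
move=> [df fd]; exists (fun u => if u == t then d else (f u - f t) / (u - t)); split.
- move=> u; case: eqVneq => [->|ut]; first by rewrite subrr mulr0 addr0.
  by rewrite divfK ?subr_eq0// addrC subrK.
- by rewrite eqxx.
- apply/continuous_withinNshiftx; rewrite eqxx.
  have h : (fun h => h^-1 *: ((f \o shift t) (h *: (1 : R)) - f t)) @ 0^' --> d.
    by rewrite -fd; exact: df.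
  apply: cvg_trans h; apply: near_eq_cvg; near=> h.
  have h0 : h != 0 by near: h; exact: nbhs_dnbhs_neq.
  rewrite /= -subr_eq0 addrK (negPf h0) [h *: 1]mulr1 [_ *: _]mulrC; congr (_ / _).
Unshelve. all: by end_near. Qed.

Lemma slope_is_derive (f g : R -> R) (t : R) :
  (forall u, f u = f t + g u * (u - t)) -> {for t, continuous g} ->
  is_derive t (1 : R) f (g t).
Proof.
move=> fE /continuous_withinNshiftx cg.
have h : (fun h => h^-1 *: ((f \o shift t) (h *: (1 : R)) - f t)) @ 0^' --> g t.
  apply: cvg_trans cg; apply: near_eq_cvg; near=> h.
  have h0 : h != 0 by near: h; exact: nbhs_dnbhs_neq.
  rewrite /= [h *: 1]mulr1 (fE (h + t)) [_ *: _]mulrC addrAC subrr add0r addrK.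
  by rewrite mulfK.
split; last by apply: (cvg_lim _ h).
by apply/cvg_ex; exists (g t).
Unshelve. all: by end_near. Qed.

Definition pder (g : R -> R[i]) (t : R) (d : R[i]) :=
  is_derive t (1 : R) (fun u => Re (g u)) (Re d) /\
  is_derive t (1 : R) (fun u => Im (g u)) (Im d).

Lemma pder_slope g t d : pder g t d -> exists h : R -> R[i],
  [/\ forall u, g u = g t + h u * (u - t)%:C, h t = d & ccvg (nbhs t) h d].
Proof.
move=> [/real_slope[h1 [h1E h1t ch1]] /real_slope[h2 [h2E h2t ch2]]].
exists (fun u => Complex (h1 u) (h2 u)); split.
- move=> u; apply: complex_eq; rewrite ?(ReD, ImD) ?(ReM, ImM)/=.
    by rewrite h1E !mulr0 subr0.
  by rewrite h2E !mulr0 add0r.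
- by apply: complex_eq.
- by split => /=; rewrite -?h1t -?h2t.
Qed.

Lemma slope_pder (g h : R -> R[i]) t d : (forall u, g u = g t + h u * (u - t)%:C) ->
  h t = d -> ccvg (nbhs t) h d -> pder g t d.
Proof.
move=> gE <- [c1 c2]; split.
  apply: (slope_is_derive _ (fun u => Re (h u))) => // u.
  by rewrite {1}gE ReD ReM/= mulr0 subr0.
apply: (slope_is_derive _ (fun u => Im (h u))) => // u.
by rewrite {1}gE ImD ImM/= mulr0 add0r.
Qed.

Lemma pder_ccvg g t d : pder g t d -> ccvg (nbhs t) g (g t).
Proof.
move=> /pder_slope[h [hE _ ch]].
have -> : g = fun u => g t + h u * (u - t)%:C by apply/funext.
have -> : g t + h t * (t - t)%:C = g t + d * (t - t)%:C.
  by rewrite subrr rmorph0 !mulr0.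
apply: ccvgD; first exact: ccvg_cst.
by apply: ccvgM => //; apply: ccvgC; apply: cvgB; [exact: cvg_id|exact: cvg_cst].
Qed.

Lemma chol_path G g t d D : chol G (g t) D -> pder g t d -> pder (fun u => G (g u)) t (D * d).
Proof.
move=> [f [fE fz cf]] pg; have cg := pder_ccvg _ _ _ pg.
have [h [hE ht ch]] := pder_slope _ _ _ pg.
apply: (slope_pder _ (fun u => f (g u) * h u)).
- by move=> u; rewrite (fE (g u)) {2}(hE u); ring.
- by rewrite fz ht.
- by apply: ccvgM => //; rewrite -fz; exact: cf.
Qed.

Lemma pderM g h t d e : pder g t d -> pder h t e ->
  pder (fun u => g u * h u) t (d * h t + g t * e).
Proof.
move=> pg ph; have cg := pder_ccvg _ _ _ pg.
have [g' [gE gt cg']] := pder_slope _ _ _ pg.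
have [h' [hE ht ch]] := pder_slope _ _ _ ph.
apply: (slope_pder _ (fun u => g' u * h t + g u * h' u)).
- by move=> u; rewrite (hE u) (gE u); ring.
- by rewrite gt ht.
- by apply: ccvgD; apply: ccvgM => //; exact: ccvg_cst.
Qed.

Lemma pderD g h t d e : pder g t d -> pder h t e -> pder (fun u => g u + h u) t (d + e).
Proof.
move=> [g1 g2] [h1 h2]; split.
  rewrite ReD (_ : (fun u => _) = (fun u => Re (g u)) \+ (fun u => Re (h u))).
    exact: is_deriveD.
  by apply/funext => u; rewrite ReD.
rewrite ImD (_ : (fun u => _) = (fun u => Im (g u)) \+ (fun u => Im (h u))).
  exact: is_deriveD.
by apply/funext => u; rewrite ImD.
Qed.

Lemma pder_cst c t : pder (fun=> c) t 0.
Proof. by split; exact: is_derive_cst. Qed.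

Lemma pderC (g : R -> R) t d : is_derive t (1 : R) g d -> pder (fun u => (g u)%:C) t d%:C.
Proof. by move=> h; split => //=; exact: is_derive_cst. Qed.

Lemma pder_expi t : pder (fun u => expi u) t (Complex 0 1 * expi t).
Proof.
split.
  by rewrite ReM/= mul0r mul1r sub0r; exact: is_derive_cos.
by rewrite ImM/= mul0r mul1r add0r; exact: is_derive_sin.
Qed.

Lemma pder_eqD g t d e : d = e -> pder g t d -> pder g t e.
Proof. by move=> ->. Qed.

(** Differentiability at the origin suffices, since the addition formula for [cexp] carries it to
    every point. *)
Lemma chol_cexp0 : chol cexp 0 1.
Proof.
have [e [eE e0 ce]] := real_slope _ _ _ (is_derive_expR (0 : R)).
have [c [cE c0 cc]] := real_slope _ _ _ (is_derive_cos (0 : R)).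
have [s [sE s0 cs]] := real_slope _ _ _ (is_derive_sin (0 : R)).
rewrite expR0 in e0; rewrite sin0 oppr0 in c0; rewrite cos0 in s0.
pose m w := Complex (expR (Re w) * c (Im w)) (expR (Re w) * s (Im w)).
pose n w : R[i] := (e (Re w))%:C.
have E w : cexp w = 1 + n w * (Re w)%:C + m w * (Im w)%:C.
  rewrite /cexp /n /m; apply: complex_eq.
    by rewrite ReCM !ReD !ReM/= (cE (Im w)) cos0 mulrDr mulr1 {1}(eE (Re w)) expR0; ring.
  by rewrite ImCM !ImD !ImM/= (sE (Im w)) sin0; ring.
exists (fun w => if w == 0 then 1 else (cexp w - 1) / w); split.
- move=> w; rewrite cexp0; case: eqVneq => [->|w0]; first by rewrite subrr mulr0 cexp0 addr0.
  by rewrite subr0 divfK// addrC subrK.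
- by rewrite eqxx.
- move=> T F FF g gz; rewrite eqxx; have [g1 g2] := gz.
  (* [n] tends to 1 and [m] to i, while Re w and Im w are at most |w|. *)
  have cn : ccvg F (fun x => n (g x) - 1) 0.
    rewrite -(subrr (1%:C : R[i])); apply: ccvgB; last exact: ccvg_cst.
    by rewrite -e0; apply: ccvgC; exact: (cvg_comp _ _ g1 ce).
  have cm : ccvg F (fun x => m (g x) - Complex 0 1) 0.
    rewrite -(subrr (Complex 0 1 : R[i])); apply: ccvgB; last exact: ccvg_cst.
    have cx : (fun x => expR (Re (g x))) @ F --> (1 : R).
      by rewrite -(expR0 R); apply: (cvg_comp _ _ g1); exact: continuous_expR.
    split => /=.
      rewrite -[X in _ --> X](mul1r 0) -c0; apply: cvgM => //; exact: (cvg_comp _ _ g2 cc).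
    rewrite -[X in _ --> X](mul1r 1) -{2}s0; apply: cvgM => //; exact: (cvg_comp _ _ g2 cs).
  have lim0 : (fun x => cabs (n (g x) - 1) + cabs (m (g x) - Complex 0 1)) @ F --> (0 : R).
    have c1 := @ccvg_cabs _ _ FF _ _ cn; have c2 := @ccvg_cabs _ _ FF _ _ cm.
    rewrite cabs0 in c1 c2; rewrite -[X in _ --> X](addr0 (0 : R)); exact: (cvgD c1 c2).
  suff : ccvg F (fun x => (if g x == 0 then 1 else (cexp (g x) - 1) / g x) - 1) 0.
    move=> h; have := ccvgD _ _ _ _ h (ccvg_cst 1); rewrite add0r => h2.
    by apply: (ccvg_near _ _ _ _ (h2 FF FF)); apply: filterE => x /=; rewrite subrK.
  apply: ccvg_cabs0; apply: squeeze_cvgr lim0; last exact: cvg_cst.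
  apply: filterE => x; rewrite cabs_ge0/=; case: eqVneq => [_|gx0].
    by rewrite subrr cabs0 addr_ge0// cabs_ge0.
  have -> : (cexp (g x) - 1) / g x - 1 =
     ((n (g x) - 1) * (Re (g x))%:C + (m (g x) - Complex 0 1) * (Im (g x))%:C) / g x.
    apply: (mulIf gx0); rewrite mulrBl mul1r !divfK// E.
    have gE : g x = (Re (g x))%:C + Complex 0 1 * (Im (g x))%:C.
      by apply: complex_eq; rewrite ?(ReD, ImD, ReM, ImM)/=; ring.
    move: gE; move: (n (g x)) (m (g x)) (Re (g x))%:C (Im (g x))%:C (Complex 0 1) => N M X Y I ->.
    ring.
  rewrite cabsM cabsV ler_pdivrMr ?cabs_gt0// [leRHS]mulrDl.
  apply: (le_trans (cabsD_le _ _)); rewrite !cabsM !cabsC.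
  by apply: lerD; apply: ler_wpM2l; rewrite ?cabs_ge0// ?normRe_le ?normIm_le.
Qed.

Lemma chol_cexp z : chol cexp z (cexp z).
Proof.
have [f [fE f0 cf]] := chol_cexp0.
exists (fun w => cexp z * f (w - z)); split.
- by move=> w; rewrite -{1}(subrK z w) cexpD (fE (w - z)) cexp0; ring.
- by rewrite subrr f0 mulr1.
- apply: ucontM; first exact: ucont_cst.
  apply: (ucont_comp (fun w => w - z)); first by apply: ucontB; [exact: ucont_id|exact: ucont_cst].
  by rewrite subrr.
Qed.

(** As [cexp (clog w) = w], the slope of [clog] is the inverse of the slope of [cexp] taken at
    [clog w]. That relation fails at [w = 0] only, where the raw difference quotient is used; this
    point is away from [z]. *)
Lemma chol_clog z : slit z -> chol clog z z^-1.
Proof.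
move=> sz; have z0 : z != 0 by exact: slit_Re_neq.
have [f [fE fz cf]] := chol_cexp (clog z); rewrite cexp_clog// in fE fz.
exists (fun w => if w == 0 then (clog w - clog z) / (w - z) else (f (clog w))^-1); split.
- move=> w; case: eqVneq => [->|w0].
    by rewrite divfK ?(addrC (clog z)) ?subrK// sub0r oppr_eq0.
  have := fE (clog w); rewrite cexp_clog// => wE.
  have [wz|wz] := eqVneq w z; first by rewrite wz subrr mulr0 addr0.
  have f0 : f (clog w) != 0.
    by apply: contraNneq wz => f0; rewrite wE f0 mul0r addr0.
  by rewrite {3}wE; field; exact: f0.
- by rewrite (negPf z0) fz.
- move=> T F FF g gz; rewrite (negPf z0).
  apply: (@ccvg_near _ _ _ (fun x => (f (clog (g x)))^-1)).
    by apply: filterS (ccvg_neq0 _ _ z0 gz) => t /= /negPf ->.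
  apply: (@ccvgV _ _ _ (fun x => f (clog (g x)))); first by rewrite fz.
  by apply: cf; exact: ccvg_clog.
Qed.

Lemma chol_near G H z D : G z = H z -> (exists2 e : R, 0 < e & forall w, cabs (w - z) < e -> G w = H w) ->
  chol G z D -> chol H z D.
Proof.
move=> GHz [e e0 GH] [f [fE fz cf]].
exists (fun w => if G w == H w then f w else (H w - H z) / (w - z)); split.
- move=> w; case: eqVneq => [<-|ne]; first by rewrite -GHz.
  rewrite divfK ?(addrC (H z)) ?subrK// subr_eq0; apply: contraNneq ne => ->; exact/eqP.
- by rewrite GHz eqxx.
- move=> T F FF g gz; rewrite GHz eqxx.
  apply: (@ccvg_near _ _ _ (fun x => f (g x))); last exact: cf.
  have h : (fun x => cabs (g x - z)) @ F --> (0 : R).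
    by rewrite -(@cabs0 R) -(subrr z); apply: ccvg_cabs; apply: ccvgB => //; exact: ccvg_cst.
  by apply: filterS (cvgr_lt _ h _ e0) => t /= /GH ->; rewrite eqxx.
Qed.

Lemma chol_cpow z (x : R) : slit z -> chol (fun w => cpow w x) z (x%:C * cpow z x / z).
Proof.
move=> sz; have z0 : z != 0 by exact: slit_Re_neq.
have a0 : 0 < cabs z by rewrite cabs_gt0.
apply: (@chol_near (fun w => cexp (x%:C * clog w))); first by rewrite cpowE.
  exists (cabs z) => // w wz; rewrite cpowE//; apply: contraTneq wz => ->.
  by rewrite sub0r cabsN ltxx.
apply: (chol_eqD _ _ (cexp (x%:C * clog z) * (x%:C * z^-1))).
  by rewrite cpowE//; ring.
apply: (chol_comp (fun w => x%:C * clog w)); last exact: chol_cexp.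
by apply: cholZ; exact: chol_clog.
Qed.

Lemma cabs_cpow z (x : R) : z != 0 -> cabs (cpow z x) = cabs z `^ x.
Proof. by move=> z0; rewrite cpowE// cabs_cexp ReCM /powR gt_eqF ?cabs_gt0. Qed.

(** At the end [-1] of the arc the base [(s + 1) / s] vanishes and leaves the slit plane; with a
    positive exponent the modulus [|w|^x] still tends to 0 there. *)
Lemma ucont_cpow0 (x : R) : 0 < x -> ucont (fun w => cpow w x) 0.
Proof.
move=> x0 T F FF g gz; rewrite {2}/cpow eqxx; apply: ccvg_cabs0.
have E w : cabs (cpow w x) = cabs w `^ x.
  have [->|w0] := eqVneq w 0; last exact: cabs_cpow.
  by rewrite /cpow eqxx !cabs0 powR0// gt_eqF.
under eq_fun do rewrite E.
have h : (fun x => cabs (g x)) @ F --> (0 : R) by rewrite -(@cabs0 R); exact: ccvg_cabs.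
apply/cvgrPdist_lt => e e0.
have d0 : 0 < e `^ x^-1 by rewrite powR_gt0.
apply: filterS (cvgr_lt _ h _ d0) => t /= ht.
rewrite sub0r normrN ger0_norm ?powR_ge0//.
have -> : e = (e `^ x^-1) `^ x by rewrite -powRrM mulVf ?gt_eqF// powRr1// ltW.
by apply: gt0_ltr_powR; rewrite ?nnegrE ?cabs_ge0 ?powR_ge0.
Qed.

Lemma ucont_cpow z (x : R) : 0 < x -> slit z \/ z = 0 -> ucont (fun w => cpow w x) z.
Proof.
move=> x0 [sz|->]; last exact: ucont_cpow0.
exact: chol_ucont (chol_cpow _ x sz).
Qed.

End ComplexCalculus.

(** * The cardinal sine and elementary sine bounds *)

Section Sinc.
Context {R : realType}.
Implicit Types x t : R.

Lemma norm_sin_le x : `|sin x| <= `|x|.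
Proof.
wlog x0 : x / 0 <= x.
  move=> h; case: (leP 0 x) => [|/ltW x0]; first exact: h.
  by rewrite -normrN -sinN -(normrN x) h// oppr_ge0.
move: x0; rewrite le_eqVlt => /predU1P[<-|x0]; first by rewrite sin0.
have [y _ ] := @MVT R sin cos 0 x x0 (fun y _ => is_derive_sin y)
  (continuous_subspaceT (@continuous_sin R)).
rewrite sin0 !subr0 => ->; by rewrite normrM ler_piMl// cos_max.
Qed.

Lemma onem_cos_le x : 0 <= 1 - cos x <= x ^+ 2 / 2.
Proof.
rewrite subr_ge0 cos_le1/=; have := norm_sin_le (x / 2).
rewrite -(@ler_pXn2r _ 2) ?nnegrE//; rewrite !real_normK ?num_real// => h.
have := cos_mulr2n (x / 2); rewrite (_ : _ *+ 2 = x); last by rewrite mulr2n; lra.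
rewrite cos2sin2 mulr2n => ->; move: h; rewrite exprMn exprVn; lra.
Qed.

Lemma norm_sinB_le x : `|sin x - x| <= `|x| ^+ 3.
Proof.
wlog x0 : x / 0 <= x.
  move=> h; case: (leP 0 x) => [|/ltW x0]; first exact: h.
  have := h (- x); rewrite oppr_ge0 => /(_ x0); rewrite sinN -opprD !normrN.
  by [].
move: x0; rewrite le_eqVlt => /predU1P[<-|x0]; first by rewrite sin0 subrr normr0 expr0n.
have [y + ] := @MVT R sin cos 0 x x0 (fun y _ => is_derive_sin y)
  (continuous_subspaceT (@continuous_sin R)).
rewrite in_itv/= => /andP[y0 yx]; rewrite sin0 !subr0 => ->.
rewrite -{2}(mul1r x) -mulrBl normrM (gtr0_norm x0) (exprSr _ 2) ler_wpM2r// ?(ltW x0)//.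
rewrite distrC; have /andP[h1 h2] := onem_cos_le y; rewrite ger0_norm//.
apply: (le_trans h2); rewrite ler_pdivrMr//.
have : y ^+ 2 <= x ^+ 2 by rewrite ler_pXn2r ?nnegrE ?ltW.
have := sqr_ge0 x; lra.
Qed.

Definition sinc x : R := if x == 0 then 1 else sin x / x.
Definition sincd x : R := if x == 0 then 0 else (x * cos x - sin x) / x ^+ 2.

Lemma sincM x : sinc x * x = sin x.
Proof. by rewrite /sinc; case: eqVneq => [->|x0]; rewrite ?mulr0 ?sin0 ?divfK. Qed.

Lemma sinc0 : sinc 0 = 1. Proof. by rewrite /sinc eqxx. Qed.

Lemma sincN x : sinc (- x) = sinc x.
Proof. by rewrite /sinc oppr_eq0 sinN invrN mulrNN. Qed.

Lemma sinc_gt0 x : - pi < x < pi -> 0 < sinc x.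
Proof.
wlog x0 : x / 0 <= x.
  move=> h /andP[x1 x2]; case: (leP 0 x) => [x0|/ltW x0]; first by apply: h => //; rewrite x1.
  by rewrite -sincN h ?oppr_ge0// -!(ltrNl pi) ?ltrN2 ?x1 //; apply/andP; split; lra.
rewrite /sinc; case: eqVneq => // xn /andP[_ xp].
have x1 : 0 < x by rewrite lt_neqAle eq_sym xn.
by rewrite divr_gt0// sin_gt0_pi// x1.
Qed.

Lemma near_neq0 x : x != 0 -> \forall u \near x, u != 0.
Proof. by move=> x0; exact: (@cvgr_neq0 _ _ _ _ _ id x cvg_id x0). Qed.

Lemma is_derive_sinc x : is_derive x (1 : R) sinc (sincd x).
Proof.
have [->|x0] := eqVneq x 0; last first.
  have d : is_derive x (1 : R) (sin * (fun u => u^-1)) (sincd x).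
    have h := is_deriveM (is_derive_sin x) (is_deriveV x0 (@is_derive_id R _ x 1)).
    apply: (is_derive_eq h); rewrite /sincd (negPf x0) /GRing.scale/=; field.
    exact: x0.
  apply: (@near_eq_is_derive _ _ _ (sin * (fun u => u^-1))) d.
  by apply: filterS (near_neq0 _ x0) => u u0; rewrite /sinc (negPf u0).
apply: is_derive_eq; last by rewrite /sincd eqxx.
pose g (u : R) := if u == 0 then 0 else (sin u - u) / u ^+ 2.
suff : is_derive 0 (1 : R) sinc (g 0) by rewrite /g eqxx.
apply: slope_is_derive; rewrite /g.
  move=> u; rewrite sinc0 subr0; case: eqVneq => [->|u0]; first by rewrite sinc0 mul0r addr0.
  by rewrite /sinc (negPf u0); field.
rewrite /prop_for /continuous_at eqxx; apply/cvgrPdist_lt => e e0.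
near=> u; rewrite sub0r normrN; case: eqVneq => [_|u0]; first by rewrite normr0.
rewrite normrM normfV normrX ltr_pdivrMr ?exprn_gt0 ?normr_gt0//.
apply: (le_lt_trans (norm_sinB_le u)); rewrite exprS ltr_pM2r ?exprn_gt0 ?normr_gt0//.
Unshelve. all: by end_near. Qed.

Lemma continuous_sinc : continuous sinc.
Proof.
by move=> x; apply: differentiable_continuous; apply/derivable1_diffP; case: (is_derive_sinc x).
Qed.

Lemma continuous_sincd : continuous sincd.
Proof.
move=> x; have [->|x0] := eqVneq x 0; last first.
  have h : {for x, continuous (fun u : R => (u * cos u - sin u) / u ^+ 2)}.
    apply: cvgM.
      apply: cvgB; last exact: continuous_sin.
      by apply: cvgM; [exact: cvg_id|exact: continuous_cos].
    by apply: cvgV; [rewrite expf_neq0|exact: exprn_continuous].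
  rewrite /continuous_at /sincd (negPf x0); apply: cvg_trans h; apply: near_eq_cvg.
  by apply: filterS (near_neq0 _ x0) => u /negPf ->.
rewrite /continuous_at {2}/sincd eqxx; apply/cvgrPdist_lt => e e0.
near=> u; rewrite sub0r normrN /sincd; case: eqVneq => [_|u0]; first by rewrite normr0.
rewrite normrM normfV normrX ltr_pdivrMr ?exprn_gt0 ?normr_gt0//.
have -> : u * cos u - sin u = u * (cos u - 1) - (sin u - u) by ring.
apply: (le_lt_trans (ler_normB _ _)).
have h1 : `|u * (cos u - 1)| <= `|u| ^+ 3.
  rewrite normrM exprS ler_wpM2l// distrC; have /andP[h1 h2] := onem_cos_le u.
  rewrite ger0_norm// (le_trans h2)// ler_pdivrMr// real_normK ?num_real//.
  have := sqr_ge0 u; lra.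
have h2 := norm_sinB_le u.
apply: (@le_lt_trans _ _ (2 * `|u| * `|u| ^+ 2)).
  by rewrite -mulrA -exprS; lra.
rewrite ltr_pM2r ?exprn_gt0 ?normr_gt0//.
have : `|u| < e / 2 by near: u; apply: cvgr0_norm_lt; [exact: cvg_id|rewrite divr_gt0].
lra.
Unshelve. all: by end_near. Qed.

(** A crude Jordan inequality. Up to 1, [sin x >= x / 2 >= x / pi] because [pi >= 2]; from 1 on,
    [sin x >= sin 1 >= 1/2 >= x / pi]. *)
Lemma sin_ge_linear x : 0 <= x <= pi / 2 -> x / pi <= sin x.
Proof.
move=> /andP[x0 xp]; have p2 := pi_ge2 R.
have hs (u : R) : 0 < u -> u <= 1 -> u / 2 <= sin u.
  move=> u0 u1.
  have [y + ] := @MVT R sin cos 0 u u0 (fun y _ => is_derive_sin y)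
    (continuous_subspaceT (@continuous_sin R)).
  rewrite in_itv/= => /andP[y0 yu]; rewrite sin0 !subr0 => ->.
  rewrite mulrC ler_pM2r//; have /andP[_] := onem_cos_le y.
  have : y ^+ 2 <= 1 by rewrite expr_le1// ?ltW// (lt_le_trans yu).
  lra.
have hp (u : R) : 0 <= u -> u / pi <= u / 2.
  by move=> u0; rewrite ler_wpM2l// lef_pV2 ?posrE ?pi_gt0.
case: (leP x 1) => x1.
  move: x0; rewrite le_eqVlt => /predU1P[<-|x0]; first by rewrite mul0r sin0.
  exact: le_trans (hp _ (ltW x0)) (hs _ x0 x1).
have h1 := hs 1 ltr01 (lexx _).
have : sin 1 < sin x by rewrite ltr_sin ?in_itv//=; apply/andP; split; lra.
have : x / pi <= 1 / 2 by rewrite ler_pdivrMr ?pi_gt0//; lra.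
lra.
Qed.

End Sinc.

(** * The curve gamma *)

Section Curve.
Context {R : realType} (theta : R) (th1 : 1 < theta).
Local Notation a := theta^-1.
Local Notation k := (1 + theta)^-1.

Lemma theta_gt0 : 0 < theta. Proof. by move: th1; lra. Qed.
Lemma a_gt0 : 0 < a. Proof. by rewrite invr_gt0 theta_gt0. Qed.
Lemma a_lt1 : a < 1. Proof. by rewrite invf_lt1 ?theta_gt0. Qed.
Lemma k_gt0 : 0 < k. Proof. by rewrite invr_gt0; move: th1; lra. Qed.
Lemma k_lt_half : k < 1 / 2.
Proof. by rewrite div1r ltf_pV2 ?posrE; move: th1; lra. Qed.
(** This relation makes [J] real on the arc: with [arg s = t] and [arg (s + 1) = k t], the argument
    of [J] is [k t - a (1 - k) t = 0]. *)
Lemma a_k : a * (1 - k) = k.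
Proof. by field; rewrite !gt_eqF//; move: th1; lra. Qed.
Lemma a1_k : (1 + a) * k = a.
Proof. by field; rewrite !gt_eqF//; move: th1; lra. Qed.

Fact rr_key : unit. Proof. exact: tt. Qed.
(* The arc gamma_1 in polar coordinates: [ss t] has argument [t] and modulus
   [rr t = sin (k t) / sin ((1 - k) t)], which makes [k t] the argument of
   [ss t + 1]; [sinc] takes care of [t = 0]. *)
Definition rr : R -> R :=
  locked_with rr_key (fun t => k * sinc (k * t) / ((1 - k) * sinc ((1 - k) * t))).
Lemma rrE : rr = fun t => k * sinc (k * t) / ((1 - k) * sinc ((1 - k) * t)).
Proof. by rewrite /rr unlock. Qed.
Definition rd t : R :=
  (k * (sincd (k * t) * k) * ((1 - k) * sinc ((1 - k) * t))
   - k * sinc (k * t) * ((1 - k) * (sincd ((1 - k) * t) * (1 - k))))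
  / ((1 - k) * sinc ((1 - k) * t)) ^+ 2.
Definition ss t : R[i] := (rr t)%:C * expi t.
(* The logarithmic derivative of [ss]. *)
Definition om t : R[i] := Complex (rd t / rr t) 1.

Implicit Type t : R.

Lemma itv_bounds t : 0 <= t <= pi -> (- pi < k * t < pi) /\ (- pi < (1 - k) * t < pi).
Proof.
have k0 := k_gt0; have k1 := k_lt_half; have p0 := pi_gt0 R.
move=> /andP[t0 tp]; have kt : 0 <= k * t by rewrite mulr_ge0// ltW.
have kt' : k * t <= k * pi by rewrite ler_wpM2l// ltW.
have kp : k * pi < 1 / 2 * pi by rewrite ltr_pM2r.
have kp0 : 0 < k * pi by rewrite mulr_gt0.
have k1t : (1 - k) * t <= (1 - k) * pi by rewrite ler_wpM2l// subr_ge0; lra.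
have k1t0 : 0 <= (1 - k) * t by rewrite mulr_ge0// subr_ge0; lra.
split; apply/andP; split; lra.
Qed.

Lemma rden_gt0 t : 0 <= t <= pi -> 0 < (1 - k) * sinc ((1 - k) * t).
Proof.
move=> /itv_bounds[_ h]; rewrite mulr_gt0 ?sinc_gt0// subr_gt0.
by have := k_lt_half; lra.
Qed.

Lemma rr_gt0 t : 0 <= t <= pi -> 0 < rr t.
Proof.
move=> ht; rewrite rrE divr_gt0 ?rden_gt0// mulr_gt0 ?k_gt0// sinc_gt0//.
by have [] := itv_bounds _ ht.
Qed.

Lemma is_derive_rr t : 0 <= t <= pi -> is_derive t (1 : R) rr (rd t).
Proof.
move=> ht; have d0 := rden_gt0 _ ht.
have dl (m : R) : is_derive t (1 : R) (fun u => m * sinc (m * u)) (m * (sincd (m * t) * m)).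
  have h1 : is_derive t (1 : R) (fun u => m * u) m.
    by have := is_deriveZ m (@is_derive_id R _ t 1); rewrite /GRing.scale/= mulr1.
  have h2 := is_derive1_comp (is_derive_sinc (m * t)) h1.
  exact: (is_deriveZ m h2).
have h := is_deriveM (dl k) (@is_deriveV _ (fun u => (1 - k) * sinc ((1 - k) * u)) t _ _ (lt0r_neq0 d0) (dl (1 - k))).
rewrite rrE; apply: (is_derive_eq h); rewrite /rd /GRing.scale/=; move: (lt0r_neq0 d0).
move: ((1 - k) * sinc ((1 - k) * t)) (sincd (k * t)) (sinc (k * t)) (sincd ((1 - k) * t)).
by move=> X A B C X0; field; rewrite ?X0/= ?andbT gt_eqF//; move: th1; lra.
Qed.

Lemma continuous_rr t : 0 <= t <= pi -> {for t, continuous rr}.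
Proof.
move=> ht; apply: differentiable_continuous; apply/derivable1_diffP.
by case: (is_derive_rr _ ht).
Qed.

Lemma continuous_rd t : 0 <= t <= pi -> {for t, continuous rd}.
Proof.
move=> ht; have d0 := rden_gt0 _ ht.
have cl (m : R) : {for t, continuous (fun u => m * u)}.
  by apply: cvgM; [exact: cvg_cst|exact: cvg_id].
have cs (m : R) : {for t, continuous (fun u => m * sinc (m * u))}.
  apply: cvgM; first exact: cvg_cst.
  by apply: (cvg_comp _ _ (cl m)); exact: continuous_sinc.
have cd (m : R) : {for t, continuous (fun u => m * (sincd (m * u) * m))}.
  apply: cvgM; first exact: cvg_cst; apply: cvgM; last exact: cvg_cst.
  by apply: (cvg_comp _ _ (cl m)); exact: continuous_sincd.
rewrite /prop_for /continuous_at /rd; apply: cvgM.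
  by apply: cvgB; apply: cvgM; [exact: cd|exact: cs|exact: cs|exact: cd].
apply: cvgV; first by rewrite expf_neq0// gt_eqF.
by under eq_fun do rewrite expr2; rewrite expr2; apply: cvgM; exact: cs.
Qed.

Lemma rr_sin t : 0 <= t <= pi -> rr t * sin ((1 - k) * t) = sin (k * t).
Proof.
move=> ht; have d0 := lt0r_neq0 (rden_gt0 _ ht).
have -> : sin ((1 - k) * t) = ((1 - k) * sinc ((1 - k) * t)) * t by rewrite -sincM; ring.
by rewrite mulrA rrE divfK// -sincM; ring.
Qed.

Lemma ss0 : ss 0 = a%:C.
Proof.
rewrite /ss rrE !mulr0 sinc0 expi0 !mulr1; congr (_%:C).
by field; rewrite !gt_eqF//; move: th1; lra.
Qed.

Lemma sin_k1pi : 0 < sin (k * pi) /\ sin ((1 - k) * pi) = sin (k * pi).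
Proof.
have k0 := k_gt0; have k1 := k_lt_half; have p0 := pi_gt0 R; split.
  by rewrite sin_gt0_pi// mulr_gt0//= -[ltRHS]mul1r ltr_pM2r//; lra.
by rewrite mulrBl mul1r sinB sinpi cospi mul0r sub0r mulN1r opprK.
Qed.

Lemma rr_pi : rr pi = 1.
Proof.
have [s0 sE] := sin_k1pi.
have h : 0 <= (pi : R) <= pi by rewrite lexx pi_ge0.
have := rr_sin _ h; rewrite sE => e.
by apply: (mulIf (lt0r_neq0 s0)); rewrite mul1r.
Qed.

Lemma ss_pi : ss pi = -1.
Proof.
rewrite /ss rr_pi mul1r; apply: complex_eq; rewrite /= ?cospi ?sinpi ?oppr0//.
Qed.

Lemma Im_ss_gt0 t : 0 < t < pi -> 0 < Im (ss t).
Proof.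
move=> ht; rewrite ImCM mulr_gt0 ?sin_gt0_pi// rr_gt0//.
by case/andP: ht => /ltW -> /ltW ->.
Qed.

Lemma ss_neq0 t : 0 <= t <= pi -> ss t != 0.
Proof.
by move=> ht; rewrite mulf_neq0 ?expi_neq0// eq_complex/= gt_eqF ?rr_gt0.
Qed.

Lemma pder_ss t : 0 <= t <= pi -> pder ss t (ss t * om t).
Proof.
move=> ht; have r0 := rr_gt0 _ ht.
apply: pder_eqD (pderM _ _ _ _ _ (pderC _ _ _ (is_derive_rr _ ht)) (pder_expi t)).
rewrite /ss /om; apply: complex_eq; rewrite !(ReD, ImD, ReM, ImM)/=; field; exact: lt0r_neq0.
Qed.

Lemma ccvg_ss t : 0 <= t <= pi -> ccvg (nbhs t) ss (ss t).
Proof. by move=> /pder_ss/pder_ccvg. Qed.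

Lemma ccvg_om t : 0 <= t <= pi -> ccvg (nbhs t) om (om t).
Proof.
move=> ht; split => /=; last exact: cvg_cst.
apply: cvgM; first exact: continuous_rd.
by apply: cvgV; [rewrite gt_eqF ?rr_gt0|exact: continuous_rr].
Qed.

(** The law of sines in the triangle with vertices [-1], [0] and [ss t], whose angles there are
    [k t], [pi - t] and [(1 - k) t]. *)
Lemma ss1 t : 0 < t <= pi -> ss t + 1 = (sin t / sin ((1 - k) * t))%:C * expi (k * t).
Proof.
move=> /andP[t0 tp]; have ht : 0 <= t <= pi by rewrite ltW.
have s0 : 0 < sin ((1 - k) * t).
  have := rden_gt0 _ ht; rewrite -sincM => h.
  have -> : sinc ((1 - k) * t) * ((1 - k) * t) = ((1 - k) * sinc ((1 - k) * t)) * t by ring.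
  by rewrite mulr_gt0.
have rE : rr t = sin (k * t) / sin ((1 - k) * t).
  by apply: (mulIf (lt0r_neq0 s0)); rewrite rr_sin// divfK// gt_eqF.
have tE : t = k * t + (1 - k) * t by ring.
have e1 := rr_sin _ ht; have h := cos2Dsin2 (k * t).
apply: complex_eq; rewrite ?(ReD, ImD, ReCM, ImCM)/=; apply: (mulIf (lt0r_neq0 s0)).
  rewrite [RHS]mulrAC divfK ?gt_eqF// mulrDl mul1r.
  have -> : rr t * cos t * sin ((1 - k) * t) = sin (k * t) * cos t by rewrite -e1; ring.
  have -> : cos t = cos (k * t) * cos ((1 - k) * t) - sin (k * t) * sin ((1 - k) * t).
    by rewrite -cosD -tE.
  have -> : sin t = sin (k * t) * cos ((1 - k) * t) + cos (k * t) * sin ((1 - k) * t).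
    by rewrite -sinD -tE.
  apply/eqP; rewrite -subr_eq0; apply/eqP.
  move: h; move: (cos (k * t)) (sin (k * t)) (cos ((1 - k) * t)) (sin ((1 - k) * t)) => C S C' S' h.
  transitivity (S' * (1 - (C ^+ 2 + S ^+ 2))); first by ring.
  by rewrite h subrr mulr0.
rewrite addr0 [RHS]mulrAC divfK ?gt_eqF//.
have -> : rr t * sin t * sin ((1 - k) * t) = sin (k * t) * sin t by rewrite -e1; ring.
by rewrite mulrC.
Qed.

Lemma cabs_ss t : 0 <= t <= pi -> cabs (ss t) = rr t.
Proof. by move=> /rr_gt0 r0; rewrite cabsM cabs_expi cabsC mulr1 gtr0_norm. Qed.

Lemma rr_min : exists2 r0 : R, 0 < r0 & forall t, 0 <= t <= pi -> r0 <= rr t.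
Proof.
have c : {within `[0, pi], continuous rr}.
  apply/continuous_within_itvP; first exact: pi_gt0.
  split.
  - move=> t; rewrite in_itv/= => /andP[t1 t2]; apply: continuous_rr; by rewrite !ltW.
  - apply: cvg_at_right_filter; apply: continuous_rr; by rewrite lexx pi_ge0.
  - apply: cvg_at_left_filter; apply: continuous_rr; by rewrite lexx pi_ge0.
have [x xI h] := EVT_min (pi_ge0 R) c.
exists (rr x); first by apply: rr_gt0; move: xI; rewrite in_itv.
by move=> t ht; apply: h; rewrite in_itv.
Qed.

(** After rotation by [- u] the second point is a positive real. For an acute angle the imaginary
    part of the first point is large enough; for an obtuse one its real part is nonpositive and the
    second modulus alone suffices. This uniform separation controls every logarithmic singularity
    below. *)
Lemma cabs_ssB (m1 m2 r0 t u : R) : 0 <= t <= pi -> 0 <= u <= pi ->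
  0 <= m1 -> 0 <= m2 -> r0 <= m1 * rr t -> r0 <= m2 * rr u ->
  r0 * (`|t - u| / pi) <= cabs (m1%:C * ss t - m2%:C * ss u).
Proof.
move=> ht hu m10 m20 h1 h2; have p0 := pi_gt0 R.
have A0 : 0 <= m1 * rr t by rewrite mulr_ge0// ltW// rr_gt0.
have B0 : 0 <= m2 * rr u by rewrite mulr_ge0// ltW// rr_gt0.
have -> : m1%:C * ss t - m2%:C * ss u =
   expi u * ((m1 * rr t)%:C * expi (t - u) - (m2 * rr u)%:C).
  rewrite /ss expiD expiN (CM m1 (rr t)) (CM m2 (rr u)); have := expi_neq0 u.
  by move: (expi u) (expi t) (m1%:C) (m2%:C) (rr t)%:C (rr u)%:C => ? ? ? ? ? ? ?; field.
rewrite cabsM cabs_expi mul1r; set z := (X in cabs X).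
have ReE : Re z = m1 * rr t * cos `|t - u| - m2 * rr u by rewrite /z ReB ReCM/= cos_norm.
have ImE : `|Im z| = m1 * rr t * `|sin `|t - u| |.
  rewrite /z ImB ImCM/= subr0 normrM (ger0_norm A0).
  by case: (ger0P (t - u)) => // _; rewrite sinN normrN.
have x0 : 0 <= `|t - u| := normr_ge0 _.
have xp : `|t - u| <= pi.
  case/andP: ht => ? ?; case/andP: hu => ? ?; rewrite ler_norml; apply/andP; split; lra.
move: ReE ImE x0 xp; set x := `|t - u| => ReE ImE x0 xp.
case: (leP x (pi / 2)) => xp2.
  apply: le_trans (normIm_le z); rewrite ImE.
  have hx : x / pi <= sin x by apply: sin_ge_linear; rewrite x0.
  have xq : 0 <= x / pi by rewrite divr_ge0// ltW.
  rewrite ger0_norm; last exact: le_trans hx.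
  by apply: le_trans (ler_wpM2r xq h1) _; exact: ler_wpM2l.
apply: le_trans (normRe_le z); rewrite ReE.
have cx : cos x <= 0.
  rewrite -(cos_pihalf R) leNgt ltr_cos ?in_itv/= -?leNgt ?(ltW xp2)//.
    by rewrite x0.
  by apply/andP; split; lra.
have c1 : m1 * rr t * cos x <= 0 by rewrite mulr_ge0_le0.
rewrite ler0_norm; last by lra.
have x1 : x / pi <= 1 by rewrite ler_pdivrMr// mul1r.
have xq : 0 <= x / pi by rewrite divr_ge0// ltW.
apply: (@le_trans _ _ (m2 * rr u)); last by lra.
by apply: le_trans (ler_wpM2r xq h2) _; rewrite ler_piMr.
Qed.

End Curve.

(** * The map J on dilates of gamma *)

Section JMap.
Context {R : realType} (theta c : R) (th1 : 1 < theta) (c0 : 0 < c).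
Local Notation a := theta^-1.
Local Notation k := (1 + theta)^-1.
Local Notation J := (Jc theta c).
Local Notation ss := (ss theta).
Local Notation rr := (rr theta).
Implicit Types (t l x : R) (s z : R[i]).

Let a0 : 0 < a := a_gt0 _ th1.
Let a1 : a < 1 := a_lt1 _ th1.
Let k0 : 0 < k := k_gt0 _ th1.
Let kh : k < 1 / 2 := k_lt_half _ th1.
Let p0 : 0 < (pi : R) := pi_gt0 R.
Let th0 : 0 < theta := theta_gt0 _ th1.

Definition Jq s : R[i] := c%:C * cpow ((s + 1) / s) a.
Definition Jd s : R[i] := Jq s * (s - a%:C) / s.
(* [TT s = s J(s)^theta], which extends holomorphically across [(-1, 0)]. *)
Definition TT s : R[i] := (c `^ theta)%:C * cpow (1 + s) (theta + 1).
Definition TTd s : R[i] := (theta + 1)%:C * TT s / (1 + s).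
Definition bb : R := c * (1 + theta) `^ (1 + a) / theta.

Lemma J_Jq s : J s = (s + 1) * Jq s.
Proof. by rewrite /Jc /Jq; ring. Qed.

Lemma ucont_q s : s != 0 -> ucont (fun w => (w + 1) / w) s.
Proof.
move=> s0; apply: ucont_div => //.
by apply: ucontD; [exact: ucont_id|exact: ucont_cst].
Qed.

Lemma ucont_Jq s : s != 0 -> slit ((s + 1) / s) \/ s = -1 -> ucont Jq s.
Proof.
move=> s0 h; apply: ucontM; first exact: ucont_cst.
apply: (ucont_comp (fun w => (w + 1) / w) (fun w => cpow w a)); first exact: ucont_q.
by apply: ucont_cpow => //; case: h => [|->]; [left|right; rewrite addNr mul0r].
Qed.

Lemma ucont_J s : s != 0 -> slit ((s + 1) / s) \/ s = -1 -> ucont J s.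
Proof.
move=> s0 h; have -> : J = fun w => (w + 1) * Jq w by apply/funext => w; exact: J_Jq.
apply: ucontM; last exact: ucont_Jq.
by apply: ucontD; [exact: ucont_id|exact: ucont_cst].
Qed.

Lemma chol_J s : s != 0 -> slit ((s + 1) / s) -> chol J s (Jd s).
Proof.
move=> s0 h; have q0 : (s + 1) / s != 0 by exact: slit_Re_neq.
have s1 : s + 1 != 0 by apply: contraNneq q0 => ->; rewrite mul0r.
have d1 : chol (fun w => w + 1) s (1 + 0) by apply: cholD; [exact: chol_id|exact: chol_cst].
have d2 := chol_div _ _ _ _ _ s0 d1 (chol_id s).
have d3 := chol_comp _ _ _ _ _ d2 (chol_cpow _ a h).
have d4 := cholM _ _ _ _ _ (cholZ c%:C _ _ _ d1) d3.
apply: chol_eqD d4; rewrite /Jd /Jq CV; move: (cpow _ _) => q.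
by field; rewrite ?fmorph_eq0 ?(gt_eqF th0) ?s0 ?s1.
Qed.

Lemma ucont_Jd s : s != 0 -> slit ((s + 1) / s) \/ s = -1 -> ucont Jd s.
Proof.
move=> s0 h; apply: ucont_div => //.
apply: ucontM; first exact: ucont_Jq.
by apply: ucontB; [exact: ucont_id|exact: ucont_cst].
Qed.

Lemma ucont_TT s : slit (1 + s) \/ s = -1 -> ucont TT s.
Proof.
move=> h; apply: ucontM; first exact: ucont_cst.
apply: (ucont_comp (fun w => 1 + w) (fun w => cpow w (theta + 1))); first by apply: ucontD; [exact: ucont_cst|exact: ucont_id].
apply: ucont_cpow; first by rewrite addr_gt0.
by case: h => [|->]; [left|right; rewrite subrr].
Qed.

Lemma chol_TT s : slit (1 + s) -> chol TT s (TTd s).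
Proof.
move=> h; have d1 : chol (fun w => 1 + w) s (0 + 1) by apply: cholD; [exact: chol_cst|exact: chol_id].
have d2 := chol_comp _ _ _ _ _ d1 (chol_cpow _ (theta + 1) h).
apply: chol_eqD (cholZ _ _ _ _ d2); rewrite /TTd /TT add0r mulr1; ring.
Qed.

Lemma ucont_TTd s : slit (1 + s) -> ucont TTd s.
Proof.
move=> h; apply: ucont_div; first exact: slit_Re_neq.
  by apply: ucontM; [exact: ucont_cst|exact: chol_ucont (chol_TT _ h)].
by apply: ucontD; [exact: ucont_cst|exact: ucont_id].
Qed.

(** Polar coordinates adapted to gamma: [l > 1] describes the exterior in the upper half-plane,
    [l < 1] the interior. *)
Definition zz l t : R[i] := l%:C * ss t.
Arguments zz : simpl never.

Lemma zzE l t : zz l t = (l * rr t)%:C * expi t.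
Proof. by rewrite /zz /ss mulrA (CM l (rr t)). Qed.

Lemma zz1 t : zz 1 t = ss t. Proof. exact: mul1r. Qed.

Lemma Im_zz_gt0 l t : 0 < l -> 0 < t < pi -> 0 < Im (zz l t).
Proof. by move=> l0 ht; rewrite ImCM mulr_gt0// Im_ss_gt0. Qed.

Lemma zz_neq0 l t : 0 < l -> 0 <= t <= pi -> zz l t != 0.
Proof. by move=> l0 ht; rewrite mulf_neq0 ?ss_neq0// C_eq0 gt_eqF. Qed.

Lemma cabs_zz l t : 0 < l -> 0 <= t <= pi -> cabs (zz l t) = l * rr t.
Proof. by move=> l0 ht; rewrite cabsM cabsC cabs_ss// gtr0_norm. Qed.

Lemma zz_t0 l : zz l 0 = (l * a)%:C. Proof. by rewrite /zz ss0// -CM. Qed.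
Lemma zz_pi l : zz l pi = (- l)%:C. Proof. by rewrite /zz ss_pi// mulrN1 CN. Qed.

Lemma slit_C x : 0 < x -> slit (x%:C : R[i]). Proof. by left. Qed.

Lemma t_cases t : 0 <= t <= pi -> [\/ t = 0, t = pi | 0 < t < pi].
Proof.
move=> /andP[]; rewrite le_eqVlt => /predU1P[<-|t0]; first by constructor 1.
rewrite le_eqVlt => /predU1P[->|tp]; first by constructor 2.
by constructor 3; rewrite t0.
Qed.

Lemma slit_q l t : 0 < l -> 0 <= t <= pi -> (t = pi -> 1 < l) ->
  slit ((zz l t + 1) / zz l t).
Proof.
move=> l0 ht hl; case: (t_cases _ ht) => [->|e|tI].
- rewrite zz_t0 -CV -(CD _ 1) -CM; apply: slit_C.
  by rewrite divr_gt0// ?addr_gt0// mulr_gt0.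
- have l1 := hl e; rewrite e zz_pi -CV -(CD _ 1) -CM; apply: slit_C.
  by rewrite -mulrNN -invrN opprK divr_gt0//; lra.
- right; have z0 := zz_neq0 _ _ l0 ht.
  rewrite mulrDl divff// mul1r ImD Im1 add0r ImV oppr_eq0 mulf_neq0//.
    by rewrite gt_eqF// Im_zz_gt0.
  by rewrite invr_eq0 -cabs_sqr expf_eq0/= cabs_eq0.
Qed.

Lemma slit_q1 l t : 1 <= l -> 0 <= t <= pi ->
  slit ((zz l t + 1) / zz l t) \/ zz l t = -1.
Proof.
move=> l1 ht; have l0 : 0 < l := lt_le_trans ltr01 l1.
move: l1; rewrite le_eqVlt => /predU1P[e|l1]; last by left; apply: slit_q.
have [->|tp] := eqVneq t pi; first by right; rewrite zz_pi -e CN.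
by left; apply: slit_q => // tE; rewrite tE eqxx in tp.
Qed.

Lemma slit_1 l t : 0 < l -> 0 <= t <= pi -> (t = pi -> l < 1) -> slit (1 + zz l t).
Proof.
move=> l0 ht hl; case: (t_cases _ ht) => [->|e|tI].
- by rewrite zz_t0 -(CD 1); apply: slit_C; rewrite addr_gt0// mulr_gt0.
- by rewrite e zz_pi -(CD 1); apply: slit_C; have := hl e; lra.
- by right; rewrite ImD Im1 add0r gt_eqF// Im_zz_gt0.
Qed.

Lemma slit_11 l t : 0 < l -> l <= 1 -> 0 <= t <= pi -> slit (1 + zz l t) \/ zz l t = -1.
Proof.
move=> l0 + ht; rewrite le_eqVlt => /predU1P[e|l1]; last by left; apply: slit_1.
have [->|tp] := eqVneq t pi; first by right; rewrite zz_pi e CN.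
by left; apply: slit_1 => // tE; rewrite tE eqxx in tp.
Qed.

Lemma cpowC x u : 0 < x -> cpow (x%:C : R[i]) u = (x `^ u)%:C.
Proof.
move=> x0; have := cpow_polar x 0 u x0; rewrite expi0 !mulr1 mulr0 expi0 mulr1 => ->.
  by rewrite /powR gt_eqF.
by rewrite ltW// andbT oppr_lt0.
Qed.

Lemma J_real x : 0 < (x + 1) / x -> J x%:C = (c * (x + 1) * ((x + 1) / x) `^ a)%:C.
Proof. by move=> h; rewrite /Jc -(CD x 1) -(CV x) -(CM (x + 1) x^-1) cpowC// -!CM. Qed.

Lemma powR1D x u : 0 < x -> x `^ (1 + u) = x * x `^ u.
Proof. by move=> x0; rewrite powRD ?powRr1 ?ltW//; apply/implyP => _; exact: lt0r_neq0. Qed.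

Lemma powJ (A X : R) : 0 < A -> 0 < X -> (c * A * X `^ a) `^ theta = c `^ theta * A `^ theta * X.
Proof.
move=> A0 X0; have cA : 0 <= c * A by rewrite mulr_ge0// ltW.
rewrite powRM ?powR_ge0// powRM ?ltW// -powRrM mulVf ?gt_eqF//.
by rewrite powRr1 ?ltW.
Qed.

(* Tangent-line form of the weighted AM-GM inequality at [x = a]. *)
Lemma ln_amgm x : 0 < x -> (1 + a) * ln (1 + a) - a * ln a <= (1 + a) * ln (1 + x) - a * ln x.
Proof.
move=> x0; have lnle (u : R) : 0 < u -> ln u <= u - 1.
  move=> u0; have := @le_ln1Dx R (u - 1); rewrite (addrC 1) subrK; apply; lra.
have m0 : 0 < (1 + x) / (1 + a) by rewrite divr_gt0// addr_gt0.
have h1 := lnle _ (divr_gt0 (addr_gt0 ltr01 a0) (addr_gt0 ltr01 x0)).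
have h2 := lnle _ (divr_gt0 (divr_gt0 x0 a0) m0).
rewrite ln_div ?posrE ?addr_gt0// in h1.
rewrite !ln_div ?posrE ?addr_gt0// ?divr_gt0 ?addr_gt0// in h2.
have h3 : (1 - k) * ((1 + a) / (1 + x) - 1) + k * (x / a / ((1 + x) / (1 + a)) - 1) = 0.
  by field; rewrite !gt_eqF ?addr_gt0//; move: th1; lra.
have kk : 0 <= 1 - k by move: kh; lra.
have h4 := ler_wpM2l kk h1; have h5 := ler_wpM2l (ltW k0) h2.
have ak : a = (1 + a) * k by rewrite a1_k.
have h6 : (1 - k) * (ln (1 + a) - ln (1 + x)) + k * (ln x - ln a - (ln (1 + x) - ln (1 + a))) <= 0.
  by rewrite -h3; exact: lerD.
have h7 : 0 <= 1 + a by rewrite addr_ge0// ltW.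
have := ler_wpM2l h7 h6; rewrite mulr0 => h8.
have e : (1 + a) * ((1 - k) * (ln (1 + a) - ln (1 + x)) + k * (ln x - ln a - (ln (1 + x) - ln (1 + a))))
  = (1 + a) * (ln (1 + a) - ln (1 + x)) + ((1 + a) * k) * (ln x - ln a) by ring.
rewrite e -ak in h8; lra.
Qed.

Lemma ln_Jreal x : 0 < x ->
  ln (c * (x + 1) * ((x + 1) / x) `^ a) = ln c + ((1 + a) * ln (1 + x) - a * ln x).
Proof.
move=> x0; have x1 : 0 < x + 1 by rewrite addr_gt0.
rewrite lnM ?posrE ?mulr_gt0 ?powR_gt0 ?divr_gt0// lnM// ln_powR ln_div// (addrC x 1); ring.
Qed.

Lemma Jreal_a : c * (a + 1) * ((a + 1) / a) `^ a = bb.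
Proof.
rewrite /bb; have -> : (a + 1) / a = 1 + theta by field; rewrite gt_eqF.
by rewrite powR1D ?addr_gt0//; field; rewrite gt_eqF.
Qed.

Lemma bb_gt0 : 0 < bb.
Proof. by rewrite !mulr_gt0 ?invr_gt0// powR_gt0// addr_gt0. Qed.

(** [ln_amgm] says that [ln J] is least at the critical point [1/theta]. Hence dilating that end of
    the arc in either direction never meets a value below [b], which keeps the arguments of both
    logarithms nonzero there. *)
Lemma Jreal_ge x : 0 < x -> bb <= c * (x + 1) * ((x + 1) / x) `^ a.
Proof.
move=> x0; have h u : 0 < u -> 0 < c * (u + 1) * ((u + 1) / u) `^ a.
  by move=> u0; rewrite !mulr_gt0// ?powR_gt0 ?divr_gt0 ?addr_gt0.
by rewrite -Jreal_a -ler_ln ?posrE ?h// !ln_Jreal// lerD2l ln_amgm.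
Qed.

Lemma Jmax_bb : Jmax theta c = bb.
Proof.
rewrite /Jmax J_real ?ReC ?Jreal_a//.
by rewrite divr_gt0// addr_gt0.
Qed.

Definition yy t : R := Re (J (ss t)).

Lemma m_gt0 t : 0 < t < pi -> 0 < sin t / sin ((1 - k) * t).
Proof.
move=> /andP[t0 tp]; rewrite divr_gt0// sin_gt0_pi ?t0 ?tp//.
have k1 : 0 < 1 - k by move: kh; lra.
rewrite mulr_gt0//= (lt_trans _ tp)// gtr_pMl//; move: k0; lra.
Qed.

Lemma J_ss_polar t : 0 < t < pi -> J (ss t) =
  (c * (sin t / sin ((1 - k) * t)) * ((sin t / sin ((1 - k) * t)) / rr t) `^ a)%:C.
Proof.
move=> tI; have [t0 tp] := andP tI; have m0 := m_gt0 _ tI.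
have ht : 0 <= t <= pi by rewrite !ltW.
have r0 := rr_gt0 _ th1 _ ht; have e1 := ss1 _ th1 t; rewrite t0 (ltW tp) in e1.
rewrite /Jc e1//; move: m0; move: (sin t / sin _) => m m0.
have -> : m%:C * expi (k * t) / ss t = (m / rr t)%:C * expi (- ((1 - k) * t)).
  have -> : k * t = t - (1 - k) * t by ring.
  rewrite /ss expiD CM CV; field; rewrite expi_neq0 C_eq0 gt_eqF//.
rewrite cpow_polar ?divr_gt0//; last first.
  have kt : 0 < k * t by rewrite mulr_gt0.
  have kt2 : k * t < 1 / 2 * t by rewrite ltr_pM2r.
  by apply/andP; split; lra.
have -> : a * - ((1 - k) * t) = - (k * t) by rewrite -{2}(a_k _ th1); ring.
have -> : expR (a * ln (m / rr t)) = (m / rr t) `^ a by rewrite /powR gt_eqF// divr_gt0.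
rewrite !CM expiN; field; exact: expi_neq0.
Qed.

Lemma J_ss t : 0 <= t <= pi -> J (ss t) = (yy t)%:C.
Proof.
move=> ht; rewrite /yy; case: (t_cases _ ht) => [->|->|tI].
- by rewrite ss0// J_real// divr_gt0// addr_gt0.
- by rewrite ss_pi// /Jc addNr mulr0 mul0r.
- by rewrite J_ss_polar.
Qed.

Lemma yy0 : yy 0 = bb.
Proof. by rewrite /yy ss0// J_real ?ReC ?Jreal_a// divr_gt0// addr_gt0. Qed.

Lemma yypi : yy pi = 0.
Proof. by rewrite /yy ss_pi// /Jc addNr mulr0 mul0r. Qed.

Lemma yy_gt0 t : 0 <= t < pi -> 0 < yy t.
Proof.
move=> /andP[]; rewrite le_eqVlt => /predU1P[<-|t0] tp; first by rewrite yy0 bb_gt0.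
have tI : 0 < t < pi by rewrite t0.
have ht : 0 <= t <= pi by rewrite !ltW.
have m0 := m_gt0 _ tI; have r0 := rr_gt0 _ th1 _ ht.
rewrite /yy J_ss_polar// ReC; move: m0; move: (sin t / sin _) => m m0.
by rewrite !mulr_gt0 ?powR_gt0 ?divr_gt0.
Qed.

(** The phase of [(1 + s)^(theta + 1)] on the arc is [(theta + 1) k t = t], the phase of [s] itself;
    the moduli agree by [powJ]. *)
Lemma TT_ss t : 0 <= t <= pi -> TT (ss t) = ss t * (yy t `^ theta)%:C.
Proof.
move=> ht; rewrite /TT; have t1 : theta + 1 != 0 by rewrite gt_eqF// addr_gt0.
case: (t_cases _ ht) => [->|->|tI].
- rewrite ss0// yy0 -(CD 1) cpowC ?addr_gt0// -!CM; congr (_%:C).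
  rewrite -Jreal_a powJ ?addr_gt0 ?divr_gt0 ?addr_gt0// (addrC theta) powR1D ?addr_gt0//.
  by rewrite (addrC a 1); field; rewrite gt_eqF.
- by rewrite ss_pi// yypi subrr /cpow eqxx powR0 ?gt_eqF// !mulr0.
- have [t0 tp] := andP tI; have m0 := m_gt0 _ tI.
  have r0 := rr_gt0 _ th1 _ ht; have e1 := ss1 _ th1 t; rewrite t0 (ltW tp) in e1.
  rewrite (addrC 1) e1// /yy J_ss_polar// ReC; move: m0; move: (sin t / sin _) => m m0.
  have kt : k * t < 1 / 2 * t by rewrite ltr_pM2r.
  have kt0 : 0 < k * t by rewrite mulr_gt0.
  rewrite cpow_polar//; last by apply/andP; split; lra.
  have -> : (theta + 1) * (k * t) = t by field; rewrite gt_eqF// addr_gt0.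
  have -> : expR ((theta + 1) * ln m) = m `^ (theta + 1) by rewrite /powR gt_eqF.
  rewrite powJ ?divr_gt0// (addrC theta) powR1D// /ss.
  by rewrite !CM CV; field; rewrite C_eq0 gt_eqF.
Qed.

Lemma sin_gt0_inv x : - pi < x < pi -> 0 < sin x -> 0 < x.
Proof.
move=> /andP[x1 x2] sx; rewrite ltNge; apply/negP => x3.
have : 0 <= sin (- x) by apply: sin_ge0_pi; apply/andP; split; lra.
rewrite sinN; lra.
Qed.

(** Rotate [z + 1] in two ways and take imaginary parts: [|z + 1| sin (t - al) = sin t] and [|z + 1|
    sin (al - k t) = (l - 1) sin (k t)]. The signs place [al] below [t], and on the side of [k t]
    given by the sign of [l - 1]. *)
Lemma Arg_zz1 l t : 0 < l -> 0 < t < pi ->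
  exists al : R, [/\ zz l t + 1 = (cabs (zz l t + 1))%:C * expi al,
   0 < al < t, 1 < l -> k * t < al & l < 1 -> al < k * t].
Proof.
move=> l0 tI; have [t0 tp] := andP tI; have ht : 0 <= t <= pi by rewrite !ltW.
have I0 : 0 < Im (zz l t + 1) by rewrite ImD Im1 addr0 Im_zz_gt0.
have zn : zz l t + 1 != 0 by apply: slit_Re_neq; right; rewrite gt_eqF.
have A0 : 0 < cabs (zz l t + 1) by rewrite cabs_gt0.
set al := Arg (zz l t + 1); have /andP[al0 alp] : 0 < al < pi := Arg_upper _ I0.
have zE : zz l t + 1 = (cabs (zz l t + 1))%:C * expi al := polar _ zn.
have r0 := rr_gt0 _ th1 _ ht.
have kt : k * t < 1 / 2 * t by rewrite ltr_pM2r.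
have kt0 : 0 < k * t by rewrite mulr_gt0.
have skt : 0 < sin (k * t) by rewrite sin_gt0_pi//; apply/andP; split; lra.
have h1 : cabs (zz l t + 1) * sin (t - al) = sin t.
  have := congr1 (fun w => Im (expi t * cconj w)) zE.
  rewrite cconjM cconjC cconj_expi mulrCA -expiD ImCM Im_expi => <-.
  rewrite zzE cconjD cconjM !cconjC cconj_expi mulrDr mulrCA -expiD subrr expi0 mulr1.
  by rewrite ImD ImC add0r ImM ImC mulr0 ReC mulr1 add0r Im_expi.
have h2 : cabs (zz l t + 1) * sin (al - k * t) = (l - 1) * sin (k * t).
  have := congr1 (fun w => Im (w * expi (- (k * t)))) zE.
  rewrite -mulrA -expiD ImCM Im_expi => <-.
  rewrite zzE mulrDl mul1r -mulrA -expiD ImD ImCM !Im_expi sinN.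
  have -> : t - k * t = (1 - k) * t by ring.
  by rewrite -mulrA rr_sin//; ring.
exists al; split => //.
- rewrite al0 /= -subr_gt0; apply: sin_gt0_inv; first by apply/andP; split; lra.
  by rewrite -(pmulr_rgt0 _ A0) h1 sin_gt0_pi.
- move=> l1; rewrite -subr_gt0; apply: sin_gt0_inv; first by apply/andP; split; lra.
  by rewrite -(pmulr_rgt0 _ A0) h2 mulr_gt0// subr_gt0.
- move=> l1; rewrite -subr_gt0; apply: sin_gt0_inv; first by apply/andP; split; lra.
  rewrite -opprB sinN oppr_gt0 -(pmulr_rlt0 _ A0) h2 pmulr_llt0//; lra.
Qed.

Lemma J_zz_polar l t al : 0 < l -> 0 < t < pi -> 0 < al < t ->
  zz l t + 1 = (cabs (zz l t + 1))%:C * expi al ->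
  exists2 P : R, 0 < P & J (zz l t) = P%:C * expi ((1 + a) * (al - k * t)).
Proof.
move=> l0 tI /andP[al0 alt] zE; have [t0 tp] := andP tI; have ht : 0 <= t <= pi by rewrite !ltW.
have I0 : 0 < Im (zz l t + 1) by rewrite ImD Im1 addr0 Im_zz_gt0.
have zn : zz l t + 1 != 0 by apply: slit_Re_neq; right; rewrite gt_eqF.
have A0 : 0 < cabs (zz l t + 1) by rewrite cabs_gt0.
have lr : 0 < l * rr t by rewrite mulr_gt0// rr_gt0.
have q0 : 0 < cabs (zz l t + 1) / (l * rr t) by rewrite divr_gt0.
exists (c * cabs (zz l t + 1) * expR (a * ln (cabs (zz l t + 1) / (l * rr t)))).
  by rewrite !mulr_gt0// expR_gt0.
rewrite /Jc; move: A0 q0 zE; set A := cabs _ => A0 q0 zE.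
have -> : (zz l t + 1) / zz l t = (A / (l * rr t))%:C * expi (al - t).
  rewrite zE zzE expiD expiN (CM A) CV; field.
  by rewrite expi_neq0 !fmorph_eq0 !gt_eqF ?rr_gt0.
rewrite cpow_polar//; last by apply/andP; split; lra.
rewrite zE.
have -> : (1 + a) * (al - k * t) = al + a * (al - t).
  by rewrite mulrBr mulrA a1_k//; ring.
rewrite expiD; move: (expR _) => e; rewrite (CM (c * A)) (CM c); ring.
Qed.

(** The argument [(1 + a) (al - k t)] is positive since [al > k t]; rewritten as [al + a (al - t)],
    it is below [al < pi]. *)
Lemma ImJ_gt0 l t : 1 < l -> 0 < t < pi -> 0 < Im (J (zz l t)).
Proof.
move=> l1 tI; have l0 : 0 < l := lt_trans ltr01 l1.
have [al [zE alI /(_ l1) kal _]] := Arg_zz1 _ _ l0 tI.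
have [P P0 ->] := J_zz_polar _ _ _ l0 tI alI zE.
have [t0 tp] := andP tI; have [al0 alt] := andP alI.
rewrite ImCM mulr_gt0// Im_expi sin_gt0_pi//; apply/andP; split.
  by rewrite mulr_gt0 ?subr_gt0// addr_gt0.
rewrite mulrBr mulrA a1_k// mulrDl mul1r.
have : a * (al - t) < 0 by rewrite pmulr_rlt0// subr_lt0.
rewrite mulrBr; lra.
Qed.

Lemma ImJ_lt0 l t : 0 < l -> l < 1 -> 0 < t < pi -> Im (J (zz l t)) < 0.
Proof.
move=> l0 l1 tI.
have [al [zE alI _ /(_ l1) kal]] := Arg_zz1 _ _ l0 tI.
have [P P0 ->] := J_zz_polar _ _ _ l0 tI alI zE.
have [t0 tp] := andP tI; have [al0 alt] := andP alI.
rewrite ImCM pmulr_rlt0// Im_expi -oppr_gt0 -sinN sin_gt0_pi// -mulrN opprB; apply/andP; split.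
  by rewrite mulr_gt0 ?subr_gt0// addr_gt0.
rewrite mulrBr mulrA a1_k// mulrDl mul1r.
have : a * t < 1 * t by rewrite ltr_pM2r.
have : 0 < a * al by rewrite mulr_gt0.
lra.
Qed.

(** The argument of [TT z / z] is [(theta + 1) al - t]; it would vanish for [al = k t], and inside
    gamma [al < k t] puts it in [(- t, 0)]. *)
Lemma ImTT_lt0 l t : 0 < l -> l < 1 -> 0 < t < pi -> Im (TT (zz l t) / zz l t) < 0.
Proof.
move=> l0 l1 tI.
have [al [zE alI _ /(_ l1) kal]] := Arg_zz1 _ _ l0 tI.
have [t0 tp] := andP tI; have [al0 alt] := andP alI; have ht : 0 <= t <= pi by rewrite !ltW.
have I0 : 0 < Im (zz l t + 1) by rewrite ImD Im1 addr0 Im_zz_gt0.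
have zn : zz l t + 1 != 0 by apply: slit_Re_neq; right; rewrite gt_eqF.
have A0 : 0 < cabs (zz l t + 1) by rewrite cabs_gt0.
have lr : 0 < l * rr t by rewrite mulr_gt0// rr_gt0.
rewrite /TT (addrC 1) zE; move: A0; set A := cabs _ => A0.
rewrite cpow_polar//; last by apply/andP; split; lra.
rewrite zzE; set E := expR _.
have -> : (c `^ theta)%:C * (E%:C * expi ((theta + 1) * al)) / ((l * rr t)%:C * expi t) =
   (c `^ theta * E / (l * rr t))%:C * expi ((theta + 1) * al - t).
  rewrite expiD expiN (CM (c `^ theta * E)) (CM _ E) CV; field.
  by rewrite expi_neq0 !fmorph_eq0 !gt_eqF ?rr_gt0.
rewrite ImCM pmulr_rlt0 ?Im_expi; last by rewrite divr_gt0// mulr_gt0 ?powR_gt0 ?expR_gt0.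
rewrite -oppr_gt0 -sinN opprB sin_gt0_pi//; apply/andP; split.
  have : (theta + 1) * al < (theta + 1) * (k * t) by rewrite ltr_pM2l// addr_gt0.
  rewrite mulrA (addrC theta) mulfV; last by rewrite gt_eqF// addr_gt0.
  lra.
have : 0 < (theta + 1) * al by rewrite mulr_gt0// addr_gt0.
lra.
Qed.

Lemma J_zz0 l : 0 < l -> exists2 x : R, bb <= x & J (zz l 0) = x%:C.
Proof.
move=> l0; have la : 0 < l * a by rewrite mulr_gt0.
exists (c * (l * a + 1) * ((l * a + 1) / (l * a)) `^ a); first exact: Jreal_ge.
by rewrite zz_t0 J_real// divr_gt0// addr_gt0.
Qed.

Lemma J_zzpi l : 1 < l -> exists2 x : R, x < 0 & J (zz l pi) = x%:C.
Proof.
move=> l1; have l0 : 0 < l := lt_trans ltr01 l1.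
have q0 : 0 < (- l + 1) / - l by rewrite -mulrNN -invrN opprK divr_gt0//; lra.
exists (c * (- l + 1) * ((- l + 1) / - l) `^ a); last by rewrite zz_pi J_real.
by rewrite pmulr_llt0 ?powR_gt0// pmulr_rlt0//; lra.
Qed.

Lemma TT_zz0 l : 0 < l -> exists2 x : R, zz l 0 = (l * a)%:C /\ l * a * bb `^ theta <= x & TT (zz l 0) = x%:C.
Proof.
move=> l0; have la : 0 < l * a by rewrite mulr_gt0.
have la1 : 0 < l * a + 1 by rewrite addr_gt0.
exists (c `^ theta * (1 + l * a) `^ (theta + 1)); last first.
  by rewrite zz_t0 /TT -(CD 1) cpowC ?addr_gt0// -CM.
split; first exact: zz_t0.
have h := Jreal_ge _ la; have hb := bb_gt0.
have := @ge0_ler_powR R theta (ltW th0) bb _ _ _ h.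
rewrite !nnegrE (ltW hb) (le_trans (ltW hb) h) => /(_ isT isT).
rewrite powJ ?divr_gt0// => h2.
have := ler_wpM2l (ltW la) h2; congr (_ <= _).
rewrite (addrC theta) powR1D ?addr_gt0// (addrC 1); field; rewrite !gt_eqF//.
Qed.

Lemma TT_zzpi l : 0 < l -> l < 1 -> exists2 x : R, 0 < x & TT (zz l pi) = x%:C.
Proof.
move=> l0 l1; have l2 : 0 < 1 - l by rewrite subr_gt0.
exists (c `^ theta * (1 - l) `^ (theta + 1)); first by rewrite mulr_gt0 ?powR_gt0.
by rewrite zz_pi /TT -(CD 1) cpowC// -CM.
Qed.

End JMap.

(** * The values of J along the arc and integrals over dilates *)

Section YMap.
Context {R : realType} (theta c : R) (th1 : 1 < theta) (c0 : 0 < c).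
Local Notation a := theta^-1.
Local Notation J := (Jc theta c).
Local Notation Jq := (Jq theta c).
Local Notation Jd := (Jd theta c).
Local Notation ss := (ss theta).
Local Notation rr := (rr theta).
Local Notation om := (om theta).
Local Notation zz := (zz theta).
Local Notation yy := (yy theta c).
Local Notation bb := (bb theta c).
Implicit Types (t u l x : R) (s z : R[i]).

Let a0 : 0 < a := a_gt0 _ th1.
Let p0 : 0 < (pi : R) := pi_gt0 R.

Definition yd t : R := Re (Jd (ss t) * (ss t * om t)).

Lemma slit_ss t : 0 <= t < pi -> slit ((ss t + 1) / ss t).
Proof.
move=> /andP[h1 h2]; have := @slit_q _ _ th1 1 t ltr01; rewrite h1 (ltW h2) zz1; apply => //.
by move=> e; rewrite e ltxx in h2.
Qed.

Lemma slit_ss1 t : 0 <= t <= pi -> slit ((ss t + 1) / ss t) \/ ss t = -1.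
Proof. by move=> h; have := @slit_q1 _ _ th1 1 t (lexx _) h; rewrite zz1. Qed.

Lemma pder_J_ss t : 0 <= t < pi -> pder (fun u => J (ss u)) t (Jd (ss t) * (ss t * om t)).
Proof.
move=> h; have /andP[h1 h2] := h; have ht : 0 <= t <= pi by rewrite h1 ltW.
apply: chol_path (pder_ss _ th1 _ ht).
by apply: chol_J => //; [exact: ss_neq0|exact: slit_ss].
Qed.

Lemma is_derive_yy t : 0 <= t < pi -> is_derive t (1 : R) yy (yd t).
Proof. by move=> /pder_J_ss[]. Qed.

Lemma ccvg_ss_comp G t : 0 <= t <= pi -> ucont G (ss t) ->
  ccvg (nbhs t) (fun u => G (ss u)) (G (ss t)).
Proof. by move=> ht h; apply: h; exact: ccvg_ss. Qed.

Lemma continuous_yy t : 0 <= t <= pi -> {for t, continuous yy}.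
Proof.
move=> ht; have [] // := @ccvg_ss_comp J t ht.
by apply: ucont_J => //; [exact: ss_neq0|exact: slit_ss1].
Qed.

Lemma continuous_yd t : 0 <= t <= pi -> {for t, continuous yd}.
Proof.
move=> ht; apply: ccvg_Re.
apply: ccvgM; last by apply: ccvgM; [exact: ccvg_ss|exact: ccvg_om].
apply: ccvg_ss_comp => //.
by apply: ucont_Jd => //; [exact: ss_neq0|exact: slit_ss1].
Qed.

Lemma within_cont (f : R -> R) (u v : R) : (forall t, u <= t <= v -> {for t, continuous f}) ->
  {within `[u, v], continuous f}.
Proof.
move=> h; apply: continuous_in_subspaceT => t; rewrite inE/= in_itv/=; exact: h.
Qed.

Lemma yd_real t : 0 < t < pi -> Jd (ss t) * (ss t * om t) = (yd t)%:C.
Proof.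
move=> tI; have /andP[h1 h2] := tI; apply: complex_eq => //.
have ht : 0 <= t < pi by rewrite ltW.
have [_ h] := pder_J_ss _ ht.
have hz : is_derive t (1 : R) (fun u => Im (J (ss u))) (0 : R).
  apply: near_eq_is_derive (@is_derive_cst _ _ _ (0 : R) t (1 : R)).
  have : \forall u \near t, u \in `]0, pi[ by apply: near_in_itvoo; rewrite in_itv.
  apply: filterS => u; rewrite in_itv/= => /andP[u0 up].
  by rewrite J_ss// !ltW.
by rewrite ImC; case: h => _ <-; case: hz.
Qed.

(** The velocity is [y m om] with [m = (s - a) / (s + 1)]. It is real and [Im (om t) = 1], so [Re m]
    can be eliminated, leaving [- y Im m (r^2 + 1)] with [r = Re (om t)]; and [Im m > 0] in the
    upper half-plane. *)
Lemma yd_lt0 t : 0 < t < pi -> yd t < 0.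
Proof.
move=> tI; have /andP[h1 h2] := tI; have ht : 0 <= t <= pi by rewrite !ltW.
have ht' : 0 <= t < pi by rewrite ltW.
have I0 := Im_ss_gt0 _ th1 _ tI.
have s1 : ss t + 1 != 0 by apply: slit_Re_neq; right; rewrite ImD Im1 addr0 gt_eqF.
have s0 := ss_neq0 _ th1 _ ht.
set m := (ss t - a%:C) / (ss t + 1).
have mE : m = 1 - (1 + a)%:C / (ss t + 1) by rewrite /m (CD 1 a); move: (a%:C) => A; field.
have m2 : 0 < Im m.
  rewrite mE ImB Im1 sub0r ImCM ImV mulrN opprK mulr_gt0 ?addr_gt0// divr_gt0//.
    by rewrite ImD Im1 addr0.
  by rewrite -cabs_sqr exprn_gt0// cabs_gt0.
have E : (yd t)%:C = (yy t)%:C * (m * om t).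
  rewrite -yd_real// -J_ss// /Jd J_Jq /m; move: (Jq _) => q; field.
  by rewrite s0 s1 fmorph_eq0 gt_eqF// theta_gt0.
have e1 : 0 = yy t * (Re m + Im m * (rd theta t / rr t)).
  by have := congr1 (@complex.Im R) E; rewrite ImCM ImM [Im (om t)]/= mulr1.
have -> : yd t = yy t * (Re m * (rd theta t / rr t) - Im m).
  by have := congr1 (@complex.Re R) E; rewrite ReCM [Re (m * _)]ReM [Im (om t)]/= mulr1.
have y0 : 0 < yy t by apply: yy_gt0.
have e2 : Re m = - (Im m * (rd theta t / rr t)).
  have : yy t * (Re m + Im m * (rd theta t / rr t)) = 0 by rewrite -e1.
  by move/eqP; rewrite mulf_eq0 gt_eqF//= addr_eq0 => /eqP.
rewrite e2; move: (rd theta t / rr t) => r.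
rewrite pmulr_rlt0// (_ : _ - _ = - (Im m * (r ^+ 2 + 1))); last by ring.
by rewrite oppr_lt0 mulr_gt0// ltr_wpDl ?sqr_ge0.
Qed.

Lemma yy_decr t u : 0 <= t -> t < u -> u <= pi -> yy u < yy t.
Proof.
move=> t0 tu up.
have d1 x : x \in `]t, u[ -> is_derive x (1 : R) yy (yd x).
  rewrite in_itv/= => /andP[h1 h2]; apply: is_derive_yy.
  by rewrite (le_trans t0 (ltW h1)) (lt_le_trans h2).
have d2 : {within `[t, u], continuous yy}.
  apply: within_cont => x /andP[h1 h2]; apply: continuous_yy.
  by rewrite (le_trans t0 h1) (le_trans h2).
have [x] := MVT tu d1 d2.
rewrite in_itv/= => /andP[h1 h2] e; rewrite -subr_lt0 e nmulr_rlt0 ?subr_gt0//.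
by apply: yd_lt0; rewrite (le_lt_trans t0 h1) (lt_le_trans h2).
Qed.

Lemma yy_inj t u : 0 <= t <= pi -> 0 <= u <= pi -> yy t = yy u -> t = u.
Proof.
move=> /andP[t0 tp] /andP[u0 up] e; case: (ltgtP t u) => // h.
  by have := yy_decr _ _ t0 h up; rewrite e ltxx.
by have := yy_decr _ _ u0 h tp; rewrite e ltxx.
Qed.

Lemma yy_range t : 0 <= t <= pi -> 0 <= yy t <= bb.
Proof.
move=> /andP[t0 tp]; apply/andP; split.
  move: tp; rewrite le_eqVlt => /predU1P[->|tp]; first by rewrite yypi.
  by apply: ltW; apply: yy_gt0 => //; rewrite t0.
move: t0; rewrite le_eqVlt => /predU1P[<-|t0]; first by rewrite yy0.
by rewrite -(yy0 _ _ th1) ltW// yy_decr.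
Qed.

Lemma yy_surj x : 0 <= x <= bb -> exists2 t, 0 <= t <= pi & yy t = x.
Proof.
move=> /andP[x0 xb]; have := @IVT R yy 0 pi x (ltW p0).
have cy : {within `[0, pi], continuous yy} by apply: within_cont => t; exact: continuous_yy.
move=> /(_ cy); have b0 := bb_gt0 _ _ th1 c0; rewrite yy0// yypi// (min_r (ltW b0)) (max_l (ltW b0)) x0 xb => /(_ isT)[t].
by rewrite in_itv/= => ht yt; exists t.
Qed.

Lemma gamma1_ss t : 0 <= t <= pi -> gamma1 theta c (ss t).
Proof.
move=> ht; case: (t_cases _ ht) => [->|->|tI].
- by right; right; rewrite ss0.
- by right; left; rewrite ss_pi.
- by left; split; [exact: Im_ss_gt0|rewrite J_ss].
Qed.

(** A point of the upper half-plane lies on exactly one dilate of the arc, at its own argument.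
    There [Im J] has the sign of [l - 1], so [J] real forces [l = 1]. *)
Lemma gamma1_exists z : gamma1 theta c z -> exists2 t, 0 <= t <= pi & z = ss t.
Proof.
case=> [[zi Jz]|[->|->]]; last 2 first.
- by exists pi; rewrite ?ss_pi// lexx ltW.
- by exists 0; rewrite ?ss0// lexx ltW.
have zn : z != 0 by apply: slit_Re_neq; right; rewrite gt_eqF.
set t := Arg z; have tI : 0 < t < pi := Arg_upper _ zi.
have /andP[h1 h2] := tI; have ht : 0 <= t <= pi by rewrite !ltW.
have r0 := rr_gt0 _ th1 _ ht; have z0 : 0 < cabs z by rewrite cabs_gt0.
pose l := cabs z / rr t; have l0 : 0 < l by rewrite divr_gt0.
have zE : z = zz l t by rewrite zzE /l divfK ?gt_eqF//; exact: polar.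
exists t => //; rewrite zE; case: (ltgtP l 1) => l1.
- by have := ImJ_lt0 _ _ th1 c0 _ _ l0 l1 tI; rewrite -zE Jz ltxx.
- by have := ImJ_gt0 _ _ th1 c0 _ _ l1 tI; rewrite -zE Jz ltxx.
- by rewrite l1 zz1.
Qed.

Lemma cvg_zz l t : 0 <= t <= pi ->
  ccvg (nbhs (l, t)) (fun x : R * R => zz x.1 x.2) (zz l t).
Proof.
move=> ht; apply: ccvgM.
  by apply: ccvgC; exact: (@cvg_fst _ _ (nbhs l) (nbhs t)).
have [h1 h2] := ccvg_ss _ th1 _ ht.
have h : (fun x : R * R => x.2) @ nbhs (l, t) --> t by exact: (@cvg_snd _ _ (nbhs l) (nbhs t)).
by split; [exact: (cvg_comp _ _ h h1)|exact: (cvg_comp _ _ h h2)].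
Qed.

Lemma cvg_zz_comp G l t : 0 <= t <= pi -> ucont G (zz l t) ->
  ccvg (nbhs (l, t)) (fun x : R * R => G (zz x.1 x.2)) (G (zz l t)).
Proof. by move=> ht h; apply: h; exact: cvg_zz. Qed.

Lemma cvg_om2 l t : 0 <= t <= pi ->
  ccvg (nbhs (l, t)) (fun x : R * R => om x.2) (om t).
Proof.
move=> ht; have [h1 h2] := ccvg_om _ th1 _ ht.
have h : (fun x : R * R => x.2) @ nbhs (l, t) --> t by exact: (@cvg_snd _ _ (nbhs l) (nbhs t)).
by split; [exact: (cvg_comp _ _ h h1)|exact: (cvg_comp _ _ h h2)].
Qed.

Lemma compact_rect (u v p q : R) : compact (`[u, v]%classic `*` `[p, q]%classic).
Proof. by apply: compact_setX; exact: segment_compact. Qed.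

Lemma within_rect (u v p q : R) (f : R * R -> R) :
  (forall l t, u <= l <= v -> p <= t <= q -> {for (l, t), continuous f}) ->
  {within `[u, v]%classic `*` `[p, q]%classic, continuous f}.
Proof.
move=> h; apply: continuous_in_subspaceT => -[l t]; rewrite inE/= => -[].
by rewrite !in_itv/=; exact: h.
Qed.

Lemma rect_bound (u v p q : R) (f : R * R -> R) : u <= v -> p <= q ->
  (forall l t, u <= l <= v -> p <= t <= q -> {for (l, t), continuous f}) ->
  exists2 M : R, 0 <= M & forall l t, u <= l <= v -> p <= t <= q -> `|f (l, t)| <= M.
Proof.
move=> uv pq h; have n0 : `[u, v]%classic `*` `[p, q]%classic !=set0.
  by exists (u, p); split; rewrite /= in_itv/= lexx.
have cf : {within `[u, v]%classic `*` `[p, q]%classic, continuous (fun x : R * R => `|f x|)}.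
  by apply: within_rect => l t hl ht; apply: cvg_norm; exact: h.
have [x _ hx] := compact_EVT_max n0 (@compact_rect u v p q) cf.
exists `|f x| => // l t hl ht; apply: hx; rewrite inE; split => /=; by rewrite in_itv.
Qed.

Lemma rect_min (u v p q : R) (f : R * R -> R) : u <= v -> p <= q ->
  (forall l t, u <= l <= v -> p <= t <= q -> {for (l, t), continuous f} /\ 0 < f (l, t)) ->
  exists2 M : R, 0 < M & forall l t, u <= l <= v -> p <= t <= q -> M <= f (l, t).
Proof.
move=> uv pq h; have n0 : `[u, v]%classic `*` `[p, q]%classic !=set0.
  by exists (u, p); split; rewrite /= in_itv/= lexx.
have cf : {within `[u, v]%classic `*` `[p, q]%classic, continuous f}.
  by apply: within_rect => l t hl ht; have [] := h _ _ hl ht.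
have [[l0 t0] /set_mem[/=]] := compact_EVT_min n0 (@compact_rect u v p q) cf.
rewrite !in_itv/= => hl0 ht0 hx.
exists (f (l0, t0)); first by have [] := h _ _ hl0 ht0.
by move=> l t hl ht; apply: hx; rewrite inE; split => /=; rewrite in_itv.
Qed.

Local Notation mu := (@lebesgue_measure R).

(* The real part of the integral of [G(s) ds / s] along the dilate of gamma_1 by [l]. *)
Definition QQ (G : R[i] -> R[i]) l : R := \int[mu]_(t in `[0, pi]) Re (G (zz l t) * om t).

Lemma pder_zz_l l t : pder (fun l => zz l t) l (ss t).
Proof.
have := pderM _ _ _ _ _ (pderC _ _ _ (@is_derive_id R _ l 1)) (pder_cst (ss t) l).
by apply: pder_eqD; rewrite mul1r mulr0 addr0.
Qed.

Lemma pder_zz_t l t : 0 <= t <= pi -> pder (fun t => zz l t) t (zz l t * om t).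
Proof.
move=> ht; have := pderM _ _ _ _ _ (pder_cst l%:C t) (pder_ss _ th1 _ ht).
by apply: pder_eqD; rewrite mul0r add0r mulrA.
Qed.

Lemma integrable_itv (f : R -> R) (u v : R) : (forall t, u <= t <= v -> {for t, continuous f}) ->
  mu.-integrable `[u, v] (EFin \o f).
Proof.
move=> h; apply: continuous_compact_integrable; first exact: segment_compact.
exact: within_cont.
Qed.

Lemma FTC_itv (F f : R -> R) (u v : R) : u < v ->
  (forall t, u <= t <= v -> {for t, continuous f} /\ {for t, continuous F}) ->
  (forall t, u < t < v -> is_derive t (1 : R) F (f t)) ->
  \int[mu]_(t in `[u, v]) f t = F v - F u.
Proof.
move=> uv hf hF; rewrite /Rintegral (@continuous_FTC2 _ f F)//.
- by apply: within_cont => t ht; have [] := hf _ ht.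
- split.
  + by move=> t; rewrite in_itv/= => /hF[].
  + by apply: cvg_at_right_filter; have [] := hf u; rewrite ?lexx ?ltW.
  + by apply: cvg_at_left_filter; have [] := hf v; rewrite ?lexx ?ltW.
- by move=> t; rewrite in_itv/= => /hF[_ <-]; rewrite derive1E.
Qed.

(** Cauchy's theorem for dilates. The [l]-derivative of [G (l s)] is [D (l s) s], and times [om] it
    is [1 / l] times the [t]-derivative of [G (l s(t))]. Differentiating under the integral thus
    leaves the difference of the end values, which vanishes. *)
Lemma QQ_const (u v : R) (G D : R[i] -> R[i]) : 0 <= u ->
  (forall l t, u < l < v -> 0 <= t <= pi ->
    chol G (zz l t) (D (zz l t)) /\ ucont D (zz l t)) ->
  (forall l, u < l < v -> Re (G (zz l 0)) = Re (G (zz l pi))) ->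
  forall l1 l2, u < l1 < v -> u < l2 < v -> QQ G l1 = QQ G l2.
Proof.
move=> u0 hG hend l1 l2.
wlog l12 : l1 l2 / l1 < l2.
  move=> h h1 h2; case: (ltgtP l1 l2) => [l12|l21|->//]; first exact: h.
  by apply/esym/h.
move=> /andP[ul1 _] /andP[_ l2v].
(* A closed rectangle strictly inside the strip: compactness bounds the derivative there, which
   justifies differentiation under the integral. *)
pose u' := (u + l1) / 2; pose v' := (l2 + v) / 2.
have hu' : u < u' by rewrite /u'; lra.
have u'1 : u' < l1 by rewrite /u'; lra.
have v'2 : l2 < v' by rewrite /v'; lra.
have hv' : v' < v by rewrite /v'; lra.
have cD l t : u' <= l <= v' -> 0 <= t <= pi ->
    {for (l, t), continuous (fun x : R * R => Re (D (zz x.1 x.2) * ss x.2 * om x.2))}.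
  move=> /andP[h1 h2] ht; have hl : u < l < v by rewrite (lt_le_trans hu' h1) (le_lt_trans h2).
  have [_ ucD] := hG _ _ hl ht.
  apply: (@ccvg_Re _ _ (fun x : R * R => D (zz x.1 x.2) * ss x.2 * om x.2)).
  apply: ccvgM; last exact: cvg_om2.
  apply: ccvgM; first exact: cvg_zz_comp.
  have [h3 h4] := ccvg_ss _ th1 _ ht.
  have h : (fun x : R * R => x.2) @ nbhs (l, t) --> t by exact: (@cvg_snd _ _ (nbhs l) (nbhs t)).
  by split; [exact: (cvg_comp _ _ h h3)|exact: (cvg_comp _ _ h h4)].
have [M M0 hM] := rect_bound _ _ _ _ _ (ltW (lt_trans (lt_trans u'1 l12) v'2)) (ltW p0) cD.
have inI l : `]u', v'[%classic l -> u < l < v /\ u' <= l <= v'.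
  rewrite /= in_itv/= => /andP[h1 h2].
  by rewrite (lt_trans hu' h1) (lt_trans h2 hv') !ltW.
have derl l t : `]u', v'[%classic l -> 0 <= t <= pi ->
    is_derive l (1 : R) (fun l => Re (G (zz l t) * om t)) (Re (D (zz l t) * ss t * om t)).
  move=> /inI[hl _] ht; have [hG1 _] := hG _ _ hl ht.
  have h := chol_path _ (fun l => zz l t) _ _ _ hG1 (pder_zz_l l t).
  suff : pder (fun l => G (zz l t) * om t) l (D (zz l t) * ss t * om t) by case.
  by apply: pder_eqD (pderM _ _ _ _ _ h (pder_cst (om t) l)); rewrite mulr0 addr0.
have contt l t : `]u', v'[%classic l -> 0 <= t <= pi ->
    ccvg (nbhs t) (fun t => G (zz l t)) (G (zz l t)).
  move=> /inI[hl _] ht; have [hG1 _] := hG _ _ hl ht.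
  apply: (chol_ucont _ _ _ hG1); exact: pder_ccvg (pder_zz_t _ _ ht).
have der0 l : `]u', v'[%classic l -> is_derive l (1 : R) (QQ G) (0 : R).
  move=> hl.
  have intf x : `]u', v'[%classic x ->
      mu.-integrable `[0, pi] (EFin \o (fun t => Re (G (zz x t) * om t))).
    move=> hx; apply: integrable_itv => t ht.
    have [] // := @ccvgM _ _ (nbhs t) _ _ _ _ _ (contt _ _ hx ht) (ccvg_om _ th1 _ ht).
  have derf1 x t : `]u', v'[%classic x -> `[0, pi]%classic t ->
      derivable ((fun l t => Re (G (zz l t) * om t)) ^~ t) x 1.
    by move=> hx; rewrite /= in_itv/= => ht; case: (derl _ _ hx ht).
  have intG : mu.-integrable `[0, pi] (EFin \o (fun=> M)).
    by apply: integrable_itv => t _; exact: cvg_cst.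
  have bnd x t : `]u', v'[%classic x -> `[0, pi]%classic t ->
      `|partial1of2 (fun l t => Re (G (zz l t) * om t)) x t| <= M.
    move=> hx; rewrite /= in_itv/= => ht; rewrite partial1of2E.
    case: (derl _ _ hx ht) => _ ->; have [_ hx2] := inI _ hx.
    exact: (hM _ _ hx2 ht).
  pose f l t := Re (G (zz l t) * om t).
  have mI : measurable (`[0, pi]%classic : set R) by exact: measurable_itv.
  have d1 := @derivable_under_integral R _ _ mu f _ mI l u' v' hl intf derf1 (fun=> M) (fun=> M0) intG bnd.
  have d2 := @differentiation_under_integral R _ _ mu f _ mI l u' v' hl intf derf1 (fun=> M) (fun=> M0) intG bnd.
  apply: DeriveDef; first exact: d1.
  rewrite -derive1E d2.
  have l0 : 0 < l by have [/andP[h _] _] := inI _ hl; exact: le_lt_trans h.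
  have E t : t \in `[0, pi] -> partial1of2 (fun l t => Re (G (zz l t) * om t)) l t =
      l^-1 * Re (D (zz l t) * (zz l t * om t)).
    rewrite in_itv/= => ht; rewrite partial1of2E; case: (derl _ _ hl ht) => _ ->.
    have -> : D (zz l t) * (zz l t * om t) = l%:C * (D (zz l t) * ss t * om t).
      by move: (D (zz l t)) => d; rewrite /zz; ring.
    by rewrite ReCM mulKf// gt_eqF.
  transitivity (\int[mu]_(t in `[0, pi]) (l^-1 * Re (D (zz l t) * (zz l t * om t)))).
    by apply: eq_Rintegral => t; rewrite inE/= => ht; exact: E.
  have cd t : 0 <= t <= pi -> {for t, continuous (fun t => Re (D (zz l t) * (zz l t * om t)))}.
    move=> ht; have cz := pder_ccvg _ _ _ (pder_zz_t l _ ht).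
    have [hl2 _] := inI _ hl; have [_ ucD] := hG _ _ hl2 ht.
    have [] // := @ccvgM _ _ (nbhs t) _ _ _ _ _ (ucD _ _ _ _ cz)
      (@ccvgM _ _ (nbhs t) _ _ _ _ _ cz (ccvg_om _ th1 _ ht)).
  rewrite RintegralZl//; last exact: integrable_itv.
  have [hl2 _] := inI _ hl.
  have -> : \int[mu]_(t in `[0, pi]) Re (D (zz l t) * (zz l t * om t)) =
      Re (G (zz l pi)) - Re (G (zz l 0)); last by rewrite hend// subrr mulr0.
  apply: (FTC_itv (fun t => Re (G (zz l t))) _ _ _ (pi_gt0 R)).
  - by move=> t ht; split; [exact: cd|have [] := contt _ _ hl ht].
  - move=> t /andP[h1 h2]; have ht : 0 <= t <= pi by rewrite !ltW.
    have [hG1 _] := hG _ _ hl2 ht.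
    by have [] := chol_path _ (fun t => zz l t) _ _ _ hG1 (pder_zz_t l _ ht).
have inJ x : l1 <= x <= l2 -> `]u', v'[%classic x.
  by move=> /andP[h1 h2]; rewrite /= in_itv/=; apply/andP; split; lra.
have [x _] := @MVT R (QQ G) (fun=> 0) l1 l2 l12 (fun x hx => der0 x (inJ x (subset_itv_oo_cc hx)))
  (within_cont _ _ _ (fun x hx => differentiable_continuous
     (proj1 (derivable1_diffP (QQ G) x) (@ex_derive _ _ _ _ _ _ _ (der0 x (inJ x hx)))))).
by rewrite mul0r => /eqP; rewrite subr_eq0 => /eqP.
Qed.

End YMap.

Section Chol1.
Context {R : realType}.
Implicit Types (S : set R[i]) (G H : R[i] -> R[i]).

(** Holomorphic with continuous derivative, as [QQ_const] demands. Hiding the derivative lets the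
    closure rules compose without computing it. *)
Definition chol1 G S := exists D : R[i] -> R[i], forall z, S z -> chol G z (D z) /\ ucont D z.

Lemma chol1_ucont G S z : chol1 G S -> S z -> ucont G z.
Proof. by move=> [D h] /h[/chol_ucont]. Qed.

Lemma chol1_sub G S T : T `<=` S -> chol1 G S -> chol1 G T.
Proof. by move=> TS [D h]; exists D => z /TS/h. Qed.

Lemma chol1_cst c S : chol1 (fun=> c) S.
Proof. by exists (fun=> 0) => z _; split; [exact: chol_cst|exact: ucont_cst]. Qed.

Lemma chol1_id S : chol1 id S.
Proof. by exists (fun=> 1) => z _; split; [exact: chol_id|exact: ucont_cst]. Qed.

Lemma chol1D G H S : chol1 G S -> chol1 H S -> chol1 (fun z => G z + H z) S.
Proof.
move=> [D hG] [E hH]; exists (fun z => D z + E z) => z Sz.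
by have [? ?] := hG _ Sz; have [? ?] := hH _ Sz; split; [exact: cholD|exact: ucontD].
Qed.

Lemma chol1M G H S : chol1 G S -> chol1 H S -> chol1 (fun z => G z * H z) S.
Proof.
move=> [D hG] [E hH]; exists (fun z => D z * H z + G z * E z) => z Sz.
have [h1 h2] := hG _ Sz; have [h3 h4] := hH _ Sz; split; first exact: cholM.
by apply: ucontD; apply: ucontM => //; [exact: chol_ucont h3|exact: chol_ucont h1].
Qed.

Lemma chol1N G S : chol1 G S -> chol1 (fun z => - G z) S.
Proof.
move=> [D hG]; exists (fun z => - D z) => z Sz.
by have [? ?] := hG _ Sz; split; [exact: cholN|exact: ucontN].
Qed.

Lemma chol1B G H S : chol1 G S -> chol1 H S -> chol1 (fun z => G z - H z) S.
Proof. by move=> hG hH; apply: chol1D => //; exact: chol1N. Qed.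

Lemma chol1V G S : (forall z, S z -> G z != 0) -> chol1 G S -> chol1 (fun z => (G z)^-1) S.
Proof.
move=> nz [D hG]; exists (fun z => - D z / G z ^+ 2) => z Sz; have gz := nz _ Sz.
have [h1 h2] := hG _ Sz; split; first exact: cholV.
apply: ucont_div; [by rewrite expf_neq0|exact: ucontN|].
rewrite (_ : (fun w => G w ^+ 2) = fun w => G w * G w); last by apply/funext => w; rewrite expr2.
by apply: ucontM; exact: chol_ucont h1.
Qed.

Lemma chol1_div G H S : (forall z, S z -> H z != 0) -> chol1 G S -> chol1 H S ->
  chol1 (fun z => G z / H z) S.
Proof. by move=> nz hG hH; apply: chol1M => //; exact: chol1V. Qed.

End Chol1.

(** * Homotopy of contours *)

Section Contour.
Context {R : realType} (theta : R) (th1 : 1 < theta).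
Local Notation a := theta^-1.
Local Notation ss := (ss theta).
Local Notation rr := (rr theta).
Local Notation om := (om theta).
Local Notation zz := (zz theta).
Local Notation QQ := (QQ theta).
Local Notation mu := (@lebesgue_measure R).
Implicit Types (t u v l x : R) (s z : R[i]).

Let p0 : 0 < (pi : R) := pi_gt0 R.

(** The half-annulus in the closed upper half-plane swept by the dilates of gamma_1 between [u] and
    [v]. *)
Definition Sz (u v : R) : set R[i] :=
  [set z | exists l t, [/\ u < l < v, 0 <= t <= pi & z = zz l t]].

Lemma Sz_zz u v l t : u < l < v -> 0 <= t <= pi -> Sz u v (zz l t).
Proof. by exists l, t. Qed.

Lemma QQ_const1 (u v : R) (G : R[i] -> R[i]) : 0 <= u -> chol1 G (Sz u v) ->
  (forall l, u < l < v -> Re (G (zz l 0)) = Re (G (zz l pi))) ->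
  forall l1 l2, u < l1 < v -> u < l2 < v -> QQ G l1 = QQ G l2.
Proof.
move=> u0 [D hD] hend; apply: (QQ_const _ th1 _ _ G D u0) => // l t hl ht.
by apply: hD; exact: Sz_zz.
Qed.

Lemma cont_zz_t G l t : 0 <= t <= pi -> ucont G (zz l t) ->
  ccvg (nbhs t) (fun t => G (zz l t)) (G (zz l t)).
Proof. by move=> ht; apply; exact: pder_ccvg (pder_zz_t _ th1 _ _ ht). Qed.

Lemma integrable_QQ G l : (forall t, 0 <= t <= pi -> ucont G (zz l t)) ->
  mu.-integrable `[0, pi] (EFin \o (fun t => Re (G (zz l t) * om t))).
Proof.
move=> h; apply: integrable_itv => t ht; apply: ccvg_Re.
by apply: ccvgM; [apply: cont_zz_t => //; exact: h|exact: ccvg_om].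
Qed.

Lemma QQD G H l : (forall t, 0 <= t <= pi -> ucont G (zz l t)) ->
  (forall t, 0 <= t <= pi -> ucont H (zz l t)) ->
  QQ (fun z => G z + H z) l = QQ G l + QQ H l.
Proof.
move=> hG hH; rewrite /QQ -RintegralD//; [|exact: integrable_QQ|exact: integrable_QQ].
by apply: eq_Rintegral => t _; rewrite mulrDl ReD.
Qed.

Lemma eq_QQ G H l : (forall t, 0 <= t <= pi -> G (zz l t) = H (zz l t)) -> QQ G l = QQ H l.
Proof.
by move=> h; apply: eq_Rintegral => t; rewrite inE/= in_itv/= => ht; rewrite h.
Qed.

(** The imaginary part of [om] is 1, the unit speed of the argument, so an imaginary constant
    contributes a multiple of the length [pi]. This is the half-residue collected at 0 or at
    infinity. *)
Lemma QQ_cst l x : QQ (fun=> Complex 0 x) l = - (x * pi).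
Proof.
rewrite /QQ (@eq_Rintegral _ _ _ _ _ (cst (- x))); last first.
  by move=> t _; rewrite ReM/= mul0r sub0r mulr1.
rewrite Rintegral_cst//= lebesgue_measure_itv/= lte_fin p0.
by rewrite -EFinB/= subr0 mulNr.
Qed.

Lemma om_bound : exists2 M : R, 0 < M & forall t, 0 <= t <= pi -> cabs (om t) <= M.
Proof.
have h l t : 0 <= l <= 1 -> 0 <= t <= pi -> {for (l, t), continuous (fun x : R * R => cabs (om x.2))}.
  by move=> _ ht; apply: ccvg_cabs; exact: cvg_om2.
have [M M0 hM] := rect_bound _ _ _ _ _ ler01 (ltW p0) h.
exists (M + 1) => [|t ht]; first by rewrite ltr_wpDl.
have := hM 0 t; rewrite lexx ler01 => /(_ isT ht) /= h1.
by rewrite (le_trans (ler_norm _))// (le_trans h1)// lerDl.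
Qed.

Lemma QQ_bound G l C : 0 <= C -> (forall t, 0 <= t <= pi -> ucont G (zz l t)) ->
  (forall t, 0 <= t <= pi -> cabs (G (zz l t) * om t) <= C) -> `|QQ G l| <= C * pi.
Proof.
move=> C0 hG hC; rewrite /QQ.
apply: le_trans (le_normr_Rintegral _ (integrable_QQ _ _ hG)) _; first exact: measurable_itv.
have -> : C * pi = \int[mu]_(t in `[0, pi]) cst C t.
  by rewrite Rintegral_cst//= lebesgue_measure_itv/= lte_fin p0 -EFinB/= subr0.
apply: le_Rintegral => //.
- by apply/integrable_norm/integrable_QQ.
- by apply: integrable_itv => t _; exact: cvg_cst.
- move=> t; rewrite /= in_itv/= => ht; apply: le_trans (normRe_le _) _; exact: hC.
Qed.

Lemma QQ_cont (u v : R) G : u < v ->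
  (forall l t, u <= l <= v -> 0 <= t <= pi -> ucont G (zz l t)) ->
  {in `]u, v[%classic, continuous (QQ G)}.
Proof.
move=> uv h.
have hc l t : u <= l <= v -> 0 <= t <= pi ->
    {for (l, t), continuous (fun x : R * R => Re (G (zz x.1 x.2) * om x.2))}.
  move=> hl ht; apply: (@ccvg_Re _ _ (fun x : R * R => G (zz x.1 x.2) * om x.2)).
  by apply: ccvgM; [apply: cvg_zz_comp => //; exact: h|exact: cvg_om2].
have [M M0 hM] := rect_bound _ _ _ _ _ (ltW uv) (ltW p0) hc.
have inI l : `]u, v[%classic l -> u <= l <= v by rewrite /= in_itv/= => /andP[/ltW -> /ltW ->].
have mI : measurable (`[0, pi]%classic : set R) by exact: measurable_itv.
apply: (@continuity_under_integral R _ _ mu (fun l t => Re (G (zz l t) * om t)) _ mI u v _ _ (fun=> M)).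
- by move=> l hl; apply: integrable_QQ => t ht; apply: h => //; exact: inI.
- apply: aeW => t; rewrite /= in_itv/= => ht l; rewrite inE => hl.
  apply: (@ccvg_Re _ _ (fun l => G (zz l t) * om t)); apply: ccvgM; last exact: ccvg_cst.
  by apply: h => //; [exact: inI|exact: pder_ccvg (pder_zz_l _ l t)].
- by apply: integrable_itv => t _; exact: cvg_cst.
- move=> l hl; apply: aeW => t; rewrite /= in_itv/= => ht.
  exact: (hM l t (inI _ hl) ht).
Qed.

Section Kernel.
Context (lp tp : R) (lp1 : 1 < lp) (tpI : 0 < tp < pi).
Let p := zz lp tp.
Let w : R[i] := p * (p + 1) / (p - a%:C).

Let lp0 : 0 < lp := lt_trans ltr01 lp1.
Let tpI' : 0 <= tp <= pi.
Proof. by have /andP[h1 h2] := tpI; rewrite !ltW. Qed.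
Let Imp : 0 < Im p := Im_zz_gt0 _ th1 _ _ lp0 tpI.

(* Since [w = J(p) / J'(p)], the residue of [J' ff / (J - y)] at [p] is [J(p) / (J(p) - y)]. *)
Definition ff s : R[i] := w / (s - p) - cconj w / (s - cconj p).
Definition fd s : R[i] := - w / (s - p) ^+ 2 + cconj w / (s - cconj p) ^+ 2.

Lemma zz_eq_p l t : 0 < l -> 0 <= t <= pi -> zz l t = p -> l = lp /\ t = tp.
Proof.
move=> l0 ht e; have e1 := congr1 (@Arg R) e; have e2 := congr1 (@cabs R) e.
have bnd u : 0 <= u <= pi -> - pi < u <= pi.
  by move=> /andP[u0 ->]; rewrite andbT (lt_le_trans _ u0)// oppr_lt0.
rewrite /p !zzE !Arg_polar ?mulr_gt0 ?rr_gt0 ?bnd// in e1.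
split => //; rewrite /p !cabs_zz// e1 in e2.
by apply: (mulIf _ e2); rewrite gt_eqF// rr_gt0.
Qed.

Lemma zz_neq_p l t : 0 < l -> 0 <= t <= pi -> l != lp \/ t != tp -> zz l t - p != 0.
Proof.
move=> l0 ht h; rewrite subr_eq0; apply/negP => /eqP /(zz_eq_p _ _ l0 ht)[e1 e2].
by case: h; rewrite ?e1 ?e2 eqxx.
Qed.

Lemma zz_neq_pc l t : 0 <= l -> 0 <= t <= pi -> zz l t - cconj p != 0.
Proof.
move=> l0 ht; apply: slit_Re_neq; right; rewrite ImB ImJ opprK gt_eqF//.
rewrite ltr_wpDl// ImCM mulr_ge0//.
by rewrite ImCM mulr_ge0 ?Im_expi ?sin_ge0_pi// ltW// rr_gt0.
Qed.

(** On the real axis the second term is the conjugate of the first. This is the purpose of the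
    reflected pole: boundary terms vanish for every cofactor that is real at the ends. *)
Lemma ff_real x : Re (ff x%:C) = 0.
Proof.
rewrite /ff; have -> : cconj w / (x%:C - cconj p) = cconj (w / (x%:C - p)).
  by rewrite [RHS]cconjM cconjV [cconj (_ - p)]cconjD cconjN cconjC.
by rewrite ReB ReJ subrr.
Qed.

Lemma Sz_neq (u v : R) z : 0 <= u -> ~~ (u < lp < v) -> Sz u v z -> z - p != 0 /\ z - cconj p != 0.
Proof.
move=> u0 hlp [l [t [hl ht ->]]]; have /andP[ul lv] := hl; split.
  apply: zz_neq_p => //; first exact: le_lt_trans ul.
  by left; apply: contra hlp => /eqP <-.
by apply: zz_neq_pc => //; apply: le_trans u0 (ltW ul).
Qed.

Lemma chol_ff s : s - p != 0 -> s - cconj p != 0 -> chol ff s (fd s).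
Proof.
move=> h1 h2.
have d q : s - q != 0 -> forall W, chol (fun z => W / (z - q)) s (- W / (s - q) ^+ 2).
  move=> hq W; have d1 : chol (fun z => z - q) s (1 - 0).
    by apply: cholB; [exact: chol_id|exact: chol_cst].
  have d2 := cholZ W _ _ _ (cholV (fun z => z - q) _ _ hq d1).
  apply: chol_eqD d2; rewrite subr0; ring.
by apply: chol_eqD (cholB _ _ _ _ _ (d _ h1 w) (d _ h2 (cconj w))); rewrite /fd; ring.
Qed.

Lemma ucont_fd s : s - p != 0 -> s - cconj p != 0 -> ucont fd s.
Proof.
move=> h1 h2; have d q : s - q != 0 -> forall W, ucont (fun z => W / (z - q) ^+ 2) s.
  move=> hq W; apply: ucont_div; [by rewrite expf_neq0|exact: ucont_cst|].
  rewrite (_ : (fun z => (z - q) ^+ 2) = fun z => (z - q) * (z - q)); last by apply/funext => z; rewrite expr2.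
  by apply: ucontM; apply: ucontB; [exact: ucont_id|exact: ucont_cst|exact: ucont_id|exact: ucont_cst].
by apply: ucontD; apply: d.
Qed.

Lemma chol1_ff (u v : R) : 0 <= u -> ~~ (u < lp < v) -> chol1 ff (Sz u v).
Proof.
move=> u0 hlp; exists fd => z hz; have [h1 h2] := Sz_neq _ _ _ u0 hlp hz.
by split; [exact: chol_ff|exact: ucont_fd].
Qed.

Lemma ucont_ff l t : 0 <= l -> 0 <= t <= pi -> l != lp -> ucont ff (zz l t).
Proof.
move=> l0 ht hl; apply: chol_ucont (chol_ff _ _ _); last exact: zz_neq_pc.
move: l0; rewrite le_eqVlt => /predU1P[<-|l0]; last by apply: zz_neq_p => //; left.
rewrite /zz mul0r sub0r oppr_eq0; exact: zz_neq0.
Qed.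

(* A function vanishing at [p] cancels the pole of the kernel, so the homotopy
   crosses [p] without picking up a residue. *)
Lemma QQ_cross (u v : R) H : 0 < u -> u < lp < v -> chol1 H (Sz u v) -> H p = 0 ->
  (forall l, u < l < v -> Im (H (zz l 0)) = 0 /\ Im (H (zz l pi)) = 0) ->
  forall l1 l2, u < l1 -> l1 < lp -> lp < l2 -> l2 < v ->
  QQ (fun z => H z * ff z) l1 = QQ (fun z => H z * ff z) l2.
Proof.
move=> u0 ulpv hH Hp Hend l1 l2 ul1 l1p pl2 l2v.
have Sp : Sz u v p by exact: Sz_zz.
have [D hD] := hH; have [[f [fE _ cf]] _] := hD _ Sp; rewrite Hp in fE.
pose G z : R[i] := f z * w - H z * (cconj w / (z - cconj p)).
have GE l t : 0 < l -> 0 <= t <= pi -> l != lp -> G (zz l t) = H (zz l t) * ff (zz l t).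
  move=> l0 ht lnp; have zp : zz l t - p != 0 by apply: zz_neq_p => //; left.
  rewrite /G /ff mulrBr; congr (_ - _); rewrite (fE (zz l t)) add0r.
  by rewrite -mulrA; congr (_ * _); field.
have ucf z : Sz u v z -> ucont f z.
  move=> hz; have [->|zp] := eqVneq z p; first exact: cf.
  have zp' : z - p != 0 by rewrite subr_eq0.
  have cH := chol1_ucont _ _ _ hH hz.
  have hq : ucont (fun y => H y / (y - p)) z.
    by apply: ucont_div => //; apply: ucontB; [exact: ucont_id|exact: ucont_cst].
  move=> T F FF g gz; have -> : f z = H z / (z - p) by rewrite fE add0r mulfK.
  apply: ccvg_near (hq _ _ _ _ gz).
  have := ccvg_neq0 _ _ zp' (ccvgB _ _ _ _ gz (ccvg_cst p)).
  move=> /(_ FF FF FF).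
  by apply: filterS => x /= xp; rewrite (fE (g x)) add0r mulfK.
have ucG l t : u < l < v -> 0 <= t <= pi -> ucont G (zz l t).
  move=> hl ht; have hz : Sz u v (zz l t) by exact: Sz_zz.
  have l0 : 0 <= l by have /andP[h _] := hl; apply: ltW; exact: lt_trans h.
  apply: ucontB; first by apply: ucontM; [exact: ucf|exact: ucont_cst].
  apply: ucontM; first exact: (chol1_ucont _ _ _ hH hz).
  apply: ucont_div; [exact: zz_neq_pc|exact: ucont_cst|].
  by apply: ucontB; [exact: ucont_id|exact: ucont_cst].
have cst (u' v' : R) : u <= u' -> v' <= v -> ~~ (u' < lp < v') ->
    forall x y, u' < x < v' -> u' < y < v' -> QQ G x = QQ G y.
  move=> uu vv hlp x y hx hy.
  have xp (d : R) : u' < d < v' -> d != lp by move=> hz; apply: contra hlp => /eqP <-.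
  have x0 (d : R) : u' < d < v' -> 0 < d.
    by move=> /andP[h _]; rewrite (lt_trans _ h)// (lt_le_trans u0).
  rewrite (eq_QQ G (fun z => H z * ff z) _ (fun t ht => GE x t (x0 _ hx) ht (xp _ hx))).
  rewrite (eq_QQ G (fun z => H z * ff z) _ (fun t ht => GE y t (x0 _ hy) ht (xp _ hy))).
  apply: (QQ_const1 u' v') => //; first exact: le_trans (ltW u0) uu.
    apply: chol1M; last by apply: chol1_ff => //; exact: le_trans (ltW u0) uu.
    apply: chol1_sub hH => z [l [t [/andP[h1 h2] ht ->]]]; apply: Sz_zz => //.
    by rewrite (le_lt_trans uu h1) (lt_le_trans h2).
  move=> l /andP[h1 h2]; have hl : u < l < v by rewrite (le_lt_trans uu h1) (lt_le_trans h2).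
  have [e1 e2] := Hend _ hl.
  by rewrite !ReM e1 e2 zz_t0// zz_pi// !ff_real !mulr0 !mul0r.
have [ulp lpv] := andP ulpv.
have l1n : l1 != lp by rewrite lt_eqF.
have l2n : l2 != lp by rewrite gt_eqF.
rewrite -(eq_QQ G (fun z => H z * ff z) _ (fun t ht => GE l1 t (lt_trans u0 ul1) ht l1n)).
rewrite -(eq_QQ G (fun z => H z * ff z) _ (fun t ht => GE l2 t (lt_trans lp0 pl2) ht l2n)).
have cG : {for lp, continuous (QQ G)}.
  apply: (@QQ_cont ((u + lp) / 2) ((lp + v) / 2)); first by lra.
    by move=> l t /andP[h1 h2] ht; apply: ucG => //; apply/andP; split; lra.
  by rewrite inE/= in_itv/=; apply/andP; split; lra.
have side (F : set_system R) (FF : ProperFilter F) x : F --> lp ->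
    (\forall l \near F, QQ G l = x) -> QQ G lp = x.
  move=> Flp h; have c1 : QQ G @ F --> QQ G lp by exact: cvg_comp Flp cG.
  have c2 : QQ G @ F --> x.
    by apply: cvg_near_cst.
  by apply/esym; apply: (cvg_unique _ c2 c1).
have e1 : QQ G lp = QQ G l1.
  apply: (side lp^'-); first exact: cvg_within.
  near=> l; apply: (cst u lp); [exact: lexx|exact: ltW lpv|by rewrite ltxx andbF| |by rewrite ul1].
  by apply/andP; split; near: l; [exact: nbhs_left_gt|exact: nbhs_left_lt].
have e2 : QQ G lp = QQ G l2.
  apply: (side lp^'+); first exact: cvg_within.
  near=> l; apply: (cst lp v); [exact: ltW ulp|exact: lexx|by rewrite ltxx| |by rewrite pl2].
  by apply/andP; split; near: l; [exact: nbhs_right_gt|exact: nbhs_right_lt].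
by rewrite -e1 e2.
Unshelve. all: by end_near. Qed.

Lemma QQ_approx G (g0 e l : R) : 0 <= e ->
  (forall t, 0 <= t <= pi -> ucont G (zz l t)) ->
  (forall t, 0 <= t <= pi -> cabs (G (zz l t) - Complex 0 g0) <= e) ->
  forall M, 0 < M -> (forall t, 0 <= t <= pi -> cabs (om t) <= M) ->
  `|QQ G l + g0 * pi| <= e * (M * pi).
Proof.
move=> e0 hG he M M0 hM.
have -> : QQ G l + g0 * pi = QQ (fun z => G z - Complex 0 g0) l.
  rewrite (QQD G (fun=> - Complex 0 g0))//; last by move=> t _; exact: ucont_cst.
  have -> : (fun _ : R[i] => - Complex 0 g0) = (fun=> Complex 0 (- g0)).
    by apply/funext => z; apply: complex_eq; rewrite /= ?oppr0.
  by rewrite QQ_cst mulNr opprK.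
rewrite mulrA; apply: QQ_bound; first by rewrite mulr_ge0// ltW.
  by move=> t ht; apply: ucontB; [exact: hG|exact: ucont_cst].
by move=> t ht; rewrite cabsM ler_pM ?cabs_ge0// ?he ?hM.
Qed.

Lemma le0_of_small (x M : R) : 0 < M -> (forall e : R, 0 < e -> `|x| <= e * M) -> x = 0.
Proof.
move=> M0 h; apply/eqP; rewrite -normr_le0 leNgt; apply/negP => x0.
have := h (`|x| / (2 * M)); rewrite divr_gt0 ?mulr_gt0// => /(_ isT).
rewrite (_ : _ * M = `|x| / 2); last by field; rewrite gt_eqF.
by move: x0; move: `|x| => y; lra.
Qed.

Lemma ff_large s : cabs p < cabs s -> cabs (ff s) <= 2 * cabs w / (cabs s - cabs p).
Proof.
move=> h; have d0 : 0 < cabs s - cabs p by rewrite subr_gt0.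
have h1 q : cabs q = cabs p -> cabs s - cabs p <= cabs (s - q).
  by move=> <-; rewrite lerBlDr -{1}(subrK q s); exact: cabsD_le.
have h2 q W : cabs q = cabs p -> cabs W = cabs w -> cabs (W / (s - q)) <= cabs w / (cabs s - cabs p).
  move=> /h1 hq <-; rewrite cabsM cabsV ler_wpM2l ?cabs_ge0// lef_pV2// posrE//.
  exact: lt_le_trans hq.
rewrite /ff; apply: (le_trans (cabsD_le _ _)); rewrite cabsN.
have -> : 2 * cabs w / (cabs s - cabs p) =
  cabs w / (cabs s - cabs p) + cabs w / (cabs s - cabs p) by ring.
by apply: lerD; apply: h2; rewrite ?cabsJ.
Qed.

Lemma ucont_affine (A B : R) z : ucont (fun z => A%:C + B%:C * z) z.
Proof.
apply: ucontD; first exact: ucont_cst.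
by apply: ucontM; [exact: ucont_cst|exact: ucont_id].
Qed.

Lemma QQ_affine_const (u v : R) (A B : R) : 0 <= u -> ~~ (u < lp < v) ->
  forall l1 l2, u < l1 < v -> u < l2 < v ->
  QQ (fun z => (A%:C + B%:C * z) * ff z) l1 = QQ (fun z => (A%:C + B%:C * z) * ff z) l2.
Proof.
move=> u0 hlp; apply: QQ_const1 => //.
  apply: chol1M; last exact: chol1_ff.
  apply: chol1D; first exact: chol1_cst.
  by apply: chol1M; [exact: chol1_cst|exact: chol1_id].
move=> l _; rewrite zz_t0// zz_pi// !ReM !ff_real -!CM -!CD !ImC !mulr0 !mul0r.
by [].
Qed.

Lemma ccvg_rr_max : exists2 M : R, 0 < M & forall t, 0 <= t <= pi -> rr t <= M.
Proof.
have h l t : 0 <= l <= 1 -> 0 <= t <= pi -> {for (l, t), continuous (fun x : R * R => cabs (ss x.2))}.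
  move=> _ ht; have [h3 h4] := ccvg_ss _ th1 _ ht.
  have h : (fun x : R * R => x.2) @ nbhs (l, t) --> t by exact: (@cvg_snd _ _ (nbhs l) (nbhs t)).
  by apply: ccvg_cabs; split; [exact: (cvg_comp _ _ h h3)|exact: (cvg_comp _ _ h h4)].
have [M M0 hM] := rect_bound _ _ _ _ _ ler01 (ltW p0) h.
exists (M + 1) => [|t ht]; first by rewrite ltr_wpDl.
have := hM 0 t; rewrite lexx ler01 => /(_ isT ht) /=; rewrite cabs_ss// => h1.
by rewrite (le_trans (ler_norm _))// (le_trans h1)// lerDl.
Qed.

(** Applying [ucont] to the filter of discs around [z] recovers the epsilon-delta form. *)
Lemma ucont_ball G z : ucont G z -> forall e : R, 0 < e ->
  exists2 d : R, 0 < d & forall s, cabs (s - z) < d -> cabs (G s - G z) < e.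
Proof.
move=> hG e e0; pose F : set_system R[i] :=
  [set A | exists2 d : R, 0 < d & forall s, cabs (s - z) < d -> A s].
have FF : Filter F.
  split.
  - by exists 1.
  - move=> P Q [d1 d10 h1] [d2 d20 h2]; exists (Num.min d1 d2); first by rewrite lt_min d10.
    by move=> s; rewrite lt_min => /andP[/h1 ? /h2].
  - by move=> P Q PQ [d d0 h]; exists d => // s /h/PQ.
have hid : ccvg F id z.
  split; apply/cvgrPdist_lt => d d0; exists d => // s hs /=; apply: le_lt_trans hs;
    rewrite distrC -?ReB -?ImB; [exact: normRe_le|exact: normIm_le].
have := ccvg_cabs _ _ (ccvgB _ _ _ _ (hG _ _ FF _ hid) (ccvg_cst (G z))).
rewrite subrr cabs0 => /(_ FF FF FF) h.
have := cvgr_lt _ h _ e0; move=> /(_ FF)[d d0 hd]; by exists d.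
Qed.

Lemma Im_prodC (x : R) z : Complex 0 (2 * x * Im z) = x%:C * z - x%:C * cconj z.
Proof. by apply: complex_eq; rewrite ?(ReB, ImB, ReCM, ImCM, ReJ, ImJ)/=; ring. Qed.

Lemma QQ_lim0 G (g0 lm : R) : 0 < lm -> ucont G 0 -> G 0 = Complex 0 g0 ->
  (forall l t, 0 < l < lm -> 0 <= t <= pi -> ucont G (zz l t)) ->
  (forall l1 l2, 0 < l1 < lm -> 0 < l2 < lm -> QQ G l1 = QQ G l2) ->
  forall l, 0 < l < lm -> QQ G l = - (g0 * pi).
Proof.
move=> lm0 cG0 G0 cG cst l hl; apply/eqP; rewrite -subr_eq0 opprK; apply/eqP.
have [M M0 hM] := om_bound; apply: (@le0_of_small _ (M * pi)); first by rewrite mulr_gt0.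
move=> e e0; have [d d0 hd] := ucont_ball _ _ cG0 _ e0.
have [N N0 hN] := ccvg_rr_max.
pose l2 := Num.min (lm / 2) (d / (2 * N)).
have l20 : 0 < l2 by rewrite lt_min !divr_gt0// mulr_gt0.
have l2m : l2 < lm.
  have : l2 <= lm / 2 by rewrite /l2 ge_min lexx.
  lra.
have l2I : 0 < l2 < lm by rewrite l20.
rewrite (cst l l2)//; apply: QQ_approx => //; first exact: ltW.
  by move=> t ht; exact: cG.
move=> t ht; rewrite -G0; apply: ltW; apply: hd; rewrite subr0 cabs_zz//.
apply: (@le_lt_trans _ _ (l2 * N)); first by rewrite ler_pM2l// hN.
apply: (@le_lt_trans _ _ (d / (2 * N) * N)); first by rewrite ler_pM2r// /l2 ge_min lexx orbT.
rewrite (_ : _ * N = d / 2); first by lra.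
by field; rewrite gt_eqF.
Qed.

Lemma QQ_limoo G (g0 lm C : R) : lp < lm ->
  (forall l t, lm < l -> 0 <= t <= pi ->
    ucont G (zz l t) /\ cabs (G (zz l t) - Complex 0 g0) <= C / (cabs (zz l t) - cabs p)) ->
  0 <= C -> (forall t l, 0 <= t <= pi -> lm < l -> cabs p < cabs (zz l t)) ->
  (forall l1 l2, lm < l1 -> lm < l2 -> QQ G l1 = QQ G l2) ->
  forall l, lm < l -> QQ G l = - (g0 * pi).
Proof.
move=> lplm hG C0 hp cst l hl; apply/eqP; rewrite -subr_eq0 opprK; apply/eqP.
have [M M0 hM] := om_bound; apply: (@le0_of_small _ (M * pi)); first by rewrite mulr_gt0.
move=> e e0; have [r0 r00 hr] := rr_min _ th1.
(* Since the modulus on the dilate is at least [l2 r0], this choice gives [|z| - |p| >= C / e + 1],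
   hence an error of at most [e]. *)
pose l2 := lm + 1 + (C / e + 1 + cabs p) / r0.
have a0 : 0 <= cabs p := cabs_ge0 _.
have C1 : 0 <= C / e by rewrite divr_ge0// ltW.
have x0 : 0 < (C / e + 1 + cabs p) / r0 by rewrite divr_gt0//; lra.
have l2m : lm < l2 by rewrite /l2; lra.
have l20 : 0 < l2 by rewrite (lt_trans _ l2m)// (lt_trans lp0).
rewrite (cst l l2)//; apply: QQ_approx => //; first exact: ltW.
  by move=> t ht; have [] := hG _ _ l2m ht.
move=> t ht; have [_ h] := hG _ _ l2m ht; apply: (le_trans h).
have h1 : C / e + 1 <= cabs (zz l2 t) - cabs p.
  rewrite cabs_zz// lerBrDr; apply: (@le_trans _ _ (l2 * r0)); last by rewrite ler_pM2l// hr.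
  rewrite -ler_pdivrMr// /l2.
  by have : 0 < lm := lt_trans lp0 lplm; lra.
have h2 : 0 < cabs (zz l2 t) - cabs p by apply: lt_le_trans h1; lra.
rewrite ler_pdivrMr// mulrC -ler_pdivrMr//; lra.
Qed.

Lemma zz_gt_p : exists2 lm : R, lp < lm & forall t l, 0 <= t <= pi -> lm < l -> cabs p < cabs (zz l t).
Proof.
have [r0 r00 hr] := rr_min _ th1.
exists (lp + 1 + cabs p / r0).
  have : 0 <= cabs p / r0 by rewrite divr_ge0 ?cabs_ge0// ltW.
  by lra.
move=> t l ht hl; have l0 : 0 < l.
  apply: lt_trans hl; rewrite ltr_wpDr ?divr_ge0 ?cabs_ge0 ?(ltW r00)// addr_gt0//.
rewrite cabs_zz//; apply: (@lt_le_trans _ _ (l * r0)); last by rewrite ler_pM2l// hr.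
by rewrite -ltr_pdivrMr//; apply: lt_trans hl; rewrite ltrDr addr_gt0.
Qed.

(** Below [p] the contour shrinks to 0, where the integrand tends to
    [A ff(0) = - 2 i A Im (w / p)]. *)
Lemma QQ_affine_in (A B l : R) : 0 < l < lp ->
  QQ (fun z => (A%:C + B%:C * z) * ff z) l = 2 * pi * (A * Im (w / p)).
Proof.
move=> hl; rewrite (QQ_lim0 _ (2 * (- A) * Im (w / p)) lp lp0 _ _ _ _ _ hl); first by ring.
- have := @ucont_ff 0 0; rewrite /zz mul0r => h.
  apply: ucontM; first exact: ucont_affine.
  by apply: h; rewrite ?lexx ?ltW// lt_eqF.
- rewrite mulr0 addr0 /ff !sub0r Im_prodC CN [cconj (w / p)]cconjM cconjV.
  by rewrite !invrN; ring.
- move=> x t /andP[x0 xp] ht; apply: ucontM; first exact: ucont_affine.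
  by apply: ucont_ff => //; [exact: ltW|rewrite lt_eqF].
- by apply: QQ_affine_const => //; rewrite ltxx andbF.
Qed.

(** Beyond [p] the contour expands to infinity, where [(A + B s) ff(s)] tends to
    [B (w - conj w) = 2 i B Im w]. The jump from the inner value is the residue at [p]. *)
Lemma QQ_affine_out (A B l : R) : lp < l ->
  QQ (fun z => (A%:C + B%:C * z) * ff z) l = - (2 * pi * (B * Im w)).
Proof.
move=> hl; have [lm lplm hlm] := zz_gt_p.
have cst l1 l2 : lp < l1 -> lp < l2 ->
    QQ (fun z => (A%:C + B%:C * z) * ff z) l1 = QQ (fun z => (A%:C + B%:C * z) * ff z) l2.
  move=> h1 h2; apply: (@QQ_affine_const lp (l1 + l2)); rewrite ?ltxx ?(ltW lp0)//.
    by rewrite h1 ltrDl (lt_trans lp0).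
  by rewrite h2 ltrDr (lt_trans lp0).
have lm1 : lm < lm + 1 by rewrite ltrDl.
rewrite (cst l (lm + 1))//; last exact: lt_trans lm1.
rewrite (@QQ_limoo _ (2 * B * Im w) lm (2 * (cabs (A%:C + B%:C * p) * cabs w)))//.
- by ring.
- move=> x t hx ht; split.
    apply: ucontM; first exact: ucont_affine.
    by apply: ucont_ff => //; [rewrite ltW// (lt_trans lp0)// (lt_trans lplm)|rewrite gt_eqF// (lt_trans lplm)].
  set s := zz x t; have hs : cabs p < cabs s by exact: hlm.
  have d0 : 0 < cabs s - cabs p by rewrite subr_gt0.
  have h1 q : cabs q = cabs p -> cabs s - cabs p <= cabs (s - q).
    by move=> <-; rewrite lerBlDr -{1}(subrK q s); exact: cabsD_le.
  have nz q : cabs q = cabs p -> s - q != 0.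
    by move=> /h1 h; rewrite -cabs_gt0; apply: lt_le_trans h.
  have E q W : cabs q = cabs p -> (A%:C + B%:C * s) * (W / (s - q)) - B%:C * W =
      (A%:C + B%:C * q) * W / (s - q).
    by move=> /nz hq; field.
  have -> : (A%:C + B%:C * s) * ff s - Complex 0 (2 * B * Im w) =
     (A%:C + B%:C * p) * w / (s - p) - (A%:C + B%:C * cconj p) * cconj w / (s - cconj p).
    by rewrite -!E ?cabsJ// Im_prodC /ff; ring.
  apply: (le_trans (cabsD_le _ _)); rewrite cabsN.
  have -> : 2 * (cabs (A%:C + B%:C * p) * cabs w) / (cabs s - cabs p) =
    cabs (A%:C + B%:C * p) * cabs w / (cabs s - cabs p) +
    cabs (A%:C + B%:C * p) * cabs w / (cabs s - cabs p) by ring.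
  have F q W : cabs q = cabs p -> cabs W = cabs ((A%:C + B%:C * p) * w) ->
      cabs (W / (s - q)) <= cabs (A%:C + B%:C * p) * cabs w / (cabs s - cabs p).
    move=> /[dup] /nz n1 /h1 hq hW; rewrite cabsM cabsV hW cabsM.
    by rewrite ler_wpM2l ?mulr_ge0 ?cabs_ge0// lef_pV2// posrE// cabs_gt0.
  apply: lerD; apply: F; rewrite ?cabsJ//.
  by rewrite -(cabsJ (_ * w)) [in RHS]cconjM cconjD cconjM !cconjC.
- by rewrite !mulr_ge0// cabs_ge0.
- by move=> l1 l2 h1 h2; apply: cst; apply: lt_trans lplm _.
Qed.

End Kernel.
End Contour.

(** * The two halves of the logarithmic kernel *)

Section OutIn.
Context {R : realType} (theta c : R) (th1 : 1 < theta) (c0 : 0 < c).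
Local Notation a := theta^-1.
Local Notation J := (Jc theta c).
Local Notation Jq := (Jq theta c).
Local Notation Jd := (Jd theta c).
Local Notation TT := (TT theta c).
Local Notation TTd := (TTd theta c).
Local Notation om := (om theta).
Local Notation zz := (zz theta).
Local Notation bb := (bb theta c).
Local Notation QQ := (QQ theta).
Local Notation Sz := (Sz theta).
Local Notation mu := (@lebesgue_measure R).
Implicit Types (t u l x : R) (s z : R[i]).

Let a0 : 0 < a := a_gt0 _ th1.
Let a1 : a < 1 := a_lt1 _ th1.
Let p0 : 0 < (pi : R) := pi_gt0 R.
Let th0 : 0 < theta := theta_gt0 _ th1.

Context (Y : R) (Y0 : 0 < Y) (Yb : Y < bb).
Let Yt := (Y `^ theta)%:C : R[i].

Lemma J_neqY l t : 1 < l -> 0 <= t <= pi -> J (zz l t) - Y%:C != 0.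
Proof.
move=> l1 ht; have l0 : 0 < l := lt_trans ltr01 l1.
rewrite subr_eq0; apply/negP => /eqP e; case: (t_cases _ ht) => [h|h|h].
- have [x hx e2] := J_zz0 _ _ th1 c0 _ l0; rewrite h e2 in e.
  by have [ex] := e; move: Yb; rewrite -ex ltNge hx.
- have [x hx e2] := J_zzpi _ _ th1 c0 _ l1; rewrite h e2 in e.
  by have [ex] := e; move: Y0; rewrite -ex ltNge (ltW hx).
- by have := ImJ_gt0 _ _ th1 c0 _ _ l1 h; rewrite e ImC ltxx.
Qed.

(* [Fo] and [Fi] are holomorphic outside and inside gamma; on gamma their real
   parts add up to [ln |J - Y| + ln |J^theta - Y^theta|]. [Ho] and [Hi] are
   [s Fo'(s)] and [s Fi'(s)]. *)
Definition Ho z : R[i] := J z * (z - a%:C) / ((z + 1) * (J z - Y%:C)) - 1.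
Definition Fo z : R[i] := clog ((J z - Y%:C) / z).
Definition Fo1 z : R[i] := Jd z / (J z - Y%:C) - z^-1.

Lemma out_facts l t : 1 < l -> 0 <= t <= pi ->
  [/\ zz l t != 0, zz l t + 1 != 0, slit ((zz l t + 1) / zz l t) & J (zz l t) - Y%:C != 0].
Proof.
move=> l1 ht; have l0 : 0 < l := lt_trans ltr01 l1.
have sq : slit ((zz l t + 1) / zz l t) by apply: slit_q.
split => //; [exact: zz_neq0| |exact: J_neqY].
by have := slit_Re_neq _ sq; apply: contraNneq => ->; rewrite mul0r.
Qed.

Lemma chol1_Ho (v : R) : chol1 Ho (Sz 1 v).
Proof.
have facts z : Sz 1 v z -> [/\ z != 0, z + 1 != 0, slit ((z + 1) / z) & J z - Y%:C != 0].
  by move=> [l [t [/andP[l1 _] ht ->]]]; exact: out_facts.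
have cJ : chol1 J (Sz 1 v).
  exists Jd => z /facts[h1 h2 h3 h4]; split; first exact: chol_J.
  by apply: ucont_Jd => //; left.
apply: chol1B; last exact: chol1_cst; apply: chol1_div.
- by move=> z /facts[h1 h2 h3 h4]; rewrite mulf_neq0.
- by apply: chol1M => //; apply: chol1B; [exact: chol1_id|exact: chol1_cst].
- apply: chol1M; first by apply: chol1D; [exact: chol1_id|exact: chol1_cst].
  by apply: chol1B => //; exact: chol1_cst.
Qed.

Lemma Fo1_Ho z : z != 0 -> z + 1 != 0 -> J z - Y%:C != 0 -> Fo1 z * z = Ho z.
Proof.
move=> z0 z1 zY; rewrite /Fo1 /Ho /Jd; move: zY; rewrite J_Jq; move: (Jq z) (Y%:C) (a%:C) => q y A zY.
by field; rewrite z0 z1 zY.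
Qed.

Lemma Ho_end l : 1 < l -> Im (Ho (zz l 0)) = 0 /\ Im (Ho (zz l pi)) = 0.
Proof.
move=> l1; have l0 : 0 < l := lt_trans ltr01 l1.
have h (x y : R) : Im (y%:C * (x%:C - a%:C) / ((x%:C + 1) * (y%:C - Y%:C)) - 1) = 0.
  by rewrite ImB Im1 subr0 -!CN -(CD x 1) -!CD -!CM -CV -CM.
have [x _ e1] := J_zz0 _ _ th1 c0 _ l0; have [x' _ e2] := J_zzpi _ _ th1 c0 _ l1.
by rewrite /Ho e1 e2 zz_t0// zz_pi.
Qed.

(** Boundedness is enough because [ff] decays at infinity. The threshold makes
    [|J| >= c |z| / 4 >= 2 Y], so [|J / (J - Y)| <= 2], while [|z - a| / |z + 1| <= 3]; and
    [7 = 2 * 3 + 1]. *)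
Lemma Ho_large : exists2 N : R, 0 < N & forall z, N <= cabs z -> cabs (Ho z) <= 7.
Proof.
exists (2 + 8 * Y / c); first by rewrite ltr_pwDl// ltW// divr_gt0// mulr_gt0.
move=> z hz; have y0 : 0 < 8 * Y / c by rewrite divr_gt0// mulr_gt0.
have z2 : 2 <= cabs z by lra.
have zY : 8 * Y / c <= cabs z by lra.
have z0 : z != 0 by rewrite -cabs_gt0; lra.
have cabs1 : cabs (1 : R[i]) = 1 by rewrite /cabs Normc.normc1.
have z1 : cabs z / 2 <= cabs (z + 1).
  have := cabsD_le (z + 1) (- 1); rewrite addrK cabsN cabs1; lra.
have z1' : 1 <= cabs (z + 1) by lra.
have zp : cabs (z + 1) <= cabs z + 1 by rewrite -cabs1 cabsD_le.
have zn1 : z + 1 != 0 by rewrite -cabs_gt0; lra.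
have q0 : (z + 1) / z != 0 by rewrite mulf_neq0// invr_eq0.
have qh : 1 / 2 <= cabs ((z + 1) / z).
  by rewrite cabsM cabsV ler_pdivlMr ?cabs_gt0//; lra.
have qa : 1 / 2 <= cabs ((z + 1) / z) `^ a.
  case: (leP 1 (cabs ((z + 1) / z))) => h1.
    apply: (@le_trans _ _ 1); first by lra.
    by rewrite -(powRr0 (cabs ((z + 1) / z))) ler_powR// ltW.
  apply: (le_trans qh); rewrite -{1}(powRr1 (cabs_ge0 ((z + 1) / z))).
  have q1 : 0 < cabs ((z + 1) / z) by rewrite cabs_gt0.
  rewrite /powR gt_eqF// ler_expR; apply: ler_wnM2r; last exact: ltW.
  by apply: ln_le0; exact: ltW.
have JE : cabs (J z) = c * cabs (z + 1) * cabs ((z + 1) / z) `^ a.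
  by rewrite /Jc !cabsM cabsC gtr0_norm// -cabsM cabs_cpow.
have Jl : c * cabs z / 4 <= cabs (J z).
  rewrite JE; have : c * (cabs z / 2) * (1 / 2) <= c * cabs (z + 1) * cabs ((z + 1) / z) `^ a.
    by apply: ler_pM => //; rewrite ?mulr_ge0 ?(ltW c0) ?divr_ge0 ?cabs_ge0 ?ler_pM2l.
  lra.
have JY : 2 * Y <= cabs (J z).
  apply: le_trans Jl; move: zY; rewrite ler_pdivrMr//; lra.
have Jd1 : cabs (J z) / 2 <= cabs (J z - Y%:C).
  have := cabsD_le (J z - Y%:C) (Y%:C); rewrite subrK cabsC (gtr0_norm Y0); lra.
have J0 : 0 < cabs (J z) by move: Y0 JY; lra.
have e1 : cabs (J z) / cabs (J z - Y%:C) <= 2 by rewrite ler_pdivrMr; lra.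
have e2 : cabs (z - a%:C) / cabs (z + 1) <= 3.
  rewrite ler_pdivrMr; last by lra.
  have := cabsD_le z (- a%:C); rewrite cabsN cabsC gtr0_norm//; move: a1; lra.
rewrite /Ho; apply: (le_trans (cabsD_le _ _)); rewrite cabsN cabs1.
have -> : cabs (J z * (z - a%:C) / ((z + 1) * (J z - Y%:C))) =
   (cabs (J z) / cabs (J z - Y%:C)) * (cabs (z - a%:C) / cabs (z + 1)).
  by rewrite !cabsM cabsV cabsM invfM; ring.
have : cabs (J z) / cabs (J z - Y%:C) * (cabs (z - a%:C) / cabs (z + 1)) <= 2 * 3.
  by apply: ler_pM => //; rewrite divr_ge0// cabs_ge0.
lra.
Qed.

Definition Hi z : R[i] := z * (TTd z - Yt) / (TT z - z * Yt).
Definition Fi z : R[i] := clog (TT z - z * Yt).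
Definition Fi1 z : R[i] := (TTd z - Yt) / (TT z - z * Yt).

(** Divide by [z]: if the expression were a nonpositive real [m], then
    [Im (TT z / z) = Im (m / z) >= 0], against [ImTT_lt0]. At the two ends everything is real and
    the sign is explicit. *)
Lemma slit_in l t : 0 < l -> l < 1 -> 0 <= t <= pi -> slit (TT (zz l t) - zz l t * Yt).
Proof.
move=> l0 l1 ht; have b0 := bb_gt0 _ _ th1 c0; case: (t_cases _ ht) => [->|->|h].
- have [x [e1 hx] e2] := TT_zz0 _ _ th1 c0 _ l0; rewrite e2 e1 -CM -CN -CD; apply: slit_C.
  rewrite subr_gt0; apply: lt_le_trans hx; rewrite ltr_pM2l ?mulr_gt0//.
  by apply: gt0_ltr_powR; rewrite ?nnegrE ?ltW.
- have [x hx e2] := TT_zzpi _ _ th1 c0 _ l0 l1; rewrite e2 zz_pi// -CM -CN -CD; apply: slit_C.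
  by rewrite mulNr opprK addr_gt0// mulr_gt0// powR_gt0.
- set z := zz l t; have z0 : z != 0 by exact: zz_neq0.
  have I0 : 0 < Im z by exact: Im_zz_gt0.
  have TI : Im (TT z / z) < 0 by exact: ImTT_lt0.
  have [e|e] := eqVneq (Im (TT z - z * Yt)) 0; last by right.
  left; rewrite ltNge; apply/negP => r0; set m := TT z - z * Yt in e r0.
  have : TT z / z = m / z + Yt by rewrite /m; field.
  move/(congr1 (@complex.Im R)); rewrite [Im (m / z + _)]ImD ImC addr0 [Im (m / z)]ImM e mul0r addr0 ImV => e2.
  move: TI; rewrite e2 mulrN oppr_lt0 => h1.
  suff : Re m * (Im z / (Re z ^+ 2 + Im z ^+ 2)) <= 0 by rewrite leNgt h1.
  by apply: mulr_le0_ge0 => //; rewrite divr_ge0 ?(ltW I0)// addr_ge0 ?sqr_ge0.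
Qed.

Lemma in_facts l t : 0 < l -> l < 1 -> 0 <= t <= pi ->
  [/\ slit (1 + zz l t), 1 + zz l t != 0 & TT (zz l t) - zz l t * Yt != 0].
Proof.
move=> l0 l1 ht; have h : slit (1 + zz l t) by apply: slit_1.
by split => //; apply: slit_Re_neq => //; exact: slit_in.
Qed.

Lemma chol1_Hi : chol1 Hi (Sz 0 1).
Proof.
have facts z : Sz 0 1 z -> [/\ slit (1 + z), 1 + z != 0 & TT z - z * Yt != 0].
  by move=> [l [t [/andP[l0 l1] ht ->]]]; exact: in_facts.
have cT : chol1 TT (Sz 0 1).
  by exists TTd => z /facts[h1 h2 h3]; split; [exact: chol_TT|exact: ucont_TTd].
apply: chol1_div; first by move=> z /facts[].
  apply: chol1M; first exact: chol1_id.
  apply: chol1B; last exact: chol1_cst.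
  apply: chol1_div; first by move=> z /facts[].
    by apply: chol1M => //; exact: chol1_cst.
  by apply: chol1D; [exact: chol1_cst|exact: chol1_id].
by apply: chol1B => //; apply: chol1M; [exact: chol1_id|exact: chol1_cst].
Qed.

Lemma Fi1_Hi z : Fi1 z * z = Hi z.
Proof. by rewrite /Fi1 /Hi; ring. Qed.

Lemma Hi_end l : 0 < l -> l < 1 -> Im (Hi (zz l 0)) = 0 /\ Im (Hi (zz l pi)) = 0.
Proof.
move=> l0 l1.
have h (x y : R) : Im (x%:C * ((theta + 1)%:C * y%:C / (1 + x%:C) - Yt) / (y%:C - x%:C * Yt)) = 0.
  by rewrite -(CD 1 x) -CV -!CM -!CN -!CD -CV -!CM.
have [x [_ _] e1] := TT_zz0 _ _ th1 c0 _ l0; have [x' _ e2] := TT_zzpi _ _ th1 c0 _ l0 l1.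
by rewrite /Hi /TTd e1 e2 zz_t0// zz_pi.
Qed.

Section WithKernel.
Context (lp tp : R) (lp1 : 1 < lp) (tpI : 0 < tp < pi).
Let p := zz lp tp.
Let w : R[i] := p * (p + 1) / (p - a%:C).
Let lp0 : 0 < lp := lt_trans ltr01 lp1.
Local Notation ff := (ff theta lp tp).
Local Notation fd := (fd theta lp tp).

Lemma ucont_Ho l t : 1 < l -> 0 <= t <= pi -> ucont Ho (zz l t).
Proof.
move=> l1 ht; apply: (chol1_ucont _ (Sz 1 (l + 1))); first exact: chol1_Ho.
by apply: Sz_zz => //; rewrite l1 ltrDl ltr01.
Qed.

(** A residue computation by subtraction: an affine function carries the value of [Ho] at [p], the
    remainder crosses [p] freely, and the affine integrals are known on both sides. *)
Lemma QQ_out l : 1 < l < lp -> QQ (fun z => Ho z * ff z) l = 2 * pi * Im (Ho p * (w / p)).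
Proof.
move=> /andP[l1 llp].
have tpI' : 0 <= tp <= pi by have /andP[h1 h2] := tpI; rewrite !ltW.
have Imp : 0 < Im p by exact: Im_zz_gt0.
(* Two real coefficients suffice to interpolate a complex value at the nonreal point [p]; being
   real, they keep the affine function real at the ends of the arc. *)
pose B := Im (Ho p) / Im p; pose A := Re (Ho p) - B * Re p.
have PE : A%:C + B%:C * p = Ho p.
  apply: complex_eq; first by rewrite ReD ReCM ReC /A subrK.
  by rewrite ImD ImCM ImC add0r /B divfK// gt_eqF.
have [lm lplm hlm] := zz_gt_p _ th1 lp tp lp1.
have [N N0 hN] := Ho_large; have [r0 r00 hr] := rr_min _ th1.
pose lm2 := lm + N / r0.
have q0 : 0 < N / r0 by rewrite divr_gt0.
have lm2p : lp < lm2 by rewrite /lm2; lra.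
have Nz x t : lm2 < x -> 0 <= t <= pi -> N <= cabs (zz x t).
  move=> hx ht; have x0 : 0 < x by rewrite (lt_trans _ hx)// (lt_trans lp0).
  rewrite cabs_zz//; apply: (@le_trans _ _ (x * r0)); last by rewrite ler_pM2l// hr.
  by rewrite -ler_pdivrMr//; move: hx; rewrite /lm2; lra.
pose H z := Ho z - (A%:C + B%:C * z).
have cH v : chol1 H (Sz 1 v).
  apply: chol1B; first exact: chol1_Ho.
  apply: chol1D; first exact: chol1_cst.
  by apply: chol1M; [exact: chol1_cst|exact: chol1_id].
have cff x t : 1 < x -> x != lp -> 0 <= t <= pi -> ucont ff (zz x t).
  by move=> x1 xp ht; apply: ucont_ff => //; rewrite ltW// (lt_trans ltr01).
have split x : 1 < x -> x != lp -> QQ (fun z => Ho z * ff z) x =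
    QQ (fun z => H z * ff z) x + QQ (fun z => (A%:C + B%:C * z) * ff z) x.
  move=> x1 xp; rewrite -QQD//.
  - by apply: eq_QQ => t ht; rewrite /H; ring.
  - move=> t ht; apply: ucontM; last exact: cff.
    by apply: (chol1_ucont _ (Sz 1 (x + 1))); [exact: cH|apply: Sz_zz => //; rewrite x1 ltrDl ltr01].
  - by move=> t ht; apply: ucontM; [exact: ucont_affine|exact: cff].
have Hend v x : 1 < x < v -> Im (H (zz x 0)) = 0 /\ Im (H (zz x pi)) = 0.
  move=> /andP[x1 _]; have [e1 e2] := Ho_end _ x1.
  have E z : Im (H z) = Im (Ho z) - Im (A%:C + B%:C * z) by exact: ImB.
  by rewrite !E e1 e2 zz_t0// zz_pi// -!CM -!CD !ImC subrr.
have cross x : lp < x -> QQ (fun z => H z * ff z) l = QQ (fun z => H z * ff z) x.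
  move=> hx; apply: (QQ_cross _ th1 _ _ lp1 tpI 1 (x + 1)) => //.
  - by rewrite lp1 (lt_trans hx)// ltrDl.
  - by rewrite /H PE subrr.
  - exact: Hend.
  - by rewrite ltrDl.
have cst x y : lm2 < x -> lm2 < y -> QQ (fun z => Ho z * ff z) x = QQ (fun z => Ho z * ff z) y.
  move=> hx hy; have px : lp < x by exact: lt_trans hx.
  have py : lp < y by exact: lt_trans hy.
  rewrite (split x (lt_trans lp1 px)) ?gt_eqF// (split y (lt_trans lp1 py)) ?gt_eqF//.
  by rewrite -(cross x px) -(cross y py) (QQ_affine_out _ th1 _ _ lp1 tpI _ _ x px) (QQ_affine_out _ th1 _ _ lp1 tpI _ _ y py).
(* The bound 7 on [Ho] times the bound [2 |w| / (|s| - |p|)] on [ff] explains the constant 14. *)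
have oo x : lm2 < x -> QQ (fun z => Ho z * ff z) x = 0.
  move=> hx; rewrite (@QQ_limoo _ _ th1 lp tp lp1 _ 0 lm2 (14 * cabs w))//.
  - by rewrite mul0r oppr0.
  - move=> x' t hx' ht; have x'p : lp < x' by exact: lt_trans hx'.
    have x'1 : 1 < x' by exact: lt_trans x'p.
    split; first by apply: ucontM; [exact: ucont_Ho|apply: cff => //; rewrite gt_eqF].
    rewrite subr0 cabsM; set z := zz x' t.
    have pz : cabs p < cabs z by apply: hlm => //; move: hx'; rewrite /lm2; lra.
    have h1 : cabs (Ho z) <= 7 by apply: hN; exact: Nz.
    have h2 := ff_large _ _ _ _ pz.
    apply: le_trans (ler_pM (cabs_ge0 _) (cabs_ge0 _) h1 h2) _.
    rewrite -/p -/w le_eqVlt; apply/orP; left; apply/eqP; ring.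
  - by rewrite mulr_ge0// cabs_ge0.
  - by move=> t l' ht hl'; apply: hlm => //; move: hl'; rewrite /lm2; lra.
have hx : lm2 < lm2 + 1 by rewrite ltrDl.
have px : lp < lm2 + 1 by exact: lt_trans hx.
have := oo _ hx; rewrite (split (lm2 + 1)) ?gt_eqF ?(lt_trans lp1)//.
rewrite QQ_affine_out// -cross// => e.
rewrite split ?lt_eqF// QQ_affine_in//; last by rewrite (lt_trans ltr01).
(* Beyond [p] the whole integral is 0 and its affine part is [- 2 pi B Im w]. The part with [H] is
   the same on both sides of [p]. *)
have -> : QQ (fun z => H z * ff z) l = 2 * pi * (B * Im w) by rewrite -/p -/w in e; lra.
rewrite -/p -/w -PE -mulrDr; congr (_ * _).
have pn : p != 0 by exact: zz_neq0.
have -> : (A%:C + B%:C * p) * (w / p) = A%:C * (w / p) + B%:C * w by field.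
by rewrite ImD !ImCM addrC.
Qed.

(** The pole [p] lies outside gamma, so the contour shrinks to 0, where [Hi] vanishes thanks to its
    factor [z]. *)
Lemma QQ_in l : 0 < l < 1 -> QQ (fun z => Hi z * ff z) l = 0.
Proof.
move=> hl; have cff x t : 0 <= x -> x < 1 -> 0 <= t <= pi -> ucont ff (zz x t).
  by move=> x0 x1 ht; apply: ucont_ff => //; rewrite lt_eqF// (lt_trans x1).
rewrite (QQ_lim0 _ th1 _ 0 1 ltr01 _ _ _ _ _ hl); first by rewrite mul0r oppr0.
- apply: ucontM; last first.
    by have := cff 0 0; rewrite /zz mul0r; apply; rewrite ?lexx ?ltW.
  have s1 : slit (1 + 0 : R[i]) by left; rewrite addr0.
  have cT : ucont TT 0 by apply: chol_ucont (chol_TT _ _ _ s1).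
  apply: ucont_div.
  + rewrite mul0r subr0 /TT addr0 cpowC// powR1 mulr1.
    by rewrite C_eq0 gt_eqF// powR_gt0.
  + apply: ucontM; first exact: ucont_id.
    by apply: ucontB; [exact: ucont_TTd|exact: ucont_cst].
  + by apply: ucontB => //; apply: ucontM; [exact: ucont_id|exact: ucont_cst].
- by rewrite /Hi !mul0r.
- move=> x t /andP[x0 x1] ht; apply: ucontM; last by apply: cff => //; exact: ltW.
  by apply: (chol1_ucont _ (Sz 0 1)); [exact: chol1_Hi|apply: Sz_zz => //; rewrite x0].
- apply: (@QQ_const1 _ _ th1 0 1) => //.
    apply: chol1M; first exact: chol1_Hi.
    by apply: chol1_ff => //; rewrite negb_and -!leNgt (ltW lp1) orbT.
  move=> x /andP[x0 x1]; have [e1 e2] := Hi_end _ x0 x1.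
  by rewrite !ReM e1 e2 zz_t0// zz_pi// !ff_real// !mulr0 !mul0r.
Qed.

(** The two integrands add up to the [t]-derivative of [Re (F ff)], which is 0 at both ends because
    [F] is real and [ff] imaginary there. *)
Lemma QQ_by_parts F F1 l : 0 < l -> l != lp ->
  (forall t, 0 <= t <= pi -> chol F (zz l t) (F1 (zz l t)) /\ ucont F1 (zz l t)) ->
  Im (F (zz l 0)) = 0 -> Im (F (zz l pi)) = 0 ->
  \int[mu]_(t in `[0, pi]) Re (F (zz l t) * (fd (zz l t) * zz l t * om t)) =
  - QQ (fun z => F1 z * z * ff z) l.
Proof.
move=> l0 lnp hF F0 Fp.
have cF t : 0 <= t <= pi -> ucont F (zz l t) by move=> /hF[/chol_ucont].
have nz t : 0 <= t <= pi -> zz l t - p != 0 /\ zz l t - cconj p != 0.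
  by move=> ht; split; [apply: zz_neq_p => //; left|apply: zz_neq_pc => //; exact: ltW].
have cfd t : 0 <= t <= pi -> ucont fd (zz l t) by move=> /nz[h1 h2]; exact: ucont_fd.
have cff t : 0 <= t <= pi -> ucont ff (zz l t).
  by move=> ht; apply: ucont_ff => //; exact: ltW.
have I1 : mu.-integrable `[0, pi] (EFin \o (fun t => Re (F (zz l t) * (fd (zz l t) * zz l t * om t)))).
  rewrite (_ : (fun t => _) = fun t => Re ((F (zz l t) * fd (zz l t) * zz l t) * om t)); last first.
    by apply/funext => t; congr (Re _); ring.
  apply: (integrable_QQ _ th1 (fun z => F z * fd z * z)) => t ht.
  by apply: ucontM; [apply: ucontM; [exact: cF|exact: cfd]|exact: ucont_id].
have cF1 t : 0 <= t <= pi -> ucont (fun z => F1 z * z * ff z) (zz l t).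
  move=> ht; apply: ucontM; last exact: cff.
  by apply: ucontM; [have [] := hF _ ht|exact: ucont_id].
have I2 := integrable_QQ _ th1 _ _ cF1.
apply/eqP; rewrite -subr_eq0 opprK /QQ -RintegralD//; apply/eqP.
have E t : Re (F (zz l t) * (fd (zz l t) * zz l t * om t)) + Re (F1 (zz l t) * zz l t * ff (zz l t) * om t)
  = Re ((F1 (zz l t) * ff (zz l t) + F (zz l t) * fd (zz l t)) * (zz l t * om t)).
  by rewrite -ReD; congr (Re _); ring.
transitivity (Re (F (zz l pi) * ff (zz l pi)) - Re (F (zz l 0) * ff (zz l 0))); last first.
  by rewrite !ReM F0 Fp zz_t0// zz_pi// !ff_real// !mulr0 !mul0r subrr.
under eq_Rintegral do rewrite E.
have cz t : 0 <= t <= pi -> ccvg (nbhs t) (fun t => zz l t) (zz l t).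
  by move=> ht; exact: pder_ccvg (pder_zz_t _ th1 _ _ ht).
have cc G t : 0 <= t <= pi -> ucont G (zz l t) -> ccvg (nbhs t) (fun t => G (zz l t)) (G (zz l t)).
  by move=> ht; exact: cont_zz_t.
apply: (FTC_itv (fun t => Re (F (zz l t) * ff (zz l t))) _ _ _ (pi_gt0 R)).
- move=> t ht; split.
    apply: (@ccvg_Re _ _ (fun t => (F1 (zz l t) * ff (zz l t) + F (zz l t) * fd (zz l t)) * (zz l t * om t))).
    apply: ccvgM; last by apply: ccvgM; [exact: cz|exact: ccvg_om].
    apply: (cc (fun z => F1 z * ff z + F z * fd z)) => //.
    apply: ucontD; apply: ucontM; [by have [] := hF _ ht|exact: cff|exact: cF|exact: cfd].
  apply: (@ccvg_Re _ _ (fun t => F (zz l t) * ff (zz l t))).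
  by apply: (cc (fun z => F z * ff z)) => //; apply: ucontM; [exact: cF|exact: cff].
- move=> t /andP[h1 h2]; have ht : 0 <= t <= pi by rewrite !ltW.
  have [hF1 _] := hF _ ht; have [n1 n2] := nz _ ht.
  have := cholM _ _ _ _ _ hF1 (chol_ff theta lp tp _ n1 n2).
  by move/chol_path/(_ (pder_zz_t _ th1 l _ ht)) => [].
Qed.

(** Here one multiplies back by [z]: a nonpositive real quotient [m] would give
    [Im J = m Im z <= 0], against [ImJ_gt0]. *)
Lemma slit_out l t : 1 < l -> 0 <= t <= pi -> slit ((J (zz l t) - Y%:C) / zz l t).
Proof.
move=> l1 ht; have l0 : 0 < l := lt_trans ltr01 l1.
case: (t_cases _ ht) => [->|->|h].
- have [x hx ->] := J_zz0 _ _ th1 c0 _ l0; rewrite zz_t0// -CN -CD -CV -CM; apply: slit_C.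
  by rewrite divr_gt0 ?mulr_gt0// subr_gt0 (lt_le_trans Yb).
- have [x hx ->] := J_zzpi _ _ th1 c0 _ l1; rewrite zz_pi// -CN -CD -CV -CM; apply: slit_C.
  rewrite -mulrNN -invrN opprK divr_gt0// oppr_gt0; move: Y0; lra.
- set z := zz l t; have z0 : z != 0 by exact: zz_neq0.
  have I0 : 0 < Im z by exact: Im_zz_gt0.
  have JI : 0 < Im (J z) by exact: ImJ_gt0.
  have [e|e] := eqVneq (Im ((J z - Y%:C) / z)) 0; last by right.
  left; rewrite ltNge; apply/negP => r0; set m := (J z - Y%:C) / z in e r0.
  have : J z = m * z + Y%:C by rewrite /m; field.
  move/(congr1 (@complex.Im R)); rewrite [Im (m * z + _)]ImD ImC addr0 [Im (m * z)]ImM e mul0r addr0 => e2.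
  by move: JI; rewrite e2 ltNge mulr_le0_ge0// ltW.
Qed.

Lemma Fo_chol l t : 1 < l -> 0 <= t <= pi ->
  chol Fo (zz l t) (Fo1 (zz l t)) /\ ucont Fo1 (zz l t).
Proof.
move=> l1 ht; have [h1 h2 h3 h4] := out_facts _ _ l1 ht.
have hs := slit_out _ _ l1 ht; have cJ := chol_J theta c th1 _ h1 h3.
have cJY : chol (fun z => J z - Y%:C) (zz l t) (Jd (zz l t) - 0).
  by apply: cholB => //; exact: chol_cst.
split.
  have d := chol_comp _ clog _ _ _ (chol_div _ id _ _ _ h1 cJY (chol_id (zz l t))) (chol_clog _ hs).
  apply: chol_eqD d; rewrite /Fo1 subr0 mulr1; move: (Jd _) => j.
  by field; rewrite h1 h4.
apply: ucontB.
  apply: ucont_div => //; last exact: chol_ucont cJY.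
  by apply: ucont_Jd => //; left.
by apply: ucontV => //; exact: ucont_id.
Qed.

Lemma Fi_chol l t : 0 < l -> l < 1 -> 0 <= t <= pi ->
  chol Fi (zz l t) (Fi1 (zz l t)) /\ ucont Fi1 (zz l t).
Proof.
move=> l0 l1 ht; have [h1 h2 h3] := in_facts _ _ l0 l1 ht.
have hs := slit_in _ _ l0 l1 ht; have cT := chol_TT theta c _ h1.
have cz : chol (fun z => z * Yt) (zz l t) (1 * Yt + zz l t * 0).
  by apply: cholM; [exact: chol_id|exact: chol_cst].
have cTY := cholB _ _ _ _ _ cT cz.
split.
  apply: chol_eqD (chol_comp _ _ _ _ _ cTY (chol_clog _ hs)).
  by rewrite /Fi1 mul1r mulr0 addr0 mulrC.
apply: ucont_div => //; last exact: chol_ucont cTY.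
by apply: ucontB; [exact: ucont_TTd|exact: ucont_cst].
Qed.

Lemma Im_clogC x : 0 < x -> Im (clog (x%:C : R[i])) = 0.
Proof.
move=> x0; have := Arg_polar x 0 x0; rewrite expi0 mulr1; apply.
by rewrite oppr_lt0 p0 ltW.
Qed.

Lemma int_out l : 1 < l < lp ->
  \int[mu]_(t in `[0, pi]) Re (Fo (zz l t) * (fd (zz l t) * zz l t * om t)) =
  - (2 * pi * Im (Ho p * (w / p))).
Proof.
move=> hl; have /andP[l1 llp] := hl; have l0 : 0 < l := lt_trans ltr01 l1.
have lnp : l != lp by rewrite lt_eqF.
have h00 : 0 <= (0 : R) <= pi by rewrite lexx ltW.
have hpp : 0 <= (pi : R) <= pi by rewrite lexx ltW.
rewrite (QQ_by_parts _ Fo1)//.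
- rewrite -(QQ_out l hl); congr (- _); apply: eq_QQ => t ht.
  by have [h1 h2 h3 h4] := out_facts _ _ l1 ht; rewrite Fo1_Ho.
- by move=> t ht; exact: Fo_chol.
- have [x hx e] := J_zz0 _ _ th1 c0 _ l0; rewrite /Fo e zz_t0// -CN -CD -CV -CM; apply: Im_clogC.
  by rewrite divr_gt0 ?mulr_gt0// subr_gt0 (lt_le_trans Yb).
- have [x hx e] := J_zzpi _ _ th1 c0 _ l1; rewrite /Fo e zz_pi// -CN -CD -CV -CM; apply: Im_clogC.
  rewrite -mulrNN -invrN opprK divr_gt0// oppr_gt0; move: Y0; lra.
Qed.

Lemma int_in l : 0 < l < 1 ->
  \int[mu]_(t in `[0, pi]) Re (Fi (zz l t) * (fd (zz l t) * zz l t * om t)) = 0.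
Proof.
move=> hl; have /andP[l0 l1] := hl; have b0 := bb_gt0 _ _ th1 c0.
have lnp : l != lp by rewrite lt_eqF// (lt_trans l1).
rewrite (QQ_by_parts _ Fi1)//.
- rewrite -[RHS]oppr0 -(QQ_in l)//; congr (- _); apply: eq_QQ => t ht.
  by rewrite Fi1_Hi.
- by move=> t ht; exact: Fi_chol.
- have [x [e1 hx] e2] := TT_zz0 _ _ th1 c0 _ l0; rewrite /Fi e2 e1 -CM -CN -CD; apply: Im_clogC.
  rewrite subr_gt0; apply: lt_le_trans hx; rewrite ltr_pM2l ?mulr_gt0//.
  by apply: gt0_ltr_powR; rewrite ?nnegrE ?ltW.
- have [x hx e2] := TT_zzpi _ _ th1 c0 _ l0 l1; rewrite /Fi e2 zz_pi// -CM -CN -CD; apply: Im_clogC.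
  by rewrite mulNr opprK addr_gt0// mulr_gt0// powR_gt0.
Qed.

End WithKernel.
End OutIn.

(** * Differentiation rules for real functions *)

Section RealDerivatives.
Context {R : realType}.
Implicit Types (f g : R -> R) (t d e : R).

Lemma rderM f g t d e : is_derive t (1 : R) f d -> is_derive t (1 : R) g e ->
  is_derive t (1 : R) (fun u => f u * g u) (d * g t + f t * e).
Proof.
move=> hf hg; have h := is_deriveM hf hg; apply: (is_derive_eq h).
by rewrite /GRing.scale/=; ring.
Qed.

Lemma rderD f g t d e : is_derive t (1 : R) f d -> is_derive t (1 : R) g e ->
  is_derive t (1 : R) (fun u => f u + g u) (d + e).
Proof. by move=> hf hg; exact: is_deriveD. Qed.

Lemma rderB f g t d e : is_derive t (1 : R) f d -> is_derive t (1 : R) g e ->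
  is_derive t (1 : R) (fun u => f u - g u) (d - e).
Proof. by move=> hf hg; exact: is_deriveB. Qed.

Lemma rder_comp f g t d e : is_derive t (1 : R) f d -> is_derive (f t) (1 : R) g e ->
  is_derive t (1 : R) (fun u => g (f u)) (d * e).
Proof. by move=> hf hg; have h := is_derive1_comp hg hf; apply: (is_derive_eq h); rewrite mulrC. Qed.

Lemma rder_id t : is_derive t (1 : R) (fun u : R => u) 1.
Proof. exact: is_derive_id. Qed.

Lemma rder_cst c t : is_derive t (1 : R) (fun=> c : R) 0.
Proof. exact: is_derive_cst. Qed.

Lemma rder_eq f t d e : d = e -> is_derive t (1 : R) f d -> is_derive t (1 : R) f e.
Proof. by move=> ->. Qed.

Lemma rder_cont f t d : is_derive t (1 : R) f d -> {for t, continuous f}.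
Proof.
by move=> h; apply/differentiable_continuous/derivable1_diffP; exact: (@ex_derive _ _ _ _ _ _ _ h).
Qed.

End RealDerivatives.

(** * Limit theorems for real-valued integrals *)

Section MeasureTools.
Context {d : measure_display} {T : measurableType d} {R : realType}
  (m : {measure set T -> \bar R}).

(** The exceptional null set is explicit, since every use excludes finitely many known points where
    a logarithm is singular or an argument degenerates. *)
Lemma Rdominated_cvg (D N : set T) (f_ : nat -> T -> R) (f g : T -> R) :
  measurable D -> measurable N -> m N = 0%E ->
  (forall n, measurable_fun D (f_ n)) -> measurable_fun D f ->
  (forall x, D x -> ~ N x -> f_ ^~ x @ \oo --> f x) ->
  m.-integrable D (EFin \o g) ->
  (forall n x, D x -> ~ N x -> `|f_ n x| <= g x) ->
  m.-integrable D (EFin \o f) /\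
  (fun n => \int[m]_(x in D) f_ n x) @ \oo --> \int[m]_(x in D) f x.
Proof.
move=> mD mN N0 mf_ mf cf ig dom.
have ae (P : T -> Prop) : (forall x, ~ N x -> P x) -> \forall x \ae m, P x.
  by move=> h; exists N; split => // x; apply: contra_notP => /h.
have mE n : measurable_fun D (EFin \o f_ n) by exact/measurable_EFinP.
have mEf : measurable_fun D (EFin \o f) by exact/measurable_EFinP.
have cE : \forall x \ae m, D x -> (EFin \o f_ n) x @[n --> \oo] --> (EFin \o f) x.
  apply: ae => x Nx Dx; apply: (cvg_comp _ _ (cf x Dx Nx)) => //.
have dE : \forall x \ae m, forall n, D x -> (`|(EFin \o f_ n) x| <= (EFin \o g) x)%E.
  by apply: ae => x Nx n Dx; rewrite /= lee_fin; exact: dom.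
have [h1 h2 h3] := dominated_convergence mD mE mEf cE ig dE.
split => //; apply: (@fine_cvg _ _ _ _ (fun n => (\int[m]_(x in D) (f_ n x)%:E)%E)).
rewrite fineK//; exact: integrable_fin_num.
Qed.

(** Fatou's lemma as a source of integrability: uniform bounds on the integrals of approximations
    stand in for a majorant. *)
Lemma fatou_integrable (D : set T) (f_ : nat -> T -> R) (f : T -> R) (M : R) :
  measurable D -> (forall n, measurable_fun D (f_ n)) -> measurable_fun D f ->
  (forall n x, D x -> 0 <= f_ n x) -> (forall x, D x -> 0 <= f x) ->
  (forall x, D x -> ((f x)%:E <= limn_einf (fun n => (f_ n x)%:E))%E) ->
  (forall n, (\int[m]_(x in D) (f_ n x)%:E <= M%:E)%E) ->
  m.-integrable D (EFin \o f) /\ (\int[m]_(x in D) (f x)%:E <= M%:E)%E.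
Proof.
move=> mD mf_ mf f_0 f0 hf hM.
have mE n : measurable_fun D (fun x => (f_ n x)%:E) by exact/measurable_EFinP.
have mfE : measurable_fun D (EFin \o f) by exact/measurable_EFinP.
have h0 n x : D x -> (0 <= (f_ n x)%:E)%E by move=> Dx; rewrite lee_fin f_0.
have bnd : (\int[m]_(x in D) (f x)%:E <= M%:E)%E.
  apply: (@le_trans _ _ (limn_einf (fun n => \int[m]_(x in D) (f_ n x)%:E))%E).
    apply: le_trans (fatou m mD mE h0); apply: ge0_le_integral => //.
    rewrite (_ : (fun x => _) = fun x => - limn_esup (-%E \o (fun n => (f_ n x)%:E)))%E; last first.
      by apply/funext => x; rewrite limn_esupN oppeK.
    apply: measurableT_comp => //; apply: measurable_fun_limn_esup => n.
    by apply: measurableT_comp => //; exact: mE.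
  rewrite limn_einf_lim; apply: lime_le; first exact: is_cvg_einfs.
  apply: nearW => n; apply: ereal_inf_le; exists (\int[m]_(x in D) (f_ n x)%:E)%E => //.
  by exists n => /=.
split => //; apply/integrableP; split => //.
rewrite (eq_integral (fun x => (f x)%:E)); last first.
  by move=> x; rewrite inE => Dx /=; rewrite ger0_norm// f0.
by apply: (le_lt_trans bnd); exact: ltry.
Qed.

End MeasureTools.

(** * Integrability of logarithms *)

Section LogIntegrable.
Context {R : realType}.
Local Notation mu := (@lebesgue_measure R).
Implicit Types (t u v x : R).

Lemma measurable_ln_dist (D : set R) t0 : measurable D ->
  measurable_fun D (fun t => ln `|t - t0|).
Proof.
move=> mD; apply: measurableT_comp; first exact: measurable_ln.
apply: measurableT_comp => //.
by apply: measurable_funB => //; exact: measurable_cst.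
Qed.

(* The antiderivative [x - x ln (x^2 + e^2) / 2] of a continuous majorant of
   [- ln (x^2 + e^2) / 2] bounds the integrals uniformly in [e]. *)
Lemma ln_dist_bound t0 rho : 1 <= rho -> let C := ln (rho ^+ 2 + 1) / 2 in
  [/\ forall t, t0 - rho <= t <= t0 + rho -> 0 <= C - ln `|t - t0|,
    mu.-integrable `[t0 - rho, t0 + rho] (EFin \o (fun t => C - ln `|t - t0|)) &
   (\int[mu]_(t in `[(t0 - rho)%R, (t0 + rho)%R]) (C - ln `|t - t0|)%:E <= (2 * rho + C * (2 * rho))%:E)%E].
Proof.
move=> rho1 C.
have C0 : 0 <= C by rewrite divr_ge0// ln_ge0// lerDr sqr_ge0.
pose e n : R := n.+1%:R^-1.
have e0 n : 0 < e n by rewrite invr_gt0.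
have e1 n : e n <= 1 by rewrite invf_le1// ler1n.
have den n x : 0 < x ^+ 2 + e n ^+ 2 by rewrite ltr_wpDl ?sqr_ge0// exprn_gt0.
pose F n t := (t - t0) - (t - t0) / 2 * ln ((t - t0) ^+ 2 + e n ^+ 2).
pose f_ n t := 1 - ln ((t - t0) ^+ 2 + e n ^+ 2) / 2 - (t - t0) ^+ 2 / ((t - t0) ^+ 2 + e n ^+ 2).
have Fd n t : is_derive t (1 : R) (F n) (f_ n t).
  have hl : is_derive t (1 : R) (fun t => ln ((t - t0) ^+ 2 + e n ^+ 2))
     ((2 * (t - t0)) * ((t - t0) ^+ 2 + e n ^+ 2)^-1).
    have h1 := rderB _ _ _ _ _ (rder_id t) (rder_cst t0 t).
    have h2 := rderD _ _ _ _ _ (rderM _ _ _ _ _ h1 h1) (rder_cst (e n ^+ 2) t).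
    have h3 := rder_comp _ _ _ _ _ h2 (is_derive1_ln (den n (t - t0))).
    by apply: rder_eq h3; ring.
  have h1 := rderB _ _ _ _ _ (rder_id t) (rder_cst t0 t).
  have h2 := rderB _ _ _ _ _ h1 (rderM _ _ _ _ _ (rderM _ _ _ _ _ h1 (rder_cst (2^-1) t)) hl).
  by apply: rder_eq h2; rewrite /f_; field; rewrite gt_eqF.
have cf n t : {for t, continuous (f_ n)}.
  have c1 : (fun t => (t - t0) ^+ 2 + e n ^+ 2) x @[x --> t] --> (t - t0) ^+ 2 + e n ^+ 2.
    have -> : (fun t => (t - t0) ^+ 2 + e n ^+ 2) = (fun t => (t - t0) * (t - t0) + e n ^+ 2).
      by apply/funext => y; rewrite expr2.
    rewrite expr2; apply: cvgD; last exact: cvg_cst.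
    by apply: cvgM; apply: cvgB; first [exact: cvg_id|exact: cvg_cst].
  have c2 : (fun t => (t - t0) ^+ 2) x @[x --> t] --> (t - t0) ^+ 2.
    have -> : (fun t => (t - t0) ^+ 2) = (fun t => (t - t0) * (t - t0)).
      by apply/funext => y; rewrite expr2.
    by rewrite expr2; apply: cvgM; apply: cvgB; first [exact: cvg_id|exact: cvg_cst].
  apply: cvgB; last by apply: cvgM => //; apply: cvgV => //; rewrite gt_eqF.
  apply: cvgB; first exact: cvg_cst.
  apply: cvgM; last exact: cvg_cst.
  exact: (cvg_comp _ _ c1 (continuous_ln (den n (t - t0)))).
have bnd t : t0 - rho <= t <= t0 + rho -> (t - t0) ^+ 2 <= rho ^+ 2.
  move=> /andP[h1 h2]; rewrite -[leLHS]real_normK ?num_real// lerXn2r ?nnegrE//; first by lra.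
  by rewrite ler_norml; apply/andP; split; lra.
have lnle n t : t0 - rho <= t <= t0 + rho -> ln ((t - t0) ^+ 2 + e n ^+ 2) / 2 <= C.
  move=> ht; rewrite ler_pM2r ?invr_gt0// ler_ln ?posrE ?den//; last by rewrite ltr_wpDl ?sqr_ge0.
  by rewrite lerD ?bnd// expr_le1// ltW.
have inI t : `[t0 - rho, t0 + rho]%classic t -> t0 - rho <= t <= t0 + rho.
  by rewrite /= in_itv.
have f_0 n t : t0 - rho <= t <= t0 + rho -> 0 <= f_ n t + C.
  move=> ht; have := lnle n _ ht.
  have : (t - t0) ^+ 2 / ((t - t0) ^+ 2 + e n ^+ 2) <= 1.
    by rewrite ler_pdivrMr ?den// mul1r lerDl sqr_ge0.
  rewrite /f_; lra.
have mf_ n : measurable_fun `[t0 - rho, t0 + rho] (fun t => f_ n t + C).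
  apply: subspace_continuous_measurable_fun => //; apply: within_cont => t _.
  by apply: cvgD; [exact: cf|exact: cvg_cst].
have mf : measurable_fun `[t0 - rho, t0 + rho] (fun t => C - ln `|t - t0|).
  by apply: measurable_funB; [exact: measurable_cst|exact: measurable_ln_dist].
have f0 t : t0 - rho <= t <= t0 + rho -> 0 <= C - ln `|t - t0|.
  move=> /bnd h; have [->|tn] := eqVneq t t0; first by rewrite subrr normr0 ln0// subr0.
  have -> : ln `|t - t0| = ln ((t - t0) ^+ 2) / 2.
    rewrite -[in RHS](real_normK (num_real _)) lnXn ?normr_gt0 ?subr_eq0//; lra.
  rewrite subr_ge0 ler_pM2r ?invr_gt0// ler_ln ?posrE ?exprn_even_gt0 ?subr_eq0//; last first.
    by rewrite ltr_wpDl ?sqr_ge0.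
  by rewrite (le_trans h)// lerDl.
suff [h1 h2] : mu.-integrable `[t0 - rho, t0 + rho] (EFin \o (fun t => C - ln `|t - t0|)) /\
   (\int[mu]_(t in `[(t0 - rho)%R, (t0 + rho)%R]) (C - ln `|t - t0|)%:E <= (2 * rho + C * (2 * rho))%:E)%E.
  by split.
apply: (@fatou_integrable _ _ _ mu _ (fun n t => f_ n t + C)) => //.
- move=> t /inI ht; have [->|tn] := eqVneq t t0.
    rewrite subrr normr0 ln0// subr0.
    rewrite limn_einf_lim; apply: lime_ge; first exact: is_cvg_einfs.
    apply: nearW => n; apply: le_ereal_inf_tmp => _ [k _ <-]; rewrite lee_fin /f_ subrr expr0n/= !mul0r subr0 add0r.
    rewrite lerDr; have : ln (e k ^+ 2) <= 0 by apply: ln_le0; rewrite expr_le1// ltW.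
    lra.
  suff hc : (fun n => f_ n t + C) @ \oo --> C - ln `|t - t0|.
    have hE : (fun n => (f_ n t + C)%:E) @ \oo --> (C - ln `|t - t0|)%:E by apply: (cvg_comp _ _ hc).
    by rewrite (cvg_limn_einf_sup hE).1.
  have t2 : 0 < (t - t0) ^+ 2 by rewrite exprn_even_gt0//= subr_eq0.
  have ec : e @ \oo --> (0 : R) by exact: cvg_harmonic.
  have e2 : (fun n => (t - t0) ^+ 2 + e n ^+ 2) @ \oo --> (t - t0) ^+ 2.
    rewrite -[X in _ --> X]addr0; apply: cvgD; first exact: cvg_cst.
    rewrite -(mulr0 (0 : R)); under eq_fun do rewrite expr2.
    exact: cvgM.
  have -> : C - ln `|t - t0| = 1 - ln ((t - t0) ^+ 2) / 2 - (t - t0) ^+ 2 / (t - t0) ^+ 2 + C.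
    rewrite divff ?gt_eqF// -[in RHS](real_normK (num_real _)) lnXn ?normr_gt0 ?subr_eq0//; lra.
  apply: cvgD; last exact: cvg_cst.
  apply: cvgB; last by apply: cvgM; [exact: cvg_cst|apply: cvgV => //; rewrite gt_eqF].
  apply: cvgB; first exact: cvg_cst.
  apply: cvgM; last exact: cvg_cst.
  exact: (cvg_comp _ _ e2 (continuous_ln t2)).
- move=> n.
  have rh : t0 - rho < t0 + rho by lra.
  have i1 : mu.-integrable `[t0 - rho, t0 + rho] (EFin \o (fun t => f_ n t + C)).
    by apply: integrable_itv => t _; apply: cvgD; [exact: cf|exact: cvg_cst].
  rewrite -[leLHS]fineK; last exact: (integrable_fin_num _ i1).
  rewrite lee_fin -/(Rintegral mu _ (fun t => f_ n t + C)).
  have c1 t : t0 - rho <= t <= t0 + rho ->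
      {for t, continuous (fun t => f_ n t + C)} /\ {for t, continuous (fun t => F n t + C * t)}.
    move=> _; split; first by apply: cvgD; [exact: cf|exact: cvg_cst].
    apply: cvgD; last by apply: cvgM; [exact: cvg_cst|exact: cvg_id].
    exact: rder_cont (Fd n t).
  have d1 t : t0 - rho < t < t0 + rho -> is_derive t (1 : R) (fun t => F n t + C * t) (f_ n t + C).
    move=> _; have h := rderD _ _ _ _ _ (Fd n t) (rderM _ _ _ _ _ (rder_cst C t) (rder_id t)).
    by apply: rder_eq h; ring.
  rewrite (FTC_itv _ _ _ _ rh c1 d1).
  have r2 : 0 <= ln (rho ^+ 2 + e n ^+ 2).
    by rewrite ln_ge0// -[leLHS]addr0 lerD ?sqr_ge0// expr_ge1//; lra.
  rewrite /F.
  have -> : t0 + rho - t0 = rho by lra.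
  have -> : t0 - rho - t0 = - rho by lra.
  rewrite sqrrN; have : 0 <= rho * ln (rho ^+ 2 + e n ^+ 2) by rewrite mulr_ge0//; lra.
  move: (ln _) => L; lra.
Qed.

Lemma integrable_ln_dist t0 u v :
  mu.-integrable `[u, v] (EFin \o (fun t => ln `|t - t0|)).
Proof.
pose rho := 1 + `|u - t0| + `|v - t0|.
have rho1 : 1 <= rho by rewrite /rho; have := normr_ge0 (u - t0); have := normr_ge0 (v - t0); lra.
apply: (@integrableS _ _ _ mu `[t0 - rho, t0 + rho]%classic) => //.
  apply: subset_itv; rewrite bnd_simp /rho.
    by have := ler_norm (- (u - t0)); rewrite normrN; have := normr_ge0 (v - t0); lra.
  by have := ler_norm (v - t0); have := normr_ge0 (u - t0); lra.
have [_ h _] := ln_dist_bound t0 _ rho1; set C := ln _ / 2 in h.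
have -> : EFin \o (fun t => ln `|t - t0|) = (fun t => C%:E - (C - ln `|t - t0|)%:E)%E.
  by apply/funext => t /=; rewrite -EFinB; congr (_%:E); ring.
by apply: integrableB => //; apply: (@integrable_itv _ (fun=> C)) => t _; exact: cvg_cst.
Qed.

(** On the window [ln <= C], so [|ln| <= C + (C - ln)]. Uniformity in [t0] is what later keeps a
    remainder bounded as [t0] approaches the ends of the arc. *)
Lemma integral_ln_dist_bound (L : R) : 0 < L -> exists2 M : R, 0 <= M &
  forall t0, 0 <= t0 <= L -> \int[mu]_(t in `[0, L]) `|ln `|t - t0| | <= M.
Proof.
move=> L0; pose rho := 1 + L; have rho1 : 1 <= rho by rewrite /rho; lra.
pose C := ln (rho ^+ 2 + 1) / 2.
have C0 : 0 <= C by rewrite divr_ge0// ln_ge0// lerDr sqr_ge0.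
exists (C * L + (2 * rho + C * (2 * rho))); first by have := mulr_ge0 C0 (ltW L0); have : 0 <= C * (2 * rho); [rewrite mulr_ge0//; lra|lra].
move=> t0 /andP[h1 h2]; have [f0 fi fb] := ln_dist_bound t0 _ rho1; rewrite -/C in f0 fi fb.
have sub : `[0, L]%classic `<=` `[t0 - rho, t0 + rho]%classic.
  by apply: subset_itv; rewrite bnd_simp /rho; lra.
have i1 : mu.-integrable `[0, L] (EFin \o (fun t => C - ln `|t - t0|)).
  by apply: integrableS fi.
have iC : mu.-integrable `[0, L] (EFin \o (fun=> C)).
  by apply: (@integrable_itv _ (fun=> C)) => t _; exact: cvg_cst.
have i2 : mu.-integrable `[0, L] (EFin \o (fun t => C + (C - ln `|t - t0|))).
  by apply: (@integrableD _ _ _ mu _ _ (fun=> C%:E) (fun t => (C - ln `|t - t0|)%:E)).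
apply: (@le_trans _ _ (\int[mu]_(t in `[0, L]) (C + (C - ln `|t - t0|)))).
  apply: le_Rintegral => //.
    by have := integrable_abse (integrable_ln_dist t0 0 L).
  move=> t ht; have := f0 t; have := sub t ht; rewrite /= in_itv/= => -> /(_ isT) h.
  by rewrite ler_norml; apply/andP; split; lra.
rewrite RintegralD//; apply: lerD.
  by rewrite Rintegral_cst//= lebesgue_measure_itv/= lte_fin L0 -EFinB subr0.
rewrite -lee_fin fineK; last exact: (integrable_fin_num _ i1).
apply: le_trans fb; apply: ge0_subset_integral => //.
exact: measurable_int fi.
Qed.

End LogIntegrable.

(** * The logarithmic kernel on gamma as a limit from both sides *)

Section LogKernel.
Context {R : realType} (theta c : R) (th1 : 1 < theta) (c0 : 0 < c).
Local Notation a := theta^-1.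
Local Notation J := (Jc theta c).
Local Notation Jd := (Jd theta c).
Local Notation TT := (TT theta c).
Local Notation TTd := (TTd theta c).
Local Notation ss := (ss theta).
Local Notation om := (om theta).
Local Notation zz := (zz theta).
Local Notation yy := (yy theta c).
Local Notation bb := (bb theta c).
Local Notation mu := (@lebesgue_measure R).
Implicit Types (t u l x : R) (s z : R[i]).

Let a0 : 0 < a := a_gt0 _ th1.
Let a1 : a < 1 := a_lt1 _ th1.
Let p0 : 0 < (pi : R) := pi_gt0 R.
Let th0 : 0 < theta := theta_gt0 _ th1.

(** The zero at [ss tY] is simple and the only one, so [G z / (z - ss tY)] extends to a continuous
    nonvanishing function on a compact rectangle and is bounded below. [cabs_ssB] then bounds
    [z - ss tY] by the angle. The estimate is uniform in [l], up to gamma itself. *)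
Lemma rect_lower (G : R[i] -> R[i]) (D : R[i]) (u v tY : R) :
  0 < u -> u <= v -> 0 <= tY <= pi -> chol G (ss tY) D -> D != 0 -> G (ss tY) = 0 ->
  (forall l t, u <= l <= v -> 0 <= t <= pi ->
     ucont G (zz l t) /\ (G (zz l t) = 0 -> zz l t = ss tY)) ->
  exists2 K : R, 0 < K & forall l t, u <= l <= v -> 0 <= t <= pi ->
    K * `|t - tY| <= cabs (G (zz l t)).
Proof.
move=> u0 uv hY [f [fE fq cf]] D0 Gq hG; set q := ss tY in fE fq cf Gq hG *.
rewrite Gq in fE.
have ucf l t : u <= l <= v -> 0 <= t <= pi -> ucont f (zz l t) /\ f (zz l t) != 0.
  move=> hl ht; have [hz hz0] := hG _ _ hl ht; set z := zz l t in hz hz0 *.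
  have [->|zq] := eqVneq z q; first by rewrite fq.
  have zq' : z - q != 0 by rewrite subr_eq0.
  have hq : ucont (fun y => G y / (y - q)) z.
    by apply: ucont_div => //; apply: ucontB; [exact: ucont_id|exact: ucont_cst].
  have fz : f z = G z / (z - q) by rewrite (fE z) add0r mulfK.
  split; last first.
    rewrite fz mulf_neq0 ?invr_eq0//; apply/eqP => /hz0 e; by rewrite e eqxx in zq.
  move=> T F FF g gz; rewrite fz; apply: ccvg_near (hq _ _ _ _ gz).
  have := ccvg_neq0 _ _ zq' (ccvgB _ _ _ _ gz (ccvg_cst q)).
  move=> /(_ FF FF FF).
  by apply: filterS => x /= xp; rewrite (fE (g x)) add0r mulfK.
have [m m0 hm] : exists2 m : R, 0 < m & forall l t, u <= l <= v -> 0 <= t <= pi -> m <= cabs (f (zz l t)).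
  apply: (rect_min _ _ _ _ (fun y : R * R => cabs (f (zz y.1 y.2)))) => //; first exact: ltW.
  move=> l t hl ht; have [h1 h2] := ucf _ _ hl ht; split; last by rewrite cabs_gt0.
  exact: (ccvg_cabs _ _ (cvg_zz_comp _ th1 f l t ht h1)).
have [r0 r00 hr] := rr_min _ th1.
pose r1 := Num.min (u * r0) r0.
have r10 : 0 < r1 by rewrite lt_min mulr_gt0.
exists (m * (r1 / pi)); first by rewrite mulr_gt0 ?divr_gt0.
move=> l t hl ht; have /andP[ul lv] := hl; have l0 : 0 <= l by rewrite ltW// (lt_le_trans u0).
rewrite fE add0r cabsM -mulrA; apply: ler_pM; [exact: ltW|by rewrite mulr_ge0 ?divr_ge0 ?(ltW r10) ?(ltW p0)|exact: hm|].
have := @cabs_ssB _ _ th1 l 1 r1 t tY ht hY l0 ler01.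
rewrite !mul1r => h; rewrite mulrAC -mulrA; apply: h.
  apply: (@le_trans _ _ (u * r0)); first by rewrite /r1 ge_min lexx.
  by apply: ler_pM; rewrite ?hr// ltW.
by apply: (@le_trans _ _ r0); [rewrite /r1 ge_min lexx orbT|exact: hr].
Qed.

Lemma ss_neq_a t : 0 < t <= pi -> ss t - a%:C != 0.
Proof.
move=> /andP[t0 tp]; rewrite subr_eq0; apply/eqP => e.
have := congr1 (@complex.Im R) e; rewrite ImC => e1.
move: tp; rewrite le_eqVlt => /predU1P[tp|tp].
  move: e; rewrite tp ss_pi// => /(congr1 (@complex.Re R)) /=; move: a0; lra.
by have := Im_ss_gt0 _ th1 t; rewrite t0 tp e1 ltxx => /(_ isT).
Qed.

Section AtY.
Context (tY : R) (tYI : 0 < tY < pi).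
Let Y := yy tY.
Let Yt := (Y `^ theta)%:C : R[i].
Let tYI' : 0 <= tY <= pi. Proof. by have /andP[h1 h2] := tYI; rewrite !ltW. Qed.

Lemma Y_gt0 : 0 < Y.
Proof. by apply: yy_gt0 => //; have /andP[h1 h2] := tYI; rewrite ltW. Qed.

Lemma Y_lt : Y < bb.
Proof.
by have /andP[h1 h2] := tYI; rewrite -(yy0 _ c th1); apply: yy_decr => //; exact: ltW.
Qed.

Lemma ss_n1 t : 0 <= t < pi -> ss t + 1 != 0.
Proof.
move=> ht; have := slit_Re_neq _ (slit_ss _ th1 _ ht).
by apply: contraNneq => ->; rewrite mul0r.
Qed.

Lemma J_lower : exists2 K : R, 0 < K & forall l t, 1 <= l <= 2 -> 0 <= t <= pi ->
  K * `|t - tY| <= cabs (J (zz l t) - Y%:C).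
Proof.
have /andP[h1 h2] := tYI; have ht : 0 <= tY < pi by rewrite ltW.
have q0 : ss tY != 0 by exact: ss_neq0.
have sq := slit_ss _ th1 _ ht.
have cJ : chol (fun z => J z - Y%:C) (ss tY) (Jd (ss tY) - 0).
  by apply: cholB; [exact: chol_J|exact: chol_cst].
apply: (rect_lower _ _ 1 2 tY ltr01 _ tYI' cJ).
- by rewrite ler1n.
- rewrite subr0 /Jd !mulf_neq0 ?invr_eq0//; last by rewrite ss_neq_a// h1 ltW.
    by rewrite C_eq0 gt_eqF.
  have q1 := slit_Re_neq _ sq.
  by rewrite -cabs_gt0 cabs_cpow// powR_gt0// cabs_gt0.
- by rewrite J_ss// subrr.
- move=> l t /andP[l1 l2] hT; have l0 : 0 < l := lt_le_trans ltr01 l1; split.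
    apply: ucontB; last exact: ucont_cst.
    by apply: ucont_J => //; [exact: zz_neq0|exact: slit_q1].
  move: l1; rewrite le_eqVlt => /predU1P[<-|l1 e].
    rewrite zz1 J_ss// => /eqP; rewrite subr_eq0 => /eqP e; congr (ss _).
    by apply: (yy_inj _ _ th1 c0) => //; have [] := e.
  by have := J_neqY _ _ th1 c0 Y Y_gt0 Y_lt l t l1 hT; rewrite e eqxx.
Qed.

Lemma TT_lower : exists2 K : R, 0 < K & forall l t, 1/2 <= l <= 1 -> 0 <= t <= pi ->
  K * `|t - tY| <= cabs (TT (zz l t) - zz l t * Yt).
Proof.
have /andP[h1 h2] := tYI; have ht : 0 <= tY < pi by rewrite ltW.
have q1 : 1 + ss tY != 0 by rewrite addrC ss_n1.
have s1 : slit (1 + ss tY) by have := slit_1 _ th1 1 tY ltr01 tYI'; rewrite zz1; apply => e; move: h2; rewrite e ltxx.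
have cz : chol (fun z => z * Yt) (ss tY) (1 * Yt + ss tY * 0).
  by apply: cholM; [exact: chol_id|exact: chol_cst].
have cT := cholB _ _ _ _ _ (chol_TT theta c _ s1) cz.
have Yt0 : Yt != 0 by rewrite C_eq0 gt_eqF// powR_gt0// Y_gt0.
have h12 : (0 : R) < 1 / 2 by lra.
have h121 : (1 : R) / 2 <= 1 by lra.
apply: (rect_lower _ _ _ 1 tY h12 h121 tYI' cT).
- rewrite mul1r mulr0 addr0 /TTd TT_ss// -/Y -/Yt.
  (* The derivative vanishes only at [1/theta], the critical point of [J], which is excluded by
     [tY > 0]; so the zero is simple. *)
  have -> : (theta + 1)%:C * (ss tY * Yt) / (1 + ss tY) - Yt = theta%:C * Yt * (ss tY - a%:C) / (1 + ss tY).
    have ta : theta%:C * a%:C = 1 :> R[i] by rewrite -CM mulfV ?gt_eqF.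
    have -> : theta%:C * Yt * (ss tY - a%:C) = theta%:C * Yt * ss tY - Yt.
      by rewrite mulrBr -[_ * _ * a%:C]mulrAC ta mul1r.
    rewrite CD; move: Yt (theta%:C) (ss tY) q1 => y th s s10; by field.
  rewrite !mulf_neq0 ?invr_eq0//; first by rewrite C_eq0 gt_eqF.
  by rewrite ss_neq_a// h1 ltW.
- by rewrite TT_ss// subrr.
- move=> l t /andP[l1 l2] hT; have l0 : 0 < l by exact: lt_le_trans l1.
  split.
    apply: ucontB; first by apply: ucont_TT => //; exact: slit_11.
    by apply: ucontM; [exact: ucont_id|exact: ucont_cst].
  move: l2; rewrite le_eqVlt => /predU1P[->|l2 e].
    rewrite zz1 TT_ss// -mulrBr => /eqP; rewrite mulf_eq0 (negPf (ss_neq0 _ th1 _ hT))/=.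
    rewrite subr_eq0 => /eqP e; congr (ss _).
    apply: (yy_inj _ _ th1 c0) => //; have [e1] := e.
    have /andP[yt0 _] := yy_range _ _ th1 c0 _ hT.
    have := congr1 (fun x => x `^ theta^-1) e1.
    by rewrite -!powRrM mulfV ?lt0r_neq0// (powRr1 yt0) (powRr1 (ltW Y_gt0)).
  by have [_ _] := in_facts _ _ th1 c0 Y Y_gt0 Y_lt l t l0 l2 hT; rewrite e eqxx.
Qed.

Section WithKernel.
Context (lp tp : R) (lp1 : 1 < lp) (tpI : 0 < tp < pi).
Let p := zz lp tp.
Let w : R[i] := p * (p + 1) / (p - a%:C).
Local Notation fd := (fd theta lp tp).
Local Notation Fo := (Fo theta c Y).
Local Notation Fi := (Fi theta c Y).

(** At [z = zz l t] this is the [t]-derivative of [ff], the density against which the Euler-Lagrange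
    equation is tested. *)
Definition Gk z t : R[i] := fd z * z * om t.
Definition LL t x : R := ln `|yy t - x| + ln `|yy t `^ theta - x `^ theta|.

Lemma fd_bound (v : R) : 1/2 <= v < lp -> exists2 M : R, 0 <= M &
  forall l t, 1/2 <= l <= v -> 0 <= t <= pi -> cabs (Gk (zz l t) t) <= M.
Proof.
move=> /andP[hv vlp].
suff h : forall l t, 1/2 <= l <= v -> 0 <= t <= pi ->
    {for (l, t), continuous (fun y : R * R => cabs (Gk (zz y.1 y.2) y.2))}.
  have [M M0 hM] := rect_bound (1/2) v 0 pi _ hv (ltW p0) h.
  by exists M => // l t hl ht; have := hM l t hl ht; rewrite /= ger0_norm ?cabs_ge0.
move=> l t /andP[hl1 hl2] ht; have l0 : 0 < l by apply: lt_le_trans hl1; lra.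
have lnp : l != lp by rewrite lt_eqF// (le_lt_trans hl2).
have ufd : ucont (fun z => fd z * z) (zz l t).
  apply: ucontM; last exact: ucont_id.
  by apply: ucont_fd; [apply: zz_neq_p => //; left|apply: zz_neq_pc => //; exact: ltW].
apply: (ccvg_cabs _ _ (ccvgM _ _ _ _ (cvg_zz_comp _ th1 _ l t ht ufd) (cvg_om2 _ th1 l t ht))).
Qed.

Lemma norm_ln_le (x y z : R) : 0 < x -> x <= y -> y <= z -> `|ln y| <= `|ln x| + `|ln z|.
Proof.
move=> x0 xy yz; have y0 : 0 < y := lt_le_trans x0 xy; have z0 : 0 < z := lt_le_trans y0 yz.
have h1 : ln x <= ln y by rewrite ler_ln ?posrE.
have h2 : ln y <= ln z by rewrite ler_ln ?posrE.
have := ler_norm (ln z); have := ler_norm (- ln x); rewrite normrN.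
have := normr_ge0 (ln z); have := normr_ge0 (ln x).
by rewrite ler_norml => ? ? ? ?; apply/andP; split; lra.
Qed.

Lemma clog_bound z (x y : R) : 0 < x -> x <= cabs z -> cabs z <= y ->
  cabs (clog z) <= `|ln x| + `|ln y| + pi.
Proof.
move=> x0 xz zy; have z0 : z != 0 by rewrite -cabs_gt0 (lt_le_trans x0).
apply: (le_trans (cabs_le _)) => /=; apply: lerD; first exact: norm_ln_le zy.
by have /andP[h1 h2] := Arg_bound _ z0; rewrite ler_norml h2 andbT ltW.
Qed.

(** The modulus under the logarithm lies between a multiple of [|t - tY|] and a constant, and the
    argument costs at most [pi]. The majorant does not depend on [l], as dominated convergence
    requires. *)
Lemma Fo_bound : exists2 C : R, 0 <= C & forall l t, 1 < l <= 2 -> 0 <= t <= pi -> t != tY ->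
  cabs (Fo (zz l t)) <= C + `|ln `|t - tY| |.
Proof.
have [K K0 hK] := J_lower; have [M M0 hM] := ccvg_rr_max _ th1.
have [r0 r00 hr] := rr_min _ th1.
have [B B0 hB] : exists2 B : R, 0 <= B & forall l t, 1 <= l <= 2 -> 0 <= t <= pi -> `|cabs (J (zz l t) - Y%:C)| <= B.
  apply: (rect_bound 1 2 0 pi (fun y : R * R => cabs (J (zz y.1 y.2) - Y%:C)) _ (ltW p0)); first by rewrite ler1n.
  move=> l t /andP[l1 l2] ht; have l0 : 0 < l := lt_le_trans ltr01 l1.
  have uJ : ucont (fun z => J z - Y%:C) (zz l t).
    apply: ucontB; last exact: ucont_cst.
    by apply: ucont_J => //; [exact: zz_neq0|exact: slit_q1].
  exact: (ccvg_cabs _ _ (cvg_zz_comp _ th1 _ l t ht uJ)).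
exists (`|ln (K / (2 * M))| + `|ln ((B + 1) / r0)| + pi); first by apply: addr_ge0; [exact: addr_ge0|exact: ltW].
move=> l t /andP[l1 l2] ht tn; have l0 : 0 < l := lt_trans ltr01 l1.
have hl : 1 <= l <= 2 by rewrite ltW.
have d0 : 0 < `|t - tY| by rewrite normr_gt0 subr_eq0.
have zb : r0 <= cabs (zz l t) <= 2 * M.
  rewrite cabs_zz//; apply/andP; split.
    by rewrite -[leLHS]mul1r; apply: ler_pM; rewrite ?ler01 ?hr// ltW.
  by apply: ler_pM; rewrite ?hM// ltW// rr_gt0.
have /andP[z1 z2] := zb; have z0 : 0 < cabs (zz l t) := lt_le_trans r00 z1.
apply: (le_trans (clog_bound _ (K / (2 * M) * `|t - tY|) ((B + 1) / r0) _ _ _)).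
- by rewrite mulr_gt0 ?divr_gt0 ?mulr_gt0.
- rewrite cabsM cabsV mulrAC; apply: ler_pM; rewrite ?hK ?mulr_ge0 ?invr_ge0 ?(ltW K0) ?mulr_ge0 ?(ltW M0)//.
  by rewrite lef_pV2 ?posrE ?mulr_gt0.
- rewrite cabsM cabsV; apply: ler_pM; rewrite ?cabs_ge0 ?invr_ge0 ?cabs_ge0//.
    have := hB _ _ hl ht; rewrite ger0_norm ?cabs_ge0//; lra.
  by rewrite lef_pV2 ?posrE.
have : `|ln (K / (2 * M) * `|t - tY|)| <= `|ln (K / (2 * M))| + `|ln `|t - tY| |.
  by rewrite lnM ?posrE ?divr_gt0 ?mulr_gt0// ler_normD.
move: (ln (_ * _)) (ln (K / _)) (ln `|_|) (ln (_ / r0)) => x1 x2 x3 x4; lra.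
Qed.

Lemma Fi_bound : exists2 C : R, 0 <= C & forall l t, 1/2 <= l < 1 -> 0 <= t <= pi -> t != tY ->
  cabs (Fi (zz l t)) <= C + `|ln `|t - tY| |.
Proof.
have [K K0 hK] := TT_lower.
have h121 : (1 : R) / 2 <= 1 by lra.
have [B B0 hB] : exists2 B : R, 0 <= B & forall l t, 1/2 <= l <= 1 -> 0 <= t <= pi -> `|cabs (TT (zz l t) - zz l t * Yt)| <= B.
  apply: (rect_bound _ 1 0 pi (fun y : R * R => cabs (TT (zz y.1 y.2) - zz y.1 y.2 * Yt)) h121 (ltW p0)).
  move=> l t /andP[l1 l2] ht; have l0 : 0 < l by apply: lt_le_trans l1; lra.
  have uT : ucont (fun z => TT z - z * Yt) (zz l t).
    apply: ucontB; first by apply: ucont_TT => //; exact: slit_11.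
    by apply: ucontM; [exact: ucont_id|exact: ucont_cst].
  exact: (ccvg_cabs _ _ (cvg_zz_comp _ th1 _ l t ht uT)).
exists (`|ln K| + `|ln (B + 1)| + pi); first by apply: addr_ge0; [exact: addr_ge0|exact: ltW].
move=> l t /andP[l1 l2] ht tn.
have hl : 1/2 <= l <= 1 by rewrite l1 ltW.
have d0 : 0 < `|t - tY| by rewrite normr_gt0 subr_eq0.
apply: (le_trans (clog_bound _ (K * `|t - tY|) (B + 1) _ _ _)).
- by rewrite mulr_gt0.
- exact: hK.
- have := hB _ _ hl ht; rewrite ger0_norm ?cabs_ge0//; lra.
have : `|ln (K * `|t - tY|)| <= `|ln K| + `|ln `|t - tY| | by rewrite lnM ?posrE// ler_normD.
move: (ln (_ * _)) (ln K) (ln `|_|) (ln (_ + 1)) => x1 x2 x3 x4; lra.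
Qed.

(* The two arguments cancel: [conj (s B)] is a positive multiple of [A / s]
   when [A] and [B] have the same sign. *)
Lemma clog_sum s (A B : R) : Im s != 0 -> 0 < A * B ->
  clog (A%:C / s) + clog (s * B%:C) = (ln `|A| + ln `|B|)%:C.
Proof.
move=> Is AB; have s0 : s != 0 by apply: slit_Re_neq; right.
have A0 : A != 0 by apply: contraTneq AB => ->; rewrite mul0r ltxx.
have B0 : B != 0 by apply: contraTneq AB => ->; rewrite mulr0 ltxx.
have cs0 : 0 < cabs s by rewrite cabs_gt0.
have w10 : A%:C / s != 0 by rewrite mulf_neq0 ?invr_eq0 ?C_eq0.
have e : cconj (s * B%:C) = (cabs s ^+ 2 * (B / A))%:C * (A%:C / s).
  rewrite cconjM cconjC CM CM CV.
  have -> : (cabs s ^+ 2)%:C = s * cconj s.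
    rewrite cabs_sqr; apply: complex_eq; rewrite ?(ReM, ImM, ReJ, ImJ, ReC, ImC); ring.
  by field; rewrite s0 C_eq0.
have x0 : 0 < cabs s ^+ 2 * (B / A).
  rewrite mulr_gt0 ?exprn_gt0//; have -> : B / A = A * B / A ^+ 2 by field.
  by rewrite divr_gt0// exprn_even_gt0.
have IB : Im (s * B%:C) != 0 by rewrite mulrC ImCM mulf_neq0.
have := congr1 (@Arg R) e; rewrite ArgJ// Arg_scale// => e2.
have RE z z' : Re (clog z + clog z') = ln (cabs z) + ln (cabs z') by [].
have IE z z' : Im (clog z + clog z') = Arg z + Arg z' by [].
apply: complex_eq; last by rewrite IE ImC -e2 addNr.
rewrite RE ReC !cabsM cabsV !cabsC !lnM ?posrE ?invr_gt0 ?normr_gt0 ?cabs_gt0// lnV ?posrE//; lra.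
Qed.

Lemma measurable_LL (D : set R) x : measurable D -> D `<=` `[0, pi]%classic ->
  measurable_fun D (fun t => LL t x).
Proof.
move=> mD Ds; have my : measurable_fun D yy.
  apply: measurable_funS Ds _ => //; apply: subspace_continuous_measurable_fun => //.
  by apply: within_cont => t ht; exact: continuous_yy.
apply: measurable_funD; apply: measurableT_comp; rewrite ?measurable_ln//;
   apply: measurableT_comp => //; apply: measurable_funB => //; try exact: measurable_cst.
by apply: measurableT_comp (measurable_powR theta) my.
Qed.

(** The dilates by [1 + e n] and [1 - e n] carry integrals whose sum does not depend on [n].
    Dominated convergence brings both onto gamma, where [clog_sum] reassembles the real kernel. *)
Lemma int_LL : mu.-integrable `[0, pi] (EFin \o (fun t => LL t Y * Re (Gk (ss t) t))) /\
  \int[mu]_(t in `[0, pi]) (LL t Y * Re (Gk (ss t) t)) =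
  - (2 * pi * Im (Ho theta c Y p * (w / p))).
Proof.
have Y0 := Y_gt0; have Yb := Y_lt.
(* The outer dilates must stay below the pole at [lp], the inner ones above [1/2], where the lower
   bound on [TT] holds. *)
pose dl := Num.min (1/2) ((lp - 1) / 2).
have dl0 : 0 < dl by rewrite lt_min; apply/andP; split; move: lp1; lra.
have dlh : dl <= 1/2 by rewrite /dl ge_min lexx.
have dlp : dl <= (lp - 1) / 2 by rewrite /dl ge_min lexx orbT.
pose e n : R := dl * n.+1%:R^-1.
have e0 n : 0 < e n by rewrite mulr_gt0 ?invr_gt0.
have e1 n : e n <= dl by rewrite ger_pMr// invf_le1// ler1n.
have ec : e @ \oo --> (0 : R).
  by rewrite -(mulr0 dl); apply: cvgM; [exact: cvg_cst|exact: cvg_harmonic].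
have vlp : 1/2 <= 1 + dl < lp by apply/andP; split; move: lp1; lra.
have [Cg Cg0 hCg] := fd_bound _ vlp.
have [C1 C10 hC1] := Fo_bound; have [C2 C20 hC2] := Fi_bound.
have lo n : [/\ 1 < 1 + e n, 1 + e n <= 2, 1 + e n <= 1 + dl & 1 + e n < lp].
  by have := e0 n; have := e1 n; split; move: lp1; lra.
have li n : [/\ 0 < 1 - e n, 1/2 <= 1 - e n, 1 - e n < 1 & 1 - e n <= 1 + dl].
  by have := e0 n; have := e1 n; split; lra.
pose f_ n t := Re (Fo (zz (1 + e n) t) * Gk (zz (1 + e n) t) t) +
               Re (Fi (zz (1 - e n) t) * Gk (zz (1 - e n) t) t).
pose g t := Cg * (C1 + C2) + 2 * Cg * `|ln `|t - tY| |.
have ucfd l t : 0 < l -> l < lp -> 0 <= t <= pi -> ucont fd (zz l t).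
  move=> l0 llp ht; apply: ucont_fd; first by apply: zz_neq_p => //; left; rewrite lt_eqF.
  by apply: zz_neq_pc => //; exact: ltW.
have intG F l : 0 < l -> l < lp -> (forall t, 0 <= t <= pi -> ucont F (zz l t)) ->
    mu.-integrable `[0, pi] (EFin \o (fun t => Re (F (zz l t) * Gk (zz l t) t))).
  move=> l0 llp hF; rewrite (_ : (fun t => _) = fun t => Re ((F (zz l t) * fd (zz l t) * zz l t) * om t)); last first.
    by apply/funext => t; rewrite /Gk; congr (Re _); ring.
  apply: (integrable_QQ _ th1 (fun z => F z * fd z * z)) => t ht.
  by apply: ucontM; [apply: ucontM; [exact: hF|exact: ucfd]|exact: ucont_id].
have iFo n : mu.-integrable `[0, pi] (EFin \o (fun t => Re (Fo (zz (1 + e n) t) * Gk (zz (1 + e n) t) t))).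
  have [h1 h2 h3 h4] := lo n; apply: intG => //; first exact: lt_trans h1.
  by move=> t ht; have [/chol_ucont] := Fo_chol _ _ th1 c0 Y Y0 Yb _ _ h1 ht.
have iFi n : mu.-integrable `[0, pi] (EFin \o (fun t => Re (Fi (zz (1 - e n) t) * Gk (zz (1 - e n) t) t))).
  have [h1 h2 h3 h4] := li n; apply: intG => //; first by move: lp1; lra.
  by move=> t ht; have [/chol_ucont] := Fi_chol _ _ th1 c0 Y Y0 Yb _ _ h1 h3 ht.
have int_f n : \int[mu]_(t in `[0, pi]) f_ n t = - (2 * pi * Im (Ho theta c Y p * (w / p))).
  have [h1 h2 h3 h4] := lo n; have [h1' h2' h3' h4'] := li n.
  rewrite /f_ RintegralD// /Gk (int_out _ _ th1 c0 Y Y0 Yb lp tp lp1 tpI) ?h1//.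
  by rewrite (int_in _ _ th1 c0 Y Y0 Yb lp tp lp1 tpI) ?h1'// addr0.
have cz l t (s : R) : 0 <= t <= pi -> (s * 0 + l = l)%R -> ccvg \oo (fun n => zz (l + s * e n) t) (zz l t).
  move=> ht _; apply: ccvgM; last exact: ccvg_cst.
  apply: ccvgC; rewrite -[X in _ --> X]addr0; apply: cvgD; first exact: cvg_cst.
  by rewrite -(mulr0 s); apply: cvgM; [exact: cvg_cst|exact: ec].
have czo t : 0 <= t <= pi -> ccvg \oo (fun n => zz (1 + e n) t) (ss t).
  move=> ht; have := cz 1 t 1 ht; rewrite mulr0 add0r zz1 => /(_ erefl).
  by under eq_fun do rewrite mul1r.
have czi t : 0 <= t <= pi -> ccvg \oo (fun n => zz (1 - e n) t) (ss t).
  move=> ht; have := cz 1 t (-1) ht; rewrite mulr0 add0r zz1 => /(_ erefl).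
  by under eq_fun do rewrite mulN1r.
(* [clog_sum] needs [Im s] nonzero, which excludes the two ends; at [tY] the kernel is singular. *)
pose N : set R := [set 0] `|` [set pi] `|` [set tY].
have mN : measurable N by apply: measurableU => //; apply: measurableU.
have N0 : mu N = 0%E by apply: countable_lebesgue_measure0; apply: finite_set_countable; rewrite !finite_setU; do !split; exact: finite_set1.
have ucG t : 0 <= t <= pi -> ccvg (nbhs t) (fun t => Gk (ss t) t) (Gk (ss t) t).
  move=> ht; apply: ccvgM; last exact: ccvg_om.
  apply: (ccvg_ss_comp _ th1 (fun z => fd z * z) t ht); apply: ucontM; last exact: ucont_id.
  by have := ucfd 1 t ltr01 lp1 ht; rewrite zz1.
have mG : measurable_fun `[0, pi] (fun t => Re (Gk (ss t) t)).
  apply: subspace_continuous_measurable_fun => //; apply: within_cont => t ht.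
  exact: ccvg_Re (ucG t ht).
have [i1 c1] : mu.-integrable `[0, pi] (EFin \o (fun t => LL t Y * Re (Gk (ss t) t))) /\
   (fun n => \int[mu]_(t in `[0, pi]) f_ n t) @ \oo --> \int[mu]_(t in `[0, pi]) (LL t Y * Re (Gk (ss t) t)).
  apply: (@Rdominated_cvg _ _ _ mu _ N f_ _ g) => //.
  - by move=> n; apply: measurable_funD; apply/measurable_EFinP; apply: measurable_int; [exact: iFo|exact: iFi].
  - by apply: measurable_funM => //; exact: measurable_LL.
  - move=> t; rewrite /= in_itv/= => ht /not_orP[/not_orP[/eqP t0 /eqP tpn] /eqP tn].
    have tI : 0 < t < pi by case: (t_cases _ ht) => [e'|e'|//]; [rewrite e' eqxx in t0|rewrite e' eqxx in tpn].
    have Is := Im_ss_gt0 _ th1 t tI; have s0 : ss t != 0 by exact: ss_neq0.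
    pose A := yy t - Y; pose B := yy t `^ theta - Y `^ theta.
    have yt0 : 0 < yy t by apply: yy_gt0 => //; have /andP[? ?] := tI; rewrite ltW.
    (* The power [theta] is increasing, so both differences have the same sign. *)
    have AB : 0 < A * B.
      have : yy t != Y by apply: contra tn => /eqP h; apply/eqP; exact: (yy_inj _ _ th1 c0).
      rewrite neq_lt => /orP[h|h].
        rewrite nmulr_rgt0 ?subr_lt0//; apply: gt0_ltr_powR => //; rewrite nnegrE ltW//.
      rewrite pmulr_rgt0 ?subr_gt0//; apply: gt0_ltr_powR => //; rewrite nnegrE ltW//.
    have A0 : A != 0 by apply: contraTneq AB => ->; rewrite mul0r ltxx.
    have B0 : B != 0 by apply: contraTneq AB => ->; rewrite mulr0 ltxx.
    have -> : LL t Y * Re (Gk (ss t) t) =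
      Re (clog (A%:C / ss t) * Gk (ss t) t) + Re (clog (ss t * B%:C) * Gk (ss t) t).
      by rewrite -ReD -mulrDl clog_sum ?gt_eqF// ReCM.
    have uG : ucont (fun z => fd z * z) (ss t).
      apply: ucontM; last exact: ucont_id.
      by have := ucfd 1 t ltr01 lp1 ht; rewrite zz1.
    have cG (h : nat -> R[i]) : ccvg \oo h (ss t) -> ccvg \oo (fun n => Gk (h n) t) (Gk (ss t) t).
      by move=> ch; apply: ccvgM (ccvg_cst _); exact: uG ch.
    have sl1 : slit (A%:C / ss t).
      right; rewrite ImCM ImV mulrN oppr_eq0 -cabs_sqr; apply: mulf_neq0 => //.
      by apply: mulf_neq0; [rewrite gt_eqF|rewrite invr_eq0 expf_eq0/= cabs_eq0].
    have sl2 : slit (ss t * B%:C) by right; rewrite mulrC ImCM mulf_neq0// gt_eqF.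
    have d1 : ccvg \oo (fun n => (J (zz (1 + e n) t) - Y%:C) / zz (1 + e n) t) (A%:C / ss t).
      have -> : A%:C / ss t = (J (ss t) - Y%:C) / ss t by rewrite J_ss// -CN -CD.
      apply: ccvgM; last by apply: ccvgV => //; exact: czo.
      apply: ccvgB; last exact: ccvg_cst.
      by apply: (ucont_J _ _ th1 _ s0) (czo t ht); exact: slit_ss1.
    have d2 : ccvg \oo (fun n => TT (zz (1 - e n) t) - zz (1 - e n) t * Yt) (ss t * B%:C).
      have -> : ss t * B%:C = TT (ss t) - ss t * Yt by rewrite TT_ss// -mulrBr -CN -CD.
      apply: ccvgB; last by apply: ccvgM; [exact: czi|exact: ccvg_cst].
      apply: (ucont_TT _ _ th1) (czi t ht).
      by have := slit_11 _ th1 1 t ltr01 (lexx _) ht; rewrite zz1.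
    apply: cvgD.
      exact: (ccvgM _ _ _ _ (ccvg_clog _ _ sl1 d1) (cG _ (czo t ht))).1.
    exact: (ccvgM _ _ _ _ (ccvg_clog _ _ sl2 d2) (cG _ (czi t ht))).1.
  - have -> : EFin \o g = (fun t => (Cg * (C1 + C2))%:E + (2 * Cg)%:E * (`|ln `|t - tY| |)%:E)%E.
      by apply/funext => t /=; rewrite /g EFinD EFinM.
    apply: integrableD => //; first by apply: (@integrable_itv _ (fun=> _)) => t _; exact: cvg_cst.
    by apply: integrableZl => //; exact: integrable_abse (integrable_ln_dist tY 0 pi).
  - move=> n t; rewrite /= in_itv/= => ht /not_orP[_ /eqP tn].
    have [h1 h2 h3 h4] := lo n; have [h1' h2' h3' h4'] := li n.
    have gg F l C : 1/2 <= l <= 1 + dl -> cabs (F (zz l t)) <= C + `|ln `|t - tY| | ->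
        `|Re (F (zz l t) * Gk (zz l t) t)| <= Cg * (C + `|ln `|t - tY| |).
      move=> hl hF; apply: (le_trans (normRe_le _)); rewrite cabsM mulrC.
      by apply: ler_pM; rewrite ?cabs_ge0// hCg.
    have b1 : `|Re (Fo (zz (1 + e n) t) * Gk (zz (1 + e n) t) t)| <= Cg * (C1 + `|ln `|t - tY| |).
      by apply: gg; [apply/andP; split => //; lra|apply: hC1 => //; rewrite h1].
    have b2 : `|Re (Fi (zz (1 - e n) t) * Gk (zz (1 - e n) t) t)| <= Cg * (C2 + `|ln `|t - tY| |).
      by apply: gg; [rewrite h2'|apply: hC2 => //; rewrite h2'].
    apply: (le_trans (ler_normD _ _)); apply: (le_trans (lerD b1 b2)).
    by rewrite /g le_eqVlt; apply/orP; left; apply/eqP; ring.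
split => //; rewrite -/p.
have ce : (fun n => \int[mu]_(t in `[0, pi]) f_ n t) @ \oo --> - (2 * pi * Im (Ho theta c Y p * (w / p))).
  by under eq_fun do rewrite int_f; exact: cvg_cst.
exact: (cvg_unique _ c1 ce).
Qed.

End WithKernel.
End AtY.
End LogKernel.

Section LogDerivative.
Context {R : realType}.

Lemma pder_ln_cabs (g : R -> R[i]) (t : R) (d : R[i]) : g t != 0 -> pder g t d ->
  is_derive t (1 : R) (fun u => ln (cabs (g u))) (Re (d / g t)).
Proof.
move=> g0 [h1 h2].
have s0 : 0 < Re (g t) * Re (g t) + Im (g t) * Im (g t).
  by rewrite -!expr2 -cabs_sqr exprn_gt0// cabs_gt0.
have h3 := rderM _ _ _ _ _ (rder_cst (2^-1) t)
  (rder_comp _ _ _ _ _ (rderD _ _ _ _ _ (rderM _ _ _ _ _ h1 h1) (rderM _ _ _ _ _ h2 h2))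
   (is_derive1_ln s0)).
have -> : (fun u => ln (cabs (g u))) =
    (fun u => 2^-1 * ln (Re (g u) * Re (g u) + Im (g u) * Im (g u))).
  apply/funext => u; rewrite -!expr2 -cabs_sqr.
  have := cabs_ge0 (g u); rewrite le_eqVlt => /predU1P[<-|h]; first by rewrite expr0n/= ln0// mulr0.
  by rewrite lnXn// mulr2n; field.
apply: rder_eq h3; rewrite [Re (d / _)]ReM ReV ImV; rewrite !expr2; move: (lt0r_neq0 s0).
by move: (Re (g t)) (Im (g t)) (Re d) (Im d) => x y u v hxy; field.
Qed.

End LogDerivative.

(** * Integration by parts against the potential *)

Section ByParts.
Context {R : realType} (theta c : R) (th1 : 1 < theta) (c0 : 0 < c).
Local Notation a := theta^-1.
Local Notation J := (Jc theta c).
Local Notation Jq := (Jq theta c).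
Local Notation Jd := (Jd theta c).
Local Notation ss := (ss theta).
Local Notation om := (om theta).
Local Notation zz := (zz theta).
Local Notation yy := (yy theta c).
Local Notation yd := (yd theta c).
Local Notation mu := (@lebesgue_measure R).
Implicit Types (t u l x : R) (s z : R[i]).

Let a0 : 0 < a := a_gt0 _ th1.
Let p0 : 0 < (pi : R) := pi_gt0 R.

(** The Green function of the upper half-plane with pole [p], restricted to the arc. *)
Definition Nk (p : R[i]) t : R := ln (cabs (ss t - cconj p)) - ln (cabs (ss t - p)).
Definition Nkd (p : R[i]) t : R :=
  Re (ss t * om t / (ss t - cconj p)) - Re (ss t * om t / (ss t - p)).
(** Equal to [- Im (1 / (p - 1/theta))]: up to a factor [pi], the Poisson kernel of the upper
    half-plane at the critical point. *)
Definition qk (p : R[i]) : R := Im p / cabs (p - a%:C) ^+ 2.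

Lemma Nk_end p : Nk p 0 = 0 /\ Nk p pi = 0.
Proof.
have h x : ln (cabs (x%:C - cconj p)) - ln (cabs (x%:C - p)) = 0.
  by rewrite -(cabsJ (_ - cconj p)) cconjD cconjN cconjK cconjC subrr.
have m1 : -1 = (-1)%:C :> R[i] by rewrite CN.
by rewrite /Nk ss0// ss_pi// m1 !h.
Qed.

Context (lp tp : R) (lp1 : 1 < lp) (tpI : 0 < tp < pi).
Let p := zz lp tp.
Local Notation ff := (ff theta lp tp).
Local Notation fd := (fd theta lp tp).
Local Notation Gk := (Gk theta lp tp).
Let q := qk p.

Let nz t : 0 <= t <= pi -> ss t - p != 0 /\ ss t - cconj p != 0.
Proof.
move=> ht; rewrite -zz1; split; first by apply: zz_neq_p => //; left; rewrite lt_eqF.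
by apply: zz_neq_pc => //; exact: ler01.
Qed.

Lemma is_derive_Nk t : 0 <= t <= pi -> is_derive t (1 : R) (Nk p) (Nkd p t).
Proof.
move=> ht; have [n1 n2] := nz t ht; have hs := pder_ss _ th1 _ ht.
have h z : pder (fun u => ss u - z) t (ss t * om t).
  by apply: pder_eqD (pderD _ _ _ _ _ hs (pder_cst (- z) t)); rewrite addr0.
by apply: rderB; exact: pder_ln_cabs.
Qed.

Lemma is_derive_Kk t : 0 <= t <= pi ->
  is_derive t (1 : R) (fun u => Re (ff (ss u))) (Re (Gk (ss t) t)).
Proof.
move=> ht; have [n1 n2] := nz t ht.
have [h _] := chol_path _ _ _ _ _ (chol_ff _ _ _ _ n1 n2) (pder_ss _ th1 _ ht).
by apply: rder_eq h; rewrite /Gk mulrA.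
Qed.

Lemma continuous_Gk t : 0 <= t <= pi -> {for t, continuous (fun t => Re (Gk (ss t) t))}.
Proof.
move=> ht; have [n1 n2] := nz t ht.
apply: (@ccvg_Re _ _ (fun t => Gk (ss t) t)); apply: ccvgM; last exact: ccvg_om.
apply: (ccvg_ss_comp _ th1 (fun z => fd z * z) t ht); apply: ucontM; last exact: ucont_id.
exact: ucont_fd.
Qed.

Lemma Kk_end : Re (ff (ss 0)) = 0 /\ Re (ff (ss pi)) = 0.
Proof.
have m1 : -1 = (-1)%:C :> R[i] by rewrite CN.
by rewrite ss0// ss_pi// m1 !ff_real.
Qed.

(** Put [W z = z (z + 1) / (z - a)] and [rho = y' / y]. Reality of [J] gives [s om = rho W(s)], and
    [w = W(p)]; so the left side divided by [y'] is the real part of [(W(p) - W(s)) / (s - p)] minus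
    the same quotient at [conj p]. The poles at [p] and [conj p] cancel and only [1 / (s - a)]
    remains, which [Im om = 1] evaluates. *)
Lemma Kk_Nk t : 0 < t < pi ->
  yd t * Re (ff (ss t)) + yy t * Nkd p t = 2 * a * q * yy t.
Proof.
move=> tI; have /andP[h1 h2] := tI; have ht : 0 <= t <= pi by rewrite !ltW.
have ht' : 0 <= t < pi by rewrite ltW.
have [n1 n2] := nz t ht; have s0 := ss_neq0 _ th1 t ht.
have s1 := ss_n1 _ th1 t ht'.
have sa : ss t - a%:C != 0 by apply: ss_neq_a => //; rewrite h1 ltW.
have ydE := yd_real _ c th1 t tI.
have y0 : 0 < yy t by exact: yy_gt0.
set s := ss t in n1 n2 s0 s1 sa ydE *.
pose rho := yd t / yy t.
have yE : yd t = rho * yy t by rewrite /rho divfK ?gt_eqF.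
have omE : om t = rho%:C * ((s + 1) / (s - a%:C)).
  have JE : J s = (yy t)%:C by exact: J_ss.
  have yc : (yy t)%:C != 0 :> R[i] by rewrite C_eq0 gt_eqF.
  have e1 : (yd t)%:C = (yy t)%:C * (s - a%:C) / (s + 1) * om t.
    rewrite -ydE -JE /Jd J_Jq; move: (Jq s) (om t) (a%:C) => j o A; by field; rewrite s0 s1.
  have e2 : rho%:C = (yd t)%:C / (yy t)%:C by rewrite /rho CM CV.
  rewrite e2 e1; move: (om t) (yy t)%:C (a%:C) yc sa => o y A yc sA; by field; rewrite s1 sA yc.
have Imp : 0 < Im p by apply: Im_zz_gt0 => //; exact: lt_trans ltr01 lp1.
have pa : p - a%:C != 0 by apply: slit_Re_neq; right; rewrite ImB ImC subr0 gt_eqF.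
have pca : cconj p - a%:C != 0 by apply: slit_Re_neq; right; rewrite ImB ImC subr0 ImJ oppr_eq0 gt_eqF.
pose W z := z * (z + 1) / (z - a%:C).
pose iq : R[i] := (p - cconj p) / ((p - a%:C) * (cconj p - a%:C)).
have iqE : iq = Complex 0 (2 * q).
  rewrite /iq /q /qk; have -> : p - cconj p = Complex 0 (2 * Im p).
    apply: complex_eq; rewrite ?ReB ?ImB ?ReJ ?ImJ /=; ring.
  have -> : (p - a%:C) * (cconj p - a%:C) = (cabs (p - a%:C) ^+ 2)%:C.
    by rewrite cabs_sqr; apply: complex_eq; rewrite ?(ReM, ImM, ReB, ImB, ReJ, ImJ, ReC, ImC); ring.
  rewrite -CV mulrC; apply: complex_eq; rewrite ?ReCM ?ImCM /=; ring.
have key : ff s + rho%:C^-1 * (s * om t / (s - cconj p) - s * om t / (s - p))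
    = - (a%:C * (1 + a%:C) * iq / (s - a%:C)) \/ rho = 0.
  have [->|r0] := eqVneq rho 0; first by right.
  have rc : rho%:C != 0 :> R[i] by rewrite C_eq0.
  have wc z : cconj (z * (z + 1) / (z - a%:C)) = cconj z * (cconj z + 1) / (cconj z - a%:C).
    rewrite !cconjM cconjV !cconjD cconjN cconjC; congr (_ * (_ + _) * _).
    by apply: complex_eq; rewrite ?ReJ ?ImJ /= ?oppr0.
  left; rewrite omE /ff -/p wc /iq.
  move: (cconj p) (p) (s) (a%:C) (rho%:C) n1 n2 sa pa pca rc => pc p' s' A r n1 n2 sa pa pca rc.
  by field; rewrite n1 n2 sa pa pca rc.
have r0 : rho != 0.
  apply: mulf_neq0; last by rewrite invr_eq0 gt_eqF.
  by rewrite lt_eqF// yd_lt0.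
have {}key : ff s + rho%:C^-1 * (s * om t / (s - cconj p) - s * om t / (s - p))
    = - (a%:C * (1 + a%:C) * iq / (s - a%:C)).
  by case: key => // e; rewrite e eqxx in r0.
have NE : Nkd p t = Re (s * om t / (s - cconj p) - s * om t / (s - p)) by rewrite ReB.
have I1 : 1 = rho * ((1 + a) * Im (s - a%:C)^-1).
  have IE : Im (om t) = 1 by [].
  rewrite -[LHS]IE omE [LHS]ImCM; congr (_ * _).
  have -> : (s + 1) / (s - a%:C) = 1 + (1 + a)%:C * (s - a%:C)^-1.
    by rewrite CD; move: sa; move: (a%:C) (s) => A s' sa; field.
  by rewrite [LHS]ImD [Im ((1 + a)%:C * _)]ImCM Im1 add0r.
have : Re (ff s) + rho^-1 * Nkd p t = 2 * a * q * ((1 + a) * Im (s - a%:C)^-1).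
  move: key NE; set D := s * om t / _ - _ => key NE.
  have := congr1 (@complex.Re R) key.
  rewrite [Re (ff s + _)]ReD -(CV rho) [Re ((rho^-1)%:C * D)]ReCM -NE => ->.
  rewrite iqE [LHS]ReN.
  have -> : a%:C * (1 + a%:C) * Complex 0 (2 * q) / (s - a%:C) =
     (a * (1 + a))%:C * (Complex 0 (2 * q) * (s - a%:C)^-1).
    rewrite CM CD; ring.
  by rewrite ReCM [Re (Complex _ _ * _)]ReM /=; ring.
move=> E; rewrite yE -mulrA [yy t * Re _]mulrC mulrA.
have -> : yy t * Nkd p t = rho * (rho^-1 * Nkd p t) * yy t by field.
rewrite -mulrDl -mulrDr E -[RHS]mulr1 [X in _ = _ * X]I1.
ring.
Qed.

Section Potential.
Context (V V1 V2 : R -> R) (cV : continuous V) (cV1 : continuous V1) (cV2 : continuous V2).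
Context (dV : forall x, 0 < x -> is_derive x (1 : R) V (V1 x)).
Context (dV1 : forall x, 0 < x -> is_derive x (1 : R) V1 (V2 x)).

Definition ZZ t : R := V1 (yy t) * yy t.
Definition ZZd t : R := (V2 (yy t) * yy t + V1 (yy t)) * yd t.

Lemma cont_yy_comp (f : R -> R) t : continuous f -> 0 <= t <= pi -> {for t, continuous (fun t => f (yy t))}.
Proof. by move=> cf ht; apply: continuous_comp; [exact: continuous_yy|exact: cf]. Qed.

Lemma continuous_ZZ t : 0 <= t <= pi -> {for t, continuous ZZ}.
Proof.
by move=> ht; apply: (@cvgM _ _ (nbhs t)); [exact: cont_yy_comp|exact: continuous_yy].
Qed.

Lemma continuous_ZZd t : 0 <= t <= pi -> {for t, continuous ZZd}.
Proof.
move=> ht; apply: (@cvgM _ _ (nbhs t)); last exact: continuous_yd.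
apply: cvgD; last exact: cont_yy_comp.
by apply: cvgM; [exact: cont_yy_comp|exact: continuous_yy].
Qed.

Lemma is_derive_ZZ t : 0 < t < pi -> is_derive t (1 : R) ZZ (ZZd t).
Proof.
move=> /andP[h1 h2]; have ht : 0 <= t < pi by rewrite ltW.
have y0 : 0 < yy t by exact: yy_gt0.
have dy := is_derive_yy _ c th1 t ht.
apply: rder_eq (rderM _ _ _ _ _ (rder_comp _ _ _ _ _ dy (dV1 _ y0)) dy).
by rewrite /ZZd; ring.
Qed.

Let oo t : 0 < t < pi -> 0 <= t <= pi. Proof. by move=> /andP[h1 h2]; rewrite !ltW. Qed.

(** By [Kk_Nk], the combined integrand is the derivative of [(V + l0) Re ff + V'(y) y Nk], which
    vanishes at both ends. The double pole of [Gk] is traded for the logarithmic singularity of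
    [Nk], which stays integrable when [p] reaches gamma. *)
Lemma int_V_Gk (l0 : R) :
  \int[mu]_(t in `[0, pi]) ((V (yy t) + l0) * Re (Gk (ss t) t)) =
  - (\int[mu]_(t in `[0, pi]) (ZZd t * Nk p t)) - 2 * a * q * \int[mu]_(t in `[0, pi]) ZZ t.
Proof.
have cNk t : 0 <= t <= pi -> {for t, continuous (Nk p)}.
  by move=> ht; exact: rder_cont (is_derive_Nk t ht).
have cKk t : 0 <= t <= pi -> {for t, continuous (fun t => Re (ff (ss t)))}.
  by move=> ht; exact: rder_cont (is_derive_Kk t ht).
have cVy t : 0 <= t <= pi -> {for t, continuous (fun t => V (yy t) + l0)}.
  by move=> ht; apply: cvgD; [exact: cont_yy_comp|exact: cvg_cst].
pose f t := (V (yy t) + l0) * Re (Gk (ss t) t) + (ZZd t * Nk p t + 2 * a * q * ZZ t).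
pose F t := (V (yy t) + l0) * Re (ff (ss t)) + ZZ t * Nk p t.
have c1 t : 0 <= t <= pi -> {for t, continuous f} /\ {for t, continuous F}.
  move=> ht; split.
    apply: (@cvgD _ _ _ (nbhs t)); first by apply: cvgM; [exact: cVy|exact: continuous_Gk].
    apply: cvgD; first by apply: cvgM; [exact: continuous_ZZd|exact: cNk].
    by apply: cvgM; [exact: cvg_cst|exact: continuous_ZZ].
  apply: (@cvgD _ _ _ (nbhs t)); first by apply: cvgM; [exact: cVy|exact: cKk].
  by apply: cvgM; [exact: continuous_ZZ|exact: cNk].
have d1 t : 0 < t < pi -> is_derive t (1 : R) F (f t).
  move=> tI; have /andP[h1 h2] := tI; have ht' : 0 <= t < pi by rewrite ltW.
  have y0 : 0 < yy t by exact: yy_gt0.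
  have dy := is_derive_yy _ c th1 t ht'.
  have dVy := rderD _ _ _ _ _ (rder_comp _ _ _ _ _ dy (dV _ y0)) (rder_cst l0 t).
  have h := rderD _ _ _ _ _ (rderM _ _ _ _ _ dVy (is_derive_Kk t (oo _ tI)))
    (rderM _ _ _ _ _ (is_derive_ZZ t tI) (is_derive_Nk t (oo _ tI))).
  apply: rder_eq h; rewrite /f /ZZ.
  have := Kk_Nk t tI; move: (Re (ff _)) (Nkd p t) (Nk p t) (Re (Gk _ _)) => K N' N G E.
  have -> : 2 * a * q * (V1 (yy t) * yy t) = V1 (yy t) * (yd t * K + yy t * N') by rewrite E; ring.
  ring.
have := FTC_itv F f 0 pi p0 c1 d1.
have [e1 e2] := Kk_end; have [e3 e4] := Nk_end p.
rewrite /F e1 e2 e3 e4 !mulr0 addr0 subr0.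
have iG : mu.-integrable `[0, pi] (EFin \o (fun t => (V (yy t) + l0) * Re (Gk (ss t) t))).
  apply: integrable_itv => t ht; apply: (@cvgM _ _ (nbhs t)); [exact: cVy|exact: continuous_Gk].
have iZN : mu.-integrable `[0, pi] (EFin \o (fun t => ZZd t * Nk p t)).
  by apply: integrable_itv => t ht; apply: (@cvgM _ _ (nbhs t)); [exact: continuous_ZZd|exact: cNk].
have iZ : mu.-integrable `[0, pi] (EFin \o ZZ) by apply: integrable_itv => t; exact: continuous_ZZ.
have iZ2 : mu.-integrable `[0, pi] (EFin \o (fun t => 2 * a * q * ZZ t)).
  by apply: integrable_itv => t ht; apply: (@cvgM _ _ (nbhs t)); [exact: cvg_cst|exact: continuous_ZZ].
have iS : mu.-integrable `[0, pi] (EFin \o (fun t => ZZd t * Nk p t + 2 * a * q * ZZ t)).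
  apply: integrable_itv => t ht; apply: (@cvgD _ _ _ (nbhs t)).
    by apply: cvgM; [exact: continuous_ZZd|exact: cNk].
  by apply: cvgM; [exact: cvg_cst|exact: continuous_ZZ].
rewrite /f RintegralD// RintegralD// RintegralZl//.
move: (Rintegral _ _ _) (Rintegral _ _ _) (Rintegral _ _ _) => x1 x2 x3; lra.
Qed.

End Potential.
End ByParts.

(* [R] and [measurableTypeR R] carry the same sigma-algebra under two displays;
   this identity transports measures from the first to the second. *)
Definition real_id {R : realType} : R -> measurableTypeR R := idfun.

Lemma measurable_real_id {R : realType} : measurable_fun setT (@real_id R).
Proof. by move=> _ A mA; rewrite setTI. Qed.

HB.instance Definition _ (R : realType) :=
  @isMeasurableFun.Build _ _ _ _ (@real_id R) measurable_real_id.

(** * The equilibrium measure *)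

Section Density.
Context {R : realType} (m : probability R R) (b : R) (psi : R -> R) (b0 : 0 < b).
Local Notation mu := (@lebesgue_measure R).
Local Notation I0b := (`](0 : R), b[%classic).
Context (cpsi : {within `]0, b[, continuous psi}).
Context (dens : forall A : set R, measurable A -> m A = (\int[mu]_(y in A `&` I0b) (psi y)%:E)%E).
Implicit Types (x y u v : R).

Lemma psi_cont x : 0 < x < b -> {for x, continuous psi}.
Proof.
move=> hx; have := cpsi; rewrite continuous_open_subspace; last exact: interval_open.
by apply; rewrite inE/= in_itv.
Qed.

Lemma measurable_psi : measurable_fun I0b psi.
Proof. exact: subspace_continuous_measurable_fun. Qed.

Lemma m_null A : measurable A -> mu A = 0%E -> m A = 0%E.
Proof.
move=> mA A0; rewrite dens//; apply: null_set_integral; first exact: measurableI.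
  by apply/measurable_EFinP; apply: measurable_funS measurable_psi => //; exact: subIsetr.
apply/eqP; rewrite eq_le measure_ge0 andbT -A0; apply: le_measure; rewrite ?inE//; exact: measurableI.
Qed.

Lemma m_out : m (~` I0b) = 0%E.
Proof. by rewrite dens ?setICl ?integral_set0//; exact: measurableC. Qed.

Lemma m_ae_in (P : R -> Prop) : (forall x, 0 < x < b -> P x) -> \forall x \ae m, P x.
Proof.
move=> h; exists (~` I0b); split; [exact: measurableC|exact: m_out|].
move=> x /=; apply: contra_not; rewrite /= in_itv/=; exact: h.
Qed.

Let sub_I u v : 0 < u -> v < b -> `[u, v]%classic `<=` I0b.
Proof. by move=> u0 vb; apply: subset_itv; rewrite bnd_simp. Qed.

Lemma integrable_psi u v : 0 < u -> v < b -> mu.-integrable `[u, v] (EFin \o psi).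
Proof.
move=> u0 vb; apply: integrable_itv => t /andP[h1 h2]; apply: psi_cont.
by rewrite (lt_le_trans u0)//= (le_lt_trans h2).
Qed.

Lemma m_itv u v : 0 < u -> v < b -> m `[u, v]%classic = (\int[mu]_(y in `[u, v]) psi y)%:E.
Proof.
move=> u0 vb; rewrite dens// (setIidl (sub_I _ _ u0 vb)) fineK//.
exact: integrable_fin_num (integrable_psi u v u0 vb).
Qed.

Lemma psi_ge0 x : 0 < x < b -> 0 <= psi x.
Proof.
move=> hx; rewrite leNgt; apply/negP => p0; have /andP[x0 xb] := hx.
have n0 : 0 < - psi x / 2 by lra.
have /cvgrPdist_le/(_ _ n0)[e /= e0 he] := psi_cont x hx.
pose d := Num.min (e / 2) (Num.min (x / 2) ((b - x) / 2)).
have d0 : 0 < d by rewrite !lt_min; apply/and3P; split; lra.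
have d1 : d <= e / 2 by rewrite /d ge_min lexx.
have d2 : d <= x / 2 by rewrite /d !ge_min lexx orbT.
have d3 : d <= (b - x) / 2 by rewrite /d !ge_min lexx !orbT.
have u0 : 0 < x - d by lra.
have vb : x + d < b by lra.
have : (0 <= m `[(x - d)%R, (x + d)%R]%classic)%E by exact: measure_ge0.
rewrite m_itv// lee_fin leNgt => /negP; apply.
apply: (@le_lt_trans _ _ (\int[mu]_(y in `[x - d, x + d]) (psi x / 2))); last first.
  rewrite Rintegral_cst//= lebesgue_measure_itv/= lte_fin ifT; last by lra.
  rewrite -EFinB/=; nra.
apply: le_Rintegral => //; first exact: integrable_psi.
  by apply: integrable_itv => t _; exact: cvg_cst.
move=> y; rewrite /= in_itv/= => /andP[y1 y2].
have := he y; rewrite /ball_/= => h.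
have : `|x - y| < e by rewrite ltr_norml; apply/andP; split; lra.
by move=> /h; rewrite ler_norml => /andP[h1 h2]; lra.
Qed.

Lemma m_itv_ge u v x : 0 < u -> u <= v -> v < b -> (forall y, u <= y <= v -> x <= psi y) ->
  ((x * (v - u))%:E <= m `[u, v]%classic)%E.
Proof.
move=> u0 uv vb h; rewrite m_itv// lee_fin.
have -> : x * (v - u) = \int[mu]_(y in `[u, v]) x.
  rewrite Rintegral_cst//= lebesgue_measure_itv/= lte_fin; case: ltP => [//|vu].
  have -> : v = u by lra.
  by rewrite subrr !mulr0.
apply: le_Rintegral => //; first by apply: integrable_itv => t _; exact: cvg_cst.
  exact: integrable_psi.
Qed.

Let nu : probability (measurableTypeR R) R := distribution m (real_id : {mfun R >-> measurableTypeR R}).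

Let nu_dom : nu `<< mu.
Proof. by apply/null_content_dominatesP => A mA A0; exact: (m_null A). Qed.

(** The Radon-Nikodym derivative and [psi] have the same integral over every measurable part of
    [[u, v]], hence agree almost everywhere there. *)
Lemma m_int u v (f : R -> R) : 0 < u -> v < b -> measurable_fun setT f ->
  m.-integrable `[u, v] (EFin \o f) ->
  \int[m]_(y in `[u, v]) f y = \int[mu]_(y in `[u, v]) (f y * psi y).
Proof.
move=> u0 vb mf iF; rewrite /Rintegral; congr fine.
have mid : measurable_fun setT (real_id : R -> measurableTypeR R) by [].
have mfE : measurable_fun setT (EFin \o f : measurableTypeR R -> \bar R) by exact/measurable_EFinP.
have inu : nu.-integrable `[u, v] (EFin \o f) by exact: (integrable_pushforward mid).
transitivity (\int[nu]_(y in `[u, v]) (f y)%:E)%E.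
  by rewrite (@integral_pushforward _ _ _ _ _ _ mid m `[u, v]%classic _ mfE).
rewrite -(Radon_Nikodym_change_of_variables nu_dom)//=.
have mp : measurable_fun `[u, v] (EFin \o psi) by exact: measurable_int (integrable_psi u v u0 vb).
under [RHS]eq_integral do rewrite EFinM.
apply: ae_eq_integral => //.
- apply: emeasurable_funM => //; first exact: measurable_int inu.
  apply: (measurable_int mu); apply: (integrableS _ _ (@subsetT _ _)) => //=.
  by apply: Radon_Nikodym_integrable; exact: nu_dom.
- by apply: emeasurable_funM => //; exact: measurable_int inu.
- apply: ae_eqe_mul2l; apply: integral_ae_eq => //.
  + apply: (integrableS _ _ (@subsetT _ _)) => //=.
    by apply: Radon_Nikodym_integrable; exact: nu_dom.
  + move=> E Euv mE; transitivity (nu E).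
      by apply/esym; apply: (@Radon_Nikodym_integral _ _ _ (charge_of_finite_measure nu)) => //; exact: nu_dom.
    rewrite [LHS](dens E mE); congr (integral _ _ _).
    by apply: setIidl; exact: subset_trans Euv (sub_I _ _ u0 vb).
Qed.

End Density.

(** * The Poisson kernel as an approximate identity *)

Section Poisson.
Context {R : realType} (m : probability R R) (b : R) (psi : R -> R) (b0 : 0 < b).
Local Notation mu := (@lebesgue_measure R).
Local Notation I0b := (`](0 : R), b[%classic).
Context (cpsi : {within `]0, b[, continuous psi}).
Context (dens : forall A : set R, measurable A -> m A = (\int[mu]_(y in A `&` I0b) (psi y)%:E)%E).
Implicit Types (x y u v e : R).

Definition poisson x e y : R := e / ((x - y) ^+ 2 + e ^+ 2).

Lemma poisson_ge0 x e y : 0 < e -> 0 <= poisson x e y.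
Proof. by move=> e0; rewrite divr_ge0 ?addr_ge0 ?sqr_ge0// ltW. Qed.

Let den x e y : 0 < e -> 0 < (x - y) ^+ 2 + e ^+ 2.
Proof. by move=> e0; rewrite ltr_wpDl ?sqr_ge0// exprn_gt0. Qed.

Lemma poisson_cont x e y : 0 < e -> {for y, continuous (poisson x e)}.
Proof.
move=> e0; apply: (@cvgM _ _ (nbhs y)); first exact: cvg_cst.
apply: cvgV; first by rewrite gt_eqF// den.
apply: cvgD; last exact: cvg_cst.
rewrite expr2; under eq_fun do rewrite expr2.
by apply: cvgM; apply: cvgB; first [exact: cvg_cst|exact: cvg_id].
Qed.

Lemma int_poisson x e u v : 0 < e -> u < v ->
  \int[mu]_(y in `[u, v]) poisson x e y = atan ((v - x) / e) - atan ((u - x) / e).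
Proof.
move=> e0 uv; have d y : is_derive y (1 : R) (fun y => atan ((y - x) / e)) (poisson x e y).
  have h := rderM _ _ _ _ _ (rderB _ _ _ _ _ (rder_id y) (rder_cst x y)) (rder_cst e^-1 y).
  apply: rder_eq (rder_comp _ _ _ _ _ h (is_derive1_atan _)).
  have := den x e y e0 => d0; rewrite /poisson; field.
  by rewrite (gt_eqF d0) (gt_eqF e0).
apply: (FTC_itv (fun y => atan ((y - x) / e))) => // y _; split; first exact: poisson_cont.
exact: rder_cont (d y).
Qed.

Lemma measurable_poisson x e (D : set R) : 0 < e -> measurable_fun D (poisson x e).
Proof.
move=> e0; apply: measurable_funTS; apply: continuous_measurable_fun => y; exact: poisson_cont.
Qed.

Lemma m_cst (r : R) : (\int[m]_y r%:E = r%:E)%E.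
Proof.
rewrite integral_cst//; transitivity (r%:E * 1)%E; last exact: mule1.
by congr (_ * _)%E; exact: probability_setT.
Qed.

Lemma integrable_poisson x e : 0 < e -> m.-integrable setT (EFin \o (fun y => y * poisson x e y)).
Proof.
move=> e0.
have mh : measurable_fun setT (EFin \o (fun y => y * poisson x e y)).
  by apply/measurable_EFinP; apply: measurable_funM => //; exact: measurable_poisson.
apply/integrableP; split => //.
apply: (@le_lt_trans _ _ (\int[m]_y (b / e)%:E)%E); last by rewrite m_cst ltry.
apply: ae_ge0_le_integral => //; first by apply: measurableT_comp.
  by move=> y _; rewrite lee_fin divr_ge0// ltW.
apply: (m_ae_in m b psi dens) => y /andP[y0 yb] _; rewrite /= lee_fin normrM.
apply: ler_pM => //; first by rewrite gtr0_norm// ltW.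
rewrite ger0_norm ?poisson_ge0// ler_pdivrMr ?den// -ler_pdivrMl ?invr_gt0// invrK.
by rewrite -expr2 lerDr sqr_ge0.
Qed.

Ltac lra_goal := clear - m b psi b0 cpsi dens den; lra.

(** Near [x] continuity of [y psi y] applies and the kernel has mass tending to [pi]. Away from [x]
    nothing is assumed on [psi]: there the total mass of [m], the bound [y <= b] and the uniform
    decay of the kernel suffice. The centre may move with [n]. *)
Lemma poisson_limit x (x_ e_ : nat -> R) : 0 < x < b ->
  x_ @ \oo --> x -> e_ @ \oo --> (0 : R) -> (forall n, 0 < e_ n) ->
  (fun n => \int[m]_y (y * poisson (x_ n) (e_ n) y)) @ \oo --> pi * (x * psi x).
Proof.
move=> hx cx ce e0; have /andP[x0 xb] := hx.
have px0 := psi_ge0 m b psi cpsi dens x hx.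
have h0 : 0 <= x * psi x by rewrite mulr_ge0// ltW.
have p0 : 0 < (pi : R) := pi_gt0 R.
have int_h n (D : set R) : measurable D -> m.-integrable D (EFin \o (fun y => y * poisson (x_ n) (e_ n) y)).
  by move=> mD; apply: (@integrableS _ _ _ m setT) => //; exact: integrable_poisson.
apply/cvgrPdist_le => eps eps0.
(* The kernel has mass at most [pi], so this tolerance costs [eps / 4]; the mass defect and the far
   part get [eps / 4] each. *)
pose eta := eps / (4 * pi).
have eta0 : 0 < eta by rewrite divr_gt0// mulr_gt0.
have cont_h : {for x, continuous (fun y => y * psi y)}.
  by apply: (@cvgM _ _ (nbhs x)); [exact: cvg_id|exact: (psi_cont b psi cpsi)].
have /cvgrPdist_le/(_ _ eta0)[d' /= d'0 hd'] := cont_h.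
pose d := Num.min (d' / 2) (Num.min (x / 2) ((b - x) / 2)).
have d0 : 0 < d by rewrite !lt_min; apply/and3P; split; lra.
have d1 : d <= d' / 2 by rewrite /d ge_min lexx.
have d2 : d <= x / 2 by rewrite /d !ge_min lexx orbT.
have d3 : d <= (b - x) / 2 by rewrite /d !ge_min lexx !orbT.
pose u := x - d; pose v := x + d.
have u0 : 0 < u by rewrite /u; lra.
have vb : v < b by rewrite /v; lra.
have uv : u < v by rewrite /u /v; lra.
have cat (s : R) (w_ : nat -> R) : 0 < s -> w_ @ \oo --> s -> (fun n => atan (w_ n / e_ n)) @ \oo --> pi / 2.
  move=> s0 cw; apply: (cvg_comp _ _ _ (@cvgy_atan R)).
  apply/cvgryPge => A; near=> n.
  have en : 0 < e_ n by [].
  have wn : s / 2 <= w_ n by near: n; apply: (cvgr_ge _ cw); lra.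
  rewrite ler_pdivlMr//; apply: le_trans wn.
  apply: (@le_trans _ _ ((`|A| + 1) * e_ n)).
    by rewrite ler_pM2r//; have := ler_norm A; lra_goal.
  have A0 : 0 < `|A| + 1 by rewrite ltr_wpDl.
  rewrite -ler_pdivlMl//; near: n; apply: (cvgr_le _ ce).
  by rewrite mulr_gt0 ?invr_gt0//; lra.
have cm : (fun n => \int[mu]_(y in `[u, v]) poisson (x_ n) (e_ n) y) @ \oo --> (pi : R).
  under eq_fun do rewrite int_poisson//.
  have -> : (pi : R) = pi / 2 - (- (pi / 2)) by lra.
  apply: cvgB.
    apply: (cat d) => //; rewrite (_ : d = v - x); last by rewrite /v; ring.
    by apply: cvgB => //; exact: cvg_cst.
  have h : (fun n => - atan ((x_ n - u) / e_ n)) @ \oo --> - (pi / 2).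
    apply: cvgN; apply: (cat d) => //; rewrite (_ : d = x - u); last by rewrite /u; ring.
    by apply: cvgB => //; exact: cvg_cst.
  by apply: cvg_trans h; apply: near_eq_cvg; apply: nearW => n; rewrite -atanN -mulNr opprB.
have hp : 0 < x * psi x + 1 by lra.
have hcm : \forall n \near \oo, `|pi - \int[mu]_(y in `[u, v]) poisson (x_ n) (e_ n) y| <= (x * psi x + 1)^-1 * (eps / 4).
  by move/cvgrPdist_le: cm; apply; rewrite mulr_gt0 ?invr_gt0//; lra.
near=> n.
have en : 0 < e_ n by [].
have xn : `|x - x_ n| <= d / 2 by near: n; move/cvgrPdist_le: cx; apply; lra.
pose h y := y * poisson (x_ n) (e_ n) y.
pose M := \int[mu]_(y in `[u, v]) poisson (x_ n) (e_ n) y.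
have mC : measurable (~` `[u, v]%classic : set R) by exact: measurableC.
have splitE : \int[m]_y h y = \int[m]_(y in `[u, v]) h y + \int[m]_(y in ~` `[u, v]) h y.
  rewrite -Rintegral_setU ?setUv//; [exact: int_h|by rewrite disj_set2E setICr].
have ip : mu.-integrable `[u, v] (EFin \o poisson (x_ n) (e_ n)).
  by apply: integrable_itv => t _; exact: poisson_cont.
have M0 : 0 <= M by apply: Rintegral_ge0 => // y _; exact: poisson_ge0.
have Mp : M <= pi.
  rewrite /M int_poisson//; have := atan_ltpi2 ((v - x_ n) / e_ n).
  by have := atan_gtNpi2 ((u - x_ n) / e_ n); lra_goal.
have inI y : `[u, v]%classic y -> u <= y <= v by rewrite /= in_itv.
have chy y : u <= y <= v -> {for y, continuous (fun y => y * psi y * poisson (x_ n) (e_ n) y)}.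
  move=> /andP[y1 y2]; apply: (@cvgM _ _ (nbhs y)); last exact: poisson_cont.
  apply: cvgM; first exact: cvg_id.
  by apply: (psi_cont b psi cpsi); rewrite (lt_le_trans u0)//= (le_lt_trans y2).
have loc : `|\int[m]_(y in `[u, v]) h y - x * psi x * M| <= eta * pi.
  rewrite (m_int m b psi cpsi dens)//; last 2 first.
  - by apply: measurable_funM => //; exact: measurable_poisson.
  - exact: int_h.
  have -> : \int[mu]_(y in `[u, v]) (h y * psi y) = \int[mu]_(y in `[u, v]) (y * psi y * poisson (x_ n) (e_ n) y).
    by apply: eq_Rintegral => y _; rewrite /h; ring.
  rewrite /M -RintegralZl// -RintegralB//; last 2 first.
  - exact: integrable_itv.
  - by apply: integrable_itv => t _; apply: (@cvgM _ _ (nbhs t)); [exact: cvg_cst|exact: poisson_cont].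
  have iD : mu.-integrable `[u, v] (EFin \o (fun y => y * psi y * poisson (x_ n) (e_ n) y - x * psi x * poisson (x_ n) (e_ n) y)).
    apply: integrable_itv => t ht; apply: (@cvgB _ _ _ (nbhs t)); first exact: chy.
    by apply: cvgM; [exact: cvg_cst|exact: poisson_cont].
  apply: (le_trans (le_normr_Rintegral _ iD)) => //.
  apply: (@le_trans _ _ (\int[mu]_(y in `[u, v]) (eta * poisson (x_ n) (e_ n) y))).
    apply: le_Rintegral => //.
    + by have := integrable_abse iD.
    + by apply: integrable_itv => t _; apply: (@cvgM _ _ (nbhs t)); [exact: cvg_cst|exact: poisson_cont].
    move=> y /inI /andP[y1 y2]; rewrite -mulrBl normrM (ger0_norm (poisson_ge0 _ _ _ _))//.
    apply: ler_wpM2r; first exact: poisson_ge0.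
    rewrite distrC; apply: hd' => /=; rewrite ltr_norml; move: y1 y2 (d1) (d'0); rewrite /u /v; lra_goal.
  by rewrite RintegralZl// -/M; apply: ler_wpM2l => //; exact: ltW.
have far : `|\int[m]_(y in ~` `[u, v]) h y| <= 4 * b * e_ n / d ^+ 2.
  have ih : m.-integrable (~` `[u, v]) (EFin \o h) by exact: int_h.
  apply: (le_trans (le_normr_Rintegral _ ih)) => //.
  pose C := 4 * b * e_ n / d ^+ 2.
  have C0 : 0 <= C by rewrite divr_ge0 ?mulr_ge0 ?sqr_ge0// ltW.
  have iah := integrable_abse ih.
  rewrite -lee_fin fineK; last exact: (integrable_fin_num _ iah).
  apply: (@le_trans _ _ (\int[m]_(y in ~` `[u, v]) C%:E)%E); last first.
    rewrite integral_cst// -[leRHS]mule1; apply: lee_wpmul2l; first by rewrite lee_fin.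
    exact: probability_le1.
  apply: ae_ge0_le_integral => //; first by exact: measurable_int iah.
  apply: (m_ae_in m b psi dens) => y /andP[y0 yb] /= hy.
  rewrite lee_fin normrM (gtr0_norm y0) (ger0_norm (poisson_ge0 _ _ _ _))//.
  (* Outside the window [y] is at least [d] away from [x], and the centre has moved by at most
     [d / 2]. *)
  have far1 : (d / 2) ^+ 2 <= (x_ n - y) ^+ 2.
    rewrite -[leRHS]real_normK ?num_real// lerXn2r ?nnegrE//; first by rewrite divr_ge0// ltW.
    have : d <= `|x - y|.
      rewrite leNgt; apply/negP; rewrite ltr_norml => /andP[z1 z2]; apply: hy.
      by rewrite in_itv/= /u /v; move: z1 z2; lra_goal.
    by have := ler_distD (x_ n) x y; move: (xn); lra_goal.
  have -> : C = b * (e_ n / (d / 2) ^+ 2) by rewrite /C; field; rewrite gt_eqF.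
  apply: ler_pM; rewrite ?(ltW y0) ?(ltW yb) ?poisson_ge0//.
  rewrite /poisson ler_pM2l// lef_pV2 ?posrE ?den ?exprn_gt0//; last by rewrite divr_gt0.
  by apply: (le_trans far1); rewrite lerDl sqr_ge0.
have s1 : 4 * b * e_ n / d ^+ 2 <= eps / 4.
  have db : 0 < 4 * b / d ^+ 2 by rewrite divr_gt0 ?mulr_gt0// exprn_gt0.
  have -> : 4 * b * e_ n / d ^+ 2 = e_ n * (4 * b / d ^+ 2) by ring.
  rewrite -ler_pdivlMr//; near: n; apply: (cvgr_le _ ce).
  by rewrite !divr_gt0 ?mulr_gt0 ?exprn_gt0.
have s2 : x * psi x * `|pi - M| <= eps / 4.
  apply: (@le_trans _ _ ((x * psi x + 1) * `|pi - M|)); first by rewrite ler_wpM2r// lerDl ler01.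
  by rewrite -ler_pdivlMl// /M; near: n; exact: hcm.
have s3 : eta * pi = eps / 4 by rewrite /eta invfM mulrA divfK// gt_eqF.
rewrite -/h splitE.
have -> : pi * (x * psi x) - (\int[m]_(y in `[u, v]) h y + \int[m]_(y in ~` `[u, v]) h y) =
  x * psi x * (pi - M) - (\int[m]_(y in `[u, v]) h y - x * psi x * M) - \int[m]_(y in ~` `[u, v]) h y by ring.
apply: (le_trans (ler_normB _ _)).
have : `|x * psi x * (pi - M) - (\int[m]_(y in `[u, v]) h y - x * psi x * M)| <= x * psi x * `|pi - M| + eta * pi.
  by apply: (le_trans (ler_normB _ _)); apply: lerD => //; rewrite normrM ger0_norm.
move: loc far (s1) (s2) (s3) (eps0); lra_goal.
Unshelve. all: by end_near. Qed.

End Poisson.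

(** * The Euler-Lagrange equation tested against the kernel *)

Section FubiniIdentity.
Context {R : realType} (theta c : R) (th1 : 1 < theta) (c0 : 0 < c).
Local Notation a := theta^-1.
Local Notation J := (Jc theta c).
Local Notation ss := (ss theta).
Local Notation zz := (zz theta).
Local Notation yy := (yy theta c).
Local Notation b := (bb theta c).
Local Notation LL := (LL theta c).
Local Notation mu := (@lebesgue_measure R).
Local Notation I0b := (`](0 : R), b[%classic).
Implicit Types (t u x y : R) (s z : R[i]).

Let a0 : 0 < a := a_gt0 _ th1.
Let th0 : 0 < theta := theta_gt0 _ th1.
Let p0 : 0 < (pi : R) := pi_gt0 R.
Let b0 : 0 < b := bb_gt0 _ _ th1 c0.

Context (m : probability R R) (psi : R -> R).
Context (cpsi : {within I0b, continuous psi}).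
Context (dens : forall A : set R, measurable A -> m A = (\int[mu]_(y in A `&` I0b) (psi y)%:E)%E).
Context (V : R -> R) (l0 : R) (cV : continuous V).
Context (EL : forall x, 0 <= x <= b -> effpot m theta V x = l0%:E).

Lemma seg_bound (f : R -> R) (u v : R) : u <= v -> (forall t, u <= t <= v -> {for t, continuous f}) ->
  exists2 M : R, 0 <= M & forall t, u <= t <= v -> `|f t| <= M.
Proof.
move=> uv cf.
have h (x t : R) : 0 <= x <= 1 -> u <= t <= v -> {for (x, t), continuous (fun z : R * R => f z.2)}.
  move=> _ ht; have c2 : (fun z : R * R => z.2) @ nbhs (x, t) --> t by exact: (@cvg_snd _ _ (nbhs x) (nbhs t)).
  exact: (cvg_comp _ _ c2 (cf t ht)).
have [M M0 hM] := rect_bound _ _ _ _ _ ler01 uv h.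
by exists M => // t ht; have := hM 0 t; rewrite lexx ler01; apply.
Qed.

Lemma m_restrict (f : R -> R) : m.-integrable setT (EFin \o f) ->
  \int[m]_y f y = \int[m]_(y in I0b) f y.
Proof.
move=> iF; rewrite /Rintegral (negligible_integral _ _ iF (m_out m b psi dens))//; last exact: measurableC.
by rewrite setTD setCK.
Qed.

(** The effective potential is a sum of extended reals with a finite value, so each summand is
    finite; finiteness of the integral then gives integrability of each logarithm. *)
Lemma eff_split x : 0 <= x <= b ->
  [/\ m.-integrable setT (EFin \o (fun y => ln `|x - y|)),
     m.-integrable setT (EFin \o (fun y => ln `|x `^ theta - y `^ theta|)) &
   \int[m]_y ln `|x - y| + \int[m]_y ln `|x `^ theta - y `^ theta| = V x + l0].
Proof.
move=> hx; have := EL x hx; rewrite /effpot => E.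
have m1 : measurable_fun setT (fun y : R => ln `|x - y|).
  apply: measurableT_comp; first exact: measurable_ln.
  by apply: measurableT_comp => //; apply: measurable_funB => //; exact: measurable_cst.
have m2 : measurable_fun setT (fun y : R => ln `|x `^ theta - y `^ theta|).
  apply: measurableT_comp; first exact: measurable_ln.
  apply: measurableT_comp => //; apply: measurable_funB; first exact: measurable_cst.
  exact: measurable_powR.
have : (\int[m]_y (ln `|x - y|)%:E + \int[m]_y (ln `|x `^ theta - y `^ theta|)%:E)%E \is a fin_num.
  have : (\int[m]_y (ln `|x - y|)%:E + \int[m]_y (ln `|x `^ theta - y `^ theta|)%:E - (V x)%:E)%E \is a fin_num by rewrite E.
  by rewrite fin_numB => /andP[].
rewrite fin_numD => /andP[f1 f2].
split.
- by apply/integrableP; split; [exact/measurable_EFinP|rewrite (integral_fin_num_abs m)].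
- by apply/integrableP; split; [exact/measurable_EFinP|rewrite (integral_fin_num_abs m)].
- move: E f1 f2; rewrite /Rintegral.
  move: (\int[m]_y (ln `|x - y|)%:E)%E (\int[m]_y (ln `|x `^ theta - y `^ theta|)%:E)%E.
  by move=> [r1| |] [r2| |] //= [] E _ _; lra.
Qed.

Lemma LL_int t : 0 <= t <= pi -> m.-integrable I0b (EFin \o LL t) /\
  \int[m]_(y in I0b) LL t y = V (yy t) + l0.
Proof.
move=> ht; have [i1 i2 E] := eff_split _ (yy_range _ _ th1 c0 t ht).
have iT : m.-integrable setT (EFin \o LL t).
  exact: (@integrableD _ _ _ m setT _ (fun y => (ln `|yy t - y|)%:E) (fun y => (ln `|yy t `^ theta - y `^ theta|)%:E)).
split; first exact: integrableS iT.
by rewrite -m_restrict// /LL RintegralD.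
Qed.

Lemma ln_norm_le x y : `|x| <= y -> ln `|x| <= `|ln y|.
Proof.
move=> xy; have [->|x0] := eqVneq x 0; first by rewrite normr0 ln0.
have x1 : 0 < `|x| by rewrite normr_gt0.
apply: le_trans (ler_norm _); rewrite ler_ln ?posrE//; exact: lt_le_trans xy.
Qed.

Lemma LL_le : exists2 C : R, 0 <= C & forall t y, 0 <= t <= pi -> 0 < y < b -> LL t y <= C.
Proof.
exists (`|ln b| + `|ln (b `^ theta)|); first by rewrite addr_ge0.
move=> t y /(yy_range _ _ th1 c0) /andP[h1 h2] /andP[h3 h4].
have pw x : 0 <= x -> x <= b -> 0 <= x `^ theta <= b `^ theta.
  by move=> x0 xb; rewrite powR_ge0 ge0_ler_powR ?nnegrE ?(ltW th0) ?(ltW b0).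
have /andP[q1 q2] := pw _ h1 h2; have /andP[q3 q4] := pw _ (ltW h3) (ltW h4).
by apply: lerD; apply: ln_norm_le; rewrite ler_norml; apply/andP; split; lra.
Qed.

(** The kernel is bounded above by [C], so [|LL| <= 2 C - LL], and the integral of [LL] is known
    from the Euler-Lagrange equation. This is the uniform absolute bound that Fubini needs. *)
Lemma LL_abs_bound : exists2 K : R, 0 <= K & forall t, 0 <= t <= pi ->
  (\int[m]_(y in I0b) (`|LL t y|)%:E <= K%:E)%E.
Proof.
have [C C0 hC] := LL_le.
have [M M0 hM] : exists2 M : R, 0 <= M & forall t, 0 <= t <= pi -> `|V (yy t)| <= M.
  by apply: (seg_bound (fun t => V (yy t))) => [|t ht]; [exact: ltW|exact: cont_yy_comp].
exists (2 * C + M + `|l0|); first by rewrite !addr_ge0// mulr_ge0.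
move=> t ht; have [i1 E] := LL_int t ht.
have iC : m.-integrable I0b (EFin \o (fun=> 2 * C)).
  apply/integrableP; split; first by exact/measurable_EFinP.
  rewrite (eq_integral (cst (`|2 * C|)%:E))// integral_cst//.
  apply: (@le_lt_trans _ _ ((`|2 * C|)%:E * 1)%E); last by rewrite mule1 ltry.
  by apply: lee_wpmul2l; [rewrite lee_fin|exact: probability_le1].
have i2 : m.-integrable I0b (EFin \o (fun y => 2 * C - LL t y)).
  exact: (@integrableB _ _ _ m _ _ (fun=> (2 * C)%:E) (fun y => (LL t y)%:E)).
apply: (@le_trans _ _ (\int[m]_(y in I0b) (2 * C - LL t y)%:E)%E).
  apply: ge0_le_integral => //.
  - apply/measurable_EFinP; apply: measurableT_comp => //.
    by apply/measurable_EFinP; exact: measurable_int i1.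
  - exact: measurable_int i2.
  - move=> y; rewrite /= in_itv/= lee_fin => hy; have := hC t y ht hy.
    by rewrite ler_norml => h; apply/andP; split; lra.
rewrite -[leLHS]fineK; last exact: (integrable_fin_num _ i2).
rewrite lee_fin -/(Rintegral m I0b (fun y => 2 * C - LL t y)) RintegralB// E.
have : \int[m]_(y in I0b) (2 * C) <= 2 * C.
  rewrite Rintegral_cst// -[leRHS]mulr1; apply: ler_wpM2l; first by rewrite mulr_ge0.
  rewrite -lee_fin fineK; first exact: probability_le1.
  exact: fin_num_measure.
have := hM t ht; rewrite ler_norml => /andP[h1 h2]; have := ler_norm (- l0); rewrite normrN.
by move: (Rintegral _ _ _) => z; lra.
Qed.

Section WithKernel.
Context (lp tp : R) (lp1 : 1 < lp) (tpI : 0 < tp < pi).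
Let p := zz lp tp.
Let q := qk theta p.
Let X := Re (J p).
Let E := Im (J p).
Local Notation Gk := (Gk theta lp tp).

Lemma ImJp_gt0 : 0 < E. Proof. exact: ImJ_gt0. Qed.

(** Partial fractions: [J / (J - y) - (p + 1) / (p - a) = y / (J - y) - (1 + a) / (p - a)]. The
    imaginary part of the first term is a Poisson kernel with centre [Re J(p)] and width [Im J(p)],
    that of the second is a multiple of [qk]. *)
Lemma Ho_poisson y : - (2 * pi * Im (Ho theta c y p * (p * (p + 1) / (p - a%:C) / p))) =
  2 * pi * (y * poisson X E y - (1 + a) * q).
Proof.
have E0 := ImJp_gt0.
have Imp : 0 < Im p by apply: Im_zz_gt0 => //; exact: lt_trans ltr01 lp1.
have pn0 : p != 0 by apply: slit_Re_neq; right; rewrite gt_eqF.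
have pn1 : p + 1 != 0 by apply: slit_Re_neq; right; rewrite ImD Im1 addr0 gt_eqF.
have pa : p - a%:C != 0 by apply: slit_Re_neq; right; rewrite ImB ImC subr0 gt_eqF.
have Jy : J p - y%:C != 0 by apply: slit_Re_neq; right; rewrite ImB ImC subr0 gt_eqF.
have -> : Ho theta c y p * (p * (p + 1) / (p - a%:C) / p) = y%:C * (J p - y%:C)^-1 - (1 + a)%:C * (p - a%:C)^-1.
  rewrite /Ho CD; move: (J p) (p) (a%:C) (y%:C) pn0 pn1 pa Jy => j P A y' pn0 pn1 pa Jy.
  by field; rewrite pn0 pn1 pa Jy.
rewrite ImB ImCM ImCM !ImV !ReB !ImB !ReC !ImC !subr0.
rewrite /poisson /q /qk cabs_sqr ReB ImB ReC ImC subr0 -/X -/E; ring.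
Qed.

(** Fubini for the product of [LL] and [Gk]. Integrating in [y] first gives the Euler-Lagrange
    equation, integrating in [t] first gives [int_LL]. *)
Lemma master_identity :
  2 * pi * (\int[m]_y (y * poisson X E y) - (1 + a) * q) =
  \int[mu]_(t in `[0, pi]) ((V (yy t) + l0) * Re (Gk (ss t) t)).
Proof.
have E0 := ImJp_gt0.
(* Functions of the angle are extended by 0, and the measure is cut to the open interval by an
   indicator, so that Fubini runs over the full product space. *)
pose yc : R -> R := yy \_ `[0, pi].
pose G : R -> R := (fun t => Re (Gk (ss t) t)) \_ `[0, pi].
pose H x y : R := ln `|x - y| + ln `|x `^ theta - y `^ theta|.
pose f : measurableTypeR R * R -> \bar R := fun v2 => (H (yc v2.1) v2.2 * G v2.1 * (\1_I0b v2.2 : R))%:E.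
have inI t : `[(0 : R), pi]%classic t -> 0 <= t <= pi by rewrite /= in_itv.
have cG t : 0 <= t <= pi -> {for t, continuous (fun t => Re (Gk (ss t) t))} by exact: continuous_Gk.
have ycE t : 0 <= t <= pi -> yc t = yy t by move=> ht; rewrite /yc patchE mem_set//= in_itv.
have GE t : 0 <= t <= pi -> G t = Re (Gk (ss t) t) by move=> ht; rewrite /G patchE mem_set//= in_itv.
have G0 t : ~ (0 <= t <= pi) -> G t = 0 by move=> ht; rewrite /G patchE memNset//= in_itv.
have mrest (h : R -> R) : (forall t, 0 <= t <= pi -> {for t, continuous h}) ->
    measurable_fun setT (h \_ `[0, pi] : measurableTypeR R -> R).
  move=> ch; have mh : measurable_fun `[0, pi] h.
    by apply: subspace_continuous_measurable_fun => //; exact: within_cont.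
  exact: (measurable_restrictT h (measurable_itv _)).1 mh.
have myc : measurable_fun setT (yc : measurableTypeR R -> R) by apply: mrest => t ht; exact: continuous_yy.
have mG : measurable_fun setT (G : measurableTypeR R -> R) by exact: mrest.
have myc1 : measurable_fun setT (fun z : measurableTypeR R * R => yc z.1).
  exact: measurableT_comp myc measurable_fst.
have mf : measurable_fun setT f.
  apply/measurable_EFinP; apply: measurable_funM; last first.
    by apply: measurableT_comp measurable_snd; exact: measurable_indic.
  apply: measurable_funM; last exact: measurableT_comp mG measurable_fst.
  apply: measurable_funD; apply: measurableT_comp; rewrite ?measurable_ln//;
     apply: measurableT_comp => //; apply: measurable_funB => //; try exact: measurable_snd.
    exact: measurableT_comp (measurable_powR theta) myc1.
  exact: measurableT_comp (measurable_powR theta) measurable_snd.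
have [K K0 hK] := LL_abs_bound.
have fE t y : 0 <= t <= pi -> f (t, y) = ((fun y => (LL t y * G t)%:E) \_ I0b) y.
  by move=> ht; rewrite /f /= patchE indicE ycE//; case: ifP => _; rewrite ?mulr1 ?mulr0.
have f0 t y : ~ (0 <= t <= pi) -> f (t, y) = 0%E by move=> ht; rewrite /f /= G0// mulr0 mul0r.
have absf t : 0 <= t <= pi -> (\int[m]_y `|f (t, y)| = (`|G t|)%:E * \int[m]_(y in I0b) (`|LL t y|)%:E)%E.
  move=> ht; have [i1 _] := LL_int t ht.
  transitivity (\int[m]_(y in I0b) ((`|G t|)%:E * (`|LL t y|)%:E))%E; last first.
    rewrite ge0_integralZl//; first by apply/measurable_EFinP; apply: measurableT_comp => //; apply/measurable_EFinP; exact: measurable_int i1.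
  rewrite [RHS]integral_mkcond; apply: eq_integral => y _; rewrite fE// !patchE.
  by case: ifP => _ /=; rewrite ?normr0// normrM mulrC.
have If : (lebesgue_measure \x m)%E.-integrable setT f.
  apply/integrable12ltyP => //.
  apply: (@le_lt_trans _ _ (\int[mu]_t (K%:E * ((fun t => (`|Re (Gk (ss t) t)|)%:E) \_ `[0%R, pi]) t)))%E.
    have mg : measurable_fun setT ((fun t => (`|Re (Gk (ss t) t)|)%:E) \_ `[(0 : R), pi] : measurableTypeR R -> \bar R).
      have mh : measurable_fun `[0, pi] (fun t => (`|Re (Gk (ss t) t)|)%:E).
        apply/measurable_EFinP; apply: subspace_continuous_measurable_fun => //.
        by apply: within_cont => t ht; apply: cvg_norm; exact: cG.
      exact: (measurable_restrictT _ (measurable_itv _)).1 mh.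
    apply: ge0_le_integral => //.
    - by move=> t _; exact: integral_ge0.
    - apply: (measurable_fun_fubini_tonelli_F (fun v2 => `|f v2|)%E) => //.
      exact: measurableT_comp.
    - by apply: emeasurable_funM => //; exact: measurable_cst.
    - move=> t _; case: (pselect (0 <= t <= pi)) => ht.
        rewrite absf// patchE mem_set/= ?in_itv//= GE// muleC; apply: lee_wpmul2r => //.
        exact: hK.
      rewrite patchE memNset/= ?in_itv//= mule0 integral0_eq// => y _.
      by rewrite /= G0// mulr0 mul0r normr0.
  have ig : mu.-integrable `[0, pi] (EFin \o (fun t => `|Re (Gk (ss t) t)|)).
    by apply: integrable_itv => t ht; apply: cvg_norm; exact: cG.
  have ig' := ig; move/integrable_mkcond : ig' => /(_ (measurable_itv _)) ig'.
  have := integrableZl measurableT K ig' => iz.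
  have := integrable_fin_num measurableT iz; rewrite fin_numElt => /andP[_].
  by [].
have := Fubini If => FF.
have LHS : (\int[mu]_t \int[m]_y f (t, y) = (\int[mu]_(t in `[0, pi]) ((V (yy t) + l0) * Re (Gk (ss t) t)))%:E)%E.
  have iV : mu.-integrable `[0, pi] (EFin \o (fun t => (V (yy t) + l0) * Re (Gk (ss t) t))).
    apply: integrable_itv => t ht; apply: (@cvgM _ _ (nbhs t)); last exact: cG.
    by apply: cvgD; [exact: cont_yy_comp|exact: cvg_cst].
  rewrite fineK; last exact: (integrable_fin_num _ iV).
  rewrite [RHS]integral_mkcond; apply: eq_integral => t _; rewrite patchE.
  case: (pselect (0 <= t <= pi)) => ht.
    rewrite mem_set/= ?in_itv//.
    have [i1 e1] := LL_int t ht.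
    have -> : (\int[m]_y f (t, y) = \int[m]_(y in I0b) ((LL t y)%:E * (G t)%:E))%E.
      by rewrite [RHS]integral_mkcond; apply: eq_integral => y _; rewrite fE.
    rewrite (integralZr _ i1)// GE// EFinM; congr (_ * _)%E.
    by rewrite -e1 fineK//; exact: (integrable_fin_num _ i1).
  by rewrite memNset/= ?in_itv// integral0_eq// => y _; exact: f0.
have ipo : m.-integrable setT (EFin \o (fun y => y * poisson X E y)).
  exact: (integrable_poisson m b psi b0 dens).
have ipo1 : m.-integrable setT (EFin \o (fun y => y * poisson X E y - (1 + a) * q)).
  apply: (@integrableB _ _ _ m _ _ (fun y => (y * poisson X E y)%:E) (fun=> ((1 + a) * q)%:E)) => //.
  apply/integrableP; split; first by exact/measurable_EFinP.
  by rewrite (eq_integral (cst (`|(1 + a) * q|)%:E))// m_cst ltry.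
have ipo2 : m.-integrable setT (EFin \o (fun y => 2 * pi * (y * poisson X E y - (1 + a) * q))).
  exact: (@integrableZl _ _ _ m setT measurableT (2 * pi) (fun y => (y * poisson X E y - (1 + a) * q)%:E)).
have RHS : (\int[m]_y \int[mu]_t f (t, y) = (\int[m]_y (2 * pi * (y * poisson X E y - (1 + a) * q)))%:E)%E.
  rewrite m_restrict// fineK; last first.
    by apply: (integrable_fin_num _ _) => //; apply: integrableS ipo2.
  rewrite [RHS]integral_mkcond; apply: eq_integral => y _; rewrite patchE.
  case: ifPn => [|] hy.
    move: hy; rewrite inE/= in_itv/= => /andP[y1 y2].
    have yI : 0 <= y <= b by rewrite !ltW.
    have [tY hY eY] := yy_surj _ _ th1 c0 y yI.
    have tYI : 0 < tY < pi.
      case: (t_cases _ hY) => [e|e|//]; move: eY; rewrite e.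
        by rewrite yy0// => e'; rewrite e' ltxx in y2.
      by rewrite yypi// => e'; rewrite -e' ltxx in y1.
    have [iL eL] := int_LL _ _ th1 c0 tY tYI lp tp lp1 tpI.
    rewrite eY Ho_poisson in eL; rewrite eY in iL; rewrite -eL fineK; last exact: (integrable_fin_num _ iL).
    rewrite [RHS]integral_mkcond; apply: eq_integral => t _; rewrite patchE.
    case: (pselect (0 <= t <= pi)) => ht.
      rewrite mem_set/= ?in_itv// fE// patchE mem_set/= ?in_itv/= ?y1//.
      by rewrite GE.
    by rewrite memNset/= ?in_itv// f0.
  rewrite integral0_eq// => t _; rewrite /f /= indicE (negPf hy) mulr0//.
move: FF; rewrite LHS RHS => -[] ->.
have cstE (r : R) : \int[m]_y r = r by rewrite /Rintegral m_cst.
have icst (r : R) : m.-integrable setT (EFin \o (fun=> r)).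
  apply/integrableP; split; first by exact/measurable_EFinP.
  by rewrite (eq_integral (cst (`|r|)%:E))// m_cst ltry.
by rewrite RintegralZl// RintegralB// cstE.
Qed.

End WithKernel.
End FubiniIdentity.

(** * The limit onto gamma *)

Section Limit.
Context {R : realType} (theta c : R) (th1 : 1 < theta) (c0 : 0 < c).
Local Notation a := theta^-1.
Local Notation J := (Jc theta c).
Local Notation ss := (ss theta).
Local Notation rr := (rr theta).
Local Notation om := (om theta).
Local Notation zz := (zz theta).
Local Notation yy := (yy theta c).
Local Notation b := (bb theta c).
Local Notation Nk := (Nk theta).
Local Notation qk := (qk theta).
Local Notation mu := (@lebesgue_measure R).
Local Notation I0b := (`](0 : R), b[%classic).
Implicit Types (t u x y : R) (s z : R[i]).

Let a0 : 0 < a := a_gt0 _ th1.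
Let th0 : 0 < theta := theta_gt0 _ th1.
Let p0 : 0 < (pi : R) := pi_gt0 R.
Let b0 : 0 < b := bb_gt0 _ _ th1 c0.

Lemma Im_ss_ge0 t : 0 <= t <= pi -> 0 <= Im (ss t).
Proof.
move=> ht; case: (t_cases _ ht) => [->|->|h]; last exact/ltW/Im_ss_gt0.
  by rewrite ss0// ImC.
by rewrite ss_pi//= oppr0.
Qed.

(** A point of the upper half-plane is closer to [p] than to [conj p], whence the sign. The upper
    bound combines [cabs_ssB] with [|s - conj p| <= M + 2 M], and is uniform in the pole. *)
Lemma Nk_bound : exists2 C : R, 0 <= C & forall l t0 t, 1 <= l <= 2 -> 0 <= t0 <= pi ->
  0 <= t <= pi -> t != t0 -> 0 <= Nk (zz l t0) t <= C + `|ln `|t - t0| |.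
Proof.
have [M M0 hM] := ccvg_rr_max _ th1; have [r0 r00 hr] := rr_min _ th1.
exists (`|ln (r0 / pi)| + `|ln (3 * M)|); first by rewrite addr_ge0.
move=> l t0 t /andP[l1 l2] ht0 ht tn.
have l0 : 0 < l := lt_le_trans ltr01 l1.
set p := zz l t0; set s := ss t.
have Ip : 0 <= Im p by rewrite /p /zz ImCM mulr_ge0 ?Im_ss_ge0// ltW.
have Is : 0 <= Im s by exact: Im_ss_ge0.
have d0 : 0 < `|t - t0| by rewrite normr_gt0 subr_eq0.
have low : r0 / pi * `|t - t0| <= cabs (s - p).
  have := @cabs_ssB _ _ th1 1 l r0 t t0 ht ht0 ler01 (ltW l0).
  rewrite mul1r hr// => /(_ isT); rewrite [1%:C * _]mul1r => h.
  rewrite mulrAC -mulrA; apply: h.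
  by rewrite -[leLHS]mul1r; apply: ler_pM; rewrite ?ler01 ?hr// ltW.
have k0 : 0 < r0 / pi * `|t - t0| by rewrite mulr_gt0 ?divr_gt0.
have le1 : cabs (s - p) <= cabs (s - cconj p).
  rewrite -ler_sqr ?nnegrE ?cabs_ge0// !cabs_sqr !ReB !ImB ReJ ImJ lerD2l; nra.
have le2 : cabs (s - cconj p) <= 3 * M.
  apply: (le_trans (cabsD_le _ _)); rewrite cabsN cabsJ cabs_ss// cabs_zz//.
  have h1 := hM t ht; have h2 : l * rr t0 <= 2 * M by apply: ler_pM; rewrite ?hM ?(ltW l0)// ltW// rr_gt0.
  lra.
have c1 : 0 < cabs (s - p) := lt_le_trans k0 low.
have c2 : 0 < cabs (s - cconj p) := lt_le_trans c1 le1.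
rewrite /Nk -/s -/p subr_ge0 ler_ln ?posrE// le1/=.
have n1 := norm_ln_le _ _ _ k0 low (le_trans le1 le2).
have l3 : ln (cabs (s - cconj p)) <= ln (3 * M) by rewrite ler_ln ?posrE// (lt_le_trans c2).
have l4 : ln (r0 / pi * `|t - t0|) <= ln (cabs (s - p)) by rewrite ler_ln ?posrE.
move: l4; rewrite lnM ?posrE ?divr_gt0// => l4.
have := ler_norm (ln (3 * M)); have := ler_norm (- ln (r0 / pi)); have := ler_norm (- ln `|t - t0|).
rewrite !normrN; move: l3 l4; lra.
Qed.

Lemma ln_norm_mono x y : 0 < x -> x <= y -> ln `|x| <= ln `|y|.
Proof.
move=> x0 xy; have y0 : 0 < y := lt_le_trans x0 xy.
by rewrite !gtr0_norm// ler_ln ?posrE.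
Qed.

Lemma measurable_Nk p : measurable_fun `[0, pi] (Nk p).
Proof.
have h z : measurable_fun `[0, pi] (fun t => ln (cabs (ss t - z))).
  apply: measurableT_comp; first exact: measurable_ln.
  apply: subspace_continuous_measurable_fun => //; apply: within_cont => t ht.
  by apply: ccvg_cabs; apply: ccvgB; [exact: ccvg_ss|exact: ccvg_cst].
by apply: measurable_funB.
Qed.

(** Near [t = 0] the height of [ss t] is at least linear in [t], while its squared distance to
    [1/theta] is at most quadratic; so [qk] grows at least like [K / t]. *)
Lemma qk_large (A : R) : exists2 d : R, 0 < d <= pi & forall t, 0 < t < d -> A <= qk (ss t).
Proof.
have h00 : 0 <= (0 : R) <= pi by rewrite lexx ltW.
have [r0 r00 hr] := rr_min _ th1.
have [h [hE h0 ch]] := pder_slope _ _ _ (pder_ss _ th1 0 h00).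
pose D := cabs (ss 0 * om 0).
have cD : (fun x => cabs (h x)) @ nbhs (0 : R) --> D by exact: ccvg_cabs.
have D0 : 0 <= D := cabs_ge0 _.
have D1 : D < D + 1 by lra.
have /= := cvgr_lt _ cD _ D1 => -[e /= e0 he].
pose K := r0 / pi / (D + 1) ^+ 2.
have K0 : 0 < K by rewrite !divr_gt0 ?exprn_gt0//; lra.
pose d := Num.min (Num.min e (pi / 2)) (K / (`|A| + 1)).
have A1 : 0 < `|A| + 1 by rewrite ltr_wpDl.
have d0 : 0 < d by rewrite !lt_min e0/=; apply/andP; split; apply: divr_gt0.
have d1 : d <= e by rewrite /d !ge_min lexx.
have d2 : d <= pi / 2 by rewrite /d !ge_min lexx orbT.
have d3 : d <= K / (`|A| + 1) by rewrite /d !ge_min lexx orbT.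
exists d; first by rewrite d0; move: p0; lra.
move=> t /andP[t0 td]; have tp : 0 <= t <= pi / 2 by rewrite ltW//=; lra.
have ht : 0 <= t <= pi by rewrite ltW//=; move: p0; lra.
have nt : ss t - a%:C != 0 by apply: ss_neq_a => //; rewrite t0/=; move: p0; lra.
have up : cabs (ss t - a%:C) <= (D + 1) * t.
  have := hE t; rewrite ss0// => ->; rewrite addrC addKr subr0 cabsM cabsC gtr0_norm//.
  rewrite ler_pM2r//; apply/ltW/he => /=; rewrite sub0r normrN gtr0_norm//; lra.
have lo : r0 * (t / pi) <= Im (ss t).
  by rewrite /ss ImCM Im_expi; apply: ler_pM; rewrite ?hr ?sin_ge_linear// ?divr_ge0 ?ltW.
have c1 : 0 < cabs (ss t - a%:C) by rewrite cabs_gt0.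
have sq : cabs (ss t - a%:C) ^+ 2 <= ((D + 1) * t) ^+ 2.
  by rewrite lerXn2r ?nnegrE// ?mulr_ge0 ?(ltW t0)//; [exact: ltW|lra].
apply: (@le_trans _ _ (K / t)).
  rewrite ler_pdivlMr//; apply: (@le_trans _ _ ((`|A| + 1) * t)).
    by rewrite ler_pM2r//; have := ler_norm A; lra.
  by rewrite -ler_pdivlMl// mulrC; lra.
rewrite /qk; have -> : K / t = r0 * (t / pi) / ((D + 1) * t) ^+ 2.
  by rewrite /K; field; rewrite !gt_eqF//; lra.
apply: ler_pM => //; first by rewrite mulr_ge0 ?divr_ge0 ?ltW.
  by rewrite invr_ge0 exprn_ge0// mulr_ge0 ?(ltW t0)//; lra.
by rewrite lef_pV2 ?posrE ?exprn_gt0// mulr_gt0//; lra.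
Qed.

Context (m : probability R R) (psi : R -> R).
Context (cpsi : {within I0b, continuous psi}).
Context (dens : forall A : set R, measurable A -> m A = (\int[mu]_(y in A `&` I0b) (psi y)%:E)%E).
Context (V V1 V2 : R -> R) (l0 : R) (cV : continuous V) (cV1 : continuous V1) (cV2 : continuous V2).
Context (dV : forall x, 0 < x -> is_derive x (1 : R) V (V1 x)).
Context (dV1 : forall x, 0 < x -> is_derive x (1 : R) V1 (V2 x)).
Context (EL : forall x, 0 <= x <= b -> effpot m theta V x = l0%:E).
Context (ELle : forall x, 0 <= x -> (effpot m theta V x <= l0%:E)%E).
Local Notation ZZ := (ZZ theta c V1).
Local Notation ZZd := (ZZd theta c V1 V2).
Let IZ := \int[mu]_(t in `[0, pi]) ZZ t.

Lemma density_identity t0 : 0 < t0 < pi ->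
  2 * pi ^+ 2 * (yy t0 * psi (yy t0)) =
  - (\int[mu]_(t in `[0, pi]) (ZZd t * Nk (ss t0) t)) +
  2 * qk (ss t0) * ((1 + a) * pi - a * IZ).
Proof.
move=> t0I; have /andP[h1 h2] := t0I; have ht0 : 0 <= t0 <= pi by rewrite !ltW.
have ht0' : 0 <= t0 < pi by rewrite ltW.
(* The pole tends to [ss t0] along its ray from outside. There [Im J > 0] tends to 0, as the Poisson
   limit requires, and the dilation factor stays below 2, the range of [Nk_bound]. *)
pose l n : R := 1 + n.+1%:R^-1.
have ln1 n : 1 < l n by rewrite ltrDl invr_gt0.
have ln2 n : l n <= 2.
  by rewrite /l -[2]/(1 + 1) lerD2l invf_le1// ler1n.
have cl : l @ \oo --> (1 : R).
  by rewrite -[X in _ --> X]addr0; apply: cvgD; [exact: cvg_cst|exact: cvg_harmonic].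
have cp : ccvg \oo (fun n => zz (l n) t0) (ss t0).
  by rewrite -zz1; apply: ccvgM; [exact: ccvgC|exact: ccvg_cst].
have s0 := ss_neq0 _ th1 t0 ht0.
have sa : ss t0 - a%:C != 0 by apply: ss_neq_a => //; rewrite h1 ltW.
have cJ : ccvg \oo (fun n => J (zz (l n) t0)) (yy t0)%:C.
  by rewrite -J_ss//; apply: ucont_J cp => //; exact: slit_ss1.
have yI : 0 < yy t0 < b.
  apply/andP; split; first exact: yy_gt0.
  by rewrite -(yy0 _ c th1); apply: yy_decr => //; exact: ltW.
have cP := poisson_limit m b psi b0 cpsi dens (yy t0) _ _ yI cJ.1 cJ.2 (fun n => ImJ_gt0 _ _ th1 c0 _ _ (ln1 n) t0I).
have cq : (fun n => qk (zz (l n) t0)) @ \oo --> qk (ss t0).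
  have ca : (fun n => cabs (zz (l n) t0 - a%:C)) @ \oo --> cabs (ss t0 - a%:C).
    by apply: ccvg_cabs; apply: ccvgB; [exact: cp|exact: ccvg_cst].
  apply: cvgM; first exact: cp.2.
  apply: cvgV; first by rewrite expf_eq0/= cabs_eq0.
  by rewrite expr2; under eq_fun do rewrite expr2; exact: cvgM.
have [C C0 hC] := Nk_bound.
have [Mz Mz0 hMz] : exists2 Mz : R, 0 <= Mz & forall t, 0 <= t <= pi -> `|ZZd t| <= Mz.
  by apply: seg_bound => [|t ht]; [exact: ltW|exact: continuous_ZZd].
have mZd : measurable_fun `[0, pi] ZZd.
  by apply: subspace_continuous_measurable_fun => //; apply: within_cont => t ht; exact: continuous_ZZd.
have [iN cN] : mu.-integrable `[0, pi] (EFin \o (fun t => ZZd t * Nk (ss t0) t)) /\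
   (fun n => \int[mu]_(t in `[0, pi]) (ZZd t * Nk (zz (l n) t0) t)) @ \oo --> \int[mu]_(t in `[0, pi]) (ZZd t * Nk (ss t0) t).
  apply: (@Rdominated_cvg _ _ _ mu _ [set t0] _ _ (fun t => Mz * (C + `|ln `|t - t0| |))) => //.
  - by apply: countable_lebesgue_measure0; exact: countable1.
  - by move=> n; apply: measurable_funM => //; exact: measurable_Nk.
  - by apply: measurable_funM => //; exact: measurable_Nk.
  - move=> t; rewrite /= in_itv/= => ht /eqP tn.
    have n1 : ss t - ss t0 != 0.
      rewrite subr_eq0; apply: contra tn => /eqP e; apply/eqP; apply: (yy_inj _ _ th1 c0) => //.
      by rewrite /yy e.
    have n2 : ss t - cconj (ss t0) != 0.
      apply: slit_Re_neq; right; rewrite ImB ImJ opprK gt_eqF// ltr_wpDl ?Im_ss_ge0//.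
      exact: Im_ss_gt0.
    have lnc (g : nat -> R[i]) z : z != 0 -> ccvg \oo g z -> (fun n => ln (cabs (g n))) @ \oo --> ln (cabs z).
      move=> z0 gz; apply: (cvg_comp _ _ (ccvg_cabs _ _ gz)); apply: continuous_ln.
      by rewrite cabs_gt0.
    apply: cvgM; first exact: cvg_cst.
    apply: cvgB; apply: lnc => //; apply: ccvgB; try exact: ccvg_cst; last exact: cp.
    exact: ccvg_conj.
  - have -> : EFin \o (fun t => Mz * (C + `|ln `|t - t0| |)) = (fun t => Mz%:E * (C%:E + (`|ln `|t - t0| |)%:E))%E.
      by apply/funext => t /=; rewrite EFinM EFinD.
    apply: integrableZl => //; apply: integrableD => //.
      by apply: (@integrable_itv _ (fun=> C)) => t _; exact: cvg_cst.
    exact: integrable_abse (integrable_ln_dist t0 0 pi).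
  - move=> n t; rewrite /= in_itv/= => ht /eqP tn; rewrite normrM; apply: ler_pM => //; first exact: hMz.
    have hl : 1 <= l n <= 2 by rewrite (ltW (ln1 n)) ln2.
    by have /andP[g0 g1] := hC _ _ _ hl ht0 ht tn; rewrite ger0_norm.
have E n : 2 * pi * (\int[m]_y (y * poisson (Re (J (zz (l n) t0))) (Im (J (zz (l n) t0))) y) - (1 + a) * qk (zz (l n) t0)) =
  - (\int[mu]_(t in `[0, pi]) (ZZd t * Nk (zz (l n) t0) t)) - 2 * a * qk (zz (l n) t0) * IZ.
  rewrite (master_identity _ _ th1 c0 m psi dens V l0 cV EL (l n) t0 (ln1 n) t0I).
  by rewrite (int_V_Gk _ _ th1 c0 (l n) t0 (ln1 n) t0I V V1 V2 cV cV1 cV2 dV dV1).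
have c1 : (fun n => 2 * pi * (\int[m]_y (y * poisson (Re (J (zz (l n) t0))) (Im (J (zz (l n) t0))) y) - (1 + a) * qk (zz (l n) t0)))
   @ \oo --> 2 * pi * (pi * (yy t0 * psi (yy t0)) - (1 + a) * qk (ss t0)).
  apply: cvgM; first exact: cvg_cst.
  by apply: cvgB; [exact: cP|apply: cvgM; [exact: cvg_cst|exact: cq]].
have c2 : (fun n => - (\int[mu]_(t in `[0, pi]) (ZZd t * Nk (zz (l n) t0) t)) - 2 * a * qk (zz (l n) t0) * IZ) @ \oo -->
   - (\int[mu]_(t in `[0, pi]) (ZZd t * Nk (ss t0) t)) - 2 * a * qk (ss t0) * IZ.
  apply: cvgB; first exact: cvgN.
  by apply: cvgM; [apply: cvgM; [exact: cvg_cst|exact: cq]|exact: cvg_cst].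
have E2 : 2 * pi * (pi * (yy t0 * psi (yy t0)) - (1 + a) * qk (ss t0)) =
   - (\int[mu]_(t in `[0, pi]) (ZZd t * Nk (ss t0) t)) - 2 * a * qk (ss t0) * IZ.
  move: c1; under eq_fun do rewrite E.
  by move=> c1; exact: (cvg_unique _ c1 c2).
move: E2; move: (Rintegral mu _ _) => x E2; move: E2; set P := yy t0 * _; set Q := qk _ => E2.
have : 2 * pi ^+ 2 * P = 2 * pi * (pi * P - (1 + a) * Q) + 2 * pi * ((1 + a) * Q) by ring.
by rewrite E2 => ->; ring.
Qed.

(** Uniform up to the ends of the arc, so that the unbounded coefficient [qk] decides the behaviour
    of the density near [b]. *)
Lemma ZZd_Nk_bound : exists2 M : R, 0 <= M & forall t0, 0 < t0 < pi ->
  `|\int[mu]_(t in `[0, pi]) (ZZd t * Nk (ss t0) t)| <= M.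
Proof.
have [C C0 hC] := Nk_bound.
have [Mz Mz0 hMz] : exists2 Mz : R, 0 <= Mz & forall t, 0 <= t <= pi -> `|ZZd t| <= Mz.
  by apply: seg_bound => [|t ht]; [exact: ltW|exact: continuous_ZZd].
have [M M0 hM] := integral_ln_dist_bound _ p0.
exists (Mz * (C * pi + M)); first by rewrite mulr_ge0// addr_ge0// mulr_ge0// ltW.
move=> t0 /andP[h1 h2]; have ht0 : 0 <= t0 <= pi by rewrite !ltW.
have mZd : measurable_fun `[0, pi] ZZd.
  by apply: subspace_continuous_measurable_fun => //; apply: within_cont => t ht; exact: continuous_ZZd.
have iL := integrable_abse (integrable_ln_dist t0 0 pi).
have iC : mu.-integrable `[0, pi] (EFin \o (fun=> C)).
  by apply: (@integrable_itv _ (fun=> C)) => t _; exact: cvg_cst.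
have iCL : mu.-integrable `[0, pi] (EFin \o (fun t => C + `|ln `|t - t0| |)).
  exact: (@integrableD _ _ _ mu _ _ (fun=> C%:E) (fun t => (`|ln `|t - t0| |)%:E)).
have iG : mu.-integrable `[0, pi] (EFin \o (fun t => Mz * (C + `|ln `|t - t0| |))).
  exact: (@integrableZl _ _ _ mu _ _ Mz (fun t => (C + `|ln `|t - t0| |)%:E)).
pose F t := ZZd t * Nk (ss t0) t.
have mN : measurable_fun `[0, pi] F by apply: measurable_funM => //; exact: measurable_Nk.
have n0 : mu [set t0] = 0%E by apply: countable_lebesgue_measure0; exact: countable1.
have bnd t : 0 <= t <= pi -> t != t0 -> `|F t| <= Mz * (C + `|ln `|t - t0| |).
  move=> ht tn; rewrite normrM; apply: ler_pM => //; first exact: hMz.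
  have hl : 1 <= (1 : R) <= 2 by rewrite lexx ler1n.
  by have := hC _ _ _ hl ht0 ht tn; rewrite zz1 => /andP[g0 g1]; rewrite ger0_norm.
have [ifi _] : mu.-integrable `[0, pi] (EFin \o F) /\ (fun=> \int[mu]_(t in `[0, pi]) F t) @ \oo --> \int[mu]_(t in `[0, pi]) F t.
  apply: (@Rdominated_cvg _ _ _ mu _ [set t0] (fun=> F) F _ _ _ n0 _ _ _ iG) => //.
    by move=> t _ _; exact: cvg_cst.
  by move=> n t; rewrite /= in_itv/= => ht /eqP tn; exact: bnd.
apply: (le_trans (le_normr_Rintegral _ ifi)) => //.
apply: (@le_trans _ _ (\int[mu]_(t in `[0, pi]) (Mz * (C + `|ln `|t - t0| |)))).
  have iaf := integrable_abse ifi.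
  rewrite -lee_fin !fineK; [|exact: (integrable_fin_num _ iG)|exact: (integrable_fin_num _ iaf)].
  apply: ae_ge0_le_integral => //.
  - exact: measurable_int iaf.
  - by move=> t _; rewrite lee_fin mulr_ge0// addr_ge0.
  - exact: measurable_int iG.
  - exists [set t0]; split => // t /=; apply: contra_notP => /eqP tn ht.
    by rewrite lee_fin; apply: bnd => //; move: ht; rewrite in_itv.
rewrite RintegralZl//; apply: ler_wpM2l => //; rewrite RintegralD//; apply: lerD; last exact: hM.
by rewrite Rintegral_cst//= lebesgue_measure_itv/= lte_fin p0 -EFinB subr0.
Qed.

Lemma integrable_bounded (f : R -> R) (C : R) : measurable_fun setT f ->
  (forall y, 0 < y < b -> `|f y| <= C) -> m.-integrable setT (EFin \o f).
Proof.
move=> mf hC; have C0 : 0 <= C by apply: le_trans (hC (b / 2) _) => //; apply/andP; split; move: b0; lra.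
have mE : measurable_fun setT (EFin \o f) by exact/measurable_EFinP.
apply/integrableP; split => //.
apply: (@le_lt_trans _ _ (\int[m]_y C%:E)%E); last by rewrite m_cst ltry.
apply: ae_ge0_le_integral => //; first by apply: measurableT_comp.
by apply: (m_ae_in m b psi dens) => y hy _; rewrite /= lee_fin; exact: hC.
Qed.

(** Suppose [psi >= A] near [b] and compare the effective potential at [b] and at [b + ep]. The
    first logarithmic term gains at least [ln 2] times the mass of an interval of length [ep / 2],
    the second one does not decrease, and [V] grows by at most [(V'(b) + 1) ep]. For [A] large the
    inequality fails at [b + ep]. *)
Lemma density_bounded_at_b : exists A : R, forall d : R, 0 < d ->
  exists2 y, b - d < y < b & psi y < A.
Proof.
have [g [gE gb cg]] := real_slope _ _ _ (dV _ b0).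
(* Chosen so that [ln 2 * A * (ep / 2) = (|V'(b)| + 2) ep], strictly more than the growth of [V]. *)
pose A := 2 * (`|V1 b| + 2) / ln 2.
have ln2 : 0 < ln (2 : R) by rewrite ln_gt0// ltr1n.
exists A => d d0; apply: contrapT => H.
have big y : b - d < y < b -> A <= psi y.
  by move=> hy; rewrite leNgt; apply/negP => h; apply: H; exists y.
have V1lt : V1 b < V1 b + 1 by lra.
have cg' : g @ b --> V1 b by rewrite -gb.
have /= := cvgr_lt _ cg' _ V1lt => -[e /= e0 he].
pose ep := Num.min (Num.min (d / 2) (b / 2)) (e / 2).
have ep0 : 0 < ep by rewrite !lt_min; apply/andP; split; [apply/andP; split|]; apply: divr_gt0.
have ep1 : ep <= d / 2 by rewrite /ep !ge_min lexx.
have ep2 : ep <= b / 2 by rewrite /ep !ge_min lexx orbT.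
have ep3 : ep <= e / 2 by rewrite /ep !ge_min lexx orbT.
have Vle : V (b + ep) - V b <= (V1 b + 1) * ep.
  have := gE (b + ep); rewrite addrAC subrr add0r => ->; rewrite addrAC subrr add0r.
  rewrite ler_pM2r//; apply/ltW/he => /=; rewrite opprD addrA subrr sub0r normrN gtr0_norm//; lra.
have hb : 0 <= b <= b by rewrite lexx ltW.
have [i1 i2] := eff_split theta c m V l0 EL b hb.
have b1 : 0 <= b + ep by rewrite addr_ge0 ?ltW.
have mln x : measurable_fun setT (fun y : R => ln `|x - y|).
  apply: measurableT_comp; first exact: measurable_ln.
  by apply: measurableT_comp => //; apply: measurable_funB => //; exact: measurable_cst.
have mpw x : measurable_fun setT (fun y : R => ln `|x - y `^ theta|).
  apply: measurableT_comp; first exact: measurable_ln.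
  apply: measurableT_comp => //; apply: measurable_funB; first exact: measurable_cst.
  exact: measurable_powR.
have j1 : m.-integrable setT (EFin \o (fun y => ln `|b + ep - y|)).
  apply: (integrable_bounded _ (`|ln ep| + `|ln (b + ep)|)) => // y /andP[y1 y2].
  have by0 : 0 < b - y by rewrite subr_gt0.
  by apply: norm_ln_le => //; rewrite gtr0_norm; move: by0 ep0 y1; lra.
have pwb : b `^ theta < (b + ep) `^ theta by apply: gt0_ltr_powR => //; rewrite ?nnegrE ?ltW//; lra.
have pwy y : 0 < y < b -> 0 <= y `^ theta /\ y `^ theta < b `^ theta.
  move=> /andP[y1 y2]; split; first exact: powR_ge0.
  by apply: gt0_ltr_powR => //; rewrite ?nnegrE ?ltW.
have j2 : m.-integrable setT (EFin \o (fun y => ln `|(b + ep) `^ theta - y `^ theta|)).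
  apply: (integrable_bounded _ (`|ln ((b + ep) `^ theta - b `^ theta)| + `|ln ((b + ep) `^ theta)|)) => // y hy.
  have [q1 q2] := pwy y hy; apply: norm_ln_le; rewrite ?gtr0_norm; move: q1 q2 pwb; lra.
have inI y : I0b y -> 0 < y < b by rewrite /= in_itv.
have mI : measurable I0b by [].
have mle (f g1 : R -> R) : m.-integrable setT (EFin \o f) -> m.-integrable setT (EFin \o g1) ->
    (forall y, 0 < y < b -> f y <= g1 y) -> \int[m]_y f y <= \int[m]_y g1 y.
  move=> k1 k2 h; rewrite (m_restrict _ _ _ _ dens f k1) (m_restrict _ _ _ _ dens g1 k2).
  by apply: le_Rintegral => //; [exact: integrableS k1|exact: integrableS k2].
have : \int[m]_y ln `|b `^ theta - y `^ theta| <= \int[m]_y ln `|(b + ep) `^ theta - y `^ theta|.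
  apply: mle => // y hy.
  have [q1 q2] := pwy y hy.
  by apply: ln_norm_mono; [rewrite subr_gt0|rewrite lerD2r ltW].
(* The interval stops short of [b] because [psi] is controlled only on compact parts of the open
   interval. *)
pose B := `[b - ep, b - ep / 2]%classic : set R.
have mB : measurable B by exact: measurable_itv.
have iB : m.-integrable setT (EFin \o (fun y => ln 2 * \1_B y)).
  apply: (integrable_bounded _ (ln 2)); first by apply: measurable_funM => //; exact: measurable_indic.
  by move=> y _; rewrite normrM gtr0_norm// indicE; case: (_ \in _); rewrite ?normr1 ?normr0 ?mulr1 ?mulr0// ltW.
(* On [B] one has [b - y <= ep], so moving from [b] to [b + ep] at least doubles the distance to
   [y]; elsewhere the distance still increases. *)
have : \int[m]_y ln `|b - y| + \int[m]_y (ln 2 * \1_B y) <= \int[m]_y ln `|b + ep - y|.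
  rewrite -RintegralD//; apply: mle => //.
    exact: (@integrableD _ _ _ m setT _ (fun y => (ln `|b - y|)%:E) (fun y => (ln 2 * \1_B y)%:E)).
  move=> y /andP[y1 y2]; have by0 : 0 < b - y by rewrite subr_gt0.
  have le_by : b - y <= b + ep - y by rewrite lerD2r lerDl ltW.
  rewrite indicE; case: (boolP (y \in B)) => [|_]; last by rewrite mulr0 addr0; exact: ln_norm_mono.
  rewrite inE /B /= in_itv/= => /andP[y3 y4]; rewrite mulr1 (gtr0_norm by0) -lnM ?posrE//.
  rewrite gtr0_norm; last exact: lt_le_trans le_by.
  rewrite ler_ln ?posrE ?mulr_gt0//; last exact: lt_le_trans le_by.
  by move: y3; lra.
have g3 : \int[m]_y (ln 2 * \1_B y) = ln 2 * fine (m B).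
  rewrite RintegralZl//; last first.
    apply: (integrable_bounded _ 1); first exact: measurable_indic.
    by move=> y _; rewrite indicE; case: (_ \in _); rewrite ?normr1 ?normr0.
  by rewrite /Rintegral integral_indic// setIT.
have g4 : A * (ep / 2) <= fine (m B).
  rewrite -lee_fin fineK; last exact: fin_num_measure.
  have -> : A * (ep / 2) = A * ((b - ep / 2) - (b - ep)) by field.
  apply: (m_itv_ge m b psi cpsi dens); try by move: ep0 ep2 b0; lra.
  by move=> y /andP[y1 y2]; apply: big; apply/andP; split; move: y1 y2 ep0 ep1 d0; lra.
have g5 : ln 2 * (A * (ep / 2)) = (`|V1 b| + 2) * ep by rewrite /A; field; rewrite gt_eqF.
have g6 : (`|V1 b| + 2) * ep <= ln 2 * fine (m B) by rewrite -g5 ler_pM2l.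
have g7 : (V1 b + 1) * ep < (`|V1 b| + 2) * ep by rewrite ltr_pM2r//; have := ler_norm (V1 b); lra.
have ELb : \int[m]_y ln `|b + ep - y| + \int[m]_y ln `|(b + ep) `^ theta - y `^ theta| - V (b + ep) <= l0.
  move: (ELle (b + ep) b1) (integrable_fin_num measurableT j1) (integrable_fin_num measurableT j2).
  rewrite /effpot /Rintegral /=.
  move: (\int[m]_y (ln `|b + ep - y|)%:E)%E (\int[m]_y (ln `|(b + ep) `^ theta - y `^ theta|)%:E)%E.
  by move=> [r1| |] [r2| |] //= h _ _; rewrite -lee_fin.
move: ELb g3 g6 g7 Vle.
move: (Rintegral _ _ _) (Rintegral _ _ _) (Rintegral _ _ _) (Rintegral _ _ _) (Rintegral _ _ _) => x1 x2 x3 x4 x5.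
move: (_ * fine _) (_ * ep) (_ * ep) => x6 x7 x8; lra.
Qed.

Lemma int_ZZ : IZ = (1 + theta) * pi.
Proof.
have [M M0 hM] := ZZd_Nk_bound.
suff B0 : (1 + a) * pi - a * IZ = 0.
  have : theta * ((1 + a) * pi - a * IZ) = 0 by rewrite B0 mulr0.
  have -> : theta * ((1 + a) * pi - a * IZ) = (theta * a) * pi + theta * pi - theta * a * IZ by ring.
  by rewrite mulfV ?gt_eqF// !mul1r => e; lra.
set B := _ - _.
have Id t0 : 0 < t0 < pi -> `|2 * pi ^+ 2 * (yy t0 * psi (yy t0)) - 2 * qk (ss t0) * B| <= M.
  by move=> h; rewrite density_identity// addrK normrN hM.
have yI t0 : 0 < t0 < pi -> 0 < yy t0 < b.
  move=> /andP[h1 h2]; apply/andP; split; first by apply: yy_gt0 => //; rewrite ltW.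
  by rewrite -(yy0 _ c th1); apply: yy_decr => //; exact: ltW.
have pp0 : 0 < 2 * pi ^+ 2 :> R by rewrite mulr_gt0// exprn_gt0.
apply/eqP; case: (ltgtP B 0) => // sB; exfalso.
  have [d /andP[d0 dp] hd] := qk_large ((M + 1) / (- 2 * B)).
  have hd2 : 0 < d / 2 < d by apply/andP; split; lra.
  have hdp : 0 < d / 2 < pi by apply/andP; split; lra.
  have := Id _ hdp; rewrite ler_norml => /andP[k1 _].
  have := hd _ hd2; rewrite ler_pdivrMr; last by lra.
  have y0 := yI _ hdp; have /andP[y1 y2] := y0.
  have h0 : 0 <= 2 * pi ^+ 2 * (yy (d / 2) * psi (yy (d / 2))).
    apply: mulr_ge0; first exact: ltW.
    by apply: mulr_ge0; [exact: ltW|exact: (psi_ge0 m b psi cpsi dens)].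
  have := Id _ hdp; rewrite ler_norml => /andP[_ k2].
  move: h0 k2; move: (2 * pi ^+ 2 * _) (qk _) => P Q h0 k2; nra.
have [A hA] := density_bounded_at_b.
(* This threshold absorbs the remainder [M] and still leaves [2 pi^2 b (|A| + 1)], more than
   [psi < A] allows at a point of [(0, b)]. *)
have [d /andP[d0 dp] hd] := qk_large ((M + 2 * pi ^+ 2 * (b * (`|A| + 1))) / (2 * B)).
pose d' := d / 2.
have d'I : 0 < d' < pi by rewrite /d'; apply/andP; split; lra.
have /andP[e1 e2] := yI _ d'I.
have dd : 0 < b - yy d' by lra.
have [y /andP[y1 y2] yA] := hA _ dd.
have y1' : yy d' < y by lra.
have hy : 0 <= y <= b by apply/andP; split; lra.
have [t ht tE] := yy_surj _ _ th1 c0 y hy.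
have td : 0 < t < d'.
  apply/andP; split.
    have /andP[] := ht; rewrite le_eqVlt => /predU1P[e _|//].
    by move: y2; rewrite -tE -e yy0// ltxx.
  rewrite ltNge; apply/negP; rewrite le_eqVlt => /predU1P[e|e].
    by move: y1'; rewrite -tE e ltxx.
  have /andP[_ tp] := ht; have := yy_decr _ _ th1 c0 d' t _ e tp.
  by rewrite tE => /(_ (ltW (andP d'I).1)); lra.
have tI : 0 < t < pi by rewrite /d' in td; apply/andP; split; lra.
have tdd : 0 < t < d by rewrite /d' in td; apply/andP; split; lra.
have := hd _ tdd; rewrite ler_pdivrMr; last by lra.
have := Id _ tI; rewrite ler_norml tE => /andP[k1 _].
have hb : 2 * pi ^+ 2 * (y * psi y) < 2 * pi ^+ 2 * (b * (`|A| + 1)).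
  rewrite ltr_pM2l//; apply: (@le_lt_trans _ _ (y * `|A|)).
    by rewrite ler_pM2l; [have := ler_norm A; lra|lra].
  have A0 := normr_ge0 A; nra.
by move: k1 hb; lra.
Qed.

Lemma density_formula t0 : 0 < t0 < pi ->
  2 * pi ^+ 2 * (yy t0 * psi (yy t0)) =
  - (\int[mu]_(t in `[0, pi]) (ZZd t * Nk (ss t0) t)).
Proof.
move=> ht; rewrite density_identity// int_ZZ.
have -> : (1 + a) * pi - a * ((1 + theta) * pi) = 0 by field; rewrite gt_eqF.
by rewrite mulr0 addr0.
Qed.

End Limit.

(** * From the angle back to the variable y *)

Section ChangeOfVariables.
Context {R : realType} (theta c : R) (th1 : 1 < theta) (c0 : 0 < c).
Local Notation J := (Jc theta c).
Local Notation Jq := (Jq theta c).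
Local Notation ss := (ss theta).
Local Notation yy := (yy theta c).
Local Notation yd := (yd theta c).
Local Notation b := (bb theta c).
Local Notation Nk := (Nk theta).
Local Notation mu := (@lebesgue_measure R).
Implicit Types (t u x y : R) (s z : R[i]).

Let p0 : 0 < (pi : R) := pi_gt0 R.
Let b0 : 0 < b := bb_gt0 _ _ th1 c0.
Let pI : 0 <= (pi : R) <= pi. Proof. by rewrite lexx ltW. Qed.

(* [J] vanishes at [-1] to order [1 + 1/theta > 1], so it is still
   differentiable there although its argument lies on the branch cut. *)
Lemma is_derive_yy_pi : is_derive (pi : R) (1 : R) yy (yd pi).
Proof.
have m1 : -1 != 0 :> R[i] by rewrite oppr_eq0 oner_eq0.
have uJ : ucont Jq (-1) by apply: ucont_Jq => //; right.
have J1 : J (-1) = 0 by rewrite J_Jq addNr mul0r.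
have Jq1 : Jq (-1) = 0.
  rewrite /Jq addNr mul0r /cpow eqxx mulr0//.
have cJ : chol J (ss pi) (Jq (-1)).
  rewrite ss_pi//; exists Jq; split => // z; rewrite J1 add0r J_Jq opprK mulrC//.
have [h _] := chol_path _ _ _ _ _ cJ (pder_ss _ th1 _ pI).
apply: rder_eq h; rewrite /yd /Jd ss_pi// Jq1 !mul0r//.
Qed.

Lemma is_derive_yy' t : 0 <= t <= pi -> is_derive t (1 : R) yy (yd t).
Proof.
move=> /andP[h1]; rewrite le_eqVlt => /predU1P[->|h2]; first exact: is_derive_yy_pi.
by apply: is_derive_yy => //; rewrite h1.
Qed.

Lemma substitution_yy (G : R -> R) : {within `[0, b], continuous G} ->
  (\int[mu]_(y in `[0%R, b]) (G y)%:E = \int[mu]_(t in `[0%R, pi]) (G (yy t) * - yd t)%:E)%E.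
Proof.
move=> cG; have dE t : 0 <= t <= pi -> derive1 yy t = yd t.
  by move=> /is_derive_yy' h; rewrite derive1E; exact: (@derive_val _ _ _ _ _ _ _ h).
have oo t : t \in `]0, pi[ -> 0 <= t <= pi by rewrite in_itv/= => /andP[h1 h2]; rewrite !ltW.
have h00 : 0 <= (0 : R) <= pi by rewrite lexx ltW.
have near_oo (t : R) : 0 < t < pi -> \forall u \near t, 0 < u < pi.
  move=> /andP[h1 h2]; near=> u; apply/andP; split; near: u.
    exact: lt_nbhsr.
  exact: lt_nbhsl.
have cvgd (F : set_system R) (FF : Filter F) (t : R) : 0 <= t <= pi -> F --> t ->
    (\forall u \near F, 0 <= u <= pi) -> derive1 yy @ F --> yd t.
  move=> ht Ft hF; have : yd @ F --> yd t by exact: (cvg_comp _ _ Ft (continuous_yd _ c th1 t ht)).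
  apply: cvg_trans; apply: near_eq_cvg.
  by apply: filterS hF => u hu; rewrite dE.
have := @integration_by_substitution_decreasing R yy G 0 pi (ltW p0).
rewrite yypi// yy0// => ->//.
- by apply: eq_integral => t; rewrite inE/= in_itv/= => ht; rewrite -(dE t ht).
- move=> t u; rewrite !in_itv/= => /andP[h1 h2] /andP[h3 h4] tu; exact: yy_decr.
- move=> t /[dup] /oo ht; rewrite in_itv/= => tI; rewrite /continuous_at (dE t ht); apply: cvgd => //.
  by apply: filterS (near_oo t tI) => u /andP[k1 k2]; rewrite !ltW.
- apply/cvg_ex; exists (yd 0); apply: cvgd => //; first exact: cvg_within.
  near=> u; apply/andP; split; apply/ltW; near: u; [exact: nbhs_right_gt|exact: nbhs_right_lt].
- apply/cvg_ex; exists (yd pi); apply: cvgd => //; first exact: cvg_within.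
  near=> u; apply/andP; split; apply/ltW; near: u; [exact: nbhs_left_gt|exact: nbhs_left_lt].
- split.
  + by move=> t /oo /is_derive_yy' h; exact: (@ex_derive _ _ _ _ _ _ _ h).
  + by apply: cvg_at_right_filter; exact: continuous_yy.
  + by apply: cvg_at_left_filter; exact: continuous_yy.
Unshelve. all: by end_near. Qed.

Context (tau : R -> R) (tauP : forall y, 0 <= y <= b -> 0 <= tau y <= pi /\ yy (tau y) = y).

Lemma tauK t : 0 <= t <= pi -> tau (yy t) = t.
Proof.
move=> ht; have [h1 h2] := tauP _ (yy_range _ _ th1 c0 t ht).
exact: (yy_inj _ _ th1 c0).
Qed.

Lemma within_tau (f : R -> R) : (forall t, 0 <= t <= pi -> {for t, continuous f}) ->
  {within `[0, b], continuous (fun y => f (tau y))}.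
Proof.
move=> cf; have ct : {within `[0, b], continuous tau}.
  rewrite -(yypi _ c th1) -(yy0 _ c th1); apply: segment_can_ge_continuous; first exact: ltW.
    by apply: within_cont => t ht; exact: continuous_yy.
  by move=> t; rewrite in_itv/=; exact: tauK.
apply/subspace_continuousP => y yI; move/subspace_continuousP : ct => /(_ y yI) ct.
have hy : 0 <= y <= b by move: yI; rewrite /= in_itv.
have [h1 _] := tauP y hy.
exact: (cvg_comp _ _ ct (cf _ h1)).
Qed.

Context (V1 V2 : R -> R) (cV1 : continuous V1) (cV2 : continuous V2).
Local Notation ZZd := (ZZd theta c V1 V2).
Let hz y := V2 y * y + V1 y.

Lemma continuous_hz : continuous hz.
Proof.
move=> y; apply: (@cvgD _ _ _ (nbhs y)); last exact: cV1.
by apply: cvgM; [exact: cV2|exact: cvg_id].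
Qed.

Context (t0 : R) (t0I : 0 < t0 < pi).
Let s0 := ss t0.
Let x := yy t0.
Let ht0 : 0 <= t0 <= pi. Proof. by have /andP[h1 h2] := t0I; rewrite !ltW. Qed.

(** A regularization of [Nk s0], continuous across [t0]: substitution is applied to a continuous
    integrand, and then [e] tends to 0. *)
Definition Ne (e : R) t : R := ln (cabs (ss t - cconj s0)) - ln (cabs (ss t - s0) ^+ 2 + e ^+ 2) / 2.

Let Is0 : 0 < Im s0. Proof. exact: Im_ss_gt0. Qed.

Let nc t : 0 <= t <= pi -> 0 < cabs (ss t - cconj s0).
Proof.
move=> ht; rewrite cabs_gt0; apply: slit_Re_neq; right.
by rewrite ImB ImJ opprK gt_eqF// ltr_wpDl ?Im_ss_ge0 ?Is0.
Qed.

Let nd t : 0 <= t <= pi -> t != t0 -> 0 < cabs (ss t - s0).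
Proof.
move=> ht tn; rewrite cabs_gt0 subr_eq0; apply: contra tn => /eqP e; apply/eqP.
by apply: (yy_inj _ _ th1 c0) => //; rewrite /yy e.
Qed.

Let den (e d : R) : 0 < e -> 0 < d ^+ 2 + e ^+ 2.
Proof. by move=> e0; rewrite ltr_wpDl ?sqr_ge0// exprn_gt0. Qed.

Lemma Ne_cont e t : 0 < e -> 0 <= t <= pi -> {for t, continuous (Ne e)}.
Proof.
move=> e0 ht; have c1 z : (fun u => cabs (ss u - z)) @ nbhs t --> cabs (ss t - z).
  by apply: ccvg_cabs; apply: ccvgB; [exact: ccvg_ss|exact: ccvg_cst].
apply: (@cvgB _ _ _ (nbhs t)).
  exact: (cvg_comp _ _ (c1 (cconj s0)) (continuous_ln (nc t ht))).
apply: cvgM; last exact: cvg_cst.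
have c2 : (fun u => cabs (ss u - s0) ^+ 2 + e ^+ 2) @ nbhs t --> cabs (ss t - s0) ^+ 2 + e ^+ 2.
  apply: cvgD; last exact: cvg_cst.
  by rewrite expr2; under eq_fun do rewrite expr2; apply: cvgM; exact: c1.
exact: (cvg_comp _ _ c2 (continuous_ln (den e _ e0))).
Qed.

Let ln_sqr (d : R) : 0 < d -> ln d = ln (d ^+ 2) / 2.
Proof. by move=> d0; rewrite lnXn// mulr2n; field. Qed.

Lemma Ne_le e t : 0 < e -> 0 <= t <= pi -> t != t0 -> Ne e t <= Nk s0 t.
Proof.
move=> e0 ht tn; have d0 := nd t ht tn; rewrite /Ne /Nk lerD2l lerN2 [leLHS]ln_sqr//.
rewrite ler_pM2r ?invr_gt0// ler_ln ?posrE ?den ?exprn_gt0//.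
by rewrite lerDl sqr_ge0.
Qed.

Lemma Ne_ge : exists2 C : R, 0 <= C & forall e t, 0 < e <= 1 -> 0 <= t <= pi -> - C <= Ne e t.
Proof.
have [M M0 hM] := ccvg_rr_max _ th1.
exists (`|ln (Im s0)| + `|ln ((2 * M) ^+ 2 + 1) / 2|); first by rewrite addr_ge0.
move=> e t /andP[e0 e1] ht.
have h1 : ln (Im s0) <= ln (cabs (ss t - cconj s0)).
  rewrite ler_ln ?posrE ?nc//; apply: le_trans (normIm_le _).
  rewrite ImB ImJ opprK; apply: le_trans (ler_norm _).
  by rewrite lerDr Im_ss_ge0.
have h2 : ln (cabs (ss t - s0) ^+ 2 + e ^+ 2) / 2 <= ln ((2 * M) ^+ 2 + 1) / 2.
  have D : cabs (ss t - s0) <= 2 * M.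
    apply: (le_trans (cabsD_le _ _)); rewrite cabsN !cabs_ss//.
    by have := hM t ht; have := hM t0 ht0; lra.
  rewrite ler_pM2r ?invr_gt0// ler_ln ?posrE ?den//; last by rewrite ltr_wpDl ?sqr_ge0.
  apply: lerD; last by rewrite expr_le1// ltW.
  by rewrite lerXn2r ?nnegrE ?cabs_ge0// mulr_ge0// ltW.
have := ler_norm (- ln (Im s0)); have := ler_norm (ln ((2 * M) ^+ 2 + 1) / 2); rewrite normrN.
rewrite /Ne; move: h1 h2; lra.
Qed.

Lemma Ne_lim t (e_ : nat -> R) : (forall n, 0 < e_ n) -> e_ @ \oo --> (0 : R) -> 0 <= t <= pi -> t != t0 ->
  (fun n => Ne (e_ n) t) @ \oo --> Nk s0 t.
Proof.
move=> e0 ce ht tn; have d0 := nd t ht tn; rewrite /Ne /Nk.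
apply: cvgB; first exact: cvg_cst.
rewrite [X in _ --> X]ln_sqr//; apply: cvgM; last exact: cvg_cst.
have d2 : 0 < cabs (ss t - s0) ^+ 2 by rewrite exprn_gt0.
have c2 : (fun n => cabs (ss t - s0) ^+ 2 + e_ n ^+ 2) @ \oo --> cabs (ss t - s0) ^+ 2.
  rewrite -[X in _ --> X]addr0; apply: cvgD; first exact: cvg_cst.
  by rewrite -(mulr0 (0 : R)); under eq_fun do rewrite expr2; exact: cvgM.
exact: (cvg_comp _ _ c2 (continuous_ln d2)).
Qed.

Context (Ip : R -> R[i]) (IpE : forall y, 0 <= y <= b -> Ip y = ss (tau y)).
Let h y := hz y * ln (cabs ((Ip y - cconj (Ip x)) / (Ip y - Ip x))).

(** Substitution holds for each regularized integrand, and both sides pass to the limit. In the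
    angle an explicit logarithm dominates; in [y] the majorant is first shown integrable by Fatou,
    its approximations being bounded through the angle integral. *)
Lemma density_integral : mu.-integrable `[0, b] (EFin \o h) /\
  \int[mu]_(y in `[0, b]) h y = - (\int[mu]_(t in `[0, pi]) (ZZd t * Nk s0 t)).
Proof.
have xI : 0 <= x <= b by exact: yy_range.
have tx : tau x = t0 by exact: tauK.
(* At [y = x] the quotient has denominator 0; the default values of inverse and logarithm make the
   integrand 0 there. *)
have hx : h x = 0 by rewrite /h subrr invr0 mulr0 cabs0 ln0 ?mulr0.
have tau_neq y : 0 <= y <= b -> y != x -> tau y != t0.
  by move=> hy; apply: contra => /eqP e; rewrite -(tauP y hy).2 e.
have hE y : 0 <= y <= b -> y != x -> h y = hz y * Nk s0 (tau y).
  move=> hy yx; have [k1 k2] := tauP y hy; rewrite /h !IpE// tx -/s0 /Nk.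
  rewrite cabsM cabsV lnM ?posrE ?invr_gt0 ?nc ?nd ?tau_neq// lnV// posrE nd// tau_neq//.
have [C C0 hC] := Ne_ge; have [C1 C10 hC1] := Nk_bound _ th1.
have hN t : 0 <= t <= pi -> t != t0 -> 0 <= Nk s0 t <= C1 + `|ln `|t - t0| |.
  move=> ht tn; have hl : 1 <= (1 : R) <= 2 by rewrite lexx ler1n.
  by have := hC1 _ _ _ hl ht0 ht tn; rewrite zz1.
have [Mz Mz0 hMz] : exists2 Mz : R, 0 <= Mz & forall t, 0 <= t <= pi -> `|ZZd t| <= Mz.
  by apply: seg_bound => [|t ht]; [exact: ltW|exact: continuous_ZZd].
pose e n : R := n.+1%:R^-1.
have e0 n : 0 < e n by rewrite invr_gt0.
have e1 n : 0 < e n <= 1 by rewrite e0 invf_le1// ler1n.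
have ce : e @ \oo --> (0 : R) by exact: cvg_harmonic.
have cGn n : {within `[0, b], continuous (fun y => hz y * Ne (e n) (tau y))}.
  have h1 := within_tau _ (Ne_cont (e n) ^~ (e0 n)).
  apply/subspace_continuousP => y yI; move/subspace_continuousP : h1 => /(_ y yI) h1.
  apply: cvgM => //; apply: cvg_within_filter; exact: continuous_hz.
have cFn n : {within `[0, b], continuous (fun y => `|hz y| * (Ne (e n) (tau y) + C))}.
  have h1 := within_tau _ (Ne_cont (e n) ^~ (e0 n)).
  apply/subspace_continuousP => y yI; move/subspace_continuousP : h1 => /(_ y yI) h1.
  apply: cvgM; last by apply: cvgD => //; exact: cvg_cst.
  by apply: cvg_norm; apply: cvg_within_filter; exact: continuous_hz.
have inb y : `[0, b]%classic y -> 0 <= y <= b by rewrite /= in_itv.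
have inp (t : R) : `[0, pi]%classic t -> 0 <= t <= pi by rewrite /= in_itv.
(* Removing the point [x] makes the approximations agree with the default value of the integrand
   there, so that they converge at every [y]. *)
pose I y : R := \1_[set~ x] y.
have I1 y : y != x -> I y = 1 by move=> yx; rewrite /I indicE mem_set//; apply/eqP.
have I0 : I x = 0 by rewrite /I indicE memNset//=; exact.
have mI (D : set R) : measurable_fun D I by apply: measurable_indic; apply: measurableC.
have mh : measurable_fun `[0, b] hz.
  by apply: subspace_continuous_measurable_fun => //; apply: within_cont => y _; exact: continuous_hz.
have mN : measurable_fun `[0, b] (fun y => Nk s0 (tau y)).
  have k z : measurable_fun `[0, b] (fun y => ln (cabs (ss (tau y) - z))).
    apply: measurableT_comp; first exact: measurable_ln.
    apply: subspace_continuous_measurable_fun => //.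
    apply: (within_tau (fun t => cabs (ss t - z))) => t ht.
    by apply: ccvg_cabs; apply: ccvgB; [exact: ccvg_ss|exact: ccvg_cst].
  exact: measurable_funB.
(* The shift by [C] makes the approximations nonnegative, as Fatou requires. Their limit [f]
   dominates [h] and its regularizations off [x], since [- C <= Ne <= Nk]. *)
pose f_ n y := `|hz y| * (Ne (e n) (tau y) + C) * I y.
pose f y := `|hz y| * (Nk s0 (tau y) + C) * I y.
have Ig0 y : 0 <= I y by rewrite /I indicE; case: (_ \in _).
have Il1 y : I y <= 1 by rewrite /I indicE; case: (_ \in _).
have Nec n t : 0 <= t <= pi -> 0 <= Ne (e n) t + C.
  by move=> ht; have := hC _ _ (e1 n) ht; lra.
have f0 y : 0 <= y <= b -> 0 <= f y.
  move=> hy; rewrite /f; have [->|yx] := eqVneq y x; first by rewrite I0 mulr0.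
  rewrite !mulr_ge0// addr_ge0//; have [k1 k2] := tauP y hy.
  by have /andP[] := hN _ k1 (tau_neq _ hy yx).
pose gt t := Mz * (C1 + C + `|ln `|t - t0| |).
have igt : mu.-integrable `[0, pi] (EFin \o gt).
  have -> : EFin \o gt = (fun t => Mz%:E * ((C1 + C)%:E + (`|ln `|t - t0| |)%:E))%E.
    by apply/funext => t /=; rewrite /gt EFinM EFinD.
  apply: integrableZl => //; apply: integrableD => //.
    by apply: (@integrable_itv _ (fun=> C1 + C)) => t _; exact: cvg_cst.
  exact: integrable_abse (integrable_ln_dist t0 0 pi).
have n0 : mu [set t0] = 0%E by apply: countable_lebesgue_measure0; exact: countable1.
have nx : mu [set x] = 0%E by apply: countable_lebesgue_measure0; exact: countable1.
have mf_ n : measurable_fun `[0, b] (f_ n).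
  by apply: measurable_funM => //; apply: subspace_continuous_measurable_fun => //; exact: cFn.
have fbound n : (\int[mu]_(y in `[0%R, b]) (f_ n y)%:E <= (\int[mu]_(t in `[0, pi]) gt t)%:E)%E.
  have cont1 t : 0 <= t <= pi -> {for t, continuous (fun t => `|hz (yy t)| * (Ne (e n) t + C) * - yd t)}.
    move=> ht; apply: (@cvgM _ _ (nbhs t)); last by apply: cvgN; exact: continuous_yd.
    apply: cvgM; last by apply: cvgD; [exact: Ne_cont|exact: cvg_cst].
    by apply: cvg_norm; apply: cont_yy_comp => //; exact: continuous_hz.
  apply: (@le_trans _ _ (\int[mu]_(y in `[0%R, b]) (`|hz y| * (Ne (e n) (tau y) + C))%:E)%E).
    have mF : measurable_fun `[0, b] (fun y => `|hz y| * (Ne (e n) (tau y) + C)).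
      by apply: subspace_continuous_measurable_fun => //; exact: cFn.
    apply: ge0_le_integral => //.
    - move=> y /inb hy; rewrite lee_fin /f_ !mulr_ge0// Nec//; exact: (tauP y hy).1.
    - by apply/measurable_EFinP; exact: mf_.
    - exact/measurable_EFinP.
    - move=> y /inb hy; rewrite lee_fin /f_ -[leRHS]mulr1; apply: ler_wpM2l => //.
      by rewrite mulr_ge0// Nec//; exact: (tauP y hy).1.
  rewrite substitution_yy// fineK; last exact: (integrable_fin_num _ igt).
  have E1 t : 0 <= t <= pi -> `|hz (yy t)| * (Ne (e n) (tau (yy t)) + C) * - yd t = `|ZZd t| * (Ne (e n) t + C).
    (* The velocity is negative inside; at the ends it vanishes, because [1/theta] is critical and
       [J (s) / (s + 1)] is 0 at [-1]. *)
    move=> ht; rewrite tauK// /ZZd -/(hz _) normrM; have yd0 : yd t <= 0.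
      case: (t_cases _ ht) => [->|->|/(yd_lt0 _ _ th1 c0)/ltW//].
        have := @derive_val _ _ _ _ _ _ _ (is_derive_yy' 0 _) => _.
        by rewrite /yd /Jd ss0// subrr mulr0 !mul0r.
      rewrite /yd /Jd ss_pi// /Jq addNr mul0r /cpow eqxx mulr0 !mul0r//.
    by rewrite (ler0_norm yd0); ring.
  apply: (@le_trans _ _ (\int[mu]_(t in `[0%R, pi]) (`|ZZd t| * (Ne (e n) t + C))%:E)%E).
    rewrite le_eqVlt; apply/orP; left; apply/eqP; apply: eq_integral => t.
    by rewrite inE => /inp ht; rewrite E1.
  apply: ae_ge0_le_integral => //.
  - by move=> t /inp ht; rewrite lee_fin mulr_ge0// Nec.
  - apply/measurable_EFinP; apply: subspace_continuous_measurable_fun => //; apply: within_cont => t ht.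
    apply: (@cvgM _ _ (nbhs t)); first by apply: cvg_norm; exact: continuous_ZZd.
    by apply: cvgD; [exact: Ne_cont|exact: cvg_cst].
  - by move=> t _; rewrite lee_fin mulr_ge0// !addr_ge0.
  - exact: measurable_int igt.
  - exists [set t0]; split => // t /=; apply: contra_notP => /eqP tn /inp ht; rewrite lee_fin.
    apply: ler_pM => //; [exact: Nec|exact: hMz|].
    by have := Ne_le _ _ (e0 n) ht tn; have /andP[_] := hN _ ht tn; lra.
have mf : measurable_fun `[0, b] f.
  apply: measurable_funM => //; apply: measurable_funM; first exact: measurableT_comp.
  by apply: measurable_funD => //; exact: measurable_cst.
have flim y : 0 <= y <= b -> f_ ^~ y @ \oo --> f y.
  move=> hy; rewrite /f_ /f; have [->|yx] := eqVneq y x.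
    by under eq_fun do rewrite I0 mulr0; rewrite I0 mulr0; exact: cvg_cst.
  have [k1 k2] := tauP y hy.
  apply: cvgM; last exact: cvg_cst.
  apply: cvgM; first exact: cvg_cst.
  by apply: cvgD; [apply: Ne_lim => //; exact: tau_neq|exact: cvg_cst].
have [if_ _] : mu.-integrable `[0, b] (EFin \o f) /\ (\int[mu]_(y in `[0%R, b]) (f y)%:E <= (\int[mu]_(t in `[0, pi]) gt t)%:E)%E.
  apply: (@fatou_integrable _ _ _ mu _ f_) => //.
  - move=> n y /inb hy; rewrite /f_ !mulr_ge0// Nec//; exact: (tauP y hy).1.
  - move=> y /inb hy; have hc : (fun n => (f_ n y)%:E) @ \oo --> (f y)%:E by apply: (cvg_comp _ _ (flim y hy)).
    by rewrite (cvg_limn_einf_sup hc).1.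
have mhh : measurable_fun `[0, b] h.
  have -> : h = fun y => hz y * ln (cabs ((Ip y - cconj (Ip x)) / (Ip y - Ip x))) by [].
  apply: (eq_measurable_fun (fun y => hz y * Nk s0 (tau y) * I y)).
    move=> y; rewrite inE => /inb hy; have [->|yx] := eqVneq y x; first by rewrite -/(h x) hx I0 mulr0.
    by rewrite -/(h y) hE// I1// mulr1.
  by apply: measurable_funM => //; apply: measurable_funM.
have hf y : 0 <= y <= b -> `|h y| <= f y.
  move=> hy; have [->|yx] := eqVneq y x; first by rewrite hx normr0 f0.
  have [k1 k2] := tauP y hy; have /andP[k3 _] := hN _ k1 (tau_neq _ hy yx).
  by rewrite hE// /f I1// mulr1 normrM (ger0_norm k3); apply: ler_wpM2l => //; rewrite lerDl.
have [ih ch] : mu.-integrable `[0, b] (EFin \o h) /\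
   (fun n => \int[mu]_(y in `[0, b]) (hz y * Ne (e n) (tau y))) @ \oo --> \int[mu]_(y in `[0, b]) h y.
  apply: (@Rdominated_cvg _ _ _ mu _ [set x] _ _ f) => //.
  - by move=> n; apply: subspace_continuous_measurable_fun => //; exact: cGn.
  - move=> y /inb hy /eqP yx; rewrite hE//; apply: cvgM; first exact: cvg_cst.
    by apply: Ne_lim => //; [exact: (tauP y hy).1|exact: tau_neq].
  - move=> n y /inb hy /eqP yx; have [k1 k2] := tauP y hy.
    rewrite /f I1// mulr1 normrM; apply: ler_wpM2l => //; have tn := tau_neq _ hy yx.
    have := Ne_le _ _ (e0 n) k1 tn; have := hC _ _ (e1 n) k1; have /andP[k3 _] := hN _ k1 tn.
    by rewrite ler_norml => g1 g2; apply/andP; split; lra.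
split => //.
have mZd : measurable_fun `[0, pi] ZZd.
  by apply: subspace_continuous_measurable_fun => //; apply: within_cont => t ht; exact: continuous_ZZd.
have [_ cN] : mu.-integrable `[0, pi] (EFin \o (fun t => ZZd t * Nk s0 t)) /\
   (fun n => \int[mu]_(t in `[0, pi]) (ZZd t * Ne (e n) t)) @ \oo --> \int[mu]_(t in `[0, pi]) (ZZd t * Nk s0 t).
  apply: (@Rdominated_cvg _ _ _ mu _ [set t0] _ _ gt) => //.
  - move=> n; apply: measurable_funM => //; apply: subspace_continuous_measurable_fun => //.
    by apply: within_cont => t ht; exact: Ne_cont.
  - by apply: measurable_funM => //; exact: measurable_Nk.
  - move=> t /inp ht /eqP tn; apply: cvgM; first exact: cvg_cst.
    exact: Ne_lim.
  - move=> n t /inp ht /eqP tn; rewrite normrM; apply: ler_pM => //; first exact: hMz.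
    have := Ne_le _ _ (e0 n) ht tn; have := hC _ _ (e1 n) ht; have /andP[k3 k4] := hN _ ht tn.
    by move: k3 k4; rewrite ler_norml => *; apply/andP; split; lra.
have E n : \int[mu]_(y in `[0, b]) (hz y * Ne (e n) (tau y)) = - (\int[mu]_(t in `[0, pi]) (ZZd t * Ne (e n) t)).
  have iZ : mu.-integrable `[0, pi] (EFin \o (fun t => ZZd t * Ne (e n) t)).
    by apply: integrable_itv => t ht; apply: (@cvgM _ _ (nbhs t)); [exact: continuous_ZZd|exact: Ne_cont].
  rewrite -mulN1r -RintegralZl// /Rintegral substitution_yy//; congr fine.
  by apply: eq_integral => t; rewrite inE => /inp ht; rewrite tauK// /ZZd -/(hz _); congr (_%:E); ring.
move: ch; under eq_fun do rewrite E.
by move=> ch; exact: (cvg_unique _ ch (cvgN cN)).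
Qed.

End ChangeOfVariables.

(** * The contour integral *)

Section ContourIntegral.
Context {R : realType} (theta c : R) (th1 : 1 < theta) (c0 : 0 < c).
Local Notation a := theta^-1.
Local Notation J := (Jc theta c).
Local Notation ss := (ss theta).
Local Notation rr := (rr theta).
Local Notation om := (om theta).
Local Notation yy := (yy theta c).
Local Notation mu := (@lebesgue_measure R).
Implicit Types (t u x y : R) (s z : R[i]).

Let a0 : 0 < a := a_gt0 _ th1.
Let p0 : 0 < (pi : R) := pi_gt0 R.

Lemma complex_eta z : Complex (Re z) (Im z) = z. Proof. by case: z. Qed.

Lemma ss_inj t u : 0 <= t <= pi -> 0 <= u <= pi -> ss t = ss u -> t = u.
Proof. by move=> ht hu e; apply: (yy_inj _ _ th1 c0) => //; rewrite /yy e. Qed.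

(* Reparametrizing by [pi (1 - cos (pi u)) / 2] keeps the angle in [0, pi] for
   every real [u], so the path is C^1 on the whole line. *)
Lemma gamma1_param_exists : exists gx gy, gamma1_param theta c gx gy.
Proof.
pose f u : R := pi * (1 - cos (pi * u)) / 2.
pose fd u : R := pi ^+ 2 / 2 * sin (pi * u).
have fI u : 0 <= f u <= pi.
  have h1 := cos_le1 (pi * u); have h2 := cos_geN1 (pi * u).
  by rewrite /f; apply/andP; split; move: p0 h1 h2; nra.
have fder u : is_derive u (1 : R) f (fd u).
  have h := rderM _ _ _ _ _ (rder_cst pi u) (rder_id u).
  have h2 := rderB _ _ _ _ _ (rder_cst 1 u) (rder_comp _ _ _ _ _ h (is_derive_cos (pi * u))).
  apply: rder_eq (rderM _ _ _ _ _ (rderM _ _ _ _ _ (rder_cst pi u) h2) (rder_cst (2^-1) u)).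
  by rewrite /fd; ring.
have cf u : {for u, continuous f} by exact: rder_cont (fder u).
have cfd u : {for u, continuous fd}.
  have h := rderM _ _ _ _ _ (rder_cst pi u) (rder_id u).
  exact: rder_cont (rderM _ _ _ _ _ (rder_cst (pi ^+ 2 / 2) u) (rder_comp _ _ _ _ _ h (is_derive_sin (pi * u)))).
have dg u : is_derive u (1 : R) (fun u => Re (ss (f u))) (fd u * Re (ss (f u) * om (f u))) /\
    is_derive u (1 : R) (fun u => Im (ss (f u))) (fd u * Im (ss (f u) * om (f u))).
  have [d1 d2] := pder_ss _ th1 _ (fI u).
  by split; [exact: rder_comp (fder u) d1|exact: rder_comp (fder u) d2].
have cso u : ccvg (nbhs u) (fun u => ss (f u) * om (f u)) (ss (f u) * om (f u)).
  have [k1 k2] := ccvg_ss _ th1 _ (fI u); have [k3 k4] := ccvg_om _ th1 _ (fI u).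
  have ks : ccvg (nbhs u) (fun u => ss (f u)) (ss (f u)).
    by split; [exact: (cvg_comp _ _ (cf u) k1)|exact: (cvg_comp _ _ (cf u) k2)].
  have ko : ccvg (nbhs u) (fun u => om (f u)) (om (f u)).
    by split; [exact: (cvg_comp _ _ (cf u) k3)|exact: (cvg_comp _ _ (cf u) k4)].
  by apply: ccvgM; [exact: ks|exact: ko].
have D (g : R -> R) u d : is_derive u (1 : R) g d -> derive1 g u = d.
  by move=> h; rewrite derive1E; exact: (@derive_val _ _ _ _ _ _ _ h).
have f0 : f 0 = 0 by rewrite /f mulr0 cos0 subrr mulr0 mul0r.
have f1 : f 1 = pi by rewrite /f mulr1 cospi opprK; field.
exists (fun u => Re (ss (f u))), (fun u => Im (ss (f u))); split.
- by split=> u; have [d1 d2] := dg u; [exact: (@ex_derive _ _ _ _ _ _ _ d1)|exact: (@ex_derive _ _ _ _ _ _ _ d2)].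
- split=> u.
    have -> : derive1 (fun u => Re (ss (f u))) = (fun u => fd u * Re (ss (f u) * om (f u))).
      by apply/funext => w; apply: D; exact: (dg w).1.
    by apply: (@cvgM _ _ (nbhs u)); [exact: cfd|exact: (cso u).1].
  have -> : derive1 (fun u => Im (ss (f u))) = (fun u => fd u * Im (ss (f u) * om (f u))).
    by apply/funext => w; apply: D; exact: (dg w).2.
  by apply: (@cvgM _ _ (nbhs u)); [exact: cfd|exact: (cso u).2].
- by rewrite !complex_eta f0 f1 ss0// ss_pi.
- move=> t u tI uI; rewrite !complex_eta => /(ss_inj _ _ (fI t) (fI u)); rewrite /f => e.
  move: tI uI; rewrite !in_itv/= => /andP[t0 t1] /andP[u0 u1].
  have ecos : cos (pi * t) = cos (pi * u).
    have e2 : pi * (1 - cos (pi * t)) = pi * (1 - cos (pi * u)) by lra.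
    by have := mulfI (lt0r_neq0 p0) e2; lra.
  have in0 x : 0 <= x -> x <= 1 -> pi * x \in `[0, pi].
    by move=> x0 x1; rewrite in_itv/= mulr_ge0 ?(ltW p0)//= ger_pMr.
  exact: (mulfI (lt0r_neq0 p0) (cos_inj (in0 t t0 t1) (in0 u u0 u1) ecos)).
- by move=> t _; rewrite complex_eta; exact: gamma1_ss.
Qed.

Lemma cpow_conj z x : slit z -> cpow (cconj z) x = cconj (cpow z x).
Proof.
move=> sz; have [I0|I0] := eqVneq (Im z) 0.
  have R0 : 0 < Re z by case: sz => //; rewrite I0 eqxx.
  have -> : z = (Re z)%:C by apply: complex_eq; rewrite ?ReC ?ImC.
  by rewrite cconjC cpowC// cconjC.
have z0 : z != 0 by apply: slit_Re_neq; right.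
rewrite /cpow cconj_eq0 (negPf z0) cabsJ ArgJ// mulrN cosN sinN cconjM cconjC.
by congr (_ * _).
Qed.

Lemma J_conj_ss t : 0 <= t <= pi -> J (cconj (ss t)) = (yy t)%:C.
Proof.
move=> ht; rewrite -J_ss//; have [tp|tp] := eqVneq t pi.
  by rewrite tp ss_pi//; congr (J _); apply: complex_eq; rewrite ?ReJ ?ImJ /= ?oppr0.
have ht' : 0 <= t < pi by rewrite lt_neqAle tp andbA andbC; move: ht => /andP[-> ->].
have c1 : cconj 1 = 1 :> R[i] by apply: complex_eq; rewrite ?ReJ ?ImJ /= ?oppr0.
have -> : J (cconj (ss t)) = cconj (J (ss t)); last by rewrite J_ss// cconjC.
rewrite /Jc [RHS]cconjM [cconj (_ * (_ + 1))]cconjM cconjC cconjD c1 -cpow_conj; last exact: slit_ss.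
by rewrite cconjM cconjV cconjD c1.
Qed.

(** The lower arc carries the conjugate integrand with opposite orientation, so the real parts
    cancel and the imaginary parts double; division by [2 pi i] leaves a real number. *)
Lemma int_Im_conj (h k : R -> R[i]) : (forall u, 0 <= u <= 1 -> k u = cconj (h u)) ->
  mu.-integrable `[0, 1] (EFin \o (fun u => Im (h u))) ->
  ((2 * pi)%:C * Complex 0 1)^-1 * (cint01 h - cint01 k) = ((\int[mu]_(u in `[0, 1]) Im (h u)) / pi)%:C.
Proof.
move=> hk ih; have e1 : \int[mu]_(u in `[0, 1]) Re (k u) = \int[mu]_(u in `[0, 1]) Re (h u).
  by apply: eq_Rintegral => u; rewrite inE/= in_itv/= => /hk ->.
have e2 : \int[mu]_(u in `[0, 1]) Im (k u) = - (\int[mu]_(u in `[0, 1]) Im (h u)).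
  rewrite -mulN1r -RintegralZl//; apply: eq_Rintegral => u; rewrite inE/= in_itv/= => /hk ->.
  by rewrite ImJ mulN1r.
set X := \int[mu]_(u in `[0, 1]) Im (h u) in e2 *.
have -> : cint01 h - cint01 k = Complex 0 (2 * X).
  by apply: complex_eq; rewrite ?[Re (_ - _)]ReB ?[Im (_ - _)]ImB /cint01 /= ?e1 ?e2 -/X ?subrr//; ring.
have i0 : (2 * pi)%:C * Complex 0 1 != 0 :> R[i].
  by apply: slit_Re_neq; right; rewrite ImCM /= mulr1 gt_eqF// mulr_gt0.
apply: (mulfI i0); rewrite mulrA divff// mul1r.
rewrite [RHS]mulrC; apply: complex_eq; rewrite ?ReCM ?ImCM /=; first by ring.
by rewrite mulr1 [2 * pi]mulrC mulrA mulfVK ?lt0r_neq0// mulrC.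
Qed.

Context (V1 W1 : R -> R) (cW1 : continuous W1) (VW : forall x, 0 <= x -> V1 x = W1 x).
Local Notation ZZ := (ZZ theta c W1).

(** Clamping the angle extends the integrand continuously to the line. Its primitive, started at
    [-1], is then differentiable at both angles 0 and [pi]. *)
Let clip t : R := Num.max 0 (Num.min t pi).
Let clipI t : 0 <= clip t <= pi.
Proof. by rewrite /clip le_max lexx/= ge_max (ltW p0) ge_min lexx orbT. Qed.
Let clipE t : 0 <= t <= pi -> clip t = t.
Proof. by move=> /andP[t0 tp]; rewrite /clip (min_idPl tp) (max_idPr t0). Qed.
Let Zc t := ZZ (clip t).

Lemma continuous_ZZ_clip : continuous Zc.
Proof.
move=> t; have cc : {for t, continuous clip}.
  apply: (@continuous_max R R (cst 0) (fun t => Num.min t pi) t); first exact: cvg_cst.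
  by apply: (@continuous_min R R id (cst pi) t); [exact: cvg_id|exact: cvg_cst].
exact: (cvg_comp _ _ cc (continuous_ZZ theta c th1 W1 cW1 (clip t) (clipI t))).
Qed.

Let F x : R := \int[mu]_(t in `[-1, x]) Zc t.

Lemma is_derive_int_ZZ_clip x : -1 < x -> is_derive x (1 : R) F (Zc x).
Proof.
move=> x1; have xu : x < x + 1 by rewrite ltrDl.
have iZ : mu.-integrable [set` Interval (BLeft (-1)) (BRight (x + 1))] (EFin \o Zc).
  by apply: integrable_itv => t _; exact: continuous_ZZ_clip.
have [d1 d2] := continuous_FTC1_closed xu iZ x1 (continuous_ZZ_clip x).
by apply: (DeriveDef d1); rewrite -derive1E; exact: d2.
Qed.

(** For any parametrization the integrand is real times [g' / g], whose imaginary part is the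
    derivative of the argument [be]. The integral is thus a primitive composed with [be], and
    depends only on the end angles 0 and [pi]. *)
Lemma contour_value gx gy : gamma1_param theta c gx gy ->
  contour_gamma gx gy (fun s => (V1 (Re (J s)))%:C * J s / s) =
  ((\int[mu]_(t in `[0, pi]) ZZ t) / pi)%:C.
Proof.
move=> [[dx dy] [cx cy] [g0 g1] ginj gin].
pose g u := Complex (gx u) (gy u).
pose dg u := Complex (derive1 gx u) (derive1 gy u).
have gss u : 0 <= u <= 1 -> exists2 t, 0 <= t <= pi & g u = ss t.
  by move=> hu; apply: (gamma1_exists theta c th1 c0); apply: gin; rewrite in_itv.
have pg u : pder g u (dg u).
  by split; rewrite /dg /= derive1E; apply: derivableP; [exact: dx|exact: dy].
(* The end [-1] lies on the cut of the principal argument. Rotation by a quarter turn moves the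
   whole closed arc into the slit plane. *)
pose mi : R[i] := Complex 0 (-1).
pose be u : R := pi / 2 + Im (clog (mi * g u)).
have miE t : mi * ss t = (rr t)%:C * expi (t - pi / 2).
  have -> : mi = expi (- (pi / 2)).
    by rewrite /mi /expi cosN sinN cos_pihalf sin_pihalf.
  by rewrite /ss mulrCA -expiD [- _ + t]addrC.
have mn0 : mi != 0 by apply: slit_Re_neq; right; rewrite /= oppr_eq0 oner_eq0.
have beE u t : 0 <= t <= pi -> g u = ss t -> be u = t.
  move=> ht e; have /andP[h1 h2] := ht.
  have IE z : Im (clog z) = Arg z by [].
  rewrite /be e miE IE Arg_polar ?rr_gt0//; first by ring.
  by move: p0; lra.
have gn0 u : 0 <= u <= 1 -> g u != 0.
  by move=> /gss[t ht ->]; exact: ss_neq0.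
have dbe u : 0 <= u <= 1 -> is_derive u (1 : R) be (Im (dg u / g u)).
  move=> hu; have [t ht e] := gss u hu.
  have sl : slit (mi * g u).
    have Re_mi z : Re (mi * z) = Im z by rewrite ReM /=; ring.
    have Im_mi z : Im (mi * z) = - Re z by rewrite ImM /=; ring.
    rewrite /slit Re_mi Im_mi e oppr_eq0; case: (t_cases _ ht) => [->|->|h].
    - by right; rewrite ss0// ReC gt_eqF.
    - by right; rewrite ss_pi//= oppr_eq0 oner_eq0.
    - by left; exact: Im_ss_gt0.
  have [_ k] := chol_path _ _ _ _ _ (chol_clog _ sl) (pderM _ _ _ _ _ (pder_cst mi u) (pg u)).
  apply: rder_eq (rderD _ _ _ _ _ (rder_cst (pi / 2) u) k).
  rewrite add0r mul0r add0r; congr (Im _); have := gn0 u hu; move: (g u) (dg u) => G D G0.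
  by field; rewrite mn0 G0.
have cbe u : 0 <= u <= 1 -> {for u, continuous be} by move=> hu; exact: rder_cont (dbe u hu).
have beI u : 0 <= u <= 1 -> 0 <= be u <= pi by move=> /gss[t ht e]; rewrite (beE u t).
have be0 : be 0 = 0 by apply: beE; rewrite ?lexx ?(ltW p0)// /g g0 ss0.
have be1 : be 1 = pi by apply: beE; rewrite ?lexx ?(ltW p0)// /g g1 ss_pi.
have cdg u : 0 <= u <= 1 -> ccvg (nbhs u) (fun u => dg u / g u) (dg u / g u).
  move=> hu; apply: ccvgM; first by split; [exact: cx|exact: cy].
  by apply: ccvgV; [exact: gn0|exact: pder_ccvg (pg u)].
have cint u : 0 <= u <= 1 -> {for u, continuous (fun u => Zc (be u) * Im (dg u / g u))}.
  move=> hu; apply: (@cvgM _ _ (nbhs u)); last exact: (cdg u hu).2.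
  exact: (cvg_comp _ _ (cbe u hu) (continuous_ZZ_clip (be u))).
have bgt u : 0 <= u <= 1 -> -1 < be u by move=> /beI/andP[h _]; lra.
pose h u := (V1 (Re (J (g u))))%:C * J (g u) / g u * dg u.
have hE u : 0 <= u <= 1 -> h u = (Zc (be u))%:C * (dg u / g u).
  move=> hu; have [t ht e] := gss u hu; rewrite /h e (beE u t ht e) J_ss// ReC /Zc clipE// /ZZ.
  have /andP[y0 _] := yy_range _ _ th1 c0 t ht.
  by rewrite (VW _ y0) CM; ring.
have kE u : 0 <= u <= 1 ->
    (V1 (Re (J (cconj (g u)))))%:C * J (cconj (g u)) / cconj (g u) * cconj (dg u) = cconj (h u).
  move=> hu; have [t ht e] := gss u hu; rewrite /h e J_conj_ss// J_ss// ReC.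
  have E (x y : R) z w : cconj (x%:C * y%:C / z * w) = x%:C * y%:C / cconj z * cconj w.
    by rewrite [LHS]cconjM [cconj (_ / _)]cconjM cconjV -CM cconjC.
  by rewrite E.
have ImE u : 0 <= u <= 1 -> Im (h u) = Zc (be u) * Im (dg u / g u).
  by move=> hu; rewrite hE// [LHS]ImCM.
have ih : mu.-integrable `[0, 1] (EFin \o (fun u => Im (h u))).
  apply: (@eq_integrable _ _ _ mu _ _ (EFin \o (fun u => Zc (be u) * Im (dg u / g u)))) => //.
    by move=> u; rewrite inE/= in_itv/= => hu /=; rewrite ImE.
  exact: integrable_itv.
rewrite /contour_gamma -/(g _).
rewrite (int_Im_conj h)//; congr (_%:C); congr (_ / _).
have cF x : -1 < x -> {for x, continuous F} by move=> x1; exact: rder_cont (is_derive_int_ZZ_clip x x1).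
transitivity (\int[mu]_(u in `[0, 1]) (Zc (be u) * Im (dg u / g u))).
  by apply: eq_Rintegral => u; rewrite inE/= in_itv/= => /ImE ->.
have E1 : \int[mu]_(u in `[0, 1]) (Zc (be u) * Im (dg u / g u)) = F (be 1) - F (be 0).
  apply: (FTC_itv (fun u => F (be u))) => // u.
    by move=> hu; split; [exact: cint|exact: (cvg_comp _ _ (cbe u hu) (cF _ (bgt u hu)))].
  move=> /andP[u0 u1]; have hu : 0 <= u <= 1 by rewrite !ltW.
  apply: rder_eq (rder_comp _ _ _ _ _ (dbe u hu) (is_derive_int_ZZ_clip _ (bgt u hu))); exact: mulrC.
rewrite E1 be0 be1.
have -> : \int[mu]_(t in `[0, pi]) ZZ t = \int[mu]_(t in `[0, pi]) Zc t.
  by apply: eq_Rintegral => t; rewrite inE/= in_itv/= => ht; rewrite /Zc clipE.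
symmetry; apply: (FTC_itv F _ _ _ p0) => t /andP[h1 h2].
  by split; [exact: continuous_ZZ_clip|apply: cF; exact: lt_le_trans h1].
by apply: is_derive_int_ZZ_clip; exact: lt_trans h1.
Qed.

End ContourIntegral.

(** * Extension of the potential to the line and assembly *)

Lemma continuous_clip {R : realType} (f : R -> R) :
  {within `[0, +oo[, continuous f} -> continuous (fun x : R => f (Num.max 0 x)).
Proof.
move=> cf x; have A y : `[(0 : R), +oo[%classic (Num.max 0 y) by rewrite /= in_itv/= andbT le_max lexx.
have cm : {for x, continuous (fun y : R => Num.max 0 y)}.
  by apply: (@continuous_max R R (cst 0) id x); [exact: cvg_cst|exact: cvg_id].
have cw : Num.max 0 y @[y --> x] --> within `[(0 : R), +oo[%classic (nbhs (Num.max 0 x)).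
  move=> P hP; have h : nbhs x (fun y : R => `[(0 : R), +oo[%classic (Num.max 0 y) -> P (Num.max 0 y)).
    exact: (cm _ hP).
  by apply: (@filterS _ (nbhs x) _ _ _ _ h) => y; apply.
move: cf => /subspace_continuousP/(_ _ (A x)) cf.
exact: (@cvg_comp R R R (fun y : R => Num.max 0 y) f _ _ _ cw cf).
Qed.

Lemma is_derive_clip {R : realType} (f f1 : R -> R) (x : R) : 0 < x -> is_derive x (1 : R) f (f1 x) ->
  is_derive x (1 : R) (fun y : R => f (Num.max 0 y)) (f1 (Num.max 0 x)).
Proof.
move=> x0; rewrite (max_idPr (ltW x0)); apply: near_eq_is_derive.
near=> y; have y0 : 0 < y by near: y; exact: lt_nbhsr.
by rewrite (max_idPr (ltW y0)).
Unshelve. all: end_near. Qed.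

(** Since gamma_1 is exactly the arc [ss], any selection of preimages on it is [ss] composed with an
    angle function; the formula for [psi] can thus be proved in terms of angles. *)
Lemma Iplus_angle {R : realType} (theta c : R) (Ip : R -> R[i]) : 1 < theta -> 0 < c ->
  Iplus_spec theta c Ip -> exists tau, forall y, 0 <= y <= bb theta c ->
    [/\ 0 <= tau y <= pi, yy theta c (tau y) = y & Ip y = ss theta (tau y)].
Proof.
move=> th1 c0 spec.
have ex y : exists t, 0 <= y <= bb theta c -> [/\ 0 <= t <= pi, yy theta c t = y & Ip y = ss theta t].
  have [hy|hy] := boolP (0 <= y <= bb theta c); last by exists 0.
  have [|g e] := spec y; first by rewrite Jmax_bb// in_itv.
  have [t ht zt] := gamma1_exists theta c th1 c0 _ g; exists t => _; split => //.
  by have := congr1 (@complex.Re R) e; rewrite zt J_ss// !ReC.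
by have [tau tauP] := choice ex; exists tau.
Qed.

Lemma Iplus_exists {R : realType} (theta c : R) : 1 < theta -> 0 < c -> exists Ip, Iplus_spec theta c Ip.
Proof.
move=> th1 c0.
have ex (y : R) : exists z, y \in `[0, Jmax theta c] -> gamma1 theta c z /\ Jc theta c z = y%:C.
  have [hy|hy] := boolP (y \in `[0, Jmax theta c]); last by exists 0.
  have [|t ht <-] := yy_surj theta c th1 c0 y; first by rewrite -Jmax_bb// -in_itv.
  by exists (ss theta t) => _; split; [exact: gamma1_ss|exact: J_ss].
by have [Ip IpP] := choice ex; exists Ip.
Qed.

Theorem theorem1p5 (R : realType) (theta : R) (V V1 V2 : R -> R)
  (mu : probability R R) (b : R) (psi : R -> R) (l : R) :
  1 < theta ->
  (* V is C^2 on [0,+oo): V' = V1, V'' = V2 on (0,+oo), all continuous on [0,+oo) *)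
  {within `[0, +oo[, continuous V} ->
  (forall x : R, 0 < x -> is_derive x (1 : R) V (V1 x)) ->
  {within `[0, +oo[, continuous V1} ->
  (forall x : R, 0 < x -> is_derive x (1 : R) V1 (V2 x)) ->
  {within `[0, +oo[, continuous V2} ->
  (* V(x) / log x -> +oo *)
  ((fun x : R => V x / ln x) x @[x --> +oo] --> +oo) ->
  (* mu is supported on the interval [0,b] *)
  0 < b ->
  msupp mu = `[0, b]%classic ->
  (* mu has a continuous density psi on (0,b) *)
  {within `]0, b[, continuous psi} ->
  (forall A : set R, measurable A ->
     mu A = (\int[lebesgue_measure]_(y in A `&` `](0%R : R), b[%classic) (psi y)%:E)%E) ->
  (* Euler-Lagrange conditions *)
  (forall x : R, msupp mu x -> effpot mu theta V x = l%:E) ->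
  (forall x : R, 0 <= x -> (effpot mu theta V x <= l%:E)%E) ->
  exists c : R, 0 < c /\
    [/\ (* c solves (1/2 pi i) \oint_gamma V'(J_c(s)) J_c(s) / s ds = 1 + theta *)
        (exists gx gy, gamma1_param theta c gx gy),
        (forall gx gy, gamma1_param theta c gx gy ->
           contour_gamma gx gy
             (fun s => (V1 (complex.Re (Jc theta c s)))%:C * Jc theta c s / s)
           = (1 + theta)%:C),
        b = c * (1 + theta) `^ (1 + theta^-1) / theta,
        (exists Ip, Iplus_spec theta c Ip) &
        (forall Ip, Iplus_spec theta c Ip ->
         forall x : R, x \in `]0, b[ ->
           let h := fun y => (V2 y * y + V1 y) *
              ln (cabs ((Ip y - cconj (Ip x)) / (Ip y - Ip x))) in
           lebesgue_measure.-integrable `[0, b] (EFin \o h) /\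
           psi x = (2 * pi ^+ 2 * x)^-1 *
                   (\int[lebesgue_measure]_(y in `[0, b]) h y))].
Proof.
move=> th1 cV dV cV1 dV1 cV2 _ b0 supp cpsi dens ELeq ELle.
have p0 := pi_gt0 R.
have th0 : 0 < theta by rewrite (lt_trans _ th1).
have k0 : 0 < (1 + theta) `^ (1 + theta^-1) by rewrite powR_gt0// addr_gt0.
pose c := b * theta / (1 + theta) `^ (1 + theta^-1).
have c0 : 0 < c by rewrite divr_gt0// mulr_gt0.
have bE : b = bb theta c by rewrite /bb /c divfK ?lt0r_neq0// mulfK// lt0r_neq0.
(* [V] and its derivatives are given on the half-line, with one-sided continuity at 0. Freezing them
   on the negative side gives functions continuous everywhere with the same values on [[0, b]]. *)
pose clip (f : R -> R) (x : R) : R := f (Num.max 0 x).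
have clipE f x : 0 <= x -> f x = clip f x by move=> x0; rewrite /clip (max_idPr x0).
have effE x : 0 <= x -> effpot mu theta (clip V) x = effpot mu theta V x.
  by move=> x0; rewrite /effpot -clipE.
clearbody c; subst b.
have cW := continuous_clip _ cV; have cW1 := continuous_clip _ cV1; have cW2 := continuous_clip _ cV2.
have dW (x : R) : 0 < x -> is_derive x (1 : R) (clip V) (clip V1 x).
  by move=> x0; exact: is_derive_clip x0 (dV x x0).
have dW1 (x : R) : 0 < x -> is_derive x (1 : R) (clip V1) (clip V2 x).
  by move=> x0; exact: is_derive_clip x0 (dV1 x x0).
have EL x : 0 <= x <= bb theta c -> effpot mu theta (clip V) x = l%:E.
  by move=> /[dup] /andP[x0 _] hx; rewrite effE// ELeq// supp /= in_itv.
have ELl x : 0 <= x -> (effpot mu theta (clip V) x <= l%:E)%E.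
  by move=> x0; rewrite effE// ELle.
exists c; split => //; split => //.
- exact: gamma1_param_exists.
- move=> gx gy gP; rewrite (contour_value _ _ th1 c0 V1 (clip V1))//; last exact: clipE.
  rewrite (int_ZZ theta c th1 c0 mu psi cpsi dens _ _ _ _ cW cW1 cW2 dW dW1 EL ELl).
  by rewrite mulfK// lt0r_neq0.
- exact: Iplus_exists.
- move=> Ip spec x xI h; have [x0 xb] : 0 < x /\ x < bb theta c by move: xI; rewrite in_itv/= => /andP[].
  have [tau tauP] := Iplus_angle _ _ _ th1 c0 spec.
  have [|ht xE _] := tauP x; first by rewrite !ltW.
  have tI : 0 < tau x < pi.
    move: ht => /andP[h0 h1]; rewrite !lt_neqAle h0 h1 !andbT; apply/andP; split; apply/eqP => e.
      by move: xE; rewrite -e yy0// => e2; move: xb; rewrite e2 ltxx.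
    by move: xE; rewrite e yypi// => e2; move: x0; rewrite e2 ltxx.
  have tP1 y : 0 <= y <= bb theta c -> 0 <= tau y <= pi /\ yy theta c (tau y) = y by move=> /tauP[].
  have tP2 y : 0 <= y <= bb theta c -> Ip y = ss theta (tau y) by move=> /tauP[].
  have := density_integral theta c th1 c0 tau tP1 (clip V1) (clip V2) cW1 cW2 _ tI Ip tP2.
  have := density_formula theta c th1 c0 mu psi cpsi dens _ _ _ _ cW cW1 cW2 dW dW1 EL ELl _ tI.
  rewrite xE => <- [ih Ih].
  have hE : {in `[0, bb theta c], forall y, (clip V2 y * y + clip V1 y) *
      ln (cabs ((Ip y - cconj (Ip x)) / (Ip y - Ip x))) = h y}.
    by move=> y; rewrite in_itv/= => /andP[y0 _]; rewrite /h -!clipE.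
  split.
    by apply: eq_integrable ih => // y; rewrite inE/= => hy /=; rewrite hE.
  have eI : \int[lebesgue_measure]_(y in `[0, bb theta c]) h y = 2 * pi ^+ 2 * (x * psi x).
    by rewrite -Ih; apply: eq_Rintegral => y; rewrite inE/= => hy; rewrite hE.
  by rewrite eI [2 * _ * (x * _)]mulrA mulKf// !mulf_neq0 ?lt0r_neq0// exprn_gt0.
Qed.
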